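(* Put $\vartheta=(1+\sqrt5)/2$, $c_\vartheta=\sqrt{1+\vartheta^2}$, and define the constant one-forms $$\eta_1=\frac{\mathrm dx+\vartheta\,\mathrm dy}{c_\vartheta},\qquad\eta_2=\frac{-\vartheta\,\mathrm dx+\mathrm dy}{c_\vartheta}$$ on $\mathbb T^3=\mathbb R^3/\mathbb Z^3$ (coordinates $x,y,z$). The vacuum spacetime $$\mathcal M=(0,\infty)\times\mathbb T^3,\qquad g=-\mathrm dt^2+h_t,\qquad h_t=t^{-2/3}\eta_1^2+t^{4/3}(\eta_2^2+\mathrm dz^2)$$ is globally $C^0$-inextendible. Nevertheless, there are constants $0<c<C<\infty$ such that $$c\,t^{1/6}\le\operatorname{diam}(\mathbb T^3,h_t)\le C\,t^{1/6},\qquad\operatorname{Vol}(\mathbb T^3,h_t)=t,\qquad0<t\le1 .$$ On the universal cover $\pi:\mathbb R^3\to\mathbb T^3$, every nonempty relatively compact open set $\widehat U\subset\mathbb R^3$ instead satisfies (for $0<t\le1$) $$\operatorname{diam}_{\pi^*h_t}(\widehat U;\mathbb R^3)\ge c_{\widehat U}\,t^{-1/3}$$ for some $c_{\widehat U}>0$, where the diameter is measured with the distance of $(\mathbb R^3,\pi^*h_t)$.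
   Context: Globally $C^0$-inextendible: there is no connected Hausdorff second-countable smooth manifold $\widetilde{\mathcal M}$ of the same dimension with a continuous Lorentzian metric $\widetilde g$ and a smooth isometric embedding $\iota:(\mathcal M,g)\to(\widetilde{\mathcal M},\widetilde g)$ whose image is a proper open subset. *)

(* Defs.v *)
From HB Require Import structures.
From mathcomp Require Import all_boot all_order all_algebra.
From mathcomp Require Import all_classical all_reals all_analysis.
Import Order.TTheory GRing.Theory Num.Theory.
Import numFieldNormedType.Exports.

Set Implicit Arguments.
Unset Strict Implicit.
Unset Printing Implicit Defensive.

Local Open Scope classical_set_scope.
Local Open Scope ring_scope.
Local Open Scope quotient_scope.

(** Conventions.  Points and vectors of R^n are row vectors, so the Jacobian
    matrix ['J f p] of the library acts on the right, [v |-> v *m 'J f p], and a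
    bilinear form with Gram matrix [G] is [(v, w) |-> v *m G *m w^T].  A tensor
    [G'] of this type pulls back to ['J f p *m G' *m ('J f p)^T]. *)

(** * Smooth maps between open sets of R^n *)

Fixpoint Ck_on (R : realType) (n : nat) (W : normedModType R) (k : nat)
    (U : set 'rV[R]_n) (f : 'rV[R]_n -> W) : Prop :=
  if k is k'.+1 then
    forall i : 'I_n,
      (forall x, U x -> derivable f x (delta_mx 0 i)) /\
      Ck_on k' U (fun x => 'D_(delta_mx 0 i) f x)
  else forall x, U x -> {for x, continuous f}.

Definition smooth_on (R : realType) (n : nat) (W : normedModType R)
    (U : set 'rV[R]_n) (f : 'rV[R]_n -> W) : Prop :=
  forall k, Ck_on k U f.

(** * Smooth manifolds *)

(** [chart_inv] inverts [chart_map] on [chart_map @` chart_dom]; both are total functions whose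
    values elsewhere are irrelevant. *)
Record chart (R : realType) (n : nat) (X : Type) := Chart {
  chart_dom : set X ;
  chart_map : X -> 'rV[R]_n ;
  chart_inv : 'rV[R]_n -> X }.

Definition is_chart (R : realType) (n : nat) (X : topologicalType)
    (c : chart R n X) : Prop :=
  [/\ open (chart_dom c), open (chart_map c @` chart_dom c),
      forall x, chart_dom c x -> chart_inv c (chart_map c x) = x,
      forall x, chart_dom c x -> {for x, continuous (chart_map c)} &
      forall v, (chart_map c @` chart_dom c) v -> {for v, continuous (chart_inv c)}].

Definition local_rep (R : realType) (n m : nat) (X Y : Type)
    (c : chart R n X) (c' : chart R m Y) (f : X -> Y) : 'rV[R]_n -> 'rV[R]_m :=
  fun v => chart_map c' (f (chart_inv c v)).

Definition smooth_map (R : realType) (n m : nat) (X Y : topologicalType)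
    (A : set (chart R n X)) (B : set (chart R m Y)) (f : X -> Y) : Prop :=
  continuous f /\
  forall c c', A c -> B c' ->
    smooth_on (chart_map c @` (chart_dom c `&` f @^-1` chart_dom c')) (local_rep c c' f).

(** The last clause is the smoothness of the transition maps. *)
Definition is_manifold (R : realType) (n : nat) (X : topologicalType)
    (A : set (chart R n X)) : Prop :=
  [/\ hausdorff_space X, @second_countable X,
      forall c, A c -> is_chart c,
      forall x, exists2 c, A c & chart_dom c x &
      smooth_map A A id].

(** * Metrics *)

(** [g c x] is the Gram matrix at [x] of the metric in the coordinate frame of
    the chart [c]; it is meaningful when [c] is in the atlas and [x] in
    [chart_dom c]. *)
Definition metric (R : realType) (n : nat) (X : Type) :=
  chart R n X -> X -> 'M[R]_n.

Definition is_pullback (R : realType) (n m : nat) (X Y : topologicalType)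
    (A : set (chart R n X)) (gX : metric R n X)
    (B : set (chart R m Y)) (gY : metric R m Y) (f : X -> Y) : Prop :=
  forall c c', A c -> B c' -> forall x, chart_dom c x -> chart_dom c' (f x) ->
    let J := 'J (local_rep c c' f) (chart_map c x) in
    gX c x = J *m gY c' (f x) *m J^T.

(** Signature (-, +, ..., +). *)
Definition minkowski (R : realType) (d : nat) : 'M[R]_d.+1 :=
  diag_mx (\row_i (if i == 0 then -1 else 1)).

Definition lorentzian (R : realType) (d : nat) (G : 'M[R]_d.+1) : Prop :=
  G^T = G /\ exists2 P, P \in unitmx & P *m G *m P^T = minkowski R d.

(** [is_pullback A g A g id] is the tensorial transformation law under change of
    charts. *)
Definition is_C0_lorentz_metric (R : realType) (d : nat) (X : topologicalType)
    (A : set (chart R d.+1 X)) (g : metric R d.+1 X) : Prop :=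
  [/\ forall c x, A c -> chart_dom c x -> lorentzian (g c x),
      forall c x, A c -> chart_dom c x -> {for x, continuous (g c)} &
      is_pullback A g A g id].

Definition is_smooth_metric (R : realType) (n : nat) (X : topologicalType)
    (A : set (chart R n X)) (g : metric R n X) : Prop :=
  forall c, A c -> smooth_on (chart_map c @` chart_dom c) (fun v => g c (chart_inv c v)).

(** * Ricci curvature, in coordinates *)

Definition partial_deriv (R : realType) (n : nat) (i : 'I_n) (f : 'rV[R]_n -> R)
    (v : 'rV[R]_n) : R :=
  'D_(delta_mx 0 i) f v.

Definition christoffel (R : realType) (n : nat) (G : 'rV[R]_n -> 'M[R]_n)
    (k i j : 'I_n) (v : 'rV[R]_n) : R :=
  2^-1 * \sum_l invmx (G v) k l *
    (partial_deriv i (fun u => G u j l) v + partial_deriv j (fun u => G u i l) v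
     - partial_deriv l (fun u => G u i j) v).

Definition ricci (R : realType) (n : nat) (G : 'rV[R]_n -> 'M[R]_n)
    (i j : 'I_n) (v : 'rV[R]_n) : R :=
  \sum_k (partial_deriv k (christoffel G k i j) v - partial_deriv j (christoffel G k i k) v)
  + \sum_k \sum_l (christoffel G k k l v * christoffel G l i j v
                   - christoffel G k j l v * christoffel G l i k v).

Definition vacuum_spacetime (R : realType) (d : nat) (X : topologicalType)
    (A : set (chart R d.+1 X)) (g : metric R d.+1 X) : Prop :=
  [/\ is_manifold A, connected [set: X],
      is_C0_lorentz_metric A g, is_smooth_metric A g &
      forall c, A c -> forall v, (chart_map c @` chart_dom c) v ->
        forall i j, ricci (fun u => g c (chart_inv c u)) i j v = 0].

(** * Global C^0-inextendibility *)

Definition smooth_embedding (R : realType) (n m : nat) (X Y : topologicalType)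
    (A : set (chart R n X)) (B : set (chart R m Y)) (f : X -> Y) : Prop :=
  [/\ smooth_map A B f,
      forall c c', A c -> B c' -> forall x, chart_dom c x -> chart_dom c' (f x) ->
        row_free ('J (local_rep c c' f) (chart_map c x)),
      injective f &
      forall U : set X, open U ->
        exists2 V : set Y, open V & f @` U = V `&` range f].

Definition globally_C0_inextendible (R : realType) (d : nat)
    (X : topologicalType) (A : set (chart R d.+1 X)) (g : metric R d.+1 X) :
    Prop :=
  ~ exists (Y : topologicalType) (B : set (chart R d.+1 Y))
           (gY : metric R d.+1 Y) (f : X -> Y),
      [/\ is_manifold B /\ connected [set: Y],
          is_C0_lorentz_metric B gY,
          smooth_embedding A B f /\ is_pullback A g B gY f,
          open (range f) & range f <> [set: Y]].

(** * Riemannian distance, diameter, volume *)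

(** C^1 on a neighbourhood of [0, 1]. *)
Definition C1_segment (R : realType) (n : nat) (X : topologicalType)
    (A : set (chart R n X)) (gam : R -> X) : Prop :=
  forall s : R, s \in `[0, 1] ->
    {for s, continuous gam} /\
    forall c, A c -> chart_dom c (gam s) ->
      (\forall u \near s, derivable (chart_map c \o gam) u 1) /\
      {for s, continuous (derive1 (chart_map c \o gam))}.

Definition is_speed (R : realType) (n : nat) (X : topologicalType)
    (A : set (chart R n X)) (g : metric R n X) (gam : R -> X) (sp : R -> R) :
    Prop :=
  forall s : R, s \in `[0, 1] -> forall c, A c -> chart_dom c (gam s) ->
    let v := derive1 (chart_map c \o gam) s in
    sp s = Num.sqrt ((v *m g c (gam s) *m v^T) 0 0).

(** [joined A g x y l]: some piecewise C^1 curve, i.e. a finite concatenation of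
    C^1 segments, goes from [x] to [y] and has length [l]. *)
Inductive joined (R : realType) (n : nat) (X : topologicalType)
    (A : set (chart R n X)) (g : metric R n X) : X -> X -> \bar R -> Prop :=
| joined_refl x : joined A g x x 0%E
| joined_cons x y z l (gam : R -> X) (sp : R -> R) :
    C1_segment A gam -> is_speed A g gam sp ->
    gam 0 = x -> gam 1 = y -> joined A g y z l ->
    joined A g x z (\int[lebesgue_measure]_(s in `[0%R, 1%R]) (sp s)%:E + l)%E.

Definition riem_dist (R : realType) (n : nat) (X : topologicalType)
    (A : set (chart R n X)) (g : metric R n X) (x y : X) : \bar R :=
  ereal_inf [set l | joined A g x y l].

Definition riem_diam (R : realType) (n : nat) (X : topologicalType)
    (A : set (chart R n X)) (g : metric R n X) (U : set X) : \bar R :=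
  ereal_sup [set riem_dist A g x y | x in U & y in U].

Definition row3 (R : realType) (a b c : R) : 'rV[R]_3 :=
  \row_(i < 3) nth 0 [:: a; b; c] i.

(** [measurableTypeR R] is [R] with its Borel sigma-algebra. *)
Definition of_triple (R : realType)
    (p : measurableTypeR R * measurableTypeR R * measurableTypeR R) :
    'rV[R]_3 :=
  row3 p.1.1 p.1.2 p.2.

(** The integral of [sqrt (det g)] over a Borel set [E] of coordinates. *)
Definition chart_vol (R : realType) (X : topologicalType)
    (g : metric R 3 X) (c : chart R 3 X) (E : set 'rV[R]_3) : \bar R :=
  \int[((lebesgue_measure \x lebesgue_measure) \x lebesgue_measure)%E]_
      (p in @of_triple R @^-1` E)
    (Num.sqrt (\det (g c (chart_inv c (of_triple p)))))%:E.

(** Total volume of a Riemannian 3-manifold: the supremum of the volumes of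
    finite disjoint families of Borel sets, each contained in a chart (the
    [E i] are the images of these sets under the charts [c i]). *)
Definition riem_vol (R : realType) (X : topologicalType)
    (A : set (chart R 3 X)) (g : metric R 3 X) : \bar R :=
  ereal_sup [set v | exists (k : nat) (c : 'I_k -> chart R 3 X)
                            (E : 'I_k -> set 'rV[R]_3),
    [/\ forall i, A (c i),
        forall i, E i `<=` chart_map (c i) @` chart_dom (c i),
        forall i, measurable (@of_triple R @^-1` E i),
        trivIset [set: 'I_k] (fun i => chart_inv (c i) @` E i) &
        v = (\sum_(i < k) chart_vol g (c i) (E i))%E]].

(** * The torus R^3 / Z^3 *)

Definition lattice_rel (R : realType) (x y : 'rV[R]_3) : bool :=
  [forall i, (x - y) 0 i \is a Num.int].

Lemma lattice_rel_refl (R : realType) : reflexive (@lattice_rel R).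
Proof. by move=> x; apply/forallP => i; rewrite subrr mxE rpred0. Qed.

Lemma lattice_rel_sym (R : realType) : symmetric (@lattice_rel R).
Proof.
by move=> x y; apply: eq_forallb => i; rewrite !mxE -opprB rpredN.
Qed.

Lemma lattice_rel_trans (R : realType) : transitive (@lattice_rel R).
Proof.
move=> y x z /forallP xy /forallP yz; apply/forallP => i.
by have := rpredD (xy i) (yz i); rewrite !mxE addrA subrK.
Qed.

Canonical lattice_equiv (R : realType) :=
  EquivRel (@lattice_rel R) (@lattice_rel_refl R) (@lattice_rel_sym R)
    (@lattice_rel_trans R).

Definition torus (R : realType) : topologicalType :=
  quotient_topology {eq_quot @lattice_rel R}.

Definition torus_pi (R : realType) : 'rV[R]_3 -> torus R :=
  \pi_({eq_quot @lattice_rel R}).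

(** All local inverses of the covering map [torus_pi]. *)
Definition torus_atlas (R : realType) : set (chart R 3 (torus R)) :=
  [set c | is_chart c /\ forall q, chart_dom c q -> torus_pi (chart_map c q) = q].

Definition R3_atlas (R : realType) : set (chart R 3 'rV[R]_3) :=
  [set Chart [set: 'rV[R]_3] id id].

(** * The Kasner metric *)

Definition golden (R : realType) : R := (1 + Num.sqrt 5) / 2.
Definition c_golden (R : realType) : R := Num.sqrt (1 + golden R ^+ 2).

(** A covector is the row of its components on [dx], [dy], [dz]. *)
Definition eta1 (R : realType) : 'rV[R]_3 :=
  (c_golden R)^-1 *: row3 1 (golden R) 0.
Definition eta2 (R : realType) : 'rV[R]_3 :=
  (c_golden R)^-1 *: row3 (- golden R) 1 0.
Definition dz (R : realType) : 'rV[R]_3 := row3 0 0 1.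

Definition covector_sq (R : realType) (n : nat) (w : 'rV[R]_n) : 'M[R]_n :=
  w^T *m w.

Definition h_gram (R : realType) (t : R) : 'M[R]_3 :=
  t `^ (- (2 / 3)) *: covector_sq (eta1 R)
  + t `^ (4 / 3) *: (covector_sq (eta2 R) + covector_sq (dz R)).

(** All charts of [torus_atlas] have the coordinate frame (d/dx, d/dy, d/dz). *)
Definition torus_metric (R : realType) (t : R) : metric R 3 (torus R) :=
  fun _ _ => h_gram t.

Definition spacetime (R : realType) : topologicalType :=
  (set_type (`]0, +oo[%classic : set R) * torus R)%type.

(** The charts [(t, x, y, z)] with [(x, y, z)] a local lift of the torus
    component to R^3. *)
Definition spacetime_atlas (R : realType) : set (chart R 4 (spacetime R)) :=
  [set c | is_chart c /\ forall m, chart_dom c m ->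
     let v : 'rV[R]_(1 + 3) := chart_map c m in
     v 0 0 = set_val m.1 /\ torus_pi (rsubmx v) = m.2].

Definition spacetime_metric (R : realType) : metric R 4 (spacetime R) :=
  fun _ m => (block_mx (-1)%:M 0 0 (h_gram (set_val m.1)) : 'M[R]_(1 + 3)).

(* Main.v *)
(** Diameters.  A curve of length [l] displaces its lift to R^3 by at most [l t^(1/3)] in the
    direction [eta1] and [l t^(-2/3)] in the direction [eta2].  On R^3 the direction [eta1] alone
    gives the growth [t^(-1/3)].  On the torus the end points of the lift are only given modulo
    Z^3: the product [eta1 * eta2] is a multiple of the norm form of Z[theta], hence bounded below
    on the translate [(1/2, 0, 0) + Z^3]; conversely, a power of the hyperbolic matrix
    [(x, y) |-> (y - x, x)], which scales [eta1] and [eta2] by [1 / theta] and [- theta], moves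
    every point modulo Z^3 to one with [eta1] and [eta2] of order [t^(1/2)] and [t^(-1/2)].

    Inextendibility.  Near a boundary point of the image of an extension there are linear
    coordinates in which the extended metric is almost Minkowski and the segment [s e0], [s < 0],
    runs in the image and leaves it at [0].  Its time function [t] is monotone and cannot converge
    to a positive value, since the torus is compact.
    If [t] tends to infinity, the lift of the segment up to [t = T] is deformed with fixed end
    points: its spatial displacement is contracted by a factor [1 - eps], [eps] of order
    [T^(-4/3)], and the slack near its start makes up for the difference.  The intermediate curves
    are timelike, hence stay in the box, and along the last one the box time grows by
    [sqrt eps * T] up to a constant, which is unbounded.
    If [t] tends to [0], the particle horizons [int_0^t u^(-2/3) du] shrink, so a neighbourhood of
    the segment lies below one sheet of the universal cover, in which every vertical line reaches
    each small level of [t] once.  The displacement in the direction [eta1] between the lifts of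
    two such lines at the level [t] is of order [t^(1/3)].  So the lift of the segment, translated
    by [a] in the direction [x], leaves this neighbourhood sideways at a parameter [s(a)] tending
    to [0] with [a].  At a cluster point [w] of the exit points the box time is positive.  A
    timelike curve ending near [w] can be tilted back by [a], its end then moving to [s(a) e0];
    but that point has negative box time and the curve starts at positive box time.

    Volume.  [det h_t = t^2], and Borel sets in charts with disjoint images in the torus can be cut
    along Z^3 into disjoint subsets of the unit cube. *)

Require Import Defs.
From mathcomp Require Import all_boot all_order all_algebra.
From mathcomp Require Import all_classical all_reals all_analysis.
From mathcomp Require Import ring lra zify.
Import Order.TTheory GRing.Theory Num.Theory.
Import numFieldNormedType.Exports.

Set Implicit Arguments.
Unset Strict Implicit.
Unset Printing Implicit Defensive.

Local Open Scope classical_set_scope.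
Local Open Scope ring_scope.

(** What survives is a comparison with fixed cones: in the box, vectors of slope at most 1/8 are
    uniformly timelike and causal vectors have slope at most 2. The curves are therefore preimages
    of straight lines and their explicit deformations by translations and contractions of the Kasner
    coordinates. All deformation arguments have one form: a limit of points of the domain is again
    in the domain as long as its Kasner time stays positive and its box image stays in a compact
    part of the box ([bc_closed], [bc_closed_image]). The record [box_chart] collects these facts,
    so that the core mentions no manifold. Box time may run with or against Kasner time, whence the
    sign [sg]. Towards the singularity the diameter of the torus shrinks, so that no obstruction
    comes from diverging spatial diameters as it would on the universal cover; confinement to one
    sheet recovers it locally. *)

Ltac vring := apply/matrixP => ? ?; rewrite !mxE; ring.

(** * The torus *)

Section RowVectors.
Variable R : realType.

Lemma coord_le_norm m n (v : 'M[R]_(m, n)) i j : `|v i j| <= `|v|.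
Proof.
rewrite [leRHS]/Num.Def.normr /= mx_normrE.
exact: (le_bigmax _ (fun ij : 'I_m * 'I_n => `|v ij.1 ij.2|) (i, j)).
Qed.

Lemma norm_le_coord m n (v : 'M[R]_(m, n)) e :
  0 <= e -> (forall i j, `|v i j| <= e) -> `|v| <= e.
Proof.
move=> e0 H; rewrite [leLHS]/Num.Def.normr /= mx_normrE.
by apply: bigmax_le => // -[i j] _; exact: H.
Qed.

Lemma norm_lt_coord m n (v : 'M[R]_(m, n)) e :
  0 < e -> (forall i j, `|v i j| < e) -> `|v| < e.
Proof.
move=> e0 H; rewrite [ltLHS]/Num.Def.normr /= mx_normrE.
by apply: bigmax_lt => // -[i j] _; exact: H.
Qed.

Lemma nbhs_rV n (x : 'rV[R]_n) (P : set 'rV[R]_n) :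
  nbhs x P <-> exists2 e : R, 0 < e & forall y, `|y - x| < e -> P y.
Proof.
split=> [/nbhs_ballP[e e0 H]|[e e0 H]].
  by exists e => // y yx; apply: H; rewrite -ball_normE /= distrC.
by apply/nbhs_ballP; exists e => // y; rewrite -ball_normE /= distrC; exact: H.
Qed.

End RowVectors.

Section Torus.
Variable R : realType.
Local Notation pi := (@torus_pi R).

Lemma torus_piP (x y : 'rV[R]_3) : pi x = pi y <-> lattice_rel x y.
Proof. by split=> [/eqmodP //|H]; apply/eqmodP. Qed.

Lemma torus_pi_surj (q : torus R) : exists x, pi x = q.
Proof. by exists (repr q); rewrite /torus_pi reprK. Qed.

Lemma torus_pi_continuous : continuous pi.
Proof. exact: pi_continuous. Qed.

Lemma torus_openE (U : set (torus R)) : open U <-> open (pi @^-1` U).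
Proof. by []. Qed.

Lemma lattice_shift (x n : 'rV[R]_3) :
  (forall i, n 0 i \is a Num.int) -> pi (x + n) = pi x.
Proof.
by move=> H; apply/torus_piP/forallP => i; rewrite addrAC subrr add0r.
Qed.

Lemma torus_pi_open (U : set 'rV[R]_3) : open U -> open (pi @` U).
Proof.
move=> oU; apply/torus_openE; rewrite openE => x [y Uy yx].
have /nbhs_rV[e e0 H] : nbhs y U by apply: open_nbhs_nbhs.
apply/nbhs_rV; exists e => // z zx.
exists (y + (z - x)); first by apply: H; rewrite addrAC subrr add0r.
have /torus_piP/forallP h := yx.
apply/torus_piP/forallP => i; have := h i; rewrite !mxE.
by rewrite (_ : y 0 i + (z 0 i - x 0 i) - z 0 i = y 0 i - x 0 i) //; ring.
Qed.

Lemma lattice_eq (x y : 'rV[R]_3) : pi x = pi y -> `|x - y| < 1 -> x = y.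
Proof.
move=> /torus_piP/forallP h d; apply/subr0_eq/rowP => i; rewrite [RHS]mxE.
apply/eqP; apply: contraTT (h i) => n0; apply/negP => /norm_intr_ge1/(_ n0).
by rewrite leNgt (le_lt_trans (coord_le_norm _ _ _)).
Qed.

Lemma int_dist (a : R) : a \isn't a Num.int ->
  exists2 e : R, 0 < e & forall b, `|b - a| < e -> b \isn't a Num.int.
Proof.
move=> an; have /andP[l u] := floor_itv a.
have l' : (Num.floor a)%:~R < a.
  rewrite lt_neqAle l andbT; apply: contra an => /eqP <-; exact: intr_int.
exists (Num.min (a - (Num.floor a)%:~R) ((Num.floor a + 1)%:~R - a)).
  by rewrite lt_min !subr_gt0 l' u.
move=> b; rewrite lt_min => /andP[b1 b2]; apply/negP => /intrP[m bm].
move: b1 b2; rewrite {}bm !ltr_norml => /andP[b1 _] /andP[_ b2].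
have : (Num.floor a)%:~R < (m%:~R : R) by lra.
have : (m%:~R : R) < (Num.floor a + 1)%:~R by lra.
by rewrite !ltr_int ltzD1 => ? ?; lia.
Qed.

(** If one coordinate of the difference is not an integer, it stays non-integral under perturbations
    smaller than some [e]; balls of radius [e / 2] then have disjoint images. *)
Lemma torus_hausdorff : hausdorff_space (torus R).
Proof.
rewrite open_hausdorff => q1 q2.
have [x1 <-] := torus_pi_surj q1; have [x2 <-] := torus_pi_surj q2 => ne.
have [i ni] : exists i, (x1 - x2) 0 i \isn't a Num.int.
  apply/existsP; rewrite -negb_forall; apply: contra ne => h.
  by apply/eqP/torus_piP.
have [e e0 He] := int_dist ni.
exists (pi @` ball x1 (e / 2), pi @` ball x2 (e / 2)).
  by split; rewrite inE; [exists x1 | exists x2] => //; apply: ballxx;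
    rewrite divr_gt0.
split; [exact/torus_pi_open/ball_open | exact/torus_pi_open/ball_open|].
all: rewrite ?divr_gt0 //.
apply/eqP; rewrite predeqE => q; split=> //= -[[y1 b1 <-] [y2 b2 q12]].
have /torus_piP/forallP/(_ i) := esym q12; apply/negP/He.
move: b1 b2; rewrite -!ball_normE /= => b1 b2.
have c1 := le_lt_trans (coord_le_norm _ 0 i) b1.
have c2 := le_lt_trans (coord_le_norm _ 0 i) b2.
move: c1 c2; rewrite !mxE !ltr_norml => /andP[? ?] /andP[? ?].
by apply/andP; split; lra.
Qed.

(** The difference of two lifts of the same map is continuous with lattice values near [x], hence
    locally constant. *)
Lemma lift_near (T : topologicalType) (f g : T -> 'rV[R]_3) (x : T) :
  {for x, continuous f} -> {for x, continuous g} ->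
  (\forall y \near x, pi (f y) = pi (g y)) ->
  \forall y \near x, f y = g y + (f x - g x).
Proof.
move=> cf cg H.
have Hx := nbhs_singleton H.
have c : (fun y => f y - g y) @ x --> f x - g x by exact: cvgB.
have /cvgrPdist_lt/(_ 1 ltr01) c1 := c.
near=> y.
suff : f y - (f x - g x) = g y by move/eqP; rewrite subr_eq => /eqP.
apply: lattice_eq.
  have Hy : pi (f y) = pi (g y) by near: y.
  rewrite -Hy -(subrK (f y) (f y - (f x - g x))) addrC lattice_shift // => i.
  have /torus_piP/forallP/(_ i) := esym Hx.
  by rewrite !mxE (_ : f y 0 i - (f x 0 i - g x 0 i) - f y 0 i = g x 0 i - f x 0 i) //; ring.
have -> : f y - (f x - g x) - g y = - (f x - g x - (f y - g y)).
  by vring.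
by rewrite normrN; near: y.
Unshelve. all: by end_near. Qed.

(** In the maximum norm this ball is an open unit cube, on which the covering map is injective. The
    default value of [xget] is never reached on the domain. *)
Definition torus_chart (x0 : 'rV[R]_3) : chart R 3 (torus R) :=
  Chart (pi @` ball x0 (1 / 2))
    (fun q => xget x0 [set x | ball x0 (1 / 2) x /\ pi x = q]) pi.

Lemma ball_lattice_eq (x0 x y : 'rV[R]_3) :
  ball x0 (1 / 2) x -> ball x0 (1 / 2) y -> pi x = pi y -> x = y.
Proof.
rewrite -!ball_normE /= => bx byy e; apply: lattice_eq => //.
have -> : x - y = (x0 - y) - (x0 - x) by vring.
by rewrite (le_lt_trans (ler_normB _ _)) //; lra.
Qed.

Lemma torus_chart_mapE (x0 x : 'rV[R]_3) :
  ball x0 (1 / 2) x -> chart_map (torus_chart x0) (pi x) = x.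
Proof.
move=> bx /=; case: xgetP => [y _ [by_ e]|/(_ x) []//].
exact: ball_lattice_eq by_ bx e.
Qed.

Lemma torus_chart_image (x0 : 'rV[R]_3) :
  chart_map (torus_chart x0) @` chart_dom (torus_chart x0) = ball x0 (1 / 2).
Proof.
rewrite predeqE => x; split=> [[_ [y by_ <-] <-]|bx].
  by rewrite torus_chart_mapE.
by exists (pi x); [exists x | rewrite torus_chart_mapE].
Qed.

Lemma torus_chartP (x0 : 'rV[R]_3) : torus_atlas (torus_chart x0).
Proof.
split; last by move=> q [x bx <-]; rewrite torus_chart_mapE.
have h : 0 < 1 / 2 :> R by [].
split=> /=.
- exact/torus_pi_open/ball_open.
- by have /= -> := torus_chart_image x0; exact: ball_open.
- by move=> _ [x bx <-]; have /= -> := torus_chart_mapE bx.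
- move=> _ [x bx <-] U; have /= -> := torus_chart_mapE bx => Ux.
  have [V [oV Vx] VU] : exists2 V, open_nbhs x V & V `<=` U `&` ball x0 (1 / 2).
    have : nbhs x (U `&` ball x0 (1 / 2)).
      by apply: filterI => //; apply: open_nbhs_nbhs; split=> //; exact: ball_open.
    by rewrite nbhsE => -[V ? ?]; exists V.
  apply: (@filterS _ _ _ (pi @` V)).
    move=> _ [y Vy <-]; have [Uy by_] := VU _ Vy.
    by have /= -> := torus_chart_mapE by_.
  by apply: (@open_nbhs_nbhs (torus R)); split; [exact: torus_pi_open | exists x].
- by move=> v _; exact: torus_pi_continuous.
Qed.

End Torus.

(** * Continuous induction and the lifting of paths to R^3 *)

Section RealInduction.
Variable R : realType.

(** Connectedness of the interval, in the form used for all homotopies: the supremum of the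
    parameters up to which [P] holds is itself such a parameter by the closing clause, and cannot
    lie below [b] by the opening one. *)
Lemma real_induction (a b : R) (P : R -> Prop) : a <= b -> P a ->
  (forall s, a < s <= b -> (forall u, a <= u < s -> P u) -> P s) ->
  (forall s, a <= s < b -> (forall u, a <= u <= s -> P u) ->
    exists2 e : R, 0 < e & forall u, s < u < s + e -> u <= b -> P u) ->
  forall s, a <= s <= b -> P s.
Proof.
move=> ab Pa Pcl Pop.
pose S := [set s | a <= s <= b /\ forall u, a <= u <= s -> P u].
have Sa : S a.
  by split; [rewrite lexx | move=> u; rewrite -eq_le => /eqP <-].
have hS : has_sup S by split; [exists a | exists b => s [/andP[]]].
set c := sup S.
have ac : a <= c by exact: sup_upper_bound.
have cb : c <= b by apply: sup_le_ub; [exists a | move=> s [/andP[]]].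
have Plt u : a <= u < c -> P u.
  move=> /andP[au uc]; have /(sup_adherent)/(_ hS) : 0 < c - u by rewrite subr_gt0.
  move=> [s [_ Ps]]; rewrite -/c opprB addrC subrK => us.
  by apply: Ps; rewrite au ltW.
have Pc : P c.
  move: ac; rewrite le_eqVlt => /orP[/eqP <- //|ac].
  by apply: Pcl => //; rewrite ac.
have Ple u : a <= u <= c -> P u.
  move=> /andP[au]; rewrite le_eqVlt => /orP[/eqP -> //|uc].
  by apply: Plt; rewrite au.
have -> : b = c; last by [].
apply/eqP; rewrite eq_le cb andbT leNgt; apply/negP => cltb.
have [|e e0 He] := Pop c _ Ple; first by rewrite ac.
pose d := Num.min b (c + e / 2).
have cd : c < d by rewrite lt_min cltb ltrDl divr_gt0.
suff : S d by move/(sup_upper_bound hS); rewrite leNgt cd.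
split; first by rewrite (le_trans ac (ltW cd)) ge_min lexx.
move=> u /andP[au ud]; have [uc|cu] := leP u c; first by apply: Ple; rewrite au.
move: ud; rewrite le_min => /andP[ub ud].
by apply: He => //; rewrite cu (le_lt_trans ud) // ltrD2l gtr_pMr // invf_lt1 // ltr1n.
Qed.

End RealInduction.

Section PathLifting.
Variable R : realType.
Local Notation pi := (@torus_pi R).

Lemma torus_local_section (T : topologicalType) (g : T -> torus R) (s : T)
    (x0 : 'rV[R]_3) : pi x0 = g s -> {for s, continuous g} ->
  exists2 p : T -> 'rV[R]_3, (\forall u \near s, pi (p u) = g u) &
    \forall u \near s, {for u, continuous g} -> {for u, continuous p}.
Proof.
move=> e cg; set c := torus_chart x0.
have [[od _ _ cm _] mK] := torus_chartP x0.
have ds : nbhs s [set u | chart_dom c (g u)].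
  apply: (cg); apply: (@open_nbhs_nbhs (torus R)); split => //.
  by exists x0 => //; exact: ballxx.
exists (fun u => chart_map c (g u)).
  by near=> u; apply: mK; near: u.
near=> u => cgu; apply: continuous_comp => //; apply: cm.
by near: u.
Unshelve. all: by end_near. Qed.

(** The lifting equation is asked in full neighbourhoods, even at the end points of the interval, so
    that the lift can be differentiated there. *)
Lemma path_lifting (g : R -> torus R) (a b : R) (x0 : 'rV[R]_3) :
  a <= b -> pi x0 = g a -> (forall s, a <= s <= b -> {for s, continuous g}) ->
  exists x : R -> 'rV[R]_3, [/\ x a = x0,
    forall s, a <= s <= b -> {for s, continuous x} &
    forall s, a <= s <= b -> \forall u \near s, pi (x u) = g u].
Proof.
move=> ab ea cg.
pose P s := exists x : R -> 'rV[R]_3, [/\ x a = x0,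
    forall u, a <= u <= s -> {for u, continuous x} &
    forall u, a <= u <= s -> \forall w \near u, pi (x w) = g w].
suff : forall s, a <= s <= b -> P s by apply; rewrite ab lexx.
(* A single local section around [s] prolongs a lift from [u] to [v], wherever the two lie relative
   to [s]; this serves both clauses of the induction. *)
have step s : a <= s <= b -> exists2 e : R, 0 < e &
    forall u, `|u - s| < e -> a <= u <= b -> P u ->
    forall v, `|v - s| < e -> u <= v -> v <= b -> P v.
  move=> sab; have [y ys] := torus_pi_surj (g s).
  have [p p1 p2] := torus_local_section ys (cg _ sab).
  have [e /= e0 H] := (nbhs_ballP s _).1 (filterI p1 p2).
  exists e => // u us /andP[au ub] [x [xa xc xl]] v vs uv vb.
  have inb w : u <= w <= v -> ball s e w.
    move=> /andP[uw wv]; rewrite -ball_normE /= distrC.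
    by move: us vs; rewrite !ltr_norml => /andP[? ?] /andP[? ?]; apply/andP; split; lra.
  have near1 w : u <= w <= v -> \forall z \near w, pi (p z) = g z.
    move=> /inb sw; have : \forall z \near w, ball s e z.
      by apply: open_nbhs_nbhs; split => //; exact: ball_open.
    by apply: filterS => z /H[].
  have pu : {for u, continuous p}.
    by have [|_] := H u; [apply: inb; rewrite lexx | apply; apply: cg; rewrite au].
  have xu : {for u, continuous x} by apply: xc; rewrite au lexx.
  have E : \forall z \near u, x z = p z + (x u - p u).
    apply: lift_near => //; near=> z.
    have -> : pi (x z) = g z by near: z; apply: xl; rewrite au lexx.
    by apply: esym; near: z; apply: near1; rewrite lexx uv.
  (* The section is glued on after a translation by [x u - p u], a lattice vector because both
     points project to [g u]. *)
  pose x' z := if z <= u then x z else p z + (x u - p u).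
  have E1 : \forall z \near u, x' z = x z.
    by near=> z; rewrite /x'; case: ifP => // _; apply: esym; near: z.
  have E2 w : w < u -> \forall z \near w, x' z = x z.
    move=> wu; near=> z; rewrite /x' ifT //; apply: ltW; near: z.
    exact: lt_nbhsl.
  have E3 w : u < w -> \forall z \near w, x' z = p z + (x u - p u).
    move=> uw; near=> z; rewrite /x' ifF //; apply/negbTE; rewrite -ltNge; near: z.
    exact: lt_nbhsr.
  have latt : forall i, (x u - p u) 0 i \is a Num.int.
    have /torus_piP/forallP : pi (x u) = pi (p u).
      have xlu : \forall z \near u, pi (x z) = g z by apply: xl; rewrite au lexx.
      have plu : \forall z \near u, pi (p z) = g z by apply: near1; rewrite lexx uv.
      by rewrite (nbhs_singleton xlu) (nbhs_singleton plu).
    by [].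
  exists x'; split.
  - by rewrite /x' au.
  - move=> w /andP[aw wv]; have [wu|uw|wu] := ltgtP w u.
    + rewrite /prop_for /continuous_at /x' (ltW wu) -/x'.
      apply: cvg_trans (xc w _); last by rewrite aw ltW.
      apply: near_eq_cvg; near=> z; apply: esym; near: z; exact: E2.
    + rewrite /prop_for /continuous_at [x' w](_ : _ = p w + (x u - p u)); last first.
        by rewrite /x' leNgt uw.
      apply: (@cvg_trans _ ((fun z => p z + (x u - p u)) @ w)).
        apply: near_eq_cvg; near=> z; apply: esym; near: z; exact: E3.
      have pw : {for w, continuous p}.
        have [|_] := H w; first by apply: inb; rewrite (ltW uw).
        by apply; apply: cg; rewrite aw (le_trans wv).
      exact: (cvgD pw (cvg_cst _)).
    + rewrite wu /prop_for /continuous_at /x' lexx -/x'.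
      apply: cvg_trans xu.
      by apply: near_eq_cvg; near=> z; apply: esym; near: z; exact: E1.
  - move=> w /andP[aw wv]; have [wu|uw|->] := ltgtP w u.
    + near=> z; have -> : x' z = x z by near: z; exact: E2.
      by near: z; apply: xl; rewrite aw ltW.
    + near=> z; have -> : x' z = p z + (x u - p u) by near: z; exact: E3.
      rewrite lattice_shift //.
      by near: z; apply: near1; rewrite (ltW uw).
    + near=> z; have -> : x' z = x z by near: z; exact: E1.
      by near: z; apply: xl; rewrite au lexx.
have Pa : P a.
  have [|p p1 p2] := @torus_local_section _ g a x0 ea (cg _ _); first by rewrite lexx.
  exists (fun z => p z + (x0 - p a)); split.
  - by rewrite addrC subrK.
  - move=> u; rewrite -eq_le => /eqP <-; 
    have pa : {for a, continuous p}.
      by apply: (nbhs_singleton p2); apply: cg; rewrite lexx.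
    exact: (cvgD pa (cvg_cst _)).
  - move=> u; rewrite -eq_le => /eqP <-; apply: filterS (p1) => z <-.
    apply: lattice_shift.
    have /torus_piP/forallP : pi x0 = pi (p a) by rewrite ea (nbhs_singleton p1).
    by [].
apply: real_induction => //.
- move=> s /andP[as_ sb] Ps; have [|e e0 He] := step s; first by rewrite ltW.
  pose u := Num.max a (s - e / 2).
  have us : u < s by rewrite gt_max as_ gtrBl divr_gt0.
  have au : a <= u by rewrite le_max lexx.
  apply: (He u _ _ _ s) => //; rewrite ?subrr ?normr0 //.
  + rewrite distrC gtr0_norm ?subr_gt0 // ltrBlDr -ltrBlDl.
    have : s - e / 2 <= u by rewrite le_max lexx orbT.
    lra.
  + by rewrite au (le_trans (ltW us)).
  + by apply: Ps; rewrite au.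
  + exact: ltW.
- move=> s /andP[as_ sb] Ps; have [|e e0 He] := step s; first by rewrite as_ ltW.
  exists e => // v /andP[sv vs] vb; apply: (He s _ _ _ v) => //.
  + by rewrite subrr normr0.
  + by rewrite as_ ltW.
  + by apply: Ps; rewrite as_ lexx.
  + by rewrite gtr0_norm ?subr_gt0 // ltrBlDl.
  + exact: ltW.
Unshelve. all: by end_near. Qed.

End PathLifting.

(** * Differentials of curves and maps *)

Section MeanValue.
Variable R : realType.

Lemma within_itv_continuous (T : topologicalType) (f : R -> T) (a b : R) :
  (forall s, a <= s <= b -> {for s, continuous f}) -> {within `[a, b], continuous f}.
Proof.
move=> H; apply: continuous_in_subspaceT => s.
by rewrite inE /= in_itv /= => /H.
Qed.

Lemma mean_value_ge (f : R -> R) (a b m : R) : a <= b ->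
  (forall s, a <= s <= b -> {for s, continuous f}) ->
  (forall s, a < s < b -> derivable f s 1 /\ m <= derive1 f s) ->
  m * (b - a) <= f b - f a.
Proof.
rewrite le_eqVlt => /orP[/eqP -> _ _|ab cf df].
  by rewrite !subrr mulr0.
have [|c] := @MVT _ f (derive1 f) a b ab _ (within_itv_continuous cf).
  move=> s; rewrite in_itv /= => /df[ds _].
  by apply: DeriveDef => //; rewrite derive1E.
rewrite in_itv /= => /df[_ mc] ->.
by rewrite ler_wpM2r // subr_ge0 ltW.
Qed.

Lemma mean_value_le (f : R -> R) (a b m : R) : a <= b ->
  (forall s, a <= s <= b -> {for s, continuous f}) ->
  (forall s, a < s < b -> derivable f s 1 /\ derive1 f s <= m) ->
  f b - f a <= m * (b - a).
Proof.
move=> ab cf df; rewrite -lerN2 -mulNr opprB.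
have -> : f a - f b = - f b - (- f a) by rewrite opprK addrC.
apply: (@mean_value_ge (- f)); [exact: ab | move=> s /cf | move=> s /df[ds ms]].
  by apply: continuousN.
split; first exact: derivableN.
by rewrite derive1E deriveN // -derive1E lerN2.
Qed.

Lemma mean_value_norm (f : R -> R) (a b m : R) :
  (forall s, Num.min a b <= s <= Num.max a b -> derivable f s 1 /\ `|derive1 f s| <= m) ->
  `|f b - f a| <= m * `|b - a|.
Proof.
wlog ab : a b / a <= b => [H df|df].
  have [ab|/ltW ba] := leP a b; first exact: H.
  by rewrite distrC [`|b - a|]distrC; apply: H => //; rewrite minC maxC.
rewrite (min_idPl ab) (max_idPr ab) in df.
have cf s : a <= s <= b -> {for s, continuous f}.
  by move=> /df[ds _]; apply/differentiable_continuous/derivable1_diffP.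
rewrite (ger0_norm (_ : 0 <= b - a)) ?subr_ge0 // ler_norml; apply/andP; split.
  rewrite -mulNr; apply: mean_value_ge => // s /andP[/ltW as_ /ltW sb].
  have [|ds] := df s; first by rewrite as_ sb.
  by rewrite ler_norml => /andP[].
apply: mean_value_le => // s /andP[/ltW as_ /ltW sb].
have [|ds] := df s; first by rewrite as_ sb.
by rewrite ler_norml => /andP[].
Qed.

Lemma derivable_coord m n (c : R -> 'M[R]_(m, n)) (s : R) i j : derivable c s 1 ->
  derivable (fun u => c u i j) s 1 /\ derive1 (fun u => c u i j) s = (derive1 c s) i j.
Proof.
move=> dc; have dci := (derivable_mxP c s 1).1 dc i j; split=> //.
by rewrite !derive1E derive_mx // mxE.
Qed.

End MeanValue.

Section Differential.
Variable R : realType.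

Lemma mulmx_norm_le m n p (v : 'M[R]_(m, n)) (J : 'M[R]_(n, p)) :
  `|v *m J| <= (n%:R * `|J|) * `|v|.
Proof.
apply: norm_le_coord => [|i j]; first by rewrite !mulr_ge0.
rewrite mxE (le_trans (ler_norm_sum _ _ _)) //.
apply: (@le_trans _ _ (\sum_(k < n) `|J| * `|v|)).
  apply: ler_sum => k _; rewrite normrM mulrC.
  by apply: ler_pM => //; exact: coord_le_norm.
by rewrite sumr_const card_ord -[in leLHS]mulr_natl mulrA.
Qed.

Lemma diff_epsP (V W : normedModType R) (f : V -> W) (x : V) : differentiable f x ->
  forall e : R, 0 < e -> \forall h \near (0 : V), `|f (h + x) - f x - 'd f x h| <= e * `|h|.
Proof.
by move=> /diff_locally/eqaddoP H e e0; have := H e e0; apply: filterS => h /=; rewrite /cst opprD addrA.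
Qed.

Lemma diff_eps (V W : normedModType R) (f : V -> W) (x : V) (L : {linear V -> W}) :
  continuous L ->
  (forall e : R, 0 < e -> \forall h \near (0 : V), `|f (h + x) - f x - L h| <= e * `|h|) ->
  is_diff x f L.
Proof.
move=> cL H.
have E : f \o shift x = cst (f x) + L +o_ 0 id.
  apply/eqaddoP => e e0; have := H e e0.
  by apply: filterS => h /=; rewrite /cst opprD addrA.
have dE := diff_unique cL E.
apply: DiffDef => //; apply/diff_locallyP; split; first by rewrite dE.
by rewrite dE.
Qed.

Lemma mulmxr_continuous m n p (J : 'M[R]_(n, p)) :
  continuous (mulmxr J : 'M[R]_(m, n) -> 'M[R]_(m, p)).
Proof.
suff H (v : 'M[R]_(m, n)) : mulmxr J @ v --> mulmxr J v by exact: H.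
apply/(@cvgrPdist_le _ _ _ (nbhs v)) => e e0.
set C := n%:R * `|J|.
have C0 : 0 <= C by rewrite mulr_ge0.
have eC : 0 < e / (C + 1) by rewrite divr_gt0 //; lra.
near=> u.
rewrite /= -mulmxBl (le_trans (mulmx_norm_le _ _)) // -/C.
have : `|v - u| <= e / (C + 1).
  near: u; apply: cvgr_dist_le; first exact: cvg_id.
  by [].
rewrite ler_pdivlMr; last lra.
by have := normr_ge0 (v - u); nra.
Unshelve. all: by end_near. Qed.

Lemma diff_mx_eps n m (f : 'rV[R]_n -> 'rV[R]_m) (x : 'rV[R]_n) (J : 'M[R]_(n, m)) :
  (forall e : R, 0 < e -> \forall h \near (0 : 'rV[R]_n), `|f (h + x) - f x - h *m J| <= e * `|h|) ->
  differentiable f x /\ 'J f x = J.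
Proof.
move=> H; have [df dE] : is_diff x f (mulmxr J).
  by apply: diff_eps => //; exact: mulmxr_continuous.
split=> //; apply/row_matrixP => i; rewrite !rowE.
by rewrite -deriveEjacobian // deriveE // dE.
Qed.

Lemma diff_jacobian_eps n m (f : 'rV[R]_n -> 'rV[R]_m) (x : 'rV[R]_n) :
  differentiable f x ->
  forall e : R, 0 < e -> \forall h \near (0 : 'rV[R]_n), `|f (h + x) - f x - h *m 'J f x| <= e * `|h|.
Proof.
move=> df e e0; have := diff_epsP df e0; apply: filterS => h.
by rewrite -deriveEjacobian // deriveE.
Qed.

Lemma jacobian_translation n (f : 'rV[R]_n -> 'rV[R]_n) (x k : 'rV[R]_n) :
  (\forall y \near x, f y = y + k) -> differentiable f x /\ 'J f x = 1%:M.
Proof.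
move=> H; apply: diff_mx_eps => e e0.
have := H; rewrite (near_shift 0) /= => H0.
near=> h; rewrite mulmx1 (nbhs_singleton H).
have -> : f (h + x) = h + x + k by near: h; apply: filterS H0 => h /=; rewrite subr0.
rewrite (_ : _ - _ - h = 0); first by rewrite normr0 mulr_ge0 // ltW.
by vring.
Unshelve. all: by end_near. Qed.

Lemma is_derive_comp_diff (V W : normedModType R) (f : V -> W) (c : R -> V) (s : R) :
  differentiable f (c s) -> derivable c s 1 ->
  derivable (f \o c) s 1 /\ derive1 (f \o c) s = 'd f (c s) (derive1 c s).
Proof.
move=> df /derivable1_diffP dc.
have dfc : differentiable (f \o c) s by exact: differentiable_comp.
split; first exact/derivable1_diffP.
by rewrite derive1E' // diff_comp //= derive1E'.
Qed.

Lemma derive1_comp_jacobian n m (f : 'rV[R]_n -> 'rV[R]_m) (c : R -> 'rV[R]_n) (s : R) :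
  differentiable f (c s) -> derivable c s 1 ->
  derivable (f \o c) s 1 /\ derive1 (f \o c) s = derive1 c s *m 'J f (c s).
Proof.
move=> df dc; have [d ->] := is_derive_comp_diff df dc; split=> //.
by rewrite -deriveEjacobian // deriveE.
Qed.

(** The right inverse [K] recovers [c u - c s] from [f (c u) - f (c s)], up to an error that is
    small relative to [c u - c s] itself. Absorbing this error gives a Lipschitz bound, and the
    bound gives the derivative. This takes the place of the inverse function theorem. *)
Lemma derivable_lift n m (f : 'rV[R]_n -> 'rV[R]_m) (c : R -> 'rV[R]_n) (s : R)
    (K : 'M[R]_(m, n)) :
  differentiable f (c s) -> 'J f (c s) *m K = 1%:M -> {for s, continuous c} ->
  derivable (f \o c) s 1 -> derivable c s 1.
Proof.
move=> df JK cc dfc; set J := 'J f (c s) in JK.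
set w := derive1 (f \o c) s.
set CK := m%:R * `|K|.
have CK0 : 0 <= CK by rewrite mulr_ge0.
pose e1 := (2 * (CK + 1))^-1.
have e10 : 0 < e1 by rewrite invr_gt0; lra.
have fe e : 0 < e -> \forall u \near s,
    `|f (c u) - f (c s) - (c u - c s) *m J| <= e * `|c u - c s|.
  move=> e0; have := diff_jacobian_eps df e0; rewrite (near_shift (c s)) /= => H.
  have H' : \forall u \near s,
      `|f (c u + (0 - c s) + c s) - f (c s) - (c u + (0 - c s)) *m J| <= e * `|c u + (0 - c s)|.
    exact: (cc _ H).
  by near=> u; have : `|f (c u + (0 - c s) + c s) - f (c s) - (c u + (0 - c s)) *m J| <=
    e * `|c u + (0 - c s)|; [near: u | rewrite sub0r addrNK].
have dd e : 0 < e -> \forall u \near s,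
    `|f (c u) - f (c s) - (u - s) *: w| <= e * `|u - s|.
  move=> e0; have dfc' : differentiable (f \o c) s by exact/derivable1_diffP.
  have := diff_epsP dfc' e0; rewrite (near_shift s) /=; apply: filterS => u /=.
  by rewrite (deriv1E dfc) sub0r addrNK.
have E u : (c u - c s) - (u - s) *: (w *m K) =
   (f (c u) - f (c s) - (u - s) *: w) *m K - (f (c u) - f (c s) - (c u - c s) *m J) *m K.
  rewrite !mulmxBl -!mulmxA JK !mulmx1 -scalemxAl.
  by vring.
(* With the scale [e1] the error of [f] costs at most half of [c u - c s], which moves to the left
   hand side. *)
have lip : \forall u \near s, `|c u - c s| <= (2 * (CK + `|w *m K|)) * `|u - s|.
  near=> u.
  have h1 : `|f (c u) - f (c s) - (c u - c s) *m J| <= e1 * `|c u - c s|.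
    by near: u; exact: fe.
  have h2 : `|f (c u) - f (c s) - (u - s) *: w| <= 1 * `|u - s| by near: u; exact: dd.
  have h3 := mulmx_norm_le (f (c u) - f (c s) - (u - s) *: w) K.
  have h4 := mulmx_norm_le (f (c u) - f (c s) - (c u - c s) *m J) K.
  have h5 : `|c u - c s| <= `|(u - s) *: (w *m K)| + (`|(f (c u) - f (c s) - (u - s) *: w) *m K|
      + `|(f (c u) - f (c s) - (c u - c s) *m J) *m K|).
    rewrite -{1}(subrK ((u - s) *: (w *m K)) (c u - c s)) addrC E.
    by rewrite (le_trans (ler_normD _ _)) // lerD2l ler_normB.
  rewrite normrZ in h5.
  have h6 : CK * (e1 * `|c u - c s|) <= `|c u - c s| / 2.
    have e1E : e1 * (2 * (CK + 1)) = 1 by rewrite mulVf // gt_eqF //; lra.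
    by rewrite mulrA [leRHS]mulrC ler_wpM2r //; nra.
  have h7 := le_trans h3 (ler_wpM2l CK0 h2).
  have h8 := le_trans h4 (ler_wpM2l CK0 h1).
  rewrite mulrC in h5; lra.
apply/cvg_ex; exists (w *m K); apply/cvgrPdist_le => e e0.
have D0 : 0 < 2 * (CK + 1) * (2 * (CK + `|w *m K|) + 1).
  by rewrite mulr_gt0 //; have := normr_ge0 (w *m K); lra.
have [e2 e20 e2E] : exists2 e2, 0 < e2 & e2 * (2 * (CK + 1) * (2 * (CK + `|w *m K|) + 1)) = e.
  by exists (e / (2 * (CK + 1) * (2 * (CK + `|w *m K|) + 1))); rewrite ?divr_gt0 // divfK // gt_eqF.
pose e3 := e / (2 * (CK + 1)).
have e30 : 0 < e3 by rewrite /e3 divr_gt0 //; lra.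
suff H : \forall u \near s, `|c u - c s - (u - s) *: (w *m K)| <= e * `|u - s|.
  move: H; rewrite (near_shift 0) /= => H; near=> h.
  have h0 : h != 0 by near: h; exact: nbhs_dnbhs_neq.
  have : `|c (h + (s - 0)) - c s - (h + (s - 0) - s) *: (w *m K)| <= e * `|h + (s - 0) - s|.
    by near: h; exact: cvg_within.
  rewrite subr0 addrK /GRing.scale /= mulr1 => h1.
  rewrite -[X in `|X - _|](scalerK h0) -scalerBr normrZ normfV ler_pdivrMl ?normr_gt0 //.
  by rewrite distrC mulrC.
near=> u.
have h1 : `|f (c u) - f (c s) - (c u - c s) *m J| <= e2 * `|c u - c s|.
  by near: u; exact: fe.
have h2 : `|f (c u) - f (c s) - (u - s) *: w| <= e3 * `|u - s| by near: u; exact: dd.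
have h0 : `|c u - c s| <= (2 * (CK + `|w *m K|)) * `|u - s| by near: u.
have h3 := mulmx_norm_le (f (c u) - f (c s) - (u - s) *: w) K.
have h4 := mulmx_norm_le (f (c u) - f (c s) - (c u - c s) *m J) K.
rewrite E (le_trans (ler_normB _ _)) //.
have h7 := le_trans h3 (ler_wpM2l CK0 h2).
have h8 := le_trans h4 (ler_wpM2l CK0 h1).
have a1 : CK * (e3 * `|u - s|) <= (e / 2) * `|u - s|.
  have e3E : e3 * (2 * (CK + 1)) = e by rewrite divfK // gt_eqF //; lra.
  rewrite mulrA ler_wpM2r //; nra.
have a2 : CK * (e2 * `|c u - c s|) <= (e / 2) * `|u - s|.
  have M0 : 0 <= `|w *m K| by [].
  apply: (le_trans (ler_wpM2l CK0 (ler_wpM2l (ltW e20) h0))).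
  rewrite !mulrA ler_wpM2r //.
  have h : CK * e2 * (2 * (CK + `|w *m K|)) <= (CK + 1) * e2 * (2 * (CK + `|w *m K|) + 1).
    apply: ler_pM; [exact: (mulr_ge0 CK0 (ltW e20)) | clear - CK0 M0; lra | | by rewrite lerDl ler01].
    by rewrite (ler_pM2r e20) lerDl ler01.
  have h' : 2 * ((CK + 1) * e2 * (2 * (CK + `|w *m K|) + 1)) = e by rewrite -e2E; ring.
  by rewrite -[CK * e2 * 2 * _]mulrA; lra.
lra.
Unshelve. all: by end_near. Qed.

End Differential.

(** * Continuously differentiable maps *)

Section C1.
Variable R : realType.

Lemma is_derive_mulr (k s : R) : is_derive s 1 (fun u : R => u * k) k.
Proof.
have H : is_derive s 1 (k \*: (id : R -> R)) (k *: (1 : R)) by apply: is_deriveZ.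
rewrite [X in is_derive _ _ _ X](_ : k = k *: (1 : R)); last by rewrite /GRing.scale /= mulr1.
rewrite (_ : (fun u : R => u * k) = (k \*: (id : R -> R))) //.
by apply/funext => u; rewrite /GRing.scale /= mulrC.
Qed.

Lemma derive_line (V W : normedModType R) (f : V -> W) (p v : V) (s : R) :
  derivable f (p + s *: v) v ->
  derivable (fun u : R => f (p + u *: v)) s 1 /\
  derive1 (fun u : R => f (p + u *: v)) s = 'D_v f (p + s *: v).
Proof.
move=> d; have E : (fun h : R => h^-1 *: (f (p + (h *: (1 : R^o) + s) *: v) - f (p + s *: v))) =
    (fun h => h^-1 *: (f (h *: v + (p + s *: v)) - f (p + s *: v))).
  by apply/funext => h; rewrite [h *: (1 : R^o)]mulr1 scalerDl addrCA.
split; first by rewrite /derivable E.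
by rewrite derive1E /derive E.
Qed.

(** The increment is telescoped along the coordinate axes. On each edge the mean value theorem is
    applied to one component of [f] at a time, after subtracting the linear part, since it fails for
    vector values. *)
Lemma C1_differentiable n m (f : 'rV[R]_n -> 'rV[R]_m) (U : set 'rV[R]_n) (x : 'rV[R]_n) :
  open U -> U x ->
  (forall i y, U y -> derivable f y (delta_mx 0 i)) ->
  (forall i, {for x, continuous (fun y => 'D_(delta_mx 0 i) f y)}) ->
  differentiable f x.
Proof.
move=> oU Ux df cf.
suff : forall e : R, 0 < e -> \forall h \near (0 : 'rV[R]_n),
   `|f (h + x) - f x - h *m (\matrix_(i < n) 'D_(delta_mx 0 i) f x)| <= e * `|h|.
  by move=> /diff_mx_eps[].
move=> e e0.
pose e1 := e / n.+1%:R.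
have e10 : 0 < e1 by rewrite divr_gt0.
have /nbhs_rV[d d0 Hd] : \forall y \near x, U y /\ forall i : 'I_n,
    `|'D_(delta_mx 0 i) f y - 'D_(delta_mx 0 i) f x| <= e1.
  near=> y; split; first by near: y; exact: open_nbhs_nbhs.
  move=> i; rewrite distrC; move: i; near: y; apply: filter_forall => i.
  exact: (cvgrPdist_le _ _).1 (cf i) _ e10.
near=> h.
have hd : `|h| < d.
  near: h; apply: filterS (nbhs_ball_norm (0 : 'rV[R]_n) (PosNum d0)) => h /=.
  by rewrite sub0r normrN.
(* The vertices of the edge path from [x] to [h + x]: at [p k] the first [k] coordinates have been
   moved. *)
pose p (k : nat) : 'rV[R]_n := x + \row_i (if (i < k)%N then h 0 i else 0).
have p0 : p 0%N = x by rewrite /p; apply/rowP => i; rewrite !mxE addr0.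
have pn : p n = h + x by rewrite /p; apply/rowP => i; rewrite !mxE ltn_ord addrC.
have -> : f (h + x) - f x - h *m (\matrix_(i < n) 'D_(delta_mx 0 i) f x) =
    \sum_(k < n) (f (p k.+1) - f (p k) - h 0 k *: 'D_(delta_mx 0 k) f x).
  rewrite sumrB; congr (_ - _).
    by rewrite -(big_mkord xpredT (fun k => f (p k.+1) - f (p k))) telescope_sumr // p0 pn.
  apply/rowP => j; rewrite !mxE summxE; apply: eq_bigr => i _; rewrite !mxE.
  by [].
apply: (le_trans (ler_norm_sum _ _ _)).
apply: (@le_trans _ _ (\sum_(k < n) e1 * `|h|)); last first.
  rewrite sumr_const card_ord -[X in X <= _]mulr_natr mulrAC ler_wpM2r //.
  have e1E : e1 * n.+1%:R = e by rewrite divfK.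
  by rewrite -e1E ler_wpM2l ?(ltW e10) // ler_nat.
apply: ler_sum => k _.
pose v : 'rV[R]_n := delta_mx 0 k.
have pS : p k.+1 = p k + h 0 k *: v.
  apply/rowP => i; rewrite !mxE ltnS leq_eqVlt -addrA; congr (_ + _).
  have [->|ik] := eqVneq i k; first by rewrite !eqxx ltnn mulr1 add0r.
  by rewrite -val_eqE /= in ik; rewrite (negbTE ik) /= mulr0 addr0.
have inU s : Num.min 0 (h 0 k) <= s <= Num.max 0 (h 0 k) -> `|p k + s *: v - x| < d.
  move=> sh; have sh' : `|s| <= `|h 0 k|.
    move: sh; have [h0|h0] := leP 0 (h 0 k).
      by move=> /andP[s0 s1]; rewrite !ger0_norm.
    by move=> /andP[s0 s1]; rewrite !ler0_norm ?lerN2 // ltW.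
  apply: le_lt_trans hd; apply: norm_le_coord => // i j; rewrite !ord1 !mxE.
  have [->|jk] := eqVneq j k.
    rewrite ltnn addr0 mulr1 addrAC subrr add0r (le_trans sh') //; exact: coord_le_norm.
  rewrite mulr0 addr0 addrAC subrr add0r.
  by case: ifP => _; [exact: coord_le_norm | rewrite normr0].
apply: norm_le_coord; first by rewrite mulr_ge0 // ltW.
move=> i j; rewrite !ord1 pS.
pose g s := f (p k + s *: v) 0 j - s * ('D_v f x) 0 j.
have -> : (f (p k + h 0 k *: v) - f (p k) - h 0 k *: 'D_v f x) 0 j = g (h 0 k) - g 0.
  by rewrite /g !mxE scale0r addr0 mul0r subr0 addrAC.
apply: (@le_trans _ _ (e1 * `|h 0 k - 0|)); last first.
  by rewrite subr0 ler_wpM2l ?(ltW e10) //; exact: coord_le_norm.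
apply: mean_value_norm => s /inU /Hd[Us Hs].
have [d1 d2] := derive_line (df k _ Us).
have [d3 d4] := derivable_coord 0 j d1.
have dl : is_derive s 1 (fun u : R => u * ('D_v f x) 0 j) (('D_v f x) 0 j).
  exact: is_derive_mulr.
have dg : is_derive s 1 g (derive1 (fun u => f (p k + u *: v) 0 j) s - ('D_v f x) 0 j).
  have df1 : is_derive s 1 (fun u : R => f (p k + u *: v) 0 j)
      (derive1 (fun u : R => f (p k + u *: v) 0 j) s).
    by rewrite derive1E; exact: derivableP.
  exact: is_deriveB.
split; first exact: (@ex_derive _ _ _ _ _ _ _ dg).
rewrite derive1E derive_val d4 d2.
have := coord_le_norm ('D_v f (p k + s *: v) - 'D_v f x) 0 j.
by rewrite !mxE => /le_trans; apply; exact: Hs.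
Unshelve. all: by end_near. Qed.

Lemma smooth_C1 n m (f : 'rV[R]_n -> 'rV[R]_m) (U : set 'rV[R]_n) : open U ->
  smooth_on U f -> forall x, U x ->
  differentiable f x /\ forall i, {for x, continuous (fun y => 'D_(delta_mx 0 i) f y)}.
Proof.
move=> oU sf x Ux; have /= H := sf 1%N.
have c i : {for x, continuous (fun y => 'D_(delta_mx 0 i) f y)}.
  by have [_] := H i; apply.
split=> //; apply: (C1_differentiable oU Ux) => // i y Uy.
by have [] := H i => + _; apply.
Qed.

End C1.

(** * The golden one-forms and the quadratic form of the torus metric *)

Section Forms.
Variable R : realType.

Lemma sum3 (V : nmodType) (F : 'I_3 -> V) : \sum_(i < 3) F i = F 0 + F 1 + F 2.
Proof.
rewrite !big_ord_recl big_ord0 addr0 addrA.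
by congr (F _ + F _ + F _); apply/val_inj.
Qed.

Lemma forall3 (P : 'I_3 -> Prop) : P 0 -> P 1 -> P 2 -> forall i, P i.
Proof.
move=> P0 P1 P2 [[|[|[|//]]] Hi].
- by rewrite (_ : Ordinal Hi = 0) //; apply/val_inj.
- by rewrite (_ : Ordinal Hi = 1) //; apply/val_inj.
- by rewrite (_ : Ordinal Hi = 2) //; apply/val_inj.
Qed.

Lemma forall4 (P : 'I_4 -> Prop) : P 0 -> P 1 -> P 2 -> P 3 -> forall i, P i.
Proof.
move=> P0 P1 P2 P3 [[|[|[|[|//]]]] Hi].
- by rewrite (_ : Ordinal Hi = 0) //; apply/val_inj.
- by rewrite (_ : Ordinal Hi = 1) //; apply/val_inj.
- by rewrite (_ : Ordinal Hi = 2) //; apply/val_inj.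
- by rewrite (_ : Ordinal Hi = 3) //; apply/val_inj.
Qed.

Local Notation th := (golden R).
Local Notation cg := (c_golden R).

Lemma golden_gt1 : 1 < th.
Proof.
rewrite /golden ltr_pdivlMr // mul1r.
have : 1 < Num.sqrt 5 :> R by rewrite -[ltLHS]sqrtr1 ltr_sqrt // ltr1n.
lra.
Qed.

Lemma golden_sq : th ^+ 2 = th + 1.
Proof.
have h : Num.sqrt 5 ^+ 2 = 5 :> R by rewrite sqr_sqrtr.
by rewrite /golden; field: h.
Qed.

Lemma golden_lt2 : th < 2.
Proof. have := golden_sq; have := golden_gt1; nra. Qed.

Lemma c_golden_gt0 : 0 < cg.
Proof. by rewrite /c_golden sqrtr_gt0; have := golden_gt1; nra. Qed.

Lemma c_golden_sq : cg ^+ 2 = 1 + th ^+ 2.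
Proof. by rewrite /c_golden sqr_sqrtr //; have := golden_gt1; nra. Qed.

(** The values of [eta1] and [eta2] on a vector. *)
Definition f1 (v : 'rV[R]_3) : R := cg^-1 * (v 0 0 + th * v 0 1).
Definition f2 (v : 'rV[R]_3) : R := cg^-1 * (v 0 1 - th * v 0 0).

Lemma f1D u v : f1 (u + v) = f1 u + f1 v. Proof. by rewrite /f1 !mxE; ring. Qed.
Lemma f2D u v : f2 (u + v) = f2 u + f2 v. Proof. by rewrite /f2 !mxE; ring. Qed.
Lemma f1Z k v : f1 (k *: v) = k * f1 v. Proof. by rewrite /f1 !mxE; ring. Qed.
Lemma f2Z k v : f2 (k *: v) = k * f2 v. Proof. by rewrite /f2 !mxE; ring. Qed.
Lemma f1B u v : f1 (u - v) = f1 u - f1 v. Proof. by rewrite /f1 !mxE; ring. Qed.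
Lemma f2B u v : f2 (u - v) = f2 u - f2 v. Proof. by rewrite /f2 !mxE; ring. Qed.

Lemma f12_norm (v : 'rV[R]_3) : f1 v ^+ 2 + f2 v ^+ 2 = v 0 0 ^+ 2 + v 0 1 ^+ 2.
Proof.
have c0 := c_golden_gt0; have := c_golden_sq => c2.
rewrite /f1 /f2 !exprMn -mulrDr exprVn c2.
field; rewrite -c2; exact: lt0r_neq0 (exprn_gt0 2 c0).
Qed.

Definition hform (t : R) (v : 'rV[R]_3) : R :=
  t `^ (- (2 / 3)) * f1 v ^+ 2 + t `^ (4 / 3) * (f2 v ^+ 2 + v 0 2 ^+ 2).

Lemma h_gramE t v : (v *m h_gram t *m v^T) 0 0 = hform t v.
Proof.
have quad (w : 'rV[R]_3) : (v *m covector_sq w *m v^T) 0 0 = (\sum_i v 0 i * w 0 i) ^+ 2.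
  rewrite /covector_sq mulmxA -mulmxA mxE big_ord1 expr2 !mxE.
  by congr (_ * _); apply: eq_bigr => i _; rewrite !mxE // mulrC.
rewrite /h_gram !mulmxDr !mulmxDl -!scalemxAr -!scalemxAl.
rewrite mulmxDr mulmxDl [LHS]mxE [X in X + _]mxE [X in _ + X]mxE [X in _ + _ * X]mxE !quad !sum3.
rewrite /hform /f1 /f2 /eta1 /eta2 /dz !mxE /=.
congr (_ * _ + _ * _); first by congr (_ ^+ 2); ring.
by congr (_ ^+ 2 + _ ^+ 2); ring.
Qed.

End Forms.

(** * Lengths of curves *)

Section PointwiseContinuity.
Variable R : realType.
Lemma cont_add (T : topologicalType) (V : normedModType R) (f g : T -> V) (x : T) :
  {for x, continuous f} -> {for x, continuous g} -> {for x, continuous (fun y => f y + g y)}.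
Proof. move=> cf cg; exact: (@continuousD R V T f g x cf cg). Qed.
Lemma cont_sub (T : topologicalType) (V : normedModType R) (f g : T -> V) (x : T) :
  {for x, continuous f} -> {for x, continuous g} -> {for x, continuous (fun y => f y - g y)}.
Proof. move=> cf cg; exact: (@continuousB R V T f g x cf cg). Qed.
Lemma cont_mul (T : topologicalType) (f g : T -> R) (x : T) :
  {for x, continuous f} -> {for x, continuous g} -> {for x, continuous (fun y => f y * g y)}.
Proof. move=> cf cg; exact: (@continuousM R T f g x cf cg). Qed.
Lemma cont_cst (T U : topologicalType) (k : U) (x : T) : {for x, continuous (fun _ => k)}.
Proof. exact: cst_continuous. Qed.
Lemma cont_comp (T U W : topologicalType) (f : T -> U) (g : U -> W) (x : T) :
  {for x, continuous f} -> {for f x, continuous g} -> {for x, continuous (fun y => g (f y))}.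
Proof. move=> cf cg; exact: continuous_comp. Qed.
Lemma cont_near (T U : topologicalType) (f g : T -> U) (x : T) :
  (\forall y \near x, f y = g y) -> {for x, continuous g} -> {for x, continuous f}.
Proof.
move=> fg cg; rewrite /prop_for /continuous_at (nbhs_singleton fg).
apply: cvg_trans cg; apply: near_eq_cvg.
by apply: filterS fg.
Qed.
End PointwiseContinuity.

Section CurveLength.
Variable R : realType.
Local Notation pi := (@torus_pi R).

Lemma chart_lift_near (T : topologicalType) (c : chart R 3 (torus R)) (x : T -> 'rV[R]_3) (s : T) :
  torus_atlas c -> {for s, continuous x} -> chart_dom c (pi (x s)) ->
  \forall u \near s, chart_dom c (pi (x u)) /\
    chart_map c (pi (x u)) = x u + (chart_map c (pi (x s)) - x s).
Proof.
move=> [[od _ _ cm _] mK] cx ds.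
have cpx : {for s, continuous (pi \o x)}.
  by apply: continuous_comp => //; exact: torus_pi_continuous.
have Hd : \forall u \near s, chart_dom c (pi (x u)).
  by apply: cpx; apply: (@open_nbhs_nbhs (torus R)).
apply: filterI; first exact: Hd.
apply: (@lift_near R T (fun u => chart_map c (pi (x u)))) => //.
  by apply: (@continuous_comp _ _ _ (pi \o x)) => //; exact: cm.
by apply: filterS Hd => u /mK.
Qed.

Lemma derive1_near (V : normedModType R) (f g : R -> V) (k : V) (s : R) :
  (\forall u \near s, f u = g u + k) -> derivable g s 1 ->
  derivable f s 1 /\ derive1 f s = derive1 g s.
Proof.
move=> H dg.
have dgk : is_derive s 1 (fun u => g u + k) (derive1 g s).
  rewrite -[derive1 g s]addr0 derive1E.
  by apply: is_deriveD; exact: derivableP.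
have H' : \forall u \near s, g u + k = f u by apply: filterS H.
have [d E] := near_eq_is_derive H' dgk.
by split=> //; rewrite derive1E.
Qed.

Lemma derive1_near_cont (V : normedModType R) (f g : R -> V) (k : V) (s : R) :
  (\forall u \near s, f u = g u + k) -> (\forall u \near s, derivable g u 1) ->
  {for s, continuous (derive1 g)} ->
  (\forall u \near s, derivable f u 1) /\ {for s, continuous (derive1 f)}.
Proof.
move=> H dg cg.
have HH : \forall u \near s, derivable f u 1 /\ derive1 f u = derive1 g u.
  have := nbhs_interior H; have := dg => {}dg H'.
  near=> u; apply: (@derive1_near _ f g k); last by near: u.
  by near: u.
split; first by apply: filterS HH => u [].
rewrite /prop_for /continuous_at (nbhs_singleton HH).2.
apply: cvg_trans cg; apply: near_eq_cvg.
by apply: filterS HH => u [].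
Unshelve. all: by end_near. Qed.

Lemma length_ge (F sp : R -> R) :
  (forall s : R, 0 <= s <= 1 -> derivable F s 1 /\ {for s, continuous (derive1 F)}) ->
  (forall s : R, 0 <= s <= 1 -> derive1 F s <= sp s) ->
  {within `[0, 1], continuous sp} ->
  ((F 1 - F 0)%:E <= \int[lebesgue_measure]_(s in `[0%R, 1%R]) (sp s)%:E)%E.
Proof.
move=> dF ledF csp.
have cF : {within `[0, 1], continuous (derive1 F)}.
  by apply: within_itv_continuous => s /dF[].
have cF0 s : 0 <= s <= 1 -> {for s, continuous F}.
  by move=> /dF[d _]; apply/differentiable_continuous/derivable1_diffP.
rewrite EFinB -(continuous_FTC2 ltr01 cF) //; first last.
  split.
  - move=> s; rewrite in_itv /= => /andP[s0 s1].
    exact: (dF s (introT andP (conj (ltW s0) (ltW s1)))).1.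
  - by apply: cvg_at_right_filter; apply: cF0; rewrite lexx ler01.
  - by apply: cvg_at_left_filter; apply: cF0; rewrite lexx ler01.
apply: le_integral => //.
- by apply: continuous_compact_integrable => //; exact: segment_compact.
- by apply: continuous_compact_integrable => //; exact: segment_compact.
- by move=> s; rewrite inE /= in_itv /= => s01; rewrite lee_fin; exact: ledF.
Qed.

Lemma is_derive_mull (c s : R) (f : R -> R) (df : R) :
  is_derive s 1 f df -> is_derive s 1 (fun u => c * f u) (c * df).
Proof. move=> H. exact: (@is_deriveZ R R^o R^o f c s 1 df H). Qed.

Lemma is_derive_add (s : R) (f g : R -> R) (df dg : R) :
  is_derive s 1 f df -> is_derive s 1 g dg -> is_derive s 1 (fun u => f u + g u) (df + dg).
Proof. move=> H G; exact: (@is_deriveD R R^o R^o f g s 1 df dg H G). Qed.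

Lemma is_derive_coord m n (x : R -> 'M[R]_(m, n)) s i j : derivable x s 1 ->
  is_derive s 1 (fun u => x u i j) (derive1 x s i j).
Proof.
move=> dx; have [d0 e0] := derivable_coord i j dx.
by rewrite -e0 derive1E; exact: derivableP.
Qed.

(** The scale factors of the metric, that is the square roots of its coefficients along [eta1] and
    along [eta2], [dz]. *)
Definition a1 (t : R) := t `^ (- (1 / 3)).
Definition a2 (t : R) := t `^ (2 / 3).

Lemma a1_sq t : 0 < t -> t `^ (- (2 / 3)) = a1 t ^+ 2.
Proof.
by move=> t0; rewrite /a1 -powR_mulrn ?powR_ge0 // -powRrM; congr (_ `^ _); lra.
Qed.

Lemma a2_sq t : 0 < t -> t `^ (4 / 3) = a2 t ^+ 2.
Proof.
by move=> t0; rewrite /a2 -powR_mulrn ?powR_ge0 // -powRrM; congr (_ `^ _); lra.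
Qed.

Lemma a1_gt0 t : 0 < t -> 0 < a1 t. Proof. exact: powR_gt0. Qed.
Lemma a2_gt0 t : 0 < t -> 0 < a2 t. Proof. exact: powR_gt0. Qed.

Lemma hform_ge0 (t : R) v : 0 <= hform t v.
Proof. by rewrite addr_ge0 // mulr_ge0 ?addr_ge0 ?powR_ge0 ?sqr_ge0. Qed.

Lemma hform_ge1 (t : R) v : 0 < t -> a1 t * `|f1 v| <= Num.sqrt (hform t v).
Proof.
move=> t0; rewrite -(ger0_norm (_ : 0 <= a1 t * `|f1 v|)); last first.
  by rewrite mulr_ge0 // ltW // a1_gt0.
rewrite -sqrtr_sqr ler_sqrt ?hform_ge0 // /hform a1_sq // exprMn real_normK ?num_real //.
by rewrite lerDl mulr_ge0 ?powR_ge0 // addr_ge0 ?sqr_ge0.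
Qed.

Lemma hform_ge2 (t : R) v : 0 < t -> a2 t * `|f2 v| <= Num.sqrt (hform t v).
Proof.
move=> t0; rewrite -(ger0_norm (_ : 0 <= a2 t * `|f2 v|)); last first.
  by rewrite mulr_ge0 // ltW // a2_gt0.
rewrite -sqrtr_sqr ler_sqrt ?hform_ge0 // /hform a2_sq // exprMn real_normK ?num_real //.
rewrite mulrDr addrCA lerDl addr_ge0 // mulr_ge0 ?powR_ge0 ?sqr_ge0 //.
Qed.

Lemma f1_diff (x : R -> 'rV[R]_3) s : derivable x s 1 ->
  derivable (fun u => f1 (x u)) s 1 /\ derive1 (fun u => f1 (x u)) s = f1 (derive1 x s).
Proof.
move=> dx; have E0 := is_derive_coord 0 0 dx; have E1 := is_derive_coord 0 1 dx.
have H := is_derive_mull (c_golden R)^-1 (is_derive_add E0 (is_derive_mull (golden R) E1)).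
by split; [exact: (@ex_derive _ _ _ _ _ _ _ H) | rewrite derive1E (@derive_val _ _ _ _ _ _ _ H)].
Qed.

Lemma f2_diff (x : R -> 'rV[R]_3) s : derivable x s 1 ->
  derivable (fun u => f2 (x u)) s 1 /\ derive1 (fun u => f2 (x u)) s = f2 (derive1 x s).
Proof.
move=> dx; have E0 := is_derive_coord 0 0 dx; have E1 := is_derive_coord 0 1 dx.
have H := is_derive_mull (c_golden R)^-1 (is_derive_add E1 (is_derive_mull (- golden R) E0)).
have E : (fun u => f2 (x u)) = (fun u => (c_golden R)^-1 * (x u 0 1 + - golden R * x u 0 0)).
  by apply/funext => u; rewrite /f2; ring.
rewrite E; split; first exact: (@ex_derive _ _ _ _ _ _ _ H).
by rewrite derive1E (@derive_val _ _ _ _ _ _ _ H) /f2; ring.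
Qed.

Lemma coord_cont m n (i : 'I_m) (j : 'I_n) (v : 'M[R]_(m, n)) :
  {for v, continuous (fun M : 'M[R]_(m, n) => M i j)}.
Proof. exact: coord_continuous. Qed.

Lemma f1_continuous (v : 'rV[R]_3) : {for v, continuous (@f1 R)}.
Proof.
have c0 := @coord_cont 1 3 0 0 v; have c1 := @coord_cont 1 3 0 1 v.
exact: (cont_mul (@cont_cst _ _ (c_golden R)^-1 v)
  (cont_add c0 (cont_mul (@cont_cst _ _ (golden R) v) c1))).
Qed.

Lemma f2_continuous (v : 'rV[R]_3) : {for v, continuous (@f2 R)}.
Proof.
have c0 := @coord_cont 1 3 0 0 v; have c1 := @coord_cont 1 3 0 1 v.
exact: (cont_mul (@cont_cst _ _ (c_golden R)^-1 v)
  (cont_sub c1 (cont_mul (@cont_cst _ _ (golden R) v) c0))).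
Qed.

Lemma cont_sqr (T : topologicalType) (f : T -> R) (x : T) :
  {for x, continuous f} -> {for x, continuous (fun y => f y ^+ 2)}.
Proof. by move=> cf; exact: (cont_mul cf cf). Qed.

Lemma hform_continuous t (v : 'rV[R]_3) : {for v, continuous (hform t)}.
Proof.
have c2 := cont_sqr (@coord_cont 1 3 0 2 v).
have e1 := cont_sqr (@f1_continuous v); have e2 := cont_sqr (@f2_continuous v).
exact: (cont_add (cont_mul (@cont_cst _ _ (t `^ (- (2 / 3))) v) e1)
  (cont_mul (@cont_cst _ _ (t `^ (4 / 3)) v) (cont_add e2 c2))).
Qed.

(** Calibration: a linear form bounded pointwise by the speed integrates along the curve to at most
    its length. *)
Lemma segment_length (t : R) (x : R -> 'rV[R]_3) (sp : R -> R) : 0 < t ->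
  (forall s : R, 0 <= s <= 1 -> (\forall u \near s, derivable x u 1) /\ {for s, continuous (derive1 x)}) ->
  (forall s : R, 0 <= s <= 1 -> sp s = Num.sqrt (hform t (derive1 x s))) ->
  let L := (\int[lebesgue_measure]_(s in `[0%R, 1%R]) (sp s)%:E)%E in
  ((a1 t * `|f1 (x 1 - x 0)|)%:E <= L)%E /\ ((a2 t * `|f2 (x 1 - x 0)|)%:E <= L)%E.
Proof.
move=> t0 dx spE L.
have csp : {within `[0, 1], continuous sp}.
  apply: (@subspace_eq_continuous _ _ _ (fun s => Num.sqrt (hform t (derive1 x s)))).
    by move=> s; rewrite inE /= in_itv /= => s01; rewrite /from_subspace /= spE.
  apply: within_itv_continuous => s s01; have [_ c] := dx s s01.
  by apply: (cont_comp (cont_comp c (@hform_continuous t _))); exact: sqrt_continuous.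
have key (f : 'rV[R]_3 -> R) (a : R) : (forall v, {for v, continuous f}) ->
    (forall u v, f (u - v) = f u - f v) ->
    (forall (y : R -> 'rV[R]_3) s, derivable y s 1 ->
      derivable (fun u => f (y u)) s 1 /\ derive1 (fun u => f (y u)) s = f (derive1 y s)) ->
    (forall v, a * f v <= Num.sqrt (hform t v)) -> ((a * f (x 1 - x 0))%:E <= L)%E.
  move=> cf fB df fle; rewrite fB mulrBr.
  have dG u : derivable x u 1 -> derivable (fun u => a * f (x u)) u 1 /\
      derive1 (fun u => a * f (x u)) u = a * f (derive1 x u).
    move=> /df[d e]; have D : is_derive u 1 (fun u => f (x u)) (f (derive1 x u)).
      by rewrite -e derive1E; exact: derivableP.
    have H := is_derive_mull a D.
    by split; [exact: (@ex_derive _ _ _ _ _ _ _ H) | rewrite derive1E (@derive_val _ _ _ _ _ _ _ H)].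
  apply: (@length_ge (fun s => a * f (x s))) => // s s01; have [dxs cxs] := dx s s01.
    split; first exact: (dG _ (nbhs_singleton dxs)).1.
    rewrite /prop_for /continuous_at (dG _ (nbhs_singleton dxs)).2.
    apply: (@cvg_trans _ ((fun u => a * f (derive1 x u)) @ s)).
      by apply: near_eq_cvg; apply: filterS dxs => u /dG[_ ->].
    exact: (cont_mul (@cont_cst _ _ a s) (cont_comp cxs (cf _))).
  by rewrite (dG _ (nbhs_singleton dxs)).2 spE.
have key2 (f : 'rV[R]_3 -> R) (a : R) : 0 < a -> (forall v, {for v, continuous f}) ->
    (forall u v, f (u - v) = f u - f v) ->
    (forall (y : R -> 'rV[R]_3) s, derivable y s 1 ->
      derivable (fun u => f (y u)) s 1 /\ derive1 (fun u => f (y u)) s = f (derive1 y s)) ->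
    (forall v, a * `|f v| <= Num.sqrt (hform t v)) -> ((a * `|f (x 1 - x 0)|)%:E <= L)%E.
  move=> a0 cf fB df fle; have [f0|f0] := leP 0 (f (x 1 - x 0)).
    rewrite ger0_norm //; apply: (key f) => // v; apply: le_trans (fle v).
    by rewrite ler_wpM2l ?(ltW a0) // ler_norm.
  rewrite ltr0_norm // mulrN -mulNr; apply: (key f) => // v; apply: le_trans (fle v).
  by rewrite mulNr -mulrN ler_wpM2l ?(ltW a0) // -normrN ler_norm.
split; apply: key2.
- exact: a1_gt0.
- exact: f1_continuous.
- exact: f1B.
- exact: f1_diff.
- by move=> v; exact: hform_ge1.
- exact: a2_gt0.
- exact: f2_continuous.
- exact: f2B.
- exact: f2_diff.
- by move=> v; exact: hform_ge2.
Qed.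

End CurveLength.

(** * The diameter of the torus and of its cover *)

Section Distances.
Variable R : realType.
Local Notation pi := (@torus_pi R).

(** Charts of the atlas are local lifts, so a chart expression of the curve differs from the global
    lift by a locally constant vector and has the same derivative. *)
Lemma torus_segment_lift (gam : R -> torus R) (x0 : 'rV[R]_3) :
  C1_segment (@torus_atlas R) gam -> pi x0 = gam 0 ->
  exists x : R -> 'rV[R]_3, [/\ x 0 = x0,
   (forall s : R, 0 <= s <= 1 -> (\forall u \near s, derivable x u 1) /\ {for s, continuous (derive1 x)}),
   (forall s : R, 0 <= s <= 1 -> pi (x s) = gam s) &
   (forall s : R, 0 <= s <= 1 -> forall c, torus_atlas c -> chart_dom c (gam s) ->
     derive1 (chart_map c \o gam) s = derive1 x s)].
Proof.
move=> C1 e0.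
have cg s : 0 <= s <= 1 -> {for s, continuous gam}.
  by move=> s01; have [] := C1 s; rewrite ?in_itv.
have [x [x0E cx lx]] := path_lifting ler01 e0 cg.
have key s c : 0 <= s <= 1 -> torus_atlas c -> chart_dom c (gam s) ->
    exists k, \forall u \near s, x u = (chart_map c \o gam) u + k.
  move=> s01 Ac ds; have lxs := lx s s01.
  have := @chart_lift_near R _ c x s Ac (cx s s01).
  rewrite (nbhs_singleton lxs) => /(_ ds) H.
  exists (- (chart_map c (gam s) - x s)).
  near=> u; have /= <- : pi (x u) = gam u by near: u.
  have [_ ->] : chart_dom c (pi (x u)) /\
      chart_map c (pi (x u)) = x u + (chart_map c (gam s) - x s) by near: u.
  by rewrite addrK.
exists x; split => //.
- move=> s s01; have [y ys] := torus_pi_surj (gam s).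
  have [_ H] := C1 s s01.
  have ds : chart_dom (torus_chart y) (gam s) by exists y => //; exact: ballxx.
  have [dc cc] := H _ (torus_chartP y) ds.
  have [k Hk] := key s _ s01 (torus_chartP y) ds.
  exact: derive1_near_cont Hk dc cc.
- by move=> s s01; exact: (nbhs_singleton (lx s s01)).
- move=> s s01 c Ac ds; have [_ /(_ c Ac ds)[dc _]] := C1 s s01.
  have [k Hk] := key s c s01 Ac ds.
  by have [_ ->] := derive1_near Hk (nbhs_singleton dc).
Unshelve. all: by end_near. Qed.

(** Each segment is lifted starting from the end point of the previous lift, so that displacements
    and lengths add up. *)
Lemma torus_joined_ge (t : R) (p q : torus R) (l : \bar R) : 0 < t ->
  joined (@torus_atlas R) (torus_metric t) p q l ->
  forall x, pi x = p -> exists y, [/\ pi y = q,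
    ((a1 t * `|f1 (y - x)|)%:E <= l)%E & ((a2 t * `|f2 (y - x)|)%:E <= l)%E].
Proof.
move=> t0 J; elim: J => {p q l} [p x xp|p q r l gam sp C1 isp g0 g1 J IH x xp].
  by exists x; rewrite subrr /f1 /f2 !mxE !(mulr0, addr0, subr0, normr0).
have [c [c0 dc pic ch]] := torus_segment_lift C1 (etrans xp (esym g0)).
have [|y [yr h1 h2]] := IH (c 1); first by rewrite pic ?lexx ?ler01.
exists y; rewrite yr.
have spE s : 0 <= s <= 1 -> sp s = Num.sqrt (hform t (derive1 c s)).
  move=> s01; have [z zs] := torus_pi_surj (gam s).
  have ds : chart_dom (torus_chart z) (gam s) by exists z => //; exact: ballxx.
  by rewrite (isp s s01 _ (torus_chartP z) ds) (ch s s01 _ (torus_chartP z) ds) /torus_metric h_gramE.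
have [l1 l2] := segment_length t0 dc spE.
have E : y - x = (y - c 1) + (c 1 - c 0) by rewrite c0; vring.
split=> //.
- apply: le_trans (leeD l1 h1); rewrite -EFinD lee_fin -mulrDr ler_wpM2l //.
    by rewrite ltW // a1_gt0.
  by rewrite E f1D addrC ler_normD.
- apply: le_trans (leeD l2 h2); rewrite -EFinD lee_fin -mulrDr ler_wpM2l //.
    by rewrite ltW // a2_gt0.
  by rewrite E f2D addrC ler_normD.
Qed.

Lemma straight_derive (x v : 'rV[R]_3) (s : R) :
  is_derive s 1 (fun u : R => x + u *: v) v.
Proof.
have d0 : derivable (@id 'rV[R]_3) (x + s *: v) v by exact: derivable_id.
have [d E] := derive_line d0.
by rewrite derive1E derive_id in E; apply: DeriveDef.
Qed.

Lemma torus_straight (t : R) (x y : 'rV[R]_3) :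
  joined (@torus_atlas R) (torus_metric t) (pi x) (pi y) (Num.sqrt (hform t (y - x)))%:E.
Proof.
pose c (u : R) := x + u *: (y - x).
have cc s : {for s, continuous c}.
  apply/differentiable_continuous/derivable1_diffP.
  by have [] := straight_derive x (y - x) s.
have dE : derive1 c = fun=> y - x.
  by apply/funext => s; rewrite derive1E; have [_ ->] := straight_derive x (y - x) s.
have key s ch : torus_atlas ch -> chart_dom ch (pi (c s)) ->
   (\forall u \near s, derivable (chart_map ch \o (pi \o c)) u 1) /\
   {for s, continuous (derive1 (chart_map ch \o (pi \o c)))} /\
   derive1 (chart_map ch \o (pi \o c)) s = y - x.
  move=> Ac ds; have H := chart_lift_near Ac (cc s) ds.
  have H2 : \forall u \near s, (chart_map ch \o (pi \o c)) u = c u + (chart_map ch (pi (c s)) - c s).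
    by apply: filterS H => u [_].
  have dc : \forall u \near s, derivable c u 1.
    by near=> u; have [] := straight_derive x (y - x) u.
  have [|D1 D2] := derive1_near_cont H2 dc; first by rewrite dE; exact: cont_cst.
  by have [_ ->] := derive1_near H2 (nbhs_singleton dc); rewrite dE.
rewrite -[X in joined _ _ _ _ X]adde0.
have -> : (Num.sqrt (hform t (y - x)))%:E =
    (\int[lebesgue_measure]_(s in `[0%R, 1%R]) (Num.sqrt (hform t (y - x)))%:E)%E.
  rewrite (integral_cst _ _ (Num.sqrt (hform t (y - x)))%:E) //.
  have E1 : lebesgue_measure (`[0%R, 1%R]%classic : set R) = 1%E.
    by rewrite lebesgue_measure_itv /= lte_fin ltr01 oppr0 adde0.
  by rewrite -[LHS]mule1; congr (_ * _)%E; exact: esym E1.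
apply: (@joined_cons R 3 _ _ _ _ (pi y) _ _ (pi \o c) (fun=> Num.sqrt (hform t (y - x)))).
- move=> s _; split; first by apply: continuous_comp => //; exact: torus_pi_continuous.
  by move=> ch Ac ds; have [? []] := key s ch Ac ds.
- move=> s _ ch Ac ds; have [_ [_ ->]] := key s ch Ac ds.
  by rewrite /torus_metric h_gramE.
- by rewrite /= /c scale0r addr0.
- by rewrite /= /c scale1r addrC subrK.
- exact: joined_refl.
Unshelve. all: by end_near. Qed.

Lemma R3_pullback (t : R) (k : metric R 3 'rV[R]_3) (c : chart R 3 'rV[R]_3) (x : 'rV[R]_3) :
  is_pullback (@R3_atlas R) k (@torus_atlas R) (torus_metric t) pi ->
  R3_atlas c -> k c x = h_gram t.
Proof.
move=> H ->; set c0 := Chart _ _ _.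
have ds : chart_dom (torus_chart x) (pi x) by exists x => //; exact: ballxx.
have /= := H c0 (torus_chart x) erefl (torus_chartP x) x I ds.
have cid : {for x, continuous (@id 'rV[R]_3)} by [].
have H2 : \forall u \near x, local_rep c0 (torus_chart x) pi u =
    u + (chart_map (torus_chart x) (pi x) - x).
  by have := chart_lift_near (torus_chartP x) cid ds; apply: filterS => u [_].
by have [_ ->] := jacobian_translation H2; rewrite mul1mx trmx1 mulmx1.
Qed.

Lemma R3_joined_ge (t : R) (k : metric R 3 'rV[R]_3) (x y : 'rV[R]_3) (l : \bar R) : 0 < t ->
  (forall c z, R3_atlas c -> k c z = h_gram t) ->
  joined (@R3_atlas R) k x y l -> ((a1 t * `|f1 (y - x)|)%:E <= l)%E.
Proof.
move=> t0 kE J; elim: J => {x y l} [x|x y z l gam sp C1 isp g0 g1 J IH].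
  by rewrite subrr /f1 !mxE !(mulr0, addr0, normr0).
have A0 : R3_atlas (Chart [set: 'rV[R]_3] id id) by [].
have spE (s : R) : 0 <= s <= 1 -> sp s = Num.sqrt (hform t (derive1 gam s)).
  by move=> s01; rewrite (isp s s01 _ A0 I) kE // h_gramE.
have dc (s : R) : 0 <= s <= 1 -> (\forall u \near s, derivable gam u 1) /\ {for s, continuous (derive1 gam)}.
  by move=> s01; have [_ /(_ _ A0 I)] := C1 s s01.
have [l1 _] := segment_length t0 dc spE.
have E : z - x = (z - y) + (gam 1 - gam 0) by rewrite g0 g1; vring.
apply: le_trans (leeD l1 IH); rewrite -EFinD lee_fin -mulrDr ler_wpM2l //.
  by rewrite ltW // a1_gt0.
by rewrite E f1D addrC ler_normD.
Qed.

Lemma R3_diam_ge (U : set 'rV[R]_3) : U !=set0 -> open U ->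
  exists cU : R, 0 < cU /\ forall t : R, 0 < t <= 1 -> forall k : metric R 3 'rV[R]_3,
     is_pullback (@R3_atlas R) k (@torus_atlas R) (torus_metric t) pi ->
     ((cU * t `^ (- (1 / 3)))%:E <= riem_diam (@R3_atlas R) k U)%E.
Proof.
move=> [x Ux] oU; have /nbhs_rV[e e0 He] : nbhs x U by exact: open_nbhs_nbhs.
(* Any displacement with a nonzero [eta1] component would do; it gives the constant of the bound. *)
pose y := x + (e / 2) *: delta_mx 0 0.
have Uy : U y.
  apply: He; rewrite /y addrAC subrr add0r; apply: norm_lt_coord => // i j; rewrite !mxE.
  case: (_ && _); rewrite ?mulr1 ?mulr0 ?normr0 // gtr0_norm ?divr_gt0 //; lra.
exists `|f1 (y - x)|; split.
  rewrite normr_gt0 /y addrAC subrr add0r f1Z mulf_neq0 ?gt_eqF ?divr_gt0 //.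
  by rewrite /f1 !mxE /= mulr0 addr0 mulr1 invr_gt0 c_golden_gt0.
move=> t /andP[t0 _] k kp.
apply: (@le_trans _ _ (riem_dist (@R3_atlas R) k x y)).
  apply: le_ereal_inf_tmp => l J; rewrite mulrC; apply: (R3_joined_ge t0) J => c z.
  exact: R3_pullback kp.
by apply: ereal_sup_ubound; exists x => //; exists y.
Qed.

(** Completing the square gives (2n - m)^2 = 5 m^2, and the 5-adic valuations of the two sides have
    different parities unless m = 0. *)
Lemma norm_form_eq0 (m n : int) : n ^+ 2 - m * n - m ^+ 2 = 0 -> m = 0.
Proof.
move=> E; have sq : ((2 * n - m) ^+ 2 = 5 * m ^+ 2)%R by lia.
apply/eqP; apply: contraT => m0.
have /(congr1 (logn 5)) : (absz (2 * n - m)%R ^ 2 = 5 * absz m ^ 2)%N.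
  by have := congr1 absz sq; rewrite abszM !abszX.
have m0' : (0 < absz m)%N by rewrite absz_gt0.
rewrite lognM // ?expn_gt0 ?m0' // !lognX (_ : logn 5 5 = 1%N) //; lia.
Qed.

Lemma half_point_far (v : 'rV[R]_3) : pi v = pi (row3 (1 / 2) 0 0) ->
  golden R / (4 * c_golden R ^+ 2) <= `|f1 v| * `|f2 v|.
Proof.
move=> /torus_piP/forallP H.
have /intrP[p Ep] := H 0; have /intrP[n En] := H 1.
rewrite !mxE /= in Ep En.
have v0 : v 0 0 = p%:~R + 1 / 2 by rewrite -Ep; ring.
have v1 : v 0 1 = n%:~R by rewrite -En subr0.
have th0 : 0 < golden R by have := golden_gt1 R; lra.
have c0 := c_golden_gt0 R.
(* Doubling makes both coordinates integers, the first one odd and therefore nonzero; the factor 4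
   in the bound comes from here. *)
pose m : int := 2 * p + 1.
have E : f1 v * f2 v = golden R / (4 * c_golden R ^+ 2) *
    (((2 * n) ^+ 2 - m * (2 * n) - m ^+ 2)%:~R).
  have g2 : golden R ^+ 2 = golden R + 1 by exact: golden_sq.
  rewrite /f1 /f2 v0 v1 !(rmorphB, rmorphD, rmorphM, rmorphXn) /= /m.
  rewrite !mulr1z.
  field: g2; exact: lt0r_neq0.
rewrite -normrM E normrM gtr0_norm ?divr_gt0 ?mulr_gt0 ?exprn_gt0 //.
rewrite ler_pMr ?divr_gt0 ?mulr_gt0 ?exprn_gt0 //.
apply: norm_intr_ge1; first exact: intr_int.
rewrite intr_eq0; apply/negP => /eqP/norm_form_eq0; rewrite /m; lia.
Qed.

(** For [k = 0] fractional parts suffice: both squares in the plane are at most 1 and [f12_norm]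
    gives the factor 2. Each power of the hyperbolic matrix then rescales the two bounds in opposite
    directions. *)
Lemma lattice_approx (k : nat) (w : 'rV[R]_3) : exists u, [/\ pi u = pi w,
  f1 u ^+ 2 <= 2 * (golden R ^- 2) ^+ k, f2 u ^+ 2 <= 2 * (golden R ^+ 2) ^+ k &
  u 0 2 ^+ 2 <= 1].
Proof.
have th1 := golden_gt1 R; have thn0 : golden R != 0 by rewrite gt_eqF //; lra.
elim: k w => [|k IH] w.
  pose u : 'rV[R]_3 := \row_i (w 0 i - (Num.floor (w 0 i))%:~R).
  have u01 i : 0 <= u 0 i <= 1.
    by rewrite mxE; have := floor_itv (w 0 i); rewrite intrD1 => /andP[? ?]; lra.
  have us i : u 0 i ^+ 2 <= 1 by have := u01 i; nra.
  have f0 := f12_norm u; rewrite !expr0 mulr1; exists u; split => //.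
  - apply/torus_piP/forallP => i; rewrite !mxE addrAC subrr add0r rpredN; exact: intr_int.
  - by have := us 0; have := us 1; have := sqr_ge0 (f2 u); lra.
  - by have := us 0; have := us 1; have := sqr_ge0 (f1 u); lra.
(* The inverse of the matrix is integral too, so the induction hypothesis is applied to the preimage
   of [w] and its answer is mapped forward. *)
have [u [uw h1 h2 h3]] := IH (row3 (w 0 1) (w 0 0 + w 0 1) (w 0 2)).
exists (row3 (u 0 1 - u 0 0) (u 0 0) (u 0 2)).
have g2 := golden_sq R.
have e1 : f1 (row3 (u 0 1 - u 0 0) (u 0 0) (u 0 2)) = (golden R)^-1 * f1 u.
  by rewrite /f1 !mxE /=; field: g2; rewrite thn0 gt_eqF // c_golden_gt0.
have e2 : f2 (row3 (u 0 1 - u 0 0) (u 0 0) (u 0 2)) = - golden R * f2 u.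
  by rewrite /f2 !mxE /=; ring: g2.
split.
- move/torus_piP/forallP: uw => H; apply/torus_piP/forallP; apply: forall3.
  + have := rpredB (H 1) (H 0); rewrite !mxE /=.
    by rewrite (_ : _ - _ - _ = u 0 1 - u 0 0 - w 0 0) //; ring.
  + by have := H 0; rewrite !mxE.
  + by have := H 2; rewrite !mxE.
- have eI : (golden R)^-1 ^+ 2 = golden R ^- 2 by rewrite exprVn.
  have I0 : 0 <= golden R ^- 2 by rewrite invr_ge0 sqr_ge0.
  rewrite e1 exprMn eI; move: I0 h1; set I := _ ^- 2 => I0 h1.
  by rewrite [I ^+ _]exprS [leRHS]mulrCA ler_wpM2l.
- by rewrite e2 exprMn sqrrN [_ ^+ k.+1]exprS [leRHS]mulrCA ler_wpM2l // sqr_ge0.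
- by rewrite mxE /=.
Qed.

Lemma torus_diam (t : R) : 0 < t <= 1 ->
  let D := riem_diam (@torus_atlas R) (torus_metric t) [set: torus R] in
  ((Num.sqrt (golden R / (4 * c_golden R ^+ 2)) * t `^ (1 / 6))%:E <= D)%E /\
  (D <= (Num.sqrt 11 * t `^ (1 / 6))%:E)%E.
Proof.
move=> /andP[t0 t1] D; set s := t `^ (1 / 6).
have s0 : 0 < s by exact: powR_gt0.
have s6 : t = s ^+ 6.
  by rewrite /s -powR_mulrn ?powR_ge0 // -powRrM divfK // powRr1 // ltW.
have s1 : s <= 1.
  rewrite leNgt; apply/negP => s1; move: t1; rewrite s6 leNgt.
  by rewrite exprn_egt1.
have a1E : a1 t = s ^- 2.
  rewrite /a1 /s -powR_mulrn ?powR_ge0 // -powRrM -powRN.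
  by congr (_ `^ _); lra.
have a2E : a2 t = s ^+ 4.
  by rewrite /a2 /s -powR_mulrn ?powR_ge0 // -powRrM; congr (_ `^ _); lra.
have th1 := golden_gt1 R; have c0 := c_golden_gt0 R.
split.
  set K := golden R / _; have K0 : 0 < K.
    by rewrite /K divr_gt0 ?mulr_gt0 ?exprn_gt0 //; lra.
  apply: (@le_trans _ _ (riem_dist (@torus_atlas R) (torus_metric t) (pi 0) (pi (row3 (1 / 2) 0 0)))); last first.
    by apply: ereal_sup_ubound; exists (pi 0) => //; exists (pi (row3 (1 / 2) 0 0)).
  apply: le_ereal_inf_tmp => l J.
  have [y [yp l1 l2]] := torus_joined_ge t0 J erefl.
  rewrite subr0 in l1 l2; have far := half_point_far yp.
  rewrite leNgt; apply/negP => lt.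
  have := le_lt_trans l1 lt; have := le_lt_trans l2 lt; rewrite !lte_fin => m2 m1.
  (* A shorter curve would be short in both directions, and the product of the two bounds
     contradicts the lower bound on [f1 y * f2 y]. *)
  have : a1 t * `|f1 y| * (a2 t * `|f2 y|) < (Num.sqrt K * s) * (Num.sqrt K * s).
    by apply: ltr_pM => //; rewrite mulr_ge0 // ltW ?a1_gt0 ?a2_gt0.
  rewrite [X in _ < X]mulrACA -!expr2 sqr_sqrtr ?(ltW K0) // mulrACA.
  have -> : a1 t * a2 t = s ^+ 2 by rewrite a1E a2E; field; exact: lt0r_neq0.
  by rewrite mulrC ltr_pM2r ?exprn_gt0 // ltNge far.
apply: ge_ereal_sup => _ [p _ [q _ <-]].
have [x <-] := torus_pi_surj p; have [y <-] := torus_pi_surj q.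
have q1 : 1 < golden R ^+ 2 by rewrite exprn_egt1.
(* The least admissible power overshoots 1 by at most one factor theta^2, which is below 4. *)
have [k k1 k2] : exists2 k, 1 <= t * (golden R ^+ 2) ^+ k &
    t * (golden R ^+ 2) ^+ k <= golden R ^+ 2.
  have ex : exists k, 1 <= t * (golden R ^+ 2) ^+ k.
    have qi : `|(golden R ^+ 2)^-1| < 1.
      by rewrite gtr0_norm ?invr_gt0 ?exprn_gt0 ?invf_lt1 ?exprn_gt0 //; lra.
    have /cvgrPdist_lt/(_ t t0)[N _ /(_ N (leqnn _))] := cvg_expr qi.
    rewrite sub0r normrN gtr0_norm ?exprn_gt0 ?invr_gt0 ?exprn_gt0 //; last lra.
    rewrite exprVn => h; exists N.
    by rewrite -ler_pdivrMr ?exprn_gt0 ?mul1r ?(ltW h) //; lra.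
  case: (ex_minnP ex) => -[|k] k1 kmin; [exists 0%N | exists k.+1] => //.
    by rewrite mulr1 (le_trans t1) // ltW.
  have h : t * (golden R ^+ 2) ^+ k < 1.
    by rewrite ltNge; apply/negP => /kmin; rewrite ltnn.
  by rewrite exprSr mulrA ler_piMl ?(ltW h) // ltW //; lra.
have [u [uw h1 h2 h3]] := lattice_approx k (y - x).
have -> : pi y = pi (x + u).
  move/torus_piP/forallP : uw => H; apply/torus_piP/forallP => i; have := H i.
  by rewrite -rpredN !mxE (_ : - (_ - _) = y 0 i - (x 0 i + u 0 i)) //; ring.
apply: (@le_trans _ _ (Num.sqrt (hform t (x + u - x)))%:E).
  by apply: ereal_inf_lbound; exact: torus_straight.
rewrite addrAC subrr add0r lee_fin -[s]ger0_norm ?(ltW s0) // -sqrtr_sqr -sqrtrM //.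
rewrite ler_sqrt ?mulr_ge0 ?sqr_ge0 //.
rewrite /hform a1_sq // a2_sq // a1E a2E.
set Q := (golden R ^+ 2) ^+ k in k1 k2 h2.
have Q0 : 0 < Q by rewrite !exprn_gt0 //; lra.
have h1' : f1 u ^+ 2 <= 2 * Q^-1 by move: h1; rewrite exprVn.
have iQ : Q^-1 <= s ^+ 6.
  by rewrite -s6 -(ler_pM2r Q0) mulVf // gt_eqF.
have Q6 : s ^+ 6 * Q <= 4.
  by rewrite -s6; apply: le_trans k2 _; have := golden_lt2 R; nra.
(* The three squares contribute 2, 8 and 1 times [s ^+ 2]; this is the origin of 11. *)
have e1 : (s ^- 2) ^+ 2 * f1 u ^+ 2 <= 2 * s ^+ 2.
  have -> : 2 * s ^+ 2 = (s ^- 2) ^+ 2 * (2 * s ^+ 6) by field; exact: lt0r_neq0.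
  by apply: ler_wpM2l; [rewrite sqr_ge0 | apply: le_trans h1' _; rewrite ler_wpM2l].
have e2 : (s ^+ 4) ^+ 2 * f2 u ^+ 2 <= 8 * s ^+ 2.
  apply: (@le_trans _ _ ((s ^+ 4) ^+ 2 * (2 * Q))); first by rewrite ler_wpM2l ?sqr_ge0.
  have -> : (s ^+ 4) ^+ 2 * (2 * Q) = 2 * s ^+ 2 * (s ^+ 6 * Q) by ring.
  have -> : 8 * s ^+ 2 = 2 * s ^+ 2 * 4 by ring.
  by rewrite ler_wpM2l // mulr_ge0 ?sqr_ge0.
have e3 : (s ^+ 4) ^+ 2 * u 0 2 ^+ 2 <= s ^+ 2.
  have -> : (s ^+ 4) ^+ 2 = s ^+ 2 * s ^+ 6 by ring.
  rewrite -mulrA ler_piMr ?sqr_ge0 // mulr_ile1 ?sqr_ge0 ?exprn_ge0 ?(ltW s0) //.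
  by rewrite exprn_ile1 // ltW.
by rewrite mulrDr; lra.
all: exact: ltW.
Qed.

End Distances.

(** * Causal vectors of the Kasner metric *)

Section Minkowski.
Variable R : realType.

Definition xs (v : 'rV[R]_4) : 'rV[R]_3 := @rsubmx R 1 1 3 v.
Definition emb (x : 'rV[R]_3) : 'rV[R]_4 := @row_mx R 1 1 3 0 x.
Definition gform (t : R) (u : 'rV[R]_4) : R := - u 0 0 ^+ 2 + hform t (xs u).
Definition e0 : 'rV[R]_4 := delta_mx 0 0.

Lemma emb0 x : emb x 0 0 = 0.
Proof.
rewrite /emb; have -> : (0 : 'I_4) = lshift 3 (0 : 'I_1) by apply/val_inj.
by rewrite (@row_mxEl R 1 1 3) mxE.
Qed.

Lemma xs_emb x : xs (emb x) = x.
Proof. exact: row_mxKr. Qed.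

Lemma xsD u v : xs (u + v) = xs u + xs v. Proof. by apply/rowP => i; rewrite !mxE. Qed.
Lemma xsB u v : xs (u - v) = xs u - xs v. Proof. by apply/rowP => i; rewrite !mxE. Qed.
Lemma xsN u : xs (- u) = - xs u. Proof. by apply/rowP => i; rewrite !mxE. Qed.
Lemma xsZ k v : xs (k *: v) = k *: xs v. Proof. by apply/rowP => i; rewrite !mxE. Qed.
Lemma xs0 : xs 0 = 0. Proof. by apply/rowP => i; rewrite !mxE. Qed.
Lemma xs_e0 : xs e0 = 0.
Proof. by apply/rowP => i; rewrite !mxE. Qed.

Lemma xsE v (j : 'I_3) : xs v 0 j = v 0 (@rshift 1 3 j).
Proof. by rewrite mxE. Qed.

Lemma split4 (u : 'rV[R]_4) : u = u 0 0 *: e0 + emb (xs u).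
Proof.
apply/rowP => i; rewrite !mxE /=.
case: splitP => j.
  rewrite ord1 => /= i0; have -> : i = 0 by apply/val_inj.
  by rewrite mxE /= mulr1 addr0.
move=> ij; rewrite !mxE; have -> : i = @rshift 1 3 j by apply/val_inj.
by rewrite mulr0 add0r.
Qed.

Lemma xs_norm v : `|xs v| <= `|v|.
Proof. by apply: norm_le_coord => // i j; rewrite ord1 xsE coord_le_norm. Qed.

Lemma emb_norm x : `|emb x| <= `|x|.
Proof.
apply: norm_le_coord => // i j; rewrite ord1 mxE.
case: splitP => k _; first by rewrite mxE normr0.
exact: coord_le_norm.
Qed.

Lemma cont_nonexpansive n m (f : 'rV[R]_n -> 'rV[R]_m) (x : 'rV[R]_n) :
  (forall y, `|f y - f x| <= `|y - x|) -> {for x, continuous f}.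
Proof.
move=> H U /nbhs_rV[e e_gt0 HU]; apply/nbhs_rV; exists e => // y yx.
by apply: HU; exact: le_lt_trans (H y) yx.
Qed.

Lemma xs_continuous (v : 'rV[R]_4) : {for v, continuous xs}.
Proof. by apply: cont_nonexpansive => y; rewrite -xsB xs_norm. Qed.

Lemma emb_continuous (x : 'rV[R]_3) : {for x, continuous emb}.
Proof.
apply: cont_nonexpansive => y; have -> : emb y - emb x = emb (y - x).
  by apply/rowP => i; rewrite !mxE; case: splitP => k _; rewrite !mxE ?subr0.
exact: emb_norm.
Qed.

Lemma hform_scale (t k : R) x : hform t (k *: x) = k ^+ 2 * hform t x.
Proof. by rewrite /hform f1Z f2Z mxE; ring. Qed.

Lemma gform_scale (t k : R) u : gform t (k *: u) = k ^+ 2 * gform t u.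
Proof. by rewrite /gform xsZ hform_scale mxE; ring. Qed.

Lemma gform_e0 t : gform t e0 = -1.
Proof. by rewrite /gform xs_e0 /hform /f1 /f2 !mxE /=; ring. Qed.

Lemma gform_polar t u : gform t (u + e0) = gform t u - 1 - 2 * u 0 0.
Proof. by rewrite /gform xsD xs_e0 addr0 !mxE /=; ring. Qed.

Lemma hform_add (t k : R) x y : 0 < k ->
  hform t (x + y) <= (1 + k) * hform t x + (1 + k^-1) * hform t y.
Proof.
move=> k0; have ki : k * k^-1 = 1 by rewrite mulfV // gt_eqF.
have sq (p q : R) : (p + q) ^+ 2 <= (1 + k) * p ^+ 2 + (1 + k^-1) * q ^+ 2.
  have ki0 : 0 < k^-1 by rewrite invr_gt0.
  have : 0 <= k^-1 * (k * p - q) ^+ 2 by rewrite mulr_ge0 ?sqr_ge0 // ltW.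
  have -> : k^-1 * (k * p - q) ^+ 2 = k * k^-1 * k * p ^+ 2 - 2 * (k * k^-1) * p * q + k^-1 * q ^+ 2 by ring.
  by rewrite ki; lra.
have w1 : 0 <= t `^ (- (2 / 3)) by exact: powR_ge0.
have w2 : 0 <= t `^ (4 / 3) by exact: powR_ge0.
rewrite /hform f1D f2D mxE.
have s1 := ler_wpM2l w1 (sq (f1 x) (f1 y)); have s2 := ler_wpM2l w2 (sq (f2 x) (f2 y)).
have s3 := ler_wpM2l w2 (sq (x 0 2) (y 0 2)).
lra.
Qed.

(** With the weight [th], the inequality [hform_add] inflates the spatial part of [u] by at most
    [th * K ^+ 2 <= k / 4], and [eta] allows [y] another [k / 4]. Neither choice depends on the time
    [t]. *)
Lemma timelike_slack (k K : R) : 0 < k -> exists2 eta : R, 0 < eta &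
  forall (t : R) (u : 'rV[R]_4) (y : 'rV[R]_3), `|u 0 0| <= K -> gform t u <= - k -> hform t y <= eta ->
    gform t (u + emb y) < 0.
Proof.
move=> k0; pose th := k / (4 * (K ^+ 2 + 1)).
have K1 : 0 < K ^+ 2 + 1 by have := sqr_ge0 K; lra.
have th0 : 0 < th by rewrite divr_gt0 // mulr_gt0.
have thE : th * (4 * (K ^+ 2 + 1)) = k by rewrite divfK // gt_eqF // mulr_gt0.
have t1 : 0 < 1 + th^-1 by rewrite addr_gt0 // invr_gt0.
exists (k / (4 * (1 + th^-1))); first by rewrite divr_gt0 // mulr_gt0.
move=> t u y uK gk hy; rewrite /gform xsD xs_emb [(u + emb y) 0 0]mxE emb0 addr0.
have := hform_add t (xs u) y th0.
have hyE : (1 + th^-1) * hform t y <= k / 4.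
  have -> : k / 4 = (1 + th^-1) * (k / (4 * (1 + th^-1))).
    by move: t1; generalize (1 + th^-1) => D D0; field; rewrite gt_eqF.
  by rewrite ler_wpM2l // ltW.
have u2 : u 0 0 ^+ 2 <= K ^+ 2.
  by rewrite -real_normK ?num_real // ler_sqr ?nnegrE // (le_trans _ uK).
move: gk; rewrite /gform => gk; have := hform_ge0 t (xs u).
have : th * hform t (xs u) <= th * (K ^+ 2) by rewrite ler_wpM2l ?(ltW th0) //; lra.
lra.
Qed.

(** The speed of light in coordinates is the inverse scale factor: t^(1/3) along [eta1] and t^(-2/3)
    across it. *)
Lemma causal_coord (t : R) u (j : 'I_3) : 0 < t -> gform t u <= 0 ->
  `|xs u 0 j| <= (t `^ (1 / 3) + t `^ (- (2 / 3))) * `|u 0 0|.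
Proof.
move=> t0; rewrite /gform => g.
set p := t `^ (1 / 3); set m := t `^ (- (2 / 3)).
have p0 : 0 < p by exact: powR_gt0.
have m0 : 0 < m by exact: powR_gt0.
have E1 : t `^ (- (2 / 3)) = p ^- 2.
  by rewrite /p -powR_mulrn ?powR_ge0 // -powRrM -powRN; congr (_ `^ _); lra.
have E2 : t `^ (4 / 3) = m ^- 2.
  by rewrite /m -powR_mulrn ?powR_ge0 // -powRrM -powRN; congr (_ `^ _); lra.
move: g; rewrite /hform E1 E2; set x := xs u => g.
have h1 : f1 x ^+ 2 <= p ^+ 2 * u 0 0 ^+ 2.
  rewrite -ler_pdivrMl ?exprn_gt0 //.
  have : 0 <= m ^- 2 * (f2 x ^+ 2 + x 0 2 ^+ 2).
    by rewrite mulr_ge0 ?invr_ge0 ?addr_ge0 ?sqr_ge0.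
  lra.
have h2 : f2 x ^+ 2 + x 0 2 ^+ 2 <= m ^+ 2 * u 0 0 ^+ 2.
  rewrite -ler_pdivrMl ?exprn_gt0 //.
  have : 0 <= p ^- 2 * f1 x ^+ 2 by rewrite mulr_ge0 ?invr_ge0 ?sqr_ge0.
  lra.
have n := f12_norm x.
suff : x 0 j ^+ 2 <= ((p + m) * `|u 0 0|) ^+ 2.
  rewrite -[X in X <= _ -> _]real_normK ?num_real // ler_sqr ?nnegrE //.
  by rewrite mulr_ge0 // addr_ge0 // ltW.
rewrite exprMn real_normK ?num_real //.
have pm : (p ^+ 2 + m ^+ 2) * u 0 0 ^+ 2 <= (p + m) ^+ 2 * u 0 0 ^+ 2.
  by rewrite ler_wpM2r ?sqr_ge0 //; have := mulr_gt0 p0 m0; nra.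
have q1 := sqr_ge0 (x 0 0); have q2 := sqr_ge0 (x 0 1); have q3 := sqr_ge0 (x 0 2).
have q4 := sqr_ge0 (f2 x).
by move: j; apply: forall3; nra.
Qed.

End Minkowski.

(** * Timelike curves in a box around a boundary point *)

(** Compactness of the segment makes the size of the neighbourhoods uniform. *)
Lemma tube (R : realType) (al be l : R) (P : R -> R -> Prop) :
  (forall s, al <= s <= be -> \forall p \near (l, s), P p.1 p.2) ->
  exists2 e : R, 0 < e & forall l' s, `|l' - l| < e -> al <= s <= be -> P l' s.
Proof.
move=> H.
have cov := (compact_near_coveringP _).1 (@segment_compact R al be).
have /nbhs_ballP[e /= e_gt0 He] : \forall l' \near l, `[al, be]%classic `<=` (P l').
  apply: (cov R (nbhs l) P) => s /=; rewrite in_itv /= => /H[[P1 P2] /= [nP1 nP2] P12].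
  by exists (P2, P1) => // -[s' l'] /= [h1 h2]; exact: (P12 (l', s')).
exists e => // l' s h sin; apply: He; last by rewrite /= in_itv.
by rewrite -ball_normE /= distrC.
Qed.

(** The situation near a point [0] of the boundary of the image of a spacetime extension, in linear
    coordinates where the curve [s e0], [s < 0], runs in the image and ends at [0].  [E] maps a
    part [D] of the universal cover of the Kasner spacetime to this box, and [q z] is the quadratic
    form of the extended metric at [z]. *)
Record box_chart (R : realType) (r : R) (D : set 'rV[R]_4) (E : 'rV[R]_4 -> 'rV[R]_4)
    (q : 'rV[R]_4 -> 'rV[R]_4 -> R) : Prop := BoxChart {
  bc_r : 0 < r ;
  bc_N : forall z w : 'rV[R]_4, `|z| < r -> (forall i, `|w 0 i| <= w 0 0 / 8 \/ i = 0) ->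
    q z w <= - (1 / 2) * w 0 0 ^+ 2 ;
  bc_W : forall z w : 'rV[R]_4, `|z| < r -> q z w <= 0 -> forall i, `|w 0 i| <= 2 * `|w 0 0| ;
  bc_U : forall z w : 'rV[R]_4, `|z| < r -> `|q z w| <= 6 * `|w| ^+ 2 ;
  bc_N0 : forall z w, q z (- w) = q z w ;
  bc_pos : forall v, D v -> 0 < v 0 0 ;
  bc_open : open D ;
  bc_box : forall v, D v -> `|E v| < r ;
  bc_diff : forall v, D v -> differentiable E v ;
  bc_cont : forall v, D v -> {for v, continuous (fun y => 'D_(e0 R) E y)} ;
  bc_isom : forall v u, D v -> q (E v) (u *m 'J E v) = gform (v 0 0) u ;
  bc_unit : forall v, D v -> exists K, 'J E v *m K = 1%:M ;
  bc_closed : forall K, compact K -> (forall z, K z -> `|z| < r) ->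
    forall v : 'rV[R]_4, 0 < v 0 0 -> closure (D `&` E @^-1` K) v -> D v /\ K (E v) ;
  bc_closed_image : forall K, compact K -> (forall v : 'rV[R]_4, K v -> 0 < v 0 0) ->
    forall z, `|z| < r -> closure (E @` (D `&` K)) z -> exists2 v, K v & D v /\ E v = z ;
  bc_open_map : forall v U, D v -> nbhs v U -> nbhs (E v) (E @` (U `&` D)) ;
  bc_inj : forall v v', D v -> D v' -> E v = E v' -> `|xs v - xs v'| < 1 -> v = v' ;
  bc_time : forall v v', D v -> D v' -> E v = E v' -> v 0 0 = v' 0 0 ;
  bc_red : forall v, D v -> exists v', [/\ D v', E v' = E v, v' 0 0 = v 0 0 & `|xs v'| <= 1] ;
  bc_lift : forall s0 S v0, - r < s0 -> s0 <= S -> S < 0 -> D v0 -> E v0 = s0 *: e0 R ->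
    exists c : R -> 'rV[R]_4, c s0 = v0 /\ forall s, s0 <= s <= S ->
      [/\ {for s, continuous c}, D (c s) & E (c s) = s *: e0 R] ;
  bc_start : forall s, - r < s < 0 -> exists2 v, D v & E v = s *: e0 R ;
  bc_exit : forall v, D v -> E v <> 0
}.

Lemma norm_from_cone (R : realFieldType) (a b n t0 t1 t2 k : R) :
  `|a - b| <= 2 * (t1 - t0) -> `|b| <= n -> t1 <= t2 -> n + 2 * (t2 - t0) <= k -> `|a| <= k.
Proof. by move=> h1 h2 h3 h4; have := ler_normD (a - b) b; rewrite subrK; lra. Qed.

Section Core.
Variables (R : realType) (r : R) (D : set 'rV[R]_4) (E : 'rV[R]_4 -> 'rV[R]_4).
Variable q : 'rV[R]_4 -> 'rV[R]_4 -> R.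
Hypothesis B : box_chart r D E q.

Local Notation e0 := (e0 R).

(** The box time component of the image of the Kasner time direction. Its sign tells whether the two
    times run in the same direction. *)
Definition orient (v : 'rV[R]_4) : R := ('D_e0 E v) 0 0.

Lemma E_continuous v : D v -> {for v, continuous E}.
Proof. by move=> Dv; exact/differentiable_continuous/(bc_diff B). Qed.

Lemma q0 v : D v -> q (E v) 0 = 0.
Proof.
move=> Dv; have := bc_isom B 0 Dv; rewrite mul0mx => ->.
by rewrite /gform xs0 /hform /f1 /f2 !mxE; ring.
Qed.

Lemma timelike_neq0 v w : D v -> q (E v) w < 0 -> w 0 0 != 0.
Proof.
move=> Dv qw; apply/eqP => w0.
have wi := bc_W B (bc_box B Dv) (ltW qw).
have wE : w = 0.
  apply/rowP => i; rewrite mxE; apply/eqP; rewrite -normr_le0.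
  by have := wi i; rewrite w0 normr0 mulr0.
by move: qw; rewrite wE q0 // ltxx.
Qed.

(** The cone of timelike vectors with positive time component is convex, so the box time component
    of their images has a constant sign, read off on the coordinate vector [e0]. *)
Lemma orient_sign v u : D v -> gform (v 0 0) u < 0 ->
  0 < u 0 0 * orient v * (u *m 'J E v) 0 0.
Proof.
move=> Dv; wlog u0 : u / 0 < u 0 0 => [H gu|gu].
  have [u0|u0|u0] := ltgtP (u 0 0) 0; last 1 first.
  - by move: gu; rewrite /gform u0 expr0n /= oppr0 add0r ltNge hform_ge0.
  - have E1 : (- u) 0 0 = - u 0 0 by rewrite mxE.
    have E2 : (- u *m 'J E v) 0 0 = - (u *m 'J E v) 0 0 by rewrite mulNmx mxE.
    have := H (- u); rewrite E1 E2 mulNr mulrNN; apply; first by rewrite oppr_gt0.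
    by rewrite -scaleN1r gform_scale sqrrN expr1n mul1r.
  - exact: H.
set A := orient v; set A' := (u *m 'J E v) 0 0.
have AE : A = (e0 *m 'J E v) 0 0 by rewrite -deriveEjacobian //; exact: (bc_diff B).
have key (l : R) : 0 <= l <= 1 -> (1 - l) * A + l * A' != 0.
  move=> /andP[l0 l1].
  have -> : (1 - l) * A + l * A' = (((1 - l) *: e0 + l *: u) *m 'J E v) 0 0.
    by rewrite mulmxDl -!scalemxAl [RHS]mxE [X in _ = X + _]mxE [X in _ = _ + X]mxE AE.
  apply: (timelike_neq0 (v := v)) => //; rewrite (bc_isom B) //.
  move: gu; rewrite /gform xsD !xsZ xs_e0 scaler0 add0r hform_scale.
  set h := hform _ _ => gu.
  have -> : ((1 - l) *: e0 + l *: u) 0 0 = 1 - l + l * u 0 0 by rewrite !mxE /= mulr1.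
  have h0 : 0 <= h by exact: hform_ge0.
  have p1 : 0 <= (1 - l) * (l * u 0 0) by rewrite !mulr_ge0 // ?subr_ge0 // ltW.
  have p2 : 0 <= l ^+ 2 * (u 0 0 ^+ 2 - h) by rewrite mulr_ge0 ?sqr_ge0 //; lra.
  have [->|ln0] := eqVneq l 0; first by rewrite expr0n /= mul0r; lra.
  have p3 : 0 < l ^+ 2 * (u 0 0 ^+ 2 - h).
    by rewrite mulr_gt0 ?exprn_gt0 ?lt_def ?ln0 //; lra.
  have p4 := sqr_ge0 (1 - l); nra.
have A0 : A != 0 by have := key 0; rewrite lexx ler01 subr0 mul1r mul0r addr0; apply.
have B0 : A' != 0 by have := key 1; rewrite lexx ler01 subrr mul1r mul0r add0r; apply.
rewrite -mulrA pmulr_rgt0 // ltNge; apply/negP => AB.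
have AB0 : A * A' < 0 by rewrite lt_neqAle AB mulf_neq0.
have ABn : A - A' != 0.
  apply/negP; rewrite subr_eq0 => /eqP AeB; move: AB0; rewrite AeB -expr2.
  by rewrite ltNge sqr_ge0.
have sqp : 0 < (A - A') ^+ 2 by rewrite exprn_even_gt0.
have := key (A / (A - A')).
have -> : (1 - A / (A - A')) * A + A / (A - A') * A' = 0 by field.
rewrite eqxx => /(_ _)/negP; apply => //.
have E1 : A / (A - A') = (A * (A - A')) / (A - A') ^+ 2 by field.
rewrite E1 divr_ge0 ?sqr_ge0 ?ler_pdivrMr ?mul1r //=; last by have := sqr_ge0 A; lra.
by have := sqr_ge0 A'; lra.
Qed.

Lemma orient_neq0 v : D v -> orient v != 0.
Proof.
move=> Dv; apply/eqP => ov; have := @orient_sign v e0 Dv.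
rewrite gform_e0 ov mulr0 mul0r ltxx => h.
by have : false by apply: h; lra.
Qed.

(** [sg] is the direction of Kasner time along the curve, so that both time orientations of the box
    are treated at once. Derivatives are asked only in the open interval: a broken curve can be cut
    at its corners. *)
Definition timelike_on (sg : R) (c : R -> 'rV[R]_4) (al be : R) :=
  (forall s, al <= s <= be -> {for s, continuous c}) /\
  (forall s, al < s < be -> [/\ derivable c s 1, gform (c s 0 0) (derive1 c s) < 0 &
     0 < sg * (derive1 c s) 0 0]).

(** [orient] is continuous and vanishes nowhere on [D], so the intermediate value theorem
    applies. *)
Lemma orient_path (sg : R) (c : R -> 'rV[R]_4) (al be : R) :
  (forall s, al <= s <= be -> {for s, continuous c}) ->
  (forall s, al <= s <= be -> D (c s)) -> 0 < sg * orient (c al) ->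
  forall s, al <= s <= be -> 0 < sg * orient (c s).
Proof.
move=> cc cD o0 s /andP[als sbe].
rewrite ltNge; apply/negP => os.
have [||x] := @IVT _ (fun u => sg * orient (c u)) al s 0 als.
- apply: within_itv_continuous => u /andP[alu us].
  have uin : al <= u <= be by rewrite alu (le_trans us).
  apply: cont_mul; first exact: cont_cst.
  apply: (cont_comp (f := fun u => 'D_e0 E (c u)) (g := fun M : 'rV[R]_4 => M 0 0)).
    exact: (@cont_comp _ _ _ c (fun y => 'D_e0 E y) u (cc _ uin) (bc_cont B (cD _ uin))).
  exact: coord_cont.
- by apply/andP; split; [rewrite ge_min; apply/orP; right; exact: os | rewrite le_max; apply/orP; left; exact: ltW o0].
rewrite in_itv /= => /andP[alx xs_] /eqP; rewrite mulf_eq0 => /orP[/eqP sg0|].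
  by move: o0; rewrite sg0 mul0r ltxx.
by apply/negP/orient_neq0/cD; rewrite alx (le_trans xs_).
Qed.

Lemma E_curve (c : R -> 'rV[R]_4) s : D (c s) -> derivable c s 1 ->
  derivable (E \o c) s 1 /\ derive1 (E \o c) s = derive1 c s *m 'J E (c s).
Proof. by move=> Dc dc; apply: derive1_comp_jacobian => //; exact: (bc_diff B). Qed.

(** The image of the tangent is causal for [q], hence of slope at most 2 by [bc_W], and
    [orient_sign] makes its time component positive. The mean value theorem then applies to twice
    the time plus or minus the coordinate [i]. *)
Lemma timelike_mono (sg : R) (c : R -> 'rV[R]_4) (al be : R) :
  timelike_on sg c al be -> (forall s, al <= s <= be -> D (c s)) -> 0 < sg * orient (c al) ->
  forall s1 s2, al <= s1 -> s1 <= s2 -> s2 <= be ->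
   forall i, `|E (c s2) 0 i - E (c s1) 0 i| <= 2 * (E (c s2) 0 0 - E (c s1) 0 0).
Proof.
move=> [cc tl] cD o0 s1 s2 als1 s12 s2be i.
have cE s j : al <= s <= be -> {for s, continuous (fun u => E (c u) 0 j)}.
  move=> sin; apply: (cont_comp (f := fun u => E (c u)) (g := fun M : 'rV[R]_4 => M 0 j)).
    exact: (@cont_comp _ _ _ c E s (cc _ sin) (E_continuous (cD _ sin))).
  exact: coord_cont.
have dE s j : al < s < be -> is_derive s 1 (fun u => E (c u) 0 j) ((derive1 c s *m 'J E (c s)) 0 j).
  move=> sin; have [dc _ _] := tl s sin.
  have Ds : D (c s) by apply: cD; case/andP: sin => ? ?; rewrite !ltW.
  have [d1 <-] := E_curve Ds dc.
  exact: is_derive_coord.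
have cone s : al < s < be ->
   `|(derive1 c s *m 'J E (c s)) 0 i| <= 2 * (derive1 c s *m 'J E (c s)) 0 0.
  move=> sin; have [dc g pos] := tl s sin.
  have sin' : al <= s <= be by case/andP: sin => ? ?; rewrite !ltW.
  have Ds := cD s sin'; have os := orient_path cc cD o0 sin'.
  have := bc_W B (bc_box B Ds) (w := derive1 c s *m 'J E (c s)); rewrite (bc_isom B) // => /(_ (ltW g) i).
  rewrite [X in _ <= _ * X -> _]gtr0_norm //.
  have := orient_sign Ds g.
  have : 0 < (sg * (derive1 c s) 0 0) * (sg * orient (c s)) by rewrite mulr_gt0.
  have -> : sg * derive1 c s 0 0 * (sg * orient (c s)) =
    sg ^+ 2 * (derive1 c s 0 0 * orient (c s)) by ring.
  move=> h; have h1 : 0 < derive1 c s 0 0 * orient (c s).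
    rewrite -(pmulr_rgt0 _ (_ : 0 < sg ^+ 2)) // exprn_even_gt0 //=.
    by apply/eqP => sg0; move: h; rewrite sg0 expr0n /= mul0r ltxx.
  by rewrite pmulr_rgt0.
have key (k : R) : `|k| <= 1 ->
    0 <= (2 * E (c s2) 0 0 + (- k) * E (c s2) 0 i) - (2 * E (c s1) 0 0 + (- k) * E (c s1) 0 i).
  move=> k1; rewrite -[X in X <= _](mul0r (s2 - s1)).
  pose f u := 2 * E (c u) 0 0 + (- k) * E (c u) 0 i; rewrite -/(f s2) -/(f s1).
  apply: mean_value_ge => // s /andP[h1 h2].
    have sin : al <= s <= be by rewrite (le_trans als1) // (le_trans h2).
    by apply: cont_add; apply: cont_mul; [exact: cont_cst|exact: cE|exact: cont_cst|exact: cE].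
  have sin : al < s < be by rewrite (le_lt_trans als1) // (lt_le_trans h2).
  have df := is_derive_add (is_derive_mull 2 (dE s 0 sin)) (is_derive_mull (- k) (dE s i sin)).
  split; first exact: (@ex_derive _ _ _ _ _ _ _ df).
  rewrite derive1E (@derive_val _ _ _ _ _ _ _ df).
  have := cone s sin; set w := _ 0 i => cw.
  have : k * w <= `|w|.
    by rewrite (le_trans (ler_norm _)) // normrM ler_piMl.
  lra.
have k1 := key 1; have k2 := key (-1).
rewrite normrN normr1 lexx in k1 k2.
by rewrite ler_norml; apply/andP; split; have := k1 isT; have := k2 isT; lra.
Qed.

Lemma timelike_mono2 (sg : R) (c : R -> 'rV[R]_4) (al m be : R) : al <= m <= be ->
  timelike_on sg c al m -> timelike_on sg c m be ->
  (forall s, al <= s <= be -> D (c s)) -> 0 < sg * orient (c al) ->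
  (forall s, al <= s <= be -> 0 < sg * orient (c s)) /\
  (forall s1 s2, al <= s1 -> s1 <= s2 -> s2 <= be ->
    forall i, `|E (c s2) 0 i - E (c s1) 0 i| <= 2 * (E (c s2) 0 0 - E (c s1) 0 0)).
Proof.
move=> /andP[alm mbe] T1 T2 cD o0.
have D1 s : al <= s <= m -> D (c s).
  by move=> /andP[h1 h2]; apply: cD; rewrite h1 (le_trans h2).
have D2 s : m <= s <= be -> D (c s).
  by move=> /andP[h1 h2]; apply: cD; rewrite h2 (le_trans alm).
have o1 := orient_path T1.1 D1 o0.
have om : 0 < sg * orient (c m) by apply: o1; rewrite alm lexx.
have o2 := orient_path T2.1 D2 om.
have M1 := timelike_mono T1 D1 o0; have M2 := timelike_mono T2 D2 om.
split=> [s /andP[als sbe]|s1 s2 h1 h2 h3 i].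
  by have [sm|/ltW ms] := leP s m; [apply: o1; rewrite als | apply: o2; rewrite ms].
have [s2m|/ltW ms2] := leP s2 m; first exact: M1.
have [s1m|/ltW ms1] := leP s1 m; last exact: M2.
have := M1 s1 m h1 s1m (lexx _) i; have := M2 m s2 (lexx _) ms2 h3 i.
have -> : E (c s2) 0 i - E (c s1) 0 i = (E (c s2) 0 i - E (c m) 0 i) + (E (c m) 0 i - E (c s1) 0 i) by ring.
have := ler_normD (E (c s2) 0 i - E (c m) 0 i) (E (c m) 0 i - E (c s1) 0 i).
lra.
Qed.

Lemma compact_ball (k : R) : compact [set z : 'rV[R]_4 | `|z| <= k].
Proof.
apply: bounded_closed_compact.
  by exists k; split; [exact: num_real | move=> x kx z /= /le_trans; apply; exact: ltW].
apply: (@closed_comp _ _ (fun z : 'rV[R]_4 => `|z|) [set x : R | x <= k]); last exact: closed_le.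
by move=> z _; exact: norm_continuous.
Qed.

(** Timelike curves starting at a fixed point and ending in a controlled region cannot leave the box
    along a homotopy: they stay in a compact double cone. *)
Lemma homotopy_in_box (sg : R) (H : R -> R -> 'rV[R]_4) (al m be k : R) : al <= m <= be -> k < r ->
  (forall l s, 0 <= l <= 1 -> al <= s <= be ->
    {for (l, s), continuous (fun p : R * R => H p.1 p.2)}) ->
  (forall l s, 0 <= l <= 1 -> al <= s <= be -> 0 < H l s 0 0) ->
  (forall l, 0 <= l <= 1 -> timelike_on sg (H l) al m /\ timelike_on sg (H l) m be) ->
  (forall l, 0 <= l <= 1 -> H l al = H 0 al) -> 0 < sg * orient (H 0 al) ->
  (forall l, 0 <= l <= 1 -> D (H l be) ->
    `|E (H 0 al)| + 2 * (E (H l be) 0 0 - E (H 0 al) 0 0) <= k) ->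
  (forall s, al <= s <= be -> D (H 0 s)) ->
  forall l s, 0 <= l <= 1 -> al <= s <= be -> D (H l s).
Proof.
move=> almbe kr Hc Hp Ht H0 o0 Hend HD0 l s l01 sin.
have albe : al <= be by case/andP: almbe => h1 h2; exact: le_trans h1 h2.
have bein : al <= be <= be by rewrite albe lexx.
pose P l := forall s, al <= s <= be -> D (H l s).
suff : P l by exact.
move: l l01 {s sin}; apply: real_induction => // l /andP[l0 l1] Pl.
- move=> s sin; have l01 : 0 <= l <= 1 by rewrite ltW.
  (* The curves at earlier parameters map into the compact ball of radius [k < r], so the limit
     point is still in [D]. *)
  have [||Ds _] := @bc_closed _ _ _ _ _ B [set z | `|z| <= k] (@compact_ball k) _ (H l s) (Hp l s l01 sin);
    [by move=> z /= /le_lt_trans; apply | | exact: Ds].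
  move=> N nB; have := Hc l s l01 sin N nB.
  move=> [[P1 P2] /= [nP1 nP2] P12].
  have [e /= e_gt0 He] := (nbhs_ballP l _).1 nP1.
  pose l' := Num.max 0 (l - e / 2).
  have l'l : l' < l by rewrite gt_max l0 gtrBl divr_gt0.
  have l'0 : 0 <= l' by rewrite le_max lexx.
  have l'01 : 0 <= l' <= 1 by rewrite l'0 (le_trans (ltW l'l)).
  have DH : P l' by apply: Pl; rewrite l'0.
  exists (H l' s); split; last first.
    apply: (P12 (l', s)); split; last exact: nbhs_singleton nP2.
    apply: He; rewrite -ball_normE /= gtr0_norm ?subr_gt0 //.
    have : l - e / 2 <= l' by rewrite le_max lexx orbT.
    lra.
  split; first exact: DH.
  have [T1 T2] := Ht _ l'01.
  have oal : 0 < sg * orient (H l' al) by rewrite H0.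
  have [_ M] := timelike_mono2 almbe T1 T2 DH oal.
  have Eb := Hend l' l'01 (DH be bein).
  rewrite -(H0 l' l'01) in Eb.
  case/andP: sin => als sbe.
  have Mb i := M s be als sbe (lexx _) 0.
  have tau : E (H l' s) 0 0 <= E (H l' be) 0 0.
    have := M s be als sbe (lexx _) 0; have := normr_ge0 (E (H l' be) 0 0 - E (H l' s) 0 0); lra.
  have k0 : 0 <= k.
    have := M al be (lexx _) albe (lexx _) 0.
    have := normr_ge0 (E (H l' be) 0 0 - E (H l' al) 0 0); have := normr_ge0 (E (H l' al)); lra.
  apply: norm_le_coord => [|i j]; [exact: k0 | rewrite ord1].
  exact: (norm_from_cone (M al s (lexx _) als sbe j) (coord_le_norm _ 0 j) tau Eb).
- have l01 : 0 <= l <= 1 by rewrite l0 ltW.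
  have [s sin|e e_gt0 He] := @tube R al be l (fun l' s' => D (H l' s')).
    have Ds : D (H l s) by apply: (Pl l); rewrite // l0 lexx.
    exact: Hc l s l01 sin D (open_nbhs_nbhs (conj (bc_open B) Ds)).
  exists e => // u /andP[lu ule] u1 s sin.
  by apply: He => //; rewrite gtr0_norm ?subr_gt0 // ltrBlDl.
Qed.

End Core.

(** * Gluing and displacing timelike curves *)

Section CurveTools.
Variable R : realType.
Local Notation e0 := (e0 R).

Lemma cont_glue (T : topologicalType) (f g : R -> T) (m s : R) : f m = g m ->
  {for s, continuous f} -> {for s, continuous g} ->
  {for s, continuous (fun u => if u <= m then f u else g u)}.
Proof.
move=> fg cf cg; have [sm|ms|sm] := ltgtP s m.
- apply: (cont_near (g := f)) => //; near=> u; rewrite ifT //; apply: ltW; near: u.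
  exact: lt_nbhsl.
- apply: (cont_near (g := g)) => //; near=> u; rewrite ifF //; apply/negbTE; rewrite -ltNge; near: u.
  exact: lt_nbhsr.
- move=> U; rewrite sm lexx => nU.
  have nf : \forall u \near s, U (f u) by apply: cf; rewrite sm.
  have ng : \forall u \near s, U (g u) by apply: cg; rewrite sm -fg.
  rewrite sm in nf ng.
  have nn : \forall u \near m, U (if u <= m then f u else g u).
    by near=> u; case: ifP => _; near: u.
  exact: nn.
Unshelve. all: by end_near. Qed.

Lemma cont_pair_scale (V : normedModType R) (f : R -> V) (l s : R) :
  {for s, continuous f} -> {for (l, s), continuous (fun p : R * R => p.1 *: f p.2)}.
Proof.
move=> cf; have c1 : (fun p : R * R => p.1) @ (l, s) --> l by exact: cvg_fst.
have c2 : (fun p : R * R => f p.2) @ (l, s) --> f s.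
  by apply: (@cvg_comp _ _ _ (fun p : R * R => p.2) f _ (nbhs s)) => //; exact: cvg_snd.
exact: (cvgZ c1 c2).
Qed.

Lemma cont_pair_snd (T : topologicalType) (f : R -> T) (l s : R) :
  {for s, continuous f} -> {for (l, s), continuous (fun p : R * R => f p.2)}.
Proof.
move=> cf.
apply: (@cvg_comp _ _ _ (fun p : R * R => p.2) f _ (nbhs s)); last exact: cf.
exact: cvg_snd.
Qed.

Lemma derive1_mulmx n m (c : R -> 'rV[R]_n) (s : R) (P : 'M[R]_(n, m)) : derivable c s 1 ->
  derivable (fun u => c u *m P) s 1 /\ derive1 (fun u => c u *m P) s = derive1 c s *m P.
Proof.
move=> dc; have [d J] : differentiable (fun v : 'rV[R]_n => v *m P) (c s) /\
    'J (fun v : 'rV[R]_n => v *m P) (c s) = P.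
  apply: diff_mx_eps => e e_gt0; near=> h.
  rewrite mulmxDl addrK subrr normr0 mulr_ge0 // ltW //.
by have [d1 d2] := derive1_comp_jacobian d dc; rewrite J in d2.
Unshelve. all: by end_near. Qed.

Definition spmx : 'M[R]_4 := 1%:M - delta_mx 0 0.

Lemma emb_xsE v : emb (xs v) = v *m spmx.
Proof.
apply/rowP => j; rewrite /spmx mulmxBr mulmx1 !mxE.
rewrite (bigD1 (0 : 'I_4)) //= big1 => [|i /negbTE i0]; last first.
  by rewrite [delta_mx _ _ _ _]mxE i0 mulr0.
rewrite addr0 [delta_mx _ _ _ _]mxE eqxx /=.
have := split4 v => /(congr1 (fun w : 'rV[R]_4 => w 0 j)).
rewrite !mxE /= => ->; rewrite addrAC.
have -> : (j == 0)%:R = (0 == j)%:R :> R by rewrite eq_sym.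
by rewrite addrC; case: (0 == j); rewrite /= ?mulr1 ?mulr0; ring.
Qed.

Lemma emb_scale (k : R) x : emb (k *: x) = k *: emb x.
Proof. by apply/rowP => i; rewrite !mxE; case: splitP => j _; rewrite !mxE ?mulr0. Qed.

Lemma emb_add (x y : 'rV[R]_3) : emb (x + y) = emb x + emb y.
Proof. by apply/rowP => i; rewrite !mxE; case: splitP => j _; rewrite !mxE ?addr0. Qed.

Lemma hform_le (t ta tb : R) y : 0 < ta -> ta <= t -> t <= tb ->
  hform t y <= 3 * (ta `^ (- (2 / 3)) + tb `^ (4 / 3)) * `|y| ^+ 2.
Proof.
move=> ta0 tat ttb.
have t0 : 0 < t := lt_le_trans ta0 tat.
have h1 : t `^ (- (2 / 3)) <= ta `^ (- (2 / 3)).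
  rewrite !powRN lef_pV2 ?posrE ?powR_gt0 //.
  by apply: ge0_ler_powR => //; rewrite nnegrE ltW.
have h2 : t `^ (4 / 3) <= tb `^ (4 / 3).
  apply: ge0_ler_powR => //; rewrite nnegrE ltW //; exact: lt_le_trans ttb.
have n := f12_norm y.
have sq j : y 0 j ^+ 2 <= `|y| ^+ 2.
  by rewrite -real_normK ?num_real // ler_sqr ?nnegrE // coord_le_norm.
have s0 := sq 0; have s1 := sq 1; have s2 := sq 2.
have q1 := sqr_ge0 (f1 y); have q2 := sqr_ge0 (f2 y); have q3 := sqr_ge0 (y 0 2).
have w1 : 0 <= t `^ (- (2 / 3)) by exact: powR_ge0.
have w2 : 0 <= t `^ (4 / 3) by exact: powR_ge0.
rewrite /hform; set A := t `^ _ in h1 w1 *; set A' := ta `^ _ in h1 *; set C := t `^ _ in h2 w2 *; set C' := tb `^ _ in h2 *.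
set N := `|y| ^+ 2 in s0 s1 s2 *.
have -> : 3 * (A' + C') * N = A' * (3 * N) + C' * (3 * N) by ring.
apply: lerD; apply: ler_pM => //; lra.
Qed.

Lemma delta_choice (A C : R) : 0 < A -> 0 < C -> exists2 d : R, 0 < d <= 1 & C * d ^+ 2 <= A.
Proof.
move=> A0 C0; exists (Num.min 1 (A / C)).
  by rewrite lt_min ltr01 divr_gt0 //= ge_min lexx.
set d := Num.min _ _.
have d1 : d <= 1 by rewrite ge_min lexx.
have d0 : 0 < d by rewrite lt_min ltr01 divr_gt0.
have dA : d <= A / C by rewrite ge_min lexx orbT.
rewrite ler_pdivlMr // mulrC in dA.
apply: le_trans dA; rewrite ler_wpM2l ?(ltW C0) // expr2 ler_piMr // ltW //.
Qed.

(** The Kasner coefficients depend on time alone, so a spatial displacement changes the tangent but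
    not the form at which it is measured. *)
Lemma timelike_shift (sg k al be : R) (c : R -> 'rV[R]_4) (V : 'rV[R]_3) :
  timelike_on sg c al be ->
  (forall s, al < s < be -> gform (c s 0 0) (derive1 c s + emb (k *: V)) < 0) ->
  timelike_on sg (fun s => c s + (k * (s - al)) *: emb V) al be.
Proof.
move=> [cc tl] H; split=> [s sin|s sin].
  apply: cont_add; first exact: cc.
  have : {for s, continuous (fun u : R => k * (u - al))}.
    apply: cont_mul; first exact: cont_cst.
    by apply: cont_sub; [ | exact: cont_cst].
  by move=> ck; exact: cvgZr_tmp.
have [dc g pos] := tl s sin.
have dl : is_derive s 1 (fun u : R => - (k * al) *: emb V + u *: (k *: emb V)) (k *: emb V).
  have := @derive_line R _ _ id (- (k * al) *: emb V) (k *: emb V) s.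
  have d0 : derivable (@id 'rV[R]_4) (- (k * al) *: emb V + s *: (k *: emb V)) (k *: emb V).
    exact: derivable_id.
  by move=> /(_ d0)[d E]; rewrite derive1E derive_id in E; apply: DeriveDef.
have -> : (fun u => c u + (k * (u - al)) *: emb V) =
    c \+ (fun u : R => - (k * al) *: emb V + u *: (k *: emb V)).
  apply/funext => u /=; congr (_ + _).
  by rewrite scalerA -scalerDl; congr (_ *: _); ring.
have dcc : is_derive s 1 c (derive1 c s) by rewrite derive1E; exact: derivableP.
have DD : is_derive s 1 (c \+ (fun u : R => - (k * al) *: emb V + u *: (k *: emb V)))
    (derive1 c s + k *: emb V) by exact: is_deriveD.
have DE : derive1 (c \+ (fun u : R => - (k * al) *: emb V + u *: (k *: emb V))) s
    = derive1 c s + k *: emb V by rewrite derive1E (@derive_val _ _ _ _ _ _ _ DD).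
rewrite DE.
have E1 : (c s + (- (k * al) *: emb V + s *: (k *: emb V))) 0 0 = c s 0 0.
  by rewrite !mxE -/(emb V) ; have := emb0 V; rewrite mxE => ->; rewrite !mulr0 !addr0.
have E2 : (derive1 c s + k *: emb V) 0 0 = derive1 c s 0 0.
  by rewrite [LHS]mxE [X in _ + X]mxE emb0 mulr0 addr0.
split; first exact: (@ex_derive _ _ _ _ _ _ _ DD).
  have E3 : (c s + (k * (s - al)) *: emb V) 0 0 = c s 0 0.
    by rewrite [LHS]mxE [X in _ + X]mxE emb0 mulr0 addr0.
  by rewrite E3 -[k *: emb V]emb_scale; exact: H.
by rewrite E2.
Qed.

Lemma timelike_near (sg al be : R) (c c' : R -> 'rV[R]_4) :
  timelike_on sg c al be -> (forall s, al <= s <= be -> {for s, continuous c'}) ->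
  (forall s, al < s < be -> c' s = c s) -> timelike_on sg c' al be.
Proof.
move=> [cc tl] cc' E; split; first exact: cc'.
move=> s sin; have [dc g pos] := tl s sin.
have Es : \forall u \near s, c' u = c u + 0.
  case/andP: (sin) => h1 h2; near=> u; rewrite addr0; apply: E; apply/andP; split; near: u.
    exact: lt_nbhsr.
  exact: lt_nbhsl.
have [d ->] := derive1_near Es dc.
by rewrite E.
Unshelve. all: by end_near. Qed.

End CurveTools.

(** * Lifts of straight lines of the box *)

Section Lifts.
Variables (R : realType) (r : R) (D : set 'rV[R]_4) (E : 'rV[R]_4 -> 'rV[R]_4).
Variable q : 'rV[R]_4 -> 'rV[R]_4 -> R.
Hypothesis B : box_chart r D E q.
Local Notation e0 := (e0 R).

(** A lift is only known to be continuous; it is differentiable by [derivable_lift], because the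
    Jacobian of [E] has a right inverse. *)
Lemma line_lift (c : R -> 'rV[R]_4) (p w : 'rV[R]_4) (al be s : R) : al < s < be ->
  (forall s, al <= s <= be -> [/\ {for s, continuous c}, D (c s) & E (c s) = p + s *: w]) ->
  derivable c s 1 /\ derive1 c s *m 'J E (c s) = w.
Proof.
move=> sin H; case/andP: (sin) => als sbe.
have [cs Ds Es] : [/\ {for s, continuous c}, D (c s) & E (c s) = p + s *: w].
  by apply: H; rewrite !ltW.
have [K JK] := bc_unit B Ds.
have Enear : \forall u \near s, (E \o c) u = p + u *: w + 0.
  near=> u; rewrite addr0 /=; have [|_ _ ->//] := H u.
  by apply/andP; split; apply: ltW; near: u; [exact: lt_nbhsr|exact: lt_nbhsl].
have d0 : derivable (@id 'rV[R]_4) (p + s *: w) w by exact: derivable_id.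
have [dl dE] := derive_line d0.
have [dEc EcE] := derive1_near Enear dl.
have dc : derivable c s 1 := derivable_lift (bc_diff B Ds) JK cs dEc.
split=> //; have [_ <-] := E_curve B Ds dc.
by rewrite EcE dE derive_id.
Unshelve. all: by end_near. Qed.

(** The cone of slope 1/8 on which [bc_N] gives uniformly timelike vectors, written as there. *)
Definition narrow (w : 'rV[R]_4) := forall i : 'I_4, `|w 0 i| <= w 0 0 / 8 \/ i = 0.

Lemma narrow_e0 : narrow e0.
Proof.
apply: forall4; [by right| | |]; left; rewrite !mxE /= normr0; lra.
Qed.

Lemma line_timelike (c : R -> 'rV[R]_4) (p w : 'rV[R]_4) (al be sg : R) :
  narrow w -> 0 < w 0 0 -> al <= be ->
  (forall s, al <= s <= be -> [/\ {for s, continuous c}, D (c s) & E (c s) = p + s *: w]) ->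
  0 < sg * orient E (c al) ->
  timelike_on sg c al be /\
  forall s, al < s < be -> gform (c s 0 0) (derive1 c s) <= - (1 / 2) * w 0 0 ^+ 2.
Proof.
move=> nw w0 albe H o0.
have g s : al < s < be -> gform (c s 0 0) (derive1 c s) <= - (1 / 2) * w 0 0 ^+ 2.
  move=> sin; have [dc cJ] := line_lift sin H.
  have [_ Ds _] : [/\ {for s, continuous c}, D (c s) & E (c s) = p + s *: w].
    by apply: H; case/andP: sin => ? ?; rewrite !ltW.
  rewrite -(bc_isom B) // cJ; exact: (bc_N B (bc_box B Ds) nw).
split; last exact: g.
split=> [s /H[]//|s sin].
have [dc cJ] := line_lift sin H.
have sin' : al <= s <= be by case/andP: sin => ? ?; rewrite !ltW.
have [_ Ds _] := H s sin'.
have gs : gform (c s 0 0) (derive1 c s) < 0.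
  by apply: le_lt_trans (g s sin) _; have := exprn_gt0 2 w0; lra.
split; [exact: dc | exact: gs |].
have os : 0 < sg * orient E (c s).
  by apply: (orient_path B _ _ o0) sin' => u /H[].
have := orient_sign B Ds gs; rewrite cJ (pmulr_lgt0 _ w0) => uo.
have : 0 < (sg * orient E (c s)) * (derive1 c s 0 0 * orient E (c s)) by rewrite mulr_gt0.
have -> : sg * orient E (c s) * (derive1 c s 0 0 * orient E (c s)) =
  (sg * derive1 c s 0 0) * orient E (c s) ^+ 2 by ring.
have o2 : 0 < orient E (c s) ^+ 2 by rewrite exprn_even_gt0 ?(orient_neq0 B Ds).
by rewrite (pmulr_lgt0 _ o2).
Qed.

(** Polarisation against [e0]: the time component of [u] is a difference of values of [gform] at [u]
    and [u + e0], and by the isometry these are values of [q], controlled by [bc_U]. No bound on the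
    inverse Jacobian is involved. *)
Lemma time_bound v (u : 'rV[R]_4) (M : R) : D v -> `|'D_e0 E v| <= M ->
  `|u 0 0| <= 6 * (`|u *m 'J E v| + M) ^+ 2 + 1.
Proof.
move=> Dv bM; have De := deriveEjacobian e0 (bc_diff B Dv).
have M0 : 0 <= M := le_trans (normr_ge0 _) bM.
have := gform_polar (v 0 0) u.
rewrite -!(bc_isom B) // mulmxDl -De => P.
have z := bc_box B Dv.
have h1 := bc_U B (u *m 'J E v) z; have h2 := bc_U B (u *m 'J E v + 'D_e0 E v) z.
set w := u *m 'J E v in P h1 h2 *.
have w0 := normr_ge0 w.
have n1 : `|w + 'D_e0 E v| ^+ 2 <= (`|w| + M) ^+ 2.
  rewrite ler_sqr ?nnegrE ?addr_ge0 // (le_trans (ler_normD _ _)) //; lra.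
have n2 : `|w| ^+ 2 <= (`|w| + M) ^+ 2 by rewrite ler_sqr ?nnegrE ?addr_ge0 //; lra.
move: h1 h2; rewrite !ler_norml => /andP[a1 a2] /andP[b1 b2].
apply/andP; split; lra.
Qed.

(** The set of agreement is closed by continuity. It is open because two lifts closer than 1 in
    space with the same image coincide by [bc_inj]. *)
Lemma lift_unique (c c' : R -> 'rV[R]_4) (al be : R) : al <= be -> c al = c' al ->
  (forall s, al <= s <= be -> {for s, continuous c} /\ D (c s)) ->
  (forall s, al <= s <= be -> {for s, continuous c'} /\ D (c' s)) ->
  (forall s, al <= s <= be -> E (c s) = E (c' s)) ->
  forall s, al <= s <= be -> c s = c' s.
Proof.
move=> albe e H H' HE; apply: real_induction => // s /andP[s1 s2] P.
- have sin : al <= s <= be by rewrite (ltW s1).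
  have [cs _] := H s sin; have [cs' _] := H' s sin.
  have cd := cont_sub cs cs'.
  apply/eqP; rewrite -subr_eq0; apply: contraT => n0.
  have /cvgrPdist_lt/(_ `|c s - c' s|) := cd; rewrite normr_gt0 => /(_ n0).
  move=> /nbhs_ballP[e1 /= e1_gt0 He].
  pose u := Num.max al (s - e1 / 2).
  have us : u < s by rewrite gt_max s1 gtrBl divr_gt0.
  have au : al <= u by rewrite le_max lexx.
  have : ball s e1 u.
    rewrite -ball_normE /= gtr0_norm ?subr_gt0 //.
    have : s - e1 / 2 <= u by rewrite le_max lexx orbT.
    lra.
  by move=> /He; rewrite (P u) ?au //= subrr subr0 ltxx.
- have sin : al <= s <= be by rewrite s1 ltW.
  have [cs _] := H s sin; have [cs' _] := H' s sin.
  have cd := cont_sub cs cs'.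
  have /cvgrPdist_lt/(_ 1 ltr01) := cd.
  move=> /nbhs_ballP[e1 /= e1_gt0 He]; exists e1 => // u /andP[su use] ube.
  have uin : al <= u <= be by rewrite ube (le_trans s1) // ltW.
  have [_ Du] := H u uin; have [_ Du'] := H' u uin.
  apply: (bc_inj B) => //; first exact: HE.
  have : ball s e1 u by rewrite -ball_normE /= ltr0_norm ?subr_lt0 //; lra.
  move=> /He; rewrite (P s) ?s1 ?lexx // subrr sub0r normrN -xsB => h.
  exact: le_lt_trans (xs_norm _) h.
Qed.

End Lifts.

(** * No boundary point at infinite time *)

Section Shear.
Variable R : realType.
Local Notation e0 := (e0 R).

Lemma cont_xs (T : topologicalType) (c : T -> 'rV[R]_4) (s : T) :
  {for s, continuous c} -> {for s, continuous (fun u => xs (c u))}.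
Proof. by move=> cs; exact: (@cont_comp _ _ _ c (@xs R) s cs (@xs_continuous R (c s))). Qed.

Lemma cont_emb (T : topologicalType) (c : T -> 'rV[R]_3) (s : T) :
  {for s, continuous c} -> {for s, continuous (fun u => emb (c u))}.
Proof. by move=> cs; exact: (@cont_comp _ _ _ c (@emb R) s cs (@emb_continuous R (c s))). Qed.

Lemma cont_scaler (T : topologicalType) (V : normedModType R) (k : R) (g : T -> V) (s : T) :
  {for s, continuous g} -> {for s, continuous (fun u => k *: g u)}.
Proof. by move=> cg; exact: cvgZl_tmp. Qed.

(** Contracting the spatial velocity by [1 - k] keeps the time component, and (1 - k)^2 <= 1 - k
    turns the contraction into a slack of [k] times its square. The constant [P] serves to put an
    end point back in place. *)
Lemma shear_timelike (sg k al be : R) (c : R -> 'rV[R]_4) (P : 'rV[R]_4) : 0 <= k <= 1 -> P 0 0 = 0 ->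
  timelike_on sg c al be ->
  let H s := P + (c s - k *: emb (xs (c s))) in
  timelike_on sg H al be /\
  forall s, al < s < be -> derive1 H s 0 0 = derive1 c s 0 0 /\
    gform (H s 0 0) (derive1 H s) <= - k * derive1 c s 0 0 ^+ 2.
Proof.
move=> /andP[k0 k1] P0 [cc tl] H.
pose M : 'M[R]_4 := 1%:M - k *: spmx R.
have ME (v : 'rV[R]_4) : v *m M = v - k *: emb (xs v).
  by rewrite /M mulmxBr mulmx1 -scalemxAr emb_xsE.
have HE s : H s = c s *m M + P by rewrite ME /H addrC.
have H0 s : H s 0 0 = c s 0 0.
  by rewrite /H mxE P0 add0r [LHS]mxE [X in _ + X]mxE [X in - X]mxE emb0 mulr0 subr0.
have dH s : al < s < be -> derivable H s 1 /\
    derive1 H s = derive1 c s - k *: emb (xs (derive1 c s)).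
  move=> sin; have [dc _ _] := tl s sin; have [d1 d2] := derive1_mulmx M dc.
  have [] := @derive1_near R _ H (fun u => c u *m M) P s _ d1.
    by near=> u; rewrite HE.
  by move=> d ->; split=> //; rewrite d2 ME.
have e00 s : al < s < be -> derive1 H s 0 0 = derive1 c s 0 0.
  by move=> /dH[_ ->]; rewrite [LHS]mxE [X in _ + X]mxE [X in - X]mxE emb0 mulr0 subr0.
have g s : al < s < be -> gform (H s 0 0) (derive1 H s) =
    - derive1 c s 0 0 ^+ 2 + (1 - k) ^+ 2 * hform (c s 0 0) (xs (derive1 c s)).
  move=> sin; rewrite /gform e00 // H0 (dH s sin).2; congr (_ + _).
  rewrite -hform_scale; congr (hform _ _).
  by rewrite xsB xsZ xs_emb scalerBl scale1r.
have gle s : al < s < be -> 0 <= hform (c s 0 0) (xs (derive1 c s)) < derive1 c s 0 0 ^+ 2.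
  by move=> /tl[_ + _]; rewrite hform_ge0 /gform /=; lra.
have kk : (1 - k) ^+ 2 <= 1 - k.
  have : 0 <= k * (1 - k) by rewrite mulr_ge0 ?subr_ge0.
  lra.
split; [split|].
- move=> s sin; have -> : H = fun s => c s *m M + P by apply/funext => u; exact: HE.
  apply: cont_add; last exact: cont_cst.
  by apply: (cont_comp (f := c) (g := fun v => v *m M)); [exact: cc | exact: mulmxr_continuous].
- move=> s sin; have [dc _ pos] := tl s sin; split; [exact: (dH s sin).1 | | by rewrite e00].
  rewrite g //; have := gle s sin; set h := hform _ _ => /andP[h0 h1].
  have : (1 - k) ^+ 2 * h <= 1 * h by rewrite ler_wpM2r //; lra.
  lra.
- move=> s sin; split; first exact: e00.
  rewrite g //; have := gle s sin; set h := hform _ _ => /andP[h0 h1].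
  have : (1 - k) ^+ 2 * h <= (1 - k) * h by rewrite ler_wpM2r.
  have : (1 - k) * h <= (1 - k) * derive1 c s 0 0 ^+ 2 by rewrite ler_wpM2l ?subr_ge0 // ltW.
  lra.
Unshelve. all: by end_near. Qed.

Lemma time_mono (c : R -> 'rV[R]_4) (sg al be : R) : timelike_on sg c al be ->
  forall s s', al <= s -> s <= s' -> s' <= be -> 0 <= sg * (c s' 0 0 - c s 0 0).
Proof.
move=> [cc tl] s s' als ss' s'be; rewrite -[X in X <= _](mul0r (s' - s)).
pose f u := sg * c u 0 0; rewrite [leRHS]mulrBr -/(f s) -/(f s').
apply: mean_value_ge => // u /andP[h1 h2].
  have uin : al <= u <= be by rewrite (le_trans als) // (le_trans h2).
  apply: cont_mul; first exact: cont_cst.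
  by apply: (cont_comp (f := c) (g := fun M : 'rV[R]_4 => M 0 0)); [exact: cc|exact: coord_cont].
have uin : al < u < be by rewrite (le_lt_trans als) // (lt_le_trans h2).
have [dc _ pos] := tl u uin.
have df := is_derive_mull sg (is_derive_coord 0 0 dc).
split; first exact: (@ex_derive _ _ _ _ _ _ _ df).
by rewrite derive1E (@derive_val _ _ _ _ _ _ _ df) ltW.
Qed.

Lemma causal_spread (c : R -> 'rV[R]_4) (sg al be C : R) : sg ^+ 2 = 1 -> al <= be ->
  timelike_on sg c al be -> (forall s, al <= s <= be -> 0 < c s 0 0) ->
  (forall s, al <= s <= be -> c s 0 0 `^ (1 / 3) + c s 0 0 `^ (- (2 / 3)) <= C) ->
  `|xs (c be) - xs (c al)| <= C * (sg * (c be 0 0 - c al 0 0)).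
Proof.
move=> sg2 albe T pos HC; have [cc tl] := T.
have C0 : 0 <= C.
  by apply: le_trans (HC al _); rewrite ?lexx // addr_ge0 // powR_ge0.
apply: norm_le_coord => [|i j].
  by rewrite mulr_ge0 //; apply: (time_mono T).
rewrite ord1 -xsB xsE 2!mxE; set J := rshift 1 j.
have key (k : R) : `|k| <= 1 ->
    0 <= (C * sg * c be 0 0 + k * c be 0 J) - (C * sg * c al 0 0 + k * c al 0 J).
  move=> k1; rewrite -[X in X <= _](mul0r (be - al)).
  pose f u := C * sg * c u 0 0 + k * c u 0 J; rewrite -/(f be) -/(f al).
  apply: mean_value_ge => // s sin.
    by apply: cont_add; apply: cont_mul; (try exact: cont_cst);
      apply: (cont_comp (f := c) (g := fun M : 'rV[R]_4 => M 0 _)); (try exact: cc); exact: coord_cont.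
  have [dc g p] := tl s sin.
  have sin' : al <= s <= be by case/andP: sin => ? ?; rewrite !ltW.
  have df := is_derive_add (is_derive_mull (C * sg) (is_derive_coord 0 0 dc)) (is_derive_mull k (is_derive_coord 0 J dc)).
  split; first exact: (@ex_derive _ _ _ _ _ _ _ df).
  rewrite derive1E (@derive_val _ _ _ _ _ _ _ df).
  have := causal_coord j (pos s sin') (ltW g); rewrite xsE -/J => cj.
  have a0 : `|derive1 c s 0 0| = sg * derive1 c s 0 0.
    by rewrite -[RHS](gtr0_norm p) normrM -[`|sg|]sqrtr_sqr sg2 sqrtr1 mul1r.
  rewrite a0 in cj.
  have h1 : `|derive1 c s 0 J| <= C * (sg * derive1 c s 0 0).
    by apply: le_trans cj _; rewrite ler_wpM2r ?(ltW p) // HC.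
  have : - (k * derive1 c s 0 J) <= `|derive1 c s 0 J|.
    by rewrite (le_trans (ler_norm _)) // normrN normrM ler_piMl.
  lra.
have k1 := key 1; have k2 := key (-1).
rewrite normrN normr1 lexx in k1 k2.
by rewrite ler_norml; apply/andP; split; have := k1 isT; have := k2 isT; lra.
Qed.

End Shear.

Section Future.
Variables (R : realType) (r : R) (D : set 'rV[R]_4) (E : 'rV[R]_4 -> 'rV[R]_4).
Variable q : 'rV[R]_4 -> 'rV[R]_4 -> R.
Hypothesis B : box_chart r D E q.
Local Notation e0 := (e0 R).

Lemma e0_norm : `|e0| <= 1.
Proof. by apply: norm_le_coord => // i j; rewrite !mxE; case: (_ && _); rewrite ?normr1 ?normr0. Qed.

Lemma continuous_bounded (f : R -> R) (al be : R) : al <= be ->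
  (forall s, al <= s <= be -> {for s, continuous f}) ->
  exists M, forall s, al <= s <= be -> f s <= M.
Proof.
move=> ab cf; have [c _ H] := EVT_max ab (within_itv_continuous cf).
by exists (f c) => s sin; apply: H; rewrite in_itv.
Qed.

(** On a compact stretch of the line, Kasner times stay in a compact interval of positive numbers
    and the time components of the tangents are bounded, so [timelike_slack] gives one [d] for all
    of them. *)
Lemma tilt_room (c : R -> 'rV[R]_4) (p w : 'rV[R]_4) (sg s0 s1 : R) : s0 <= s1 -> narrow w -> 0 < w 0 0 ->
  (forall s, s0 <= s <= s1 -> [/\ {for s, continuous c}, D (c s) & E (c s) = p + s *: w]) ->
  0 < sg * orient E (c s0) ->
  exists2 d : R, 0 < d <= 1 & forall (y : 'rV[R]_3) (s : R), `|y| <= d -> s0 < s < s1 ->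
    gform (c s 0 0) (derive1 c s + emb y) < 0.
Proof.
move=> s01 nw w0 H o0.
have [M HM] : exists M, forall s, s0 <= s <= s1 -> `|'D_e0 E (c s)| <= M.
  apply: continuous_bounded => // s sin; have [cs Ds _] := H s sin.
  apply: (cont_comp (f := fun u => 'D_e0 E (c u)) (g := fun v : 'rV[R]_4 => `|v|)).
    exact: (@cont_comp _ _ _ c (fun y => 'D_e0 E y) s cs (bc_cont B Ds)).
  exact: norm_continuous.
have [T g] := line_timelike B nw w0 s01 H o0.
have M0 : 0 <= M by apply: le_trans (HM s0 _); rewrite ?lexx.
have hf : (0 : R) < 1 / 2 * w 0 0 ^+ 2 by rewrite mulr_gt0 // ?exprn_gt0 //; lra.
have [eta eta0 Heta] := timelike_slack (6 * (`|w| + M) ^+ 2 + 1) hf.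
set ta := Num.min (c s0 0 0) (c s1 0 0); set tb := Num.max (c s0 0 0) (c s1 0 0).
have tp s : s0 <= s <= s1 -> 0 < c s 0 0 by move=> /H[_ /(bc_pos B)].
have ta0 : 0 < ta by rewrite lt_min !tp ?lexx ?s01.
have tb0 : 0 < tb by rewrite lt_max tp ?lexx ?s01.
have tab s : s0 <= s <= s1 -> ta <= c s 0 0 <= tb.
  move=> /andP[h1 h2].
  have m1 := time_mono T (lexx _) h1 h2; have m2 := time_mono T h1 h2 (lexx _).
  rewrite ge_min le_max; have [sg0|sg0|sg0] := ltgtP sg 0.
  - by rewrite !nmulr_rge0 ?subr_le0 // in m1 m2; rewrite m1 m2 !orbT.
  - by rewrite !pmulr_rge0 ?subr_ge0 // in m1 m2; rewrite m1 m2 !orbT.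
  - by move: o0; rewrite sg0 mul0r ltxx.
have C0 : 0 < 3 * (ta `^ (- (2 / 3)) + tb `^ (4 / 3)) by rewrite mulr_gt0 // addr_gt0 // powR_gt0.
have [d d0 Hd] := delta_choice eta0 C0.
exists d => // y s yd sin; have sin' : s0 <= s <= s1 by case/andP: sin => ? ?; rewrite !ltW.
have [cs Ds Es] := H s sin'.
apply: Heta.
- have [_ dJ] := line_lift B sin H.
  by have := time_bound B (derive1 c s) Ds (HM s sin'); rewrite dJ.
- by have := g s sin; rewrite mulNr.
- have /andP[h1 h2] := tab s sin'.
  apply: le_trans (hform_le y ta0 h1 h2) _.
  apply: le_trans Hd; rewrite ler_wpM2l ?(ltW C0) // ler_sqr ?nnegrE //.
  by case/andP: d0 => ? _; exact: ltW.
Qed.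

Lemma sqr_le (a b : R) : 0 <= a -> 0 <= b -> a ^+ 2 <= b ^+ 2 -> a <= b.
Proof. by move=> a0 b0; rewrite ler_sqr. Qed.

Lemma slope_gap (a b k x y : R) : 0 <= a + - k * x - (b + - k * y) -> a < 0 -> - r < b ->
  k * (x - y) <= r.
Proof. lra. Qed.

Lemma slope_sum (e x m l d : R) : e / 24 * x <= m -> e * (l + d) = d -> 0 <= l + d ->
  d * x <= 24 * m * (l + d).
Proof.
move=> h1 h2 h3; have -> : d * x = 24 * (e / 24 * x) * (l + d) by rewrite -{1}h2; field.
by rewrite ler_wpM2r // ler_wpM2l.
Qed.

(** 24 is the 6 of [bc_U] times the square of the slope 2 of the causal cone. *)
Lemma slope_bound (g e a n b : R) : g <= - e * a ^+ 2 -> `|g| <= 6 * n ^+ 2 -> n ^+ 2 <= (2 * b) ^+ 2 ->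
  e / 24 * a ^+ 2 <= b ^+ 2.
Proof. by move=> h; rewrite ler_norml => /andP[h1 _] h2; lra. Qed.

(** On the stretch from [s0] to [s1] the curve can be pushed sideways by [d * (s1 - s0)]. This pays
    for contracting the later displacement [L] by a factor [1 - eps], which leaves a slack of [eps]
    times the squared Kasner speed. Box time then grows at least [sqrt (eps / 24)] times as fast as
    Kasner time, while it has only an interval of length [r] at its disposal. *)
Lemma future_estimate (c : R -> 'rV[R]_4) (s0 s1 S d : R) :
  - r / 4 <= s0 -> s0 < s1 -> s1 < S -> S < 0 -> 0 < d <= 1 ->
  (forall s, s0 <= s <= S -> [/\ {for s, continuous c}, D (c s) & E (c s) = s *: e0]) ->
  0 < orient E (c s0) ->
  (forall (y : 'rV[R]_3) (s : R), `|y| <= d -> s0 < s < s1 ->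
    gform (c s 0 0) (derive1 c s + emb y) < 0) ->
  d * (s1 - s0) * (c S 0 0 - c s1 0 0) ^+ 2 <=
  24 * r ^+ 2 * (`|xs (c S) - xs (c s1)| + d * (s1 - s0)).
Proof.
move=> rs0 s01 s1S S0 /andP[d0 d1] H o0 tilt.
set L := `|_ - _|; set de := d * (s1 - s0).
have r0 := bc_r B.
have s0S : s0 <= S by rewrite ltW // (lt_trans s01).
have s0in : s0 <= s1 <= S by rewrite !ltW.
have de0 : 0 < de by rewrite mulr_gt0 // subr_gt0.
have L0 : 0 <= L by exact: normr_ge0.
pose eps := de / (L + de).
have Lde : 0 < L + de by lra.
have eps0 : 0 < eps by rewrite divr_gt0.
have eps1 : eps <= 1 by rewrite ler_pdivrMr // mul1r lerDr.
have epsL : eps * L <= de.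
  rewrite /eps mulrAC ler_pdivrMr // ler_wpM2l ?(ltW de0) //; lra.
have s10 : 0 < s1 - s0 by rewrite subr_gt0.
pose y := (s1 - s0)^-1 *: (eps *: (xs (c S) - xs (c s1))).
have yd : `|y| <= d.
  rewrite /y normrZ normrZ -/L mulrC (_ : `|eps| = eps) ?gtr0_norm ?invr_gt0 //.
  by rewrite ler_pdivrMr.
have yE : (s1 - s0) *: y = eps *: (xs (c S) - xs (c s1)) by rewrite /y scalerA divff ?scale1r // gt_eqF.
have H1 s : s0 <= s <= s1 -> [/\ {for s, continuous c}, D (c s) & E (c s) = 0 + s *: e0].
  by move=> /andP[h1 h2]; rewrite add0r; apply: H; rewrite h1 (le_trans h2) // ltW.
have H2 s : s1 <= s <= S -> [/\ {for s, continuous c}, D (c s) & E (c s) = 0 + s *: e0].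
  by move=> /andP[h1 h2]; rewrite add0r; apply: H; rewrite h2 (le_trans _ h1) // ltW.
have HH s : s0 <= s <= S -> [/\ {for s, continuous c}, D (c s) & E (c s) = 0 + s *: e0].
  by rewrite add0r; exact: H.
have e00 : e0 0 0 = 1 by rewrite mxE.
have e0p : 0 < e0 0 0 by rewrite e00.
have o0' : 0 < 1 * orient E (c s0) by rewrite mul1r.
have os1 : 0 < 1 * orient E (c s1).
  by apply: (orient_path B _ _ o0' s0in) => s /H[].
have [T1 _] := line_timelike B (@narrow_e0 R) e0p (ltW s01) H1 o0'.
have [T2 _] := line_timelike B (@narrow_e0 R) e0p (ltW s1S) H2 os1.
(* The variation field: a linear push up to [s1], then a contraction towards the end point. It
   vanishes at [s0] and [S], and the choice of [y] makes the two halves agree at [s1]. *)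
pose W s := if s <= s1 then (s - s0) *: emb y
            else eps *: (emb (xs (c S)) - emb (xs (c s))).
pose G l s := c s + l *: W s.
have embB (a b : 'rV[R]_3) : emb (a - b) = emb a - emb b.
  by rewrite -scaleN1r emb_add emb_scale scaleN1r.
have W00 s : W s 0 0 = 0.
  by rewrite /W; case: ifP => _; rewrite -?embB -emb_scale emb0.
have cW s : s0 <= s <= S -> {for s, continuous W}.
  move=> sin; have [cs _ _] := H s sin; apply: cont_glue.
  - by rewrite -emb_scale yE emb_scale embB.
  - have c1 : {for s, continuous (fun u : R => u - s0)} by apply: cont_sub; [ | exact: cont_cst].
    exact: cvgZr_tmp.
  - have c1 : {for s, continuous (fun u => emb (xs (c S)) - emb (xs (c u)))}.
      apply: cont_sub; first exact: cont_cst.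
      exact: cont_emb (cont_xs cs).
    exact: cont_scaler.
have GT1 l : 0 <= l <= 1 -> timelike_on 1 (G l) s0 s1.
  move=> /andP[l0 l1].
  apply: (timelike_near (c := fun s => c s + (l * (s - s0)) *: emb y)).
  - apply: timelike_shift => // s sin; apply: tilt => //.
    by rewrite normrZ ger0_norm // (le_trans _ yd) // ler_piMl.
  - move=> s /andP[h1 h2]; have sin : s0 <= s <= S by rewrite h1 (le_trans h2) // ltW.
    apply: cont_add; [by have [] := H s sin | exact: cont_scaler (cW s sin)].
  - by move=> s /andP[h1 h2]; rewrite /G /W (ltW h2) scalerA.
have GE2 l s : s1 < s -> G l s = (l * eps) *: emb (xs (c S)) + (c s - (l * eps) *: emb (xs (c s))).
  by move=> h; rewrite /G /W leNgt h /= scalerA scalerBr addrCA.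
have G2 l : 0 <= l <= 1 -> timelike_on 1 (G l) s1 S /\
    forall s, s1 < s < S -> derive1 (G l) s 0 0 = derive1 c s 0 0 /\
    gform (G l s 0 0) (derive1 (G l) s) <= - (l * eps) * derive1 c s 0 0 ^+ 2.
  move=> /andP[l0 l1].
  have le1 : 0 <= l * eps <= 1.
    by rewrite mulr_ge0 ?(ltW eps0) //= (le_trans _ eps1) // ler_piMl // ltW.
  have P0 : ((l * eps) *: emb (xs (c S))) 0 0 = 0 by rewrite -emb_scale emb0.
  have [Ta Tb] := shear_timelike le1 P0 T2.
  split.
    apply: (timelike_near Ta).
    - move=> s /andP[h1 h2]; have sin : s0 <= s <= S by rewrite h2 (le_trans (ltW s01)).
      apply: cont_add; [by have [] := H s sin | exact: cont_scaler (cW s sin)].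
    - by move=> s /andP[h1 h2]; exact: GE2.
  move=> s sin; have [E1 E2] := Tb s sin; case/andP: (sin) => h1 h2.
  have [dT _ _] := Ta.2 s sin.
  have nE : \forall u \near s, G l u = (l * eps) *: emb (xs (c S)) + (c u - (l * eps) *: emb (xs (c u))) + 0.
    by near=> u; rewrite addr0; apply: GE2; near: u; exact: lt_nbhsr.
  by have [_ ->] := derive1_near nE dT; rewrite GE2.
have G00 l s : G l s 0 0 = c s 0 0.
  by rewrite /G mxE [X in _ + X]mxE W00 mulr0 addr0.
have Gs0 l : G l s0 = c s0 by rewrite /G /W (ltW s01) subrr scale0r scaler0 addr0.
have GS l : G l S = c S by rewrite /G /W leNgt s1S /= subrr !scaler0 addr0.
have G0 s : G 0 s = c s by rewrite /G scale0r addr0.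
have Ds s : s0 <= s <= S -> D (c s) by move=> /H[].
have DG l s : 0 <= l <= 1 -> s0 <= s <= S -> D (G l s).
  (* The starting point has norm at most [r / 4], and the box time left until [S < 0] is at most
     [r / 4]; the slope 2 doubles the latter. *)
  apply: (homotopy_in_box (m := s1) (k := 3 / 4 * r) (sg := 1) B s0in).
  - by rewrite gtr_pMl ?(bc_r B) // ltr_pdivrMr // mul1r ltr_nat.
  - move=> {}l {}s _ sin; apply: cont_add.
      by apply: cont_pair_snd; have [] := H s sin.
    exact: cont_pair_scale (cW s sin).
  - by move=> {}l {}s _ /Ds/(bc_pos B); rewrite G00.
  - by move=> {}l lin; split; [exact: GT1 | exact: (G2 l lin).1].
  - by move=> {}l _; rewrite !Gs0.
  - by rewrite G0.
  - move=> {}l _ _; rewrite G0 GS.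
    have [|_ _ ->] := H S; first by rewrite s0S lexx.
    have [|_ _ ->] := H s0; first by rewrite s0S lexx.
    rewrite !mxE /= !mulr1 normrZ.
    have : `|s0| * `|e0| <= `|s0| by rewrite ler_piMr // e0_norm.
    rewrite ltr0_norm; last by rewrite (lt_trans s01) // (lt_trans s1S).
    lra.
  - by move=> {}s /Ds; rewrite G0.
have l11 : 0 <= (1 : R) <= 1 by rewrite ler01 lexx.
pose ka := Num.sqrt (eps / 24).
have ka2 : ka ^+ 2 = eps / 24 by rewrite sqr_sqrtr // divr_ge0 // ltW.
have ka0 : 0 <= ka by exact: sqrtr_ge0.
have [GT2 Gg] := G2 1 l11.
have oG : 0 < 1 * orient E (G 1 s0) by rewrite Gs0.
have [oall _] := timelike_mono2 B s0in (GT1 1 l11) GT2 (fun s => @DG 1 s l11) oG.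
(* Box time minus [ka] times Kasner time does not decrease along the deformed curve. *)
have inc : 0 * (S - s1) <= (E (G 1 S) 0 0 + (- ka) * G 1 S 0 0) - (E (G 1 s1) 0 0 + (- ka) * G 1 s1 0 0).
  pose f u := E (G 1 u) 0 0 + (- ka) * G 1 u 0 0; rewrite -/(f S) -/(f s1).
  apply: mean_value_ge; first exact: ltW.
    move=> s sin; have sin' : s0 <= s <= S by case/andP: sin => h1 h2; rewrite h2 (le_trans (ltW s01)).
    have cG := GT2.1 s sin.
    apply: cont_add.
      apply: (cont_comp (f := fun u => E (G 1 u)) (g := fun M : 'rV[R]_4 => M 0 0)); last exact: coord_cont.
      exact: (@cont_comp _ _ _ (G 1) E s cG (E_continuous B (DG 1 s l11 sin'))).
    apply: cont_mul; first exact: cont_cst.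
    by apply: (cont_comp (f := G 1) (g := fun M : 'rV[R]_4 => M 0 0)) => //; exact: coord_cont.
  move=> s sin; have sin' : s0 <= s <= S by case/andP: sin => h1 h2; rewrite ltW ?(lt_trans s01) // ltW.
  have [dG gG pG] := GT2.2 s sin.
  have Dsg := DG 1 s l11 sin'.
  have [dE EE] := E_curve B Dsg dG.
  have df := is_derive_add (is_derive_coord 0 0 dE) (is_derive_mull (- ka) (is_derive_coord 0 0 dG)).
  split; first exact: (@ex_derive _ _ _ _ _ _ _ df).
  rewrite derive1E (@derive_val _ _ _ _ _ _ _ df) EE.
  set u := derive1 (G 1) s in gG pG *.
  have [u0 gu] := Gg s sin; rewrite -/u in u0 gu; rewrite -u0 mul1r in gu; rewrite mul1r in pG.
  have os := oall s sin'; rewrite mul1r in os.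
  have := orient_sign B Dsg gG; rewrite -mulrA pmulr_rgt0 // pmulr_rgt0 // => w0.
  have qw := bc_isom B u Dsg.
  set w := u *m _ in w0 qw *.
  have := bc_W B (bc_box B Dsg) (w := w); rewrite qw => /(_ (ltW gG)) wi.
  have wn : `|w| <= 2 * w 0 0.
    apply: norm_le_coord => [|i j]; first by rewrite mulr_ge0 // ltW.
    by rewrite ord1; have := wi j; rewrite (gtr0_norm w0).
  have qb := bc_U B w (bc_box B Dsg); rewrite qw in qb.
  have n2 : `|w| ^+ 2 <= (2 * w 0 0) ^+ 2 by rewrite ler_sqr ?nnegrE // mulr_ge0 // ltW.
  have le2 : (ka * u 0 0) ^+ 2 <= w 0 0 ^+ 2.
    by rewrite exprMn ka2; exact: slope_bound gu qb n2.
  by rewrite mulNr subr_ge0; apply: sqr_le le2; [exact: mulr_ge0 ka0 (ltW pG) | exact: ltW w0].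
have ES : E (G 1 S) 0 0 < 0.
  by rewrite GS; have [|_ _ ->] := H S; rewrite ?s0S ?lexx // mxE e00 mulr1.
have Es1 : - r < E (G 1 s1) 0 0.
  have := coord_le_norm (E (G 1 s1)) 0 0; have := bc_box B (DG 1 s1 l11 s0in).
  by move=> h1 h2; have := le_lt_trans h2 h1; rewrite ltr_norml => /andP[].
rewrite !G00 mul0r in inc.
have t12 : 0 <= c S 0 0 - c s1 0 0.
  by have := time_mono T2 (lexx _) (ltW s1S) (lexx _); rewrite mul1r.
have kr : ka * (c S 0 0 - c s1 0 0) <= r by exact: slope_gap inc ES Es1.
have kr2 : (ka * (c S 0 0 - c s1 0 0)) ^+ 2 <= r ^+ 2.
  by rewrite ler_sqr ?nnegrE ?(ltW r0) // mulr_ge0.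
rewrite exprMn ka2 in kr2.
have epsE : eps * (L + de) = de by rewrite divfK // gt_eqF.
exact: slope_sum kr2 epsE (ltW Lde).
Unshelve. all: by end_near. Qed.

End Future.

(** Here [y] is the cube root of the final Kasner time. The displacement [L] is of order y^4,
    whereas the estimate compares its left hand side of order y^6 with [L]. It forces [y ^+ 2 <= A],
    although [A < y <= y ^+ 2]. *)
Lemma future_arith (R : realType) (de t1 m A y r L : R) : 0 < de -> 0 < t1 -> 0 < m -> 0 <= A ->
  A * de = 96 * r ^+ 2 * (1 + m + de) -> 1 + 2 * t1 + A <= y -> L <= (y + m) * (y ^+ 3 - t1) ->
  de * (y ^+ 3 - t1) ^+ 2 <= 24 * r ^+ 2 * (L + de) -> False.
Proof.
move=> de0 t10 m0 A0 AE yA LX est.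
have y1 : 1 <= y by lra.
have yp : 0 < y by lra.
have y3 : y <= y ^+ 3 by rewrite -[X in X <= _]expr1 ler_weXn2l.
set X := y ^+ 3 - t1 in LX est.
have X1 : 1 / 2 * y ^+ 3 <= X by rewrite /X; lra.
have X0 : 1 / 2 <= X by lra.
have Xp : 0 < X by lra.
have r2 : 0 <= 24 * r ^+ 2 by rewrite mulr_ge0 // sqr_ge0.
have h1 : L + de <= (y * (1 + m + 2 * de)) * X.
  have g1 : m * X <= y * m * X by rewrite ler_wpM2r ?(ltW Xp) // ler_peMl // ltW.
  have g2 : de <= 2 * de * X by nra.
  have g3 : 2 * de * X <= y * (2 * de * X) by rewrite ler_peMl // !mulr_ge0 // ltW.
  lra.
have h2 : de * X <= 24 * r ^+ 2 * (y * (1 + m + 2 * de)).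
  rewrite -(ler_pM2r Xp); apply: le_trans (_ : 24 * r ^+ 2 * (L + de) <= _).
    by rewrite -[de * X * X]mulrA -[X * X]expr2.
  by rewrite -[leRHS]mulrA ler_wpM2l.
have h3 : de * (1 / 2 * y ^+ 3) <= 24 * r ^+ 2 * (y * (1 + m + 2 * de)).
  by apply: le_trans h2; rewrite ler_wpM2l // ltW.
have h4 : 24 * r ^+ 2 * (y * (1 + m + 2 * de)) <= 1 / 2 * y * (A * de).
  rewrite AE; have : 24 * r ^+ 2 * (y * (1 + m + 2 * de)) <= 24 * r ^+ 2 * (y * (2 * (1 + m + de))).
    rewrite ler_wpM2l // ler_wpM2l ?(ltW yp) //; lra.
  lra.
have h5 : y ^+ 2 <= A.
  have yd : 0 < 1 / 2 * y * de by rewrite !mulr_gt0.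
  rewrite -(ler_pM2l yd).
  have -> : 1 / 2 * y * de * y ^+ 2 = de * (1 / 2 * y ^+ 3) by ring.
  have -> : 1 / 2 * y * de * A = 1 / 2 * y * (A * de) by ring.
  exact: le_trans h3 h4.
have : y <= y ^+ 2 by rewrite -[X in X <= _]expr1 ler_weXn2l.
lra.
Qed.

Section FutureContra.
Variables (R : realType) (r : R) (D : set 'rV[R]_4) (E : 'rV[R]_4 -> 'rV[R]_4).
Variable q : 'rV[R]_4 -> 'rV[R]_4 -> R.
Hypothesis B : box_chart r D E q.
Local Notation e0 := (e0 R).

Lemma future_contra v0 : D v0 -> E v0 = (- r / 4) *: e0 -> 0 < orient E v0 ->
  (forall T : R, exists s v, [/\ - r / 8 < s < 0, D v, E v = s *: e0 & T <= v 0 0]) -> False.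
Proof.
move=> Dv0 Ev0 o0 HT; have r0 := bc_r B.
set s0 := - r / 4 in Ev0; set s1 := - r / 8 in HT.
have rs0 : - r < s0 by rewrite /s0; lra.
have s01 : s0 < s1 by rewrite /s0 /s1; lra.
have s10 : s1 < 0 by rewrite /s1; lra.
(* This lift up to [s1] is fixed before [S] is chosen, so that [d] and [t1] do not depend on [S];
   uniqueness of lifts later identifies it with the beginning of the longer lift. *)
have [c1 [c10 c1H]] := bc_lift B rs0 (ltW s01) s10 Dv0 Ev0.
have c1H' u : s0 <= u <= s1 -> [/\ {for u, continuous c1}, D (c1 u) & E (c1 u) = 0 + u *: e0].
  by rewrite add0r; exact: c1H.
have e00 : e0 0 0 = 1 by rewrite mxE.
have [||d d01 tilt] := tilt_room (sg := 1) B (ltW s01) (@narrow_e0 R) _ c1H'.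
- by rewrite e00.
- by rewrite mul1r c10.
case/andP: (d01) => d0 d1.
set de := d * (s1 - s0); have de0 : 0 < de by rewrite mulr_gt0 // subr_gt0.
set t1 := c1 s1 0 0.
have Dc1 : D (c1 s1) by have [|] := c1H s1; rewrite ?lexx ?(ltW s01).
have t10 : 0 < t1 := bc_pos B Dc1.
set m := t1 `^ (- (2 / 3)); have m0 : 0 < m by exact: powR_gt0.
pose A := 96 * r ^+ 2 * (1 + m + de) / de.
have A0 : 0 < A.
  by rewrite divr_gt0 // mulr_gt0 // ?addr_gt0 // mulr_gt0 // exprn_gt0.
pose y0 := 1 + 2 * t1 + A.
have [S [v [/andP[s1S S0] Dv Ev vT]]] := HT (y0 ^+ 3).
have s0S : s0 <= S by rewrite ltW // (lt_trans s01).
have [c [c0 cH]] := bc_lift B rs0 s0S S0 Dv0 Ev0.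
have cc1 s : s0 <= s <= s1 -> c s = c1 s.
  apply: (lift_unique B); first exact: ltW.
  - by rewrite c0 c10.
  - move=> u /andP[h1 h2]; have [|cu Du _] := cH u; last by [].
    by rewrite h1 (le_trans h2) // ltW.
  - by move=> u /c1H[].
  - move=> u uin; have [_ _ ->] := c1H u uin; have [|_ _ ->//] := cH u.
    by case/andP: uin => h1 h2; rewrite h1 (le_trans h2) // ltW.
have T1E : c s1 0 0 = t1 by rewrite cc1 // lexx (ltW s01).
have [cS DcS EcS] : [/\ {for S, continuous c}, D (c S) & E (c S) = S *: e0].
  by apply: cH; rewrite s0S lexx.
have tS : y0 ^+ 3 <= c S 0 0 by rewrite (bc_time B DcS Dv) // EcS Ev.
have [T _] : timelike_on 1 c s0 S /\
    forall s, s0 < s < S -> gform (c s 0 0) (derive1 c s) <= - (1 / 2) * e0 0 0 ^+ 2.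
  apply: (line_timelike B (p := 0) (@narrow_e0 R)); [by rewrite e00 | exact: s0S | | by rewrite mul1r c0].
  by move=> s; rewrite add0r; exact: cH.
have est : de * (c S 0 0 - c s1 0 0) ^+ 2 <= 24 * r ^+ 2 * (`|xs (c S) - xs (c s1)| + de).
  apply: (future_estimate B (lexx _) s01 s1S S0 d01 cH).
  - by rewrite c0.
  - move=> y s yd sin; have nE : \forall u \near s, c u = c1 u + 0.
      case/andP: (sin) => h1 h2; near=> u; rewrite addr0; apply: cc1.
      by apply/andP; split; apply: ltW; near: u; [exact: lt_nbhsr|exact: lt_nbhsl].
    have [dc1 _] := line_lift B sin c1H'.
    have [_ ->] := derive1_near nE dc1.
    by rewrite cc1; [exact: tilt | case/andP: sin => h1 h2; rewrite !ltW].
have sub s : s1 <= s <= S -> s0 <= s <= S.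
  by move=> /andP[h1 h2]; rewrite h2 (le_trans (ltW s01)).
have T2 : timelike_on 1 c s1 S.
  case: T => Ta Tb; split=> [s /sub/Ta//|s /andP[h1 h2]].
  by apply: Tb; rewrite h2 (lt_trans s01).
have s1S' := ltW s1S.
have T0 : 0 < c S 0 0 := bc_pos B DcS.
pose y := c S 0 0 `^ (1 / 3).
have spread : `|xs (c S) - xs (c s1)| <= (y + m) * (1 * (c S 0 0 - c s1 0 0)).
  apply: (causal_spread _ s1S' T2); first by rewrite expr1n.
    by move=> s /sub/cH[_ /(bc_pos B)].
  move=> s sin; have s_0 : 0 < c s 0 0 by have [_ /(bc_pos B)] := cH s (sub s sin).
  case/andP: sin => h1 h2.
  have g1 : t1 <= c s 0 0.
    by have := time_mono T2 (lexx _) h1 h2; rewrite mul1r subr_ge0 T1E.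
  have g2 : c s 0 0 <= c S 0 0.
    by have := time_mono T2 h1 h2 (lexx _); rewrite mul1r subr_ge0.
  apply: lerD.
    by apply: ge0_ler_powR => //; rewrite nnegrE ltW.
  rewrite /m !powRN lef_pV2 ?posrE ?powR_gt0 //.
  by apply: ge0_ler_powR => //; rewrite nnegrE ltW.
have yE : y ^+ 3 = c S 0 0.
  rewrite /y -powR_mulrn ?powR_ge0 // -powRrM (_ : 1 / 3 * 3%:R = 1) ?powRr1 ?ltW //; lra.
rewrite mul1r T1E in spread; rewrite T1E in est; rewrite -yE in est spread tS.
have y_0 : 0 <= y by exact: powR_ge0.
have yy : y0 <= y.
  rewrite leNgt; apply/negP => yl; move: tS; apply/negP; rewrite -ltNge.
  by rewrite ltr_pXn2r // nnegrE ?(le_trans y_0 (ltW yl)).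
apply: (future_arith de0 t10 m0 _ _ yy spread est); first exact: ltW.
by rewrite /A divfK // gt_eqF.
Unshelve. all: by end_near. Qed.

End FutureContra.

(** * No boundary point at the singularity *)

Section Spread.
Variable R : realType.

(** The particle horizon: [int_0^t u^(-2/3) du] is finite. *)
Lemma past_spread (c : R -> 'rV[R]_4) (al be : R) : al <= be -> timelike_on (-1) c al be ->
  (forall s, al <= s <= be -> 0 < c s 0 0) -> c al 0 0 <= 1 ->
  `|xs (c be) - xs (c al)| <= 6 * c al 0 0 `^ (1 / 3).
Proof.
move=> albe T pos c1; have [cc tl] := T.
have tle s : al <= s <= be -> c s 0 0 <= c al 0 0.
  by move=> /andP[h1 h2]; have := time_mono T (lexx _) h1 h2; rewrite mulN1r opprB subr_ge0.
apply: norm_le_coord => [|i j]; first by rewrite mulr_ge0 // powR_ge0.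
rewrite ord1 -xsB xsE 2!mxE; set J := rshift 1 j.
have key (k : R) : `|k| <= 1 ->
    0 <= (- 6 * c be 0 0 `^ (1 / 3) + k * c be 0 J) - (- 6 * c al 0 0 `^ (1 / 3) + k * c al 0 J).
  move=> k1; rewrite -[X in X <= _](mul0r (be - al)).
  (* For times at most 1 the coordinate speed is at most 2 t^(-2/3), whose primitive is 6
     t^(1/3). *)
  pose f u := - 6 * c u 0 0 `^ (1 / 3) + k * c u 0 J; rewrite -/(f be) -/(f al).
  have dp s : 0 < c s 0 0 -> is_derive (c s 0 0) 1 (fun x : R => x `^ (1 / 3)) (1 / 3 * c s 0 0 `^ (1 / 3 - 1)).
    by move=> s0; exact: is_derive1_powR.
  apply: mean_value_ge => [//|s sin|s sin].
    have cc0 j' : {for s, continuous (fun u => c u 0 j')}.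
      by apply: (cont_comp (f := c) (g := fun M : 'rV[R]_4 => M 0 _)); [exact: cc|exact: coord_cont].
    apply: cont_add; apply: cont_mul; (try exact: cont_cst); last exact: cc0.
    apply: (cont_comp (f := fun u => c u 0 0) (g := fun x : R => x `^ (1 / 3))); first exact: cc0.
    apply/differentiable_continuous/derivable1_diffP.
    exact: (@ex_derive _ _ _ _ _ _ _ (dp s (pos s sin))).
  have sin' : al <= s <= be by case/andP: sin => ? ?; rewrite !ltW.
  have [dc g p] := tl s sin; have s0 := pos s sin'.
  have d0 := is_derive_coord 0 0 dc.
  have dpc := is_derive1_comp (dp s s0) d0.
  have df := is_derive_add (is_derive_mull (- 6) dpc) (is_derive_mull k (is_derive_coord 0 J dc)).
  split; first exact: (@ex_derive _ _ _ _ _ _ _ df).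
  rewrite derive1E (@derive_val _ _ _ _ _ _ _ df).
  have := causal_coord j s0 (ltW g); rewrite xsE -/J => cj.
  rewrite mulN1r oppr_gt0 in p; rewrite (ltr0_norm p) in cj.
  have -> : 1 / 3 - 1 = - (2 / 3) :> R by lra.
  have pm : c s 0 0 `^ (1 / 3) <= c s 0 0 `^ (- (2 / 3)).
    by apply: ger_powR; [rewrite s0 (le_trans (tle s sin')) | lra].
  set x := derive1 c s 0 J in cj *; set d := derive1 c s 0 0 in p cj *.
  have h1 : `|x| <= 2 * c s 0 0 `^ (- (2 / 3)) * - d.
    apply: le_trans cj _; rewrite ler_wpM2r ?oppr_ge0 ?(ltW p) //; lra.
  have : - (k * x) <= `|x| by rewrite (le_trans (ler_norm _)) // normrN normrM ler_piMl.
  lra.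
have k1 := key 1; have k2 := key (-1).
rewrite normrN normr1 lexx in k1 k2.
have := powR_ge0 (c be 0 0) (1 / 3).
by rewrite ler_norml => h; apply/andP; split; have := k1 isT; have := k2 isT; lra.
Qed.

Lemma narrowD (u w : 'rV[R]_4) : narrow u -> narrow w -> narrow (u + w).
Proof.
move=> nu nw i; case: (nu i) => [hu|->]; last by right.
case: (nw i) => [hw|->]; last by right.
left; rewrite !mxE; have := ler_normD (u 0 i) (w 0 i); lra.
Qed.

Lemma narrowZ (k : R) (w : 'rV[R]_4) : 0 <= k -> narrow w -> narrow (k *: w).
Proof.
move=> k0 nw i; case: (nw i) => [hw|->]; last by right.
by left; rewrite !mxE normrM ger0_norm // -mulrA ler_wpM2l.
Qed.

Lemma time_strict (c : R -> 'rV[R]_4) (sg al be : R) : al < be -> timelike_on sg c al be ->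
  0 < sg * (c be 0 0 - c al 0 0).
Proof.
move=> albe [cc tl].
have cf : {within `[al, be], continuous (fun u => c u 0 0)}.
  apply: within_itv_continuous => u uin.
  by apply: (cont_comp (f := c) (g := fun M : 'rV[R]_4 => M 0 0)); [exact: cc|exact: coord_cont].
have [|s] := MVT albe _ cf (df := fun u => derive1 c u 0 0).
  by move=> u; rewrite in_itv /= => /tl[dc _ _]; exact: is_derive_coord.
rewrite in_itv /= => /tl[_ _ pos] ->.
by rewrite mulrA mulr_gt0 // subr_gt0.
Qed.

Lemma left_approach (P : set R) (a l : R) : a < l -> nbhs l P -> exists2 u, a <= u < l & P u.
Proof.
move=> al /nbhs_ballP[e /= e_gt0 He].
exists (Num.max a (l - e / 2)).
  by rewrite le_max lexx gt_max al gtrBl divr_gt0.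
apply: He; have h : Num.max a (l - e / 2) < l by rewrite gt_max al gtrBl divr_gt0.
rewrite -ball_normE /= gtr0_norm ?subr_gt0 //.
have : l - e / 2 <= Num.max a (l - e / 2) by rewrite le_max lexx orbT.
lra.
Qed.

Lemma cont_leg (V : normedModType R) (b m : R -> V) (l u : R) :
  {for l, continuous b} -> {for l, continuous m} ->
  {for (l, u), continuous (fun p : R * R => b p.1 + p.2 *: (m p.1 - b p.1))}.
Proof.
move=> cb cm; have f1 (f : R -> V) : {for l, continuous f} -> {for (l, u), continuous (fun p : R * R => f p.1)}.
  move=> cf; apply: (@cvg_comp _ _ _ (fun p : R * R => p.1) f _ (nbhs l)); last exact: cf.
  exact: cvg_fst.
apply: cont_add; first exact: f1.
have c2 : (fun p : R * R => p.2) @ (l, u) --> u by exact: cvg_snd.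
have c1 := f1 _ (cont_sub cm cb).
exact: (cvgZ c2 c1).
Qed.

End Spread.

Section Past.
Variables (R : realType) (r : R) (D : set 'rV[R]_4) (E : 'rV[R]_4 -> 'rV[R]_4).
Variable q : 'rV[R]_4 -> 'rV[R]_4 -> R.
Hypothesis B : box_chart r D E q.
Local Notation e0 := (e0 R).

Variables (xq : 'rV[R]_3) (be eps tt : R).
Hypothesis eps_gt0 : 0 < eps.
Hypothesis eps_be : 64 * eps <= be.
Hypothesis be_r : 8 * be <= r.
Hypothesis tt_gt0 : 0 < tt.
Hypothesis tt_le1 : tt <= 1.
Hypothesis tt_spread : 6 * tt `^ (1 / 3) <= 1 / 32.
(** A ball around an axis point at negative box time. All vertical lines start in it, and by
    hypothesis it lifts near the single point [xq], at early Kasner times. *)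
Definition slab (z : 'rV[R]_4) := `|z + be *: e0| <= eps.
Hypothesis slabP : forall z, slab z ->
  exists v, [/\ D v, E v = z, `|xs v - xq| <= 1 / 8, v 0 0 <= tt & orient E v < 0].

(** The radius 1/4 keeps any two points closer than 1, so that [bc_inj] makes [E] injective here,
    and it leaves a margin above the distance 3/16 reached in [chainP]. *)
Definition sheet : set 'rV[R]_4 := [set v | `|xs v - xq| < 1 / 4].
Definition sheet_image : set 'rV[R]_4 := E @` (D `&` sheet).
Definition sheet_inv (z : 'rV[R]_4) : 'rV[R]_4 := xget 0 [set v | [/\ D v, sheet v & E v = z]].

Local Notation Phi := sheet_inv.
Local Notation V0 := sheet_image.

Lemma PhiP z : V0 z -> [/\ D (Phi z), sheet (Phi z) & E (Phi z) = z].
Proof.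
move=> [v [Dv Wv] Ev]; pose P := [set v | [/\ D v, sheet v & E v = z]].
by have : P (xget 0 P) by apply: xgetPex; exists v.
Qed.

Lemma PhiE v : D v -> sheet v -> Phi (E v) = v.
Proof.
move=> Dv Wv; have [|D1 W1 E1] := @PhiP (E v); first by exists v.
apply: (bc_inj B) => //.
have -> : xs (Phi (E v)) - xs v = (xs (Phi (E v)) - xq) + - (xs v - xq) by rewrite opprB addrA subrK.
apply: le_lt_trans (ler_normD _ _) _; rewrite normrN.
by move: Wv W1; rewrite /sheet /=; lra.
Qed.

Lemma sheet_open v : sheet v -> nbhs v sheet.
Proof.
move=> Wv; have c : {for v, continuous (fun u : 'rV[R]_4 => `|xs u - xq|)}.
  apply: (cont_comp (f := fun u : 'rV[R]_4 => xs u - xq) (g := fun x : 'rV[R]_3 => `|x|)).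
    apply: cont_sub; [exact: xs_continuous | exact: cont_cst].
  exact: norm_continuous.
by have /c := @lt_nbhsl _ _ _ Wv.
Qed.

Lemma V0_open z : V0 z -> nbhs z V0.
Proof.
move=> [v [Dv Wv] <-].
apply: filterS (bc_open_map B Dv (sheet_open Wv)) => _ [u [Wu Du] <-].
by exists u.
Qed.

Lemma Phi_cont z : V0 z -> {for z, continuous Phi}.
Proof.
move=> Vz U nU; have [Dz Wz Ez] := PhiP Vz.
have N : nbhs (E (Phi z)) (E @` ((U `&` sheet) `&` D)).
  by apply: (bc_open_map B Dz); apply: filterI => //; exact: sheet_open.
rewrite Ez in N.
suff : nbhs z (Phi @^-1` U) by [].
apply: filterS N => _ [u [[Uu Wu] Du] <-].
by rewrite /= PhiE.
Qed.

Definition up (w : 'rV[R]_4) := narrow w /\ 0 < w 0 0.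

Lemma upD u w : up u -> up w -> up (u + w).
Proof. by move=> [nu u0] [nw w0]; split; [exact: narrowD | rewrite mxE addr_gt0]. Qed.

Lemma upZ (k : R) w : 0 < k -> up w -> up (k *: w).
Proof. by move=> k0 [nw w0]; split; [apply: narrowZ => //; exact: ltW | rewrite mxE mulr_gt0]. Qed.

Definition leg (b e : 'rV[R]_4) := forall u : R, 0 <= u <= 1 -> V0 (b + u *: (e - b)).
(** Kasner time as a function on the part of the box below the sheet. *)
Definition tm (z : 'rV[R]_4) := Phi z 0 0.

Lemma lerp1 (b e : 'rV[R]_4) : b + 1 *: (e - b) = e.
Proof. by rewrite scale1r addrC subrK. Qed.

(** Since [orient] is negative, Kasner time decreases upwards; the lift of a leg is therefore
    timelike with sign -1, and [past_spread] bounds its displacement by the horizon at the starting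
    time. *)
Lemma leg_tl b e : up (e - b) -> leg b e -> orient E (Phi b) < 0 ->
  [/\ timelike_on (-1) (fun u => Phi (b + u *: (e - b))) 0 1,
     forall u : R, 0 <= u <= 1 -> orient E (Phi (b + u *: (e - b))) < 0,
     forall u : R, 0 <= u <= 1 -> tm e <= tm (b + u *: (e - b)) <= tm b,
     tm e < tm b &
     tm b <= 1 -> forall u : R, 0 <= u <= 1 -> `|xs (Phi (b + u *: (e - b))) - xs (Phi b)| <= 6 * tm b `^ (1 / 3)].
Proof.
move=> [nw w0] L ob; pose c u := Phi (b + u *: (e - b)).
have H u : 0 <= u <= 1 -> [/\ {for u, continuous c}, D (c u) & E (c u) = b + u *: (e - b)].
  move=> uin; have [D1 W1 E1] := PhiP (L u uin); split=> //.
  apply: (cont_comp (f := fun u : R => b + u *: (e - b)) (g := Phi)); last exact: Phi_cont (L u uin).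
  apply: cont_add; first exact: cont_cst.
  exact: cvgZr_tmp.
have c0 : c 0 = Phi b by rewrite /c scale0r addr0.
have c1 : c 1 = Phi e by rewrite /c lerp1.
have o0 : 0 < -1 * orient E (c 0) by rewrite mulN1r oppr_gt0 c0.
have [T _] := line_timelike B nw w0 ler01 H o0.
have mono u u' : 0 <= u -> u <= u' -> u' <= 1 -> c u' 0 0 <= c u 0 0.
  by move=> h1 h2 h3; have := time_mono T h1 h2 h3; rewrite mulN1r opprB subr_ge0.
split; first exact: T.
- move=> u uin; have := @orient_path _ _ _ _ _ B (-1) c 0 1 _ _ o0 u uin.
  by rewrite mulN1r oppr_gt0; apply=> s /H[].
- by move=> u /andP[h1 h2]; rewrite /tm -c1 -c0 -/(c u) !mono.
- by have := time_strict ltr01 T; rewrite mulN1r opprB subr_gt0 /tm c0 c1.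
- move=> tb u uin; rewrite -/(c u) /tm -c0.
  apply: past_spread; rewrite ?c0 //; first by case/andP: uin.
  + case: T => T1 T2; case/andP: uin => h1 h2; split=> s /andP[h3 h4].
      by apply: T1; rewrite h3 (le_trans h4).
    by apply: T2; rewrite h3 (lt_le_trans h4).
  + by move=> s /andP[h1 h2]; have [|_ /(bc_pos B)//] := H s; rewrite h1 (le_trans h2) //; case/andP: uin.
Qed.

Lemma slab_V0 z : slab z -> [/\ V0 z, orient E (Phi z) < 0, tm z <= tt & `|xs (Phi z) - xq| <= 1 / 8].
Proof.
move=> /slabP[v [Dv Ev xv tv ov]]; have Wv : sheet v by rewrite /sheet /=; lra.
have pv : Phi z = v by rewrite -Ev PhiE.
by split; rewrite /tm ?pv //; exists v.
Qed.

(** The slab contributes 1/8 and each of the two legs a horizon of 1/32: in total 3/16. *)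
Lemma chainP b m e : slab b -> up (m - b) -> up (e - m) -> leg b m -> leg m e ->
  forall z, (exists2 u : R, 0 <= u <= 1 & z = b + u *: (m - b) \/ z = m + u *: (e - m)) ->
  [/\ tm e <= tm z <= tt, `|xs (Phi z) - xq| <= 3 / 16 & orient E (Phi z) < 0].
Proof.
move=> Sb um ue Lm Le; have [Vb ob tb xb] := slab_V0 Sb.
have [T1 o1 t1 s1 x1] := leg_tl um Lm ob.
have i11 : 0 <= (1 : R) <= 1 by rewrite ler01 lexx.
have om : orient E (Phi m) < 0 by have := o1 1 i11; rewrite lerp1.
have [T2 o2 t2 s2 x2] := leg_tl ue Le om.
have tb1 : tm b <= 1 by exact: le_trans tb tt_le1.
have tmm : tm m <= tt by apply: le_trans tb; exact: ltW.
have tm1 : tm m <= 1 by exact: le_trans tmm tt_le1.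
have pw z : V0 z -> tm z <= tt -> 6 * tm z `^ (1 / 3) <= 1 / 32.
  move=> /PhiP[Dz _ _] tz; apply: le_trans tt_spread; rewrite ler_wpM2l //.
  by apply: ge0_ler_powR => //; rewrite nnegrE ltW // (bc_pos B).
have Vm : V0 m by have := Lm 1 i11; rewrite lerp1.
have pb := pw b Vb tb; have pm := pw m Vm tmm.
have xm : `|xs (Phi m) - xs (Phi b)| <= 1 / 32.
  by have := x1 tb1 1 i11; rewrite lerp1; lra.
move=> z [u uin [->|->]].
- have /andP[h1 h2] := t1 u uin; split; last exact: o1.
    by rewrite (le_trans _ h1) ?(le_trans h2) // ltW.
  have := x1 tb1 u uin; set y := xs (Phi (_ + _)) => h.
  have := ler_normD (y - xs (Phi b)) (xs (Phi b) - xq); rewrite subrKA; lra.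
- have /andP[h1 h2] := t2 u uin; split; last exact: o2.
    by rewrite h1 (le_trans h2).
  have := x2 tm1 u uin; set y := xs (Phi (_ + _)) => h.
  have := ler_normD (y - xs (Phi m)) (xs (Phi m) - xq); rewrite subrKA.
  have := ler_normD (xs (Phi m) - xs (Phi b)) (xs (Phi b) - xq); rewrite subrKA.
  lra.
Qed.

Lemma compact_region (t1 k : R) :
  compact [set v : 'rV[R]_4 | t1 <= v 0 0 <= tt /\ `|xs v - xq| <= k].
Proof.
apply: bounded_closed_compact.
  exists (`|t1| + `|tt| + `|xq| + k); split; first exact: num_real.
  move=> M hM v [/andP[h1 h2] h3]; apply: ltW; apply: le_lt_trans hM.
  rewrite [v]split4; apply: le_trans (ler_normD _ _) _; rewrite normrZ.
  have a1 : `|v 0 0| <= `|t1| + `|tt|.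
    have := ler_norm (- t1); have := ler_norm tt; rewrite normrN => g1 g2.
    have := normr_ge0 t1; have := normr_ge0 tt.
    by rewrite ler_norml => g3 g4; apply/andP; split; lra.
  have a2 : `|v 0 0| * `|e0| <= `|v 0 0| by rewrite ler_piMr // e0_norm.
  have := emb_norm (xs v); have := ler_normD (xs v - xq) xq; rewrite subrK.
  lra.
have cv (v : 'rV[R]_4) : {for v, continuous (fun u : 'rV[R]_4 => u 0 0)} by exact: coord_cont.
have cx (v : 'rV[R]_4) : {for v, continuous (fun u : 'rV[R]_4 => `|xs u - xq|)}.
  apply: (cont_comp (f := fun u : 'rV[R]_4 => xs u - xq) (g := fun x : 'rV[R]_3 => `|x|)).
    apply: cont_sub; [exact: xs_continuous | exact: cont_cst].
  exact: norm_continuous.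
have -> : [set v : 'rV[R]_4 | t1 <= v 0 0 <= tt /\ `|xs v - xq| <= k] =
    ((fun u : 'rV[R]_4 => u 0 0) @^-1` [set x | t1 <= x]) `&`
    ((fun u : 'rV[R]_4 => u 0 0) @^-1` [set x | x <= tt]) `&`
    ((fun u : 'rV[R]_4 => `|xs u - xq|) @^-1` [set x | x <= k]).
  apply/seteqP; split=> v /=; first by move=> [/andP[]].
  by move=> [[-> ->]].
apply: closedI; [apply: closedI|]; apply: closed_comp.
- by move=> v _; exact: cv.
- exact: closed_ge.
- by move=> v _; exact: cv.
- exact: closed_le.
- by move=> v _; exact: cx.
- exact: closed_le.
Qed.

Lemma leg_box (b e : 'rV[R]_4) (u k : R) : `|b| < k -> `|e| < k -> 0 <= u <= 1 -> `|b + u *: (e - b)| < k.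
Proof.
move=> hb he /andP[u0 u1].
have -> : b + u *: (e - b) = (1 - u) *: b + u *: e by vring.
apply: le_lt_trans (ler_normD _ _) _; rewrite !normrZ !ger0_norm ?subr_ge0 //.
have mk : Num.max `|b| `|e| < k by rewrite gt_max hb.
apply: le_lt_trans mk; set M := Num.max _ _.
have h1 : (1 - u) * `|b| <= (1 - u) * M by rewrite ler_wpM2l ?subr_ge0 // le_max lexx.
have h2 : u * `|e| <= u * M by rewrite ler_wpM2l // le_max lexx orbT.
lra.
Qed.

Lemma slab_box b : slab b -> `|b| < r.
Proof.
move=> Sb; have := ler_normD (b + be *: e0) (- (be *: e0)); rewrite addrK normrN normrZ.
have : `|be| * `|e0| <= `|be| by rewrite ler_piMr // e0_norm.
have be0 : 0 < be by apply: lt_le_trans eps_be; rewrite mulr_gt0.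
by move: Sb eps_be be_r; rewrite /slab (gtr0_norm be0); lra.
Qed.

(** The lifts of broken narrow lines that reach a level [t >= t1] stay in a compact region, so
    deforming such a line cannot change its sheet. *)
Lemma deform (b m e v : R -> 'rV[R]_4) (a t1 : R) : 0 <= a -> 0 < t1 ->
  (forall l, 0 <= l <= a -> [/\ {for l, continuous b}, {for l, continuous m} & {for l, continuous e}]) ->
  (forall l, 0 <= l <= a -> [/\ slab (b l), up (m l - b l) & up (e l - m l)]) ->
  (forall l, 0 <= l <= a -> [/\ D (v l), sheet (v l), E (v l) = e l & t1 <= v l 0 0]) ->
  (forall l, 0 <= l <= a -> `|m l| < r) ->
  leg (b 0) (m 0) -> leg (m 0) (e 0) ->
  forall l, 0 <= l <= a -> leg (b l) (m l) /\ leg (m l) (e l).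
Proof.
move=> a0 t10 Hc Hu Hv mr L1 L2; apply: real_induction => // l /andP[l0 l1] Pl.
- have lin : 0 <= l <= a by rewrite ltW.
  have [cb cm ce] := Hc l lin; have [Sb um ue] := Hu l lin.
  have [Dv Wv Ev tv] := Hv l lin.
  (* Closed bounds with the margin 3/16 < 1/4: a limit of such lifts is still inside the open sheet,
     and its time is still positive. *)
  pose K := [set v : 'rV[R]_4 | t1 <= v 0 0 <= tt /\ `|xs v - xq| <= 3 / 16].
  have close (f : R -> 'rV[R]_4) : {for l, continuous f} -> `|f l| < r ->
      (forall l', 0 <= l' < l -> V0 (f l') /\ K (Phi (f l'))) -> V0 (f l).
    move=> cf fr fK.
    have [||w [_ Kw] [Dw Ew]] := bc_closed_image B (@compact_region t1 (3 / 16)) _ fr.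
    + by move=> w [/andP[h _] _]; exact: lt_le_trans h.
    + move=> N nN; have [l' l'in Nl'] := left_approach l0 (cf N nN).
      have [Vl Kl] := fK l' l'in; have [D1 W1 E1] := PhiP Vl.
      by exists (f l'); split=> //; exists (Phi (f l')).
    + by exists w => //; split=> //; rewrite /sheet /=; lra.
  have cf (f g : R -> 'rV[R]_4) u : {for l, continuous f} -> {for l, continuous g} ->
      {for l, continuous (fun l => f l + u *: (g l - f l))}.
    by move=> cf cg; apply: (cont_add cf); exact: cont_scaler (cont_sub cg cf).
  have KK l' z : 0 <= l' < l -> (exists2 u : R, 0 <= u <= 1 & z = b l' + u *: (m l' - b l') \/ z = m l' + u *: (e l' - m l')) ->
      V0 z /\ K (Phi z).
    move=> l'in zu; have [La Lb] := Pl l' l'in.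
    have l'a : 0 <= l' <= a by case/andP: l'in => h1 h2; rewrite h1 (le_trans (ltW h2)).
    have [Sb' um' ue'] := Hu l' l'a; have [Dv' Wv' Ev' tv'] := Hv l' l'a.
    have [tz xz oz] := chainP Sb' um' ue' La Lb zu.
    have te : tm (e l') = v l' 0 0 by rewrite /tm -Ev' PhiE.
    rewrite te in tz; split; last by split=> //; case/andP: tz => h1 h2; rewrite h2 (le_trans tv').
    by case: zu => u uin [->|->]; [exact: La|exact: Lb].
  have er : `|e l| < r by rewrite -Ev; exact: (bc_box B).
  split=> u uin.
  + apply: (close (fun l => b l + u *: (m l - b l))); first exact: cf.
      by apply: leg_box => //; [exact: slab_box | exact: mr].
    by move=> l' l'in; apply: (KK l') => //; exists u => //; left.
  + apply: (close (fun l => m l + u *: (e l - m l))); first exact: cf.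
      by apply: leg_box => //; exact: mr.
    by move=> l' l'in; apply: (KK l') => //; exists u => //; right.
- have lin : 0 <= l <= a by rewrite l0 ltW.
  have [cb cm ce] := Hc l lin; have [La Lb] := Pl l (introT andP (conj l0 (lexx l))).
  have [s sin|d1 d10 H1] := @tube R 0 1 l (fun l u => V0 (b l + u *: (m l - b l))).
    exact: (cont_leg cb cm (u := s) (V0_open (La s sin))).
  have [s sin|d2 d20 H2] := @tube R 0 1 l (fun l u => V0 (m l + u *: (e l - m l))).
    exact: (cont_leg cm ce (u := s) (V0_open (Lb s sin))).
  exists (Num.min d1 d2); first by rewrite lt_min d10.
  move=> u /andP[lu]; rewrite -ltrBlDl lt_min => /andP[ud1 ud2] ua.
  have ul : `|u - l| = u - l by rewrite gtr0_norm ?subr_gt0.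
  by split=> s sin; [apply: H1|apply: H2]; rewrite ?ul.
Qed.

End Past.

Lemma scaled_sqr_le (R : realFieldType) (k x y : R) : 0 <= k -> 0 <= x -> x <= y -> k * x ^+ 2 <= k * y ^+ 2.
Proof. by move=> k0 x0 xy; rewrite ler_wpM2l // ler_sqr ?nnegrE // (le_trans x0). Qed.

(** * Vertical lines below one sheet and the levels of Kasner time *)

Section Level.
Variables (R : realType) (r : R) (D : set 'rV[R]_4) (E : 'rV[R]_4 -> 'rV[R]_4).
Variable q : 'rV[R]_4 -> 'rV[R]_4 -> R.
Hypothesis B : box_chart r D E q.
Local Notation e0 := (e0 R).
Variables (xq : 'rV[R]_3) (be eps tt : R).
Hypothesis eps_gt0 : 0 < eps.
Hypothesis eps_be : 64 * eps <= be.
Hypothesis be_r : 8 * be <= r.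
Hypothesis tt_gt0 : 0 < tt.
Hypothesis tt_le1 : tt <= 1.
Hypothesis tt_spread : 6 * tt `^ (1 / 3) <= 1 / 32.
Hypothesis slabP : forall z, slab be eps z ->
  exists v, [/\ D v, E v = z, `|xs v - xq| <= 1 / 8, v 0 0 <= tt & orient E v < 0].

Local Notation Phi := (sheet_inv D E xq).
Local Notation V0 := (sheet_image D E xq).
Lemma tmE v : D v -> sheet xq v -> tm D E xq (E v) = v 0 0.
Proof. by move=> Dv Wv; rewrite /tm (PhiE B). Qed.

Local Notation tm := (tm D E xq).
Local Notation leg := (leg D E xq).

Lemma be_gt0 : 0 < be.
Proof. by apply: lt_le_trans eps_be; rewrite mulr_gt0. Qed.

Definition pt (tau : R) (x : 'rV[R]_3) : 'rV[R]_4 := tau *: e0 + emb x.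

Lemma pt0 tau x : pt tau x 0 0 = tau.
Proof. by rewrite /pt mxE emb0 addr0 !mxE mulr1. Qed.

Lemma xs_pt tau x : xs (pt tau x) = x.
Proof. by rewrite /pt xsD xsZ xs_e0 scaler0 add0r xs_emb. Qed.

Lemma ptE (z : 'rV[R]_4) : z = pt (z 0 0) (xs z).
Proof. exact: split4. Qed.

Lemma ptD tau x tau' x' : pt tau x + pt tau' x' = pt (tau + tau') (x + x').
Proof. by rewrite /pt emb_add scalerDl addrACA. Qed.

Lemma ptZ (k : R) tau x : k *: pt tau x = pt (k * tau) (k *: x).
Proof. by rewrite /pt emb_scale scalerDr scalerA. Qed.

Lemma pt_sub tau x tau' x' : pt tau x - pt tau' x' = pt (tau - tau') (x - x').
Proof. by rewrite -[- pt _ _]scaleN1r ptZ ptD mulN1r scaleN1r. Qed.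

Lemma pt_lerp tau x tau' x' k : pt tau x + k *: (pt tau' x' - pt tau x) =
  pt (tau + k * (tau' - tau)) (x + k *: (x' - x)).
Proof. by rewrite pt_sub ptZ ptD. Qed.

Lemma pt_box (k : R) tau x : `|tau| + `|x| < k -> `|pt tau x| < k.
Proof.
apply: le_lt_trans; rewrite /pt; apply: le_trans (ler_normD _ _) _; apply: lerD; last exact: emb_norm.
by rewrite normrZ ler_piMr // e0_norm.
Qed.

Lemma up_pt tau x : 0 < tau -> 8 * `|x| <= tau -> up (pt tau x).
Proof.
move=> t0 xt; split; last by rewrite pt0.
have xsj (j : 'I_3) : `|pt tau x 0 (@rshift 1 3 j)| <= pt tau x 0 0 / 8.
  rewrite pt0 -xsE xs_pt; have := coord_le_norm x 0 j; lra.
apply: forall4; [by right| | |]; left.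
- by have := xsj 0; rewrite (_ : @rshift 1 3 0 = 1) //; exact: val_inj.
- by have := xsj 1; rewrite (_ : @rshift 1 3 1 = 2%:R) //; exact: val_inj.
- by have := xsj 2%:R; rewrite (_ : @rshift 1 3 2%:R = 3%:R) //; exact: val_inj.
Qed.

Lemma pt_cont (T : topologicalType) (f : T -> R) (g : T -> 'rV[R]_3) (x : T) :
  {for x, continuous f} -> {for x, continuous g} -> {for x, continuous (fun y => pt (f y) (g y))}.
Proof. by move=> cf cg; apply: cont_add; [exact: cvgZr_tmp | exact: cont_emb]. Qed.

Definition base x := pt (- be) x.

Lemma base_slab x : `|x| <= eps -> slab be eps (base x).
Proof.
move=> xe; rewrite /slab /base /pt scaleNr addrAC addNr add0r.
exact: le_trans (emb_norm x) xe.
Qed.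

Definition column (tau : R) (x : 'rV[R]_3) :=
  [/\ - be < tau, `|x| <= eps & forall u, - be <= u <= tau -> V0 (pt u x)].

Lemma column_leg tau x tau1 tau2 : column tau x -> - be <= tau1 -> tau1 <= tau2 -> tau2 <= tau ->
  leg (pt tau1 x) (pt tau2 x).
Proof.
move=> [bt xe C] h1 h2 h3 u /andP[u0 u1]; rewrite pt_lerp subrr scaler0 addr0; apply: C.
have p1 : 0 <= u * (tau2 - tau1) by rewrite mulr_ge0 // subr_ge0.
have p2 : u * (tau2 - tau1) <= tau2 - tau1 by rewrite ler_piMl // subr_ge0.
apply/andP; split; lra.
Qed.

Lemma leg_column tau x : - be < tau -> `|x| <= eps -> leg (base x) (pt tau x) -> column tau x.
Proof.
move=> bt xe L; split=> // u /andP[h1 h2].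
have t0 : 0 < tau + be by lra.
have := L ((u + be) / (tau + be)); rewrite pt_lerp subrr scaler0 addr0.
rewrite opprK divfK ?gt_eqF // (_ : - be + (u + be) = u); last by ring.
apply.
apply/andP; split; first by rewrite divr_ge0 //; lra.
by rewrite ler_pdivrMr // mul1r lerD2r.
Qed.

Lemma up_column tau tau' x : tau' < tau -> up (pt tau x - pt tau' x).
Proof. by move=> h; rewrite pt_sub subrr; apply: up_pt; rewrite ?normr0 ?mulr0 ?subr_ge0 ?subr_gt0 // ltW. Qed.

Lemma columnP tau x : column tau x ->
  [/\ V0 (pt tau x), tm (pt tau x) <= tt, `|xs (Phi (pt tau x)) - xq| <= 3 / 16 & orient E (Phi (pt tau x)) < 0].
Proof.
move=> C; have [bt xe CV] := C.
(* [chainP] speaks of two legs, so the column is cut at its midpoint. *)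
pose m := (tau - be) / 2.
have h1 : - be < m by rewrite /m; lra.
have h2 : m < tau by rewrite /m; lra.
have L1 := column_leg C (lexx _) (ltW h1) (ltW h2); have L2 := column_leg C (ltW h1) (ltW h2) (lexx _).
have [|/andP[t1 t2] x1 o1] := chainP B tt_gt0 tt_le1 tt_spread slabP (base_slab xe) (up_column x h1) (up_column x h2) L1 L2 (z := pt tau x).
  by exists 1; [rewrite ler01 lexx | right; rewrite lerp1].
by split=> //; apply: CV; rewrite lexx ltW.
Qed.

Lemma column_mono tau tau' x : column tau x -> - be <= tau' -> tau' < tau -> tm (pt tau x) < tm (pt tau' x).
Proof.
move=> C h1 h2; have [bt xe CV] := C.
have ob : orient E (Phi (base x)) < 0 by have [] := slab_V0 B slabP (base_slab xe).
have [->|b1] := eqVneq tau' (- be).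
  by have [] := leg_tl B (up_column x bt) (column_leg C (lexx _) (ltW bt) (lexx _)) ob.
have h1' : - be < tau' by rewrite lt_neqAle eq_sym b1.
have [_ o1 _ _ _] := leg_tl B (up_column x h1') (column_leg C (lexx _) (ltW h1') (ltW h2)) ob.
have o' : orient E (Phi (pt tau' x)) < 0 by have := o1 1; rewrite lerp1 ler01 lexx; apply.
by have [] := leg_tl B (up_column x h2) (column_leg C h1 (ltW h2) (lexx _)) o'.
Qed.

(** The column over [x], cut at [m0], is deformed into the column over [x'] up to the second point
    followed by a narrow segment to the first. The top of the chain is fixed throughout, so its
    Kasner time is the positive lower bound that [deform] asks for. Kasner time then decreases along
    the last leg. *)
Lemma achronal tau x tau' x' : column tau x -> `|tau| <= 2 * be -> - be < tau' -> `|x'| <= eps ->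
  up (pt tau x - pt tau' x') ->
  [/\ column tau' x', leg (pt tau' x') (pt tau x) & tm (pt tau x) < tm (pt tau' x')].
Proof.
move=> C tb bt' xe' ue; have [bt xe CV] := C.
pose m0 := (tau - be) / 2.
have h1 : - be < m0 by rewrite /m0; lra.
have h2 : m0 < tau by rewrite /m0; lra.
have tt' : tau' < tau by have [_] := ue; rewrite pt_sub pt0 subr_gt0.
have [Ve te xe1 oe] := columnP C.
have [De We Ee] := PhiP Ve.
pose xl (l : R) := x + l *: (x' - x); pose ml (l : R) := m0 + l * (tau' - m0).
have xlE l : 0 <= l <= 1 -> `|xl l| <= eps.
  move=> /andP[l0 l1]; have -> : xl l = (1 - l) *: x + l *: x' by rewrite /xl; vring.
  apply: le_trans (ler_normD _ _) _; rewrite !normrZ !ger0_norm ?subr_ge0 //.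
  have g1 : (1 - l) * `|x| <= (1 - l) * eps by rewrite ler_wpM2l ?subr_ge0.
  have g2 : l * `|x'| <= l * eps by rewrite ler_wpM2l.
  lra.
have mlb l : 0 <= l <= 1 -> - be < ml l /\ ml l < tau.
  move=> /andP[l0 l1].
  have E1 : ml l + be = (1 - l) * (m0 + be) + l * (tau' + be) by rewrite /ml; ring.
  have E2 : tau - ml l = (1 - l) * (tau - m0) + l * (tau - tau') by rewrite /ml; ring.
  have [->|ln] := eqVneq l 0; first by rewrite /ml mul0r addr0.
  have lp : 0 < l by rewrite lt_def ln.
  have g1 : 0 <= (1 - l) * (m0 + be) by rewrite mulr_ge0 ?subr_ge0 //; lra.
  have g2 : 0 < l * (tau' + be) by rewrite mulr_gt0 //; lra.
  have g3 : 0 <= (1 - l) * (tau - m0) by rewrite mulr_ge0 ?subr_ge0 //; lra.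
  have g4 : 0 < l * (tau - tau') by rewrite mulr_gt0 //; lra.
  split; lra.
have cxl l : {for l, continuous xl}.
  by apply: cont_add; [exact: cont_cst | exact: cvgZr_tmp].
have cml l : {for l, continuous ml}.
  by apply: cont_add; [exact: cont_cst | apply: cont_mul => //; exact: cont_cst].
have be0 := be_gt0.
have HH : forall l, 0 <= l <= 1 -> leg (base (xl l)) (pt (ml l) (xl l)) /\ leg (pt (ml l) (xl l)) (pt tau x).
  apply: (deform B eps_gt0 eps_be be_r tt_gt0 tt_le1 tt_spread slabP
    (b := fun l => base (xl l)) (m := fun l => pt (ml l) (xl l)) (e := fun=> pt tau x)
    (v := fun=> Phi (pt tau x)) (t1 := tm (pt tau x)) ler01).
  - exact: (bc_pos B).
  - move=> l _; split; [|by apply: pt_cont|exact: cont_cst].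
    by apply: pt_cont => //; exact: cont_cst.
  - move=> l lin; split; first by apply: base_slab; exact: xlE.
      by apply: up_column; have [] := mlb l lin.
    have E1 : pt tau x - pt (ml l) (xl l) = (1 - l) *: pt (tau - m0) 0 + l *: (pt tau x - pt tau' x').
      rewrite !pt_sub !ptZ ptD scaler0 add0r /ml /xl; congr (pt _ _); first by ring.
      by vring.
    rewrite E1; case/andP: lin => l0 l1; have [->|ln] := eqVneq l 0.
      rewrite subr0 scale1r scale0r addr0; apply: up_pt; rewrite ?normr0 ?mulr0 ?subr_gt0 ?subr_ge0 // ltW //.
    have [->|l1n] := eqVneq l 1; first by rewrite subrr scale0r scale1r add0r.
    apply: upD; apply: upZ => //.
    + by rewrite subr_gt0 lt_neqAle l1n.
    + by apply: up_pt; rewrite ?normr0 ?mulr0 ?subr_gt0 ?subr_ge0 // ltW.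
    + by rewrite lt_def ln.
  - by [].
  - move=> l lin; have [h3 h4] := mlb l lin; apply: pt_box.
    have := xlE l lin; have : `|ml l| <= 2 * be.
      by move: tb; rewrite !ler_norml => /andP[g1 g2]; apply/andP; split; lra.
    move: eps_be be_r; lra.
  - rewrite /ml /xl mul0r scale0r !addr0.
    exact: column_leg C (lexx _) (ltW h1) (ltW h2).
  - rewrite /ml /xl mul0r scale0r !addr0.
    exact: column_leg C (ltW h1) (ltW h2) (lexx _).
have [L1 L2] := HH 1 (introT andP (conj ler01 (lexx 1))).
have m1 : ml 1 = tau' by rewrite /ml mul1r addrC subrK.
have x1 : xl 1 = x' by rewrite /xl scale1r addrC subrK.
rewrite m1 x1 in L1 L2.
have C' := leg_column bt' xe' L1.
have [_ _ _ o'] := columnP C'.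
by split=> //; have [] := leg_tl B ue L2 o'.
Qed.

(** Two points whose difference is narrow have different Kasner times by [achronal]; on a common
    level the slope is therefore at most 8. *)
Lemma column_inj tau x tau' x' : column tau x -> column tau' x' -> `|tau| <= 2 * be -> `|tau'| <= 2 * be ->
  tm (pt tau x) = tm (pt tau' x') -> `|tau - tau'| <= 8 * `|x - x'|.
Proof.
move=> C C' tb tb' t; have [bt xe _] := C; have [bt' xe' _] := C'.
have key a y a' y' : column a y -> column a' y' -> `|a| <= 2 * be ->
    tm (pt a y) = tm (pt a' y') -> a - a' <= 8 * `|y - y'|.
  move=> Ca Ca' ab tE; rewrite leNgt; apply/negP => h.
  have [ba' ye' _] := Ca'.
  have [|_ _] := achronal Ca ab ba' ye'; last by rewrite tE ltxx.
  rewrite pt_sub; apply: up_pt; last exact: ltW.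
  by apply: le_lt_trans h; rewrite mulr_ge0.
rewrite ler_norml; apply/andP; split; last exact: key.
by rewrite lerNl opprB distrC; apply: key.
Qed.

Lemma emb_0 : emb 0 = 0 :> 'rV[R]_4.
Proof. by rewrite -(scale0r (0 : 'rV[R]_3)) emb_scale scale0r. Qed.

(** Kasner time decreases along the axis, so one horizon keeps its lift within 1/8 + 1/32 of [xq]
    all the way to box time 0. *)
Lemma gamma_column s : - be < s -> s < 0 -> column s 0.
Proof.
move=> bs s0; have be0 := be_gt0; split=> //; first by rewrite normr0 ltW.
move=> u /andP[bu us].
have [|vb [Db Eb xb tb ob]] := slabP (z := base 0); first by apply: base_slab; rewrite normr0 ltW.
have Eb' : E vb = (- be) *: e0 by rewrite Eb /base /pt emb_0 addr0.
have rb : - r < - be by move: be_r; lra.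
have [c [c0 cH]] := bc_lift B rb (ltW bs) s0 Db Eb'.
have H u' : - be <= u' <= s -> [/\ {for u', continuous c}, D (c u') & E (c u') = 0 + u' *: e0].
  by rewrite add0r; exact: cH.
have e00 : 0 < e0 0 0 by rewrite mxE.
have [|T _] := line_timelike (sg := -1) B (@narrow_e0 R) e00 (ltW bs) H.
  by rewrite c0 mulN1r oppr_gt0.
have [_ Du Eu] := cH u (introT andP (conj bu us)).
exists (c u); last by rewrite Eu /pt emb_0 addr0.
split=> //; rewrite /sheet /=.
have Tu : timelike_on (-1) c (- be) u.
  case: T => T1 T2; split=> v /andP[h1 h2]; first by apply: T1; rewrite h1 (le_trans h2).
  by apply: T2; rewrite h1 (lt_le_trans h2).
have sp : `|xs (c u) - xs (c (- be))| <= 6 * c (- be) 0 0 `^ (1 / 3).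
  apply: past_spread => //; last by rewrite c0 (le_trans tb).
  by move=> v /andP[h1 h2]; have [|_ /(bc_pos B)//] := cH v; rewrite h1 (le_trans h2).
have pw : c (- be) 0 0 `^ (1 / 3) <= tt `^ (1 / 3).
  by rewrite c0; apply: ge0_ler_powR => //; rewrite nnegrE ltW // (bc_pos B Db).
have := ler_normD (xs (c u) - xs (c (- be))) (xs (c (- be)) - xq); rewrite subrKA.
rewrite c0 in sp pw *; move: tt_spread; lra.
Qed.

Lemma tm_cont z : V0 z -> {for z, continuous tm}.
Proof.
move=> Vz; apply: (cont_comp (f := Phi) (g := fun M : 'rV[R]_4 => M 0 0)); last exact: coord_cont.
exact: (Phi_cont B Vz).
Qed.

(** If the level were never reached, the column over [x] could be continued with Kasner time above
    [t1]: this bound keeps the lifts in a compact region, so limits exist, and equality is excluded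
    by assumption. It would arrive above the axis point, where [achronal] makes the time smaller
    than [t1]. *)
Lemma level_exists s x : - be / 2 <= s -> s < 0 -> `|x| <= eps ->
  exists tau, [/\ column tau x, `|tau| <= be & tm (pt tau x) = tm (pt s 0)].
Proof.
move=> bs s0 xe; have be0 := be_gt0.
have Cs : column s 0 by apply: gamma_column => //; lra.
have [Vs _ _ _] := columnP Cs; have [Ds _ _] := PhiP Vs.
set t1 := tm (pt s 0); have t10 : 0 < t1 := bc_pos B Ds.
have xe8 : 8 * `|x| <= be / 8 by move: eps_be; lra.
apply: contrapT => NE.
have neq tau : column tau x -> `|tau| <= be -> tm (pt tau x) <> t1.
  by move=> C tb tE; apply: NE; exists tau.
pose P tau := column tau x /\ t1 < tm (pt tau x).
suff [C tl] : P (be / 2).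
  have [||||_ _] := @achronal (be / 2) x s 0 C.
  - rewrite ger0_norm; lra.
  - lra.
  - by rewrite normr0 ltW.
  - rewrite pt_sub subr0; apply: up_pt; lra.
  - by rewrite ltNge (ltW tl).
(* The column starts narrowly below the axis point and ends narrowly above it: the height
   differences are at least [be / 4], while [8 * |x|] is at most [be / 8]. *)
apply: (@real_induction R (- (3 / 4) * be) (be / 2) P _ _ _ _ (be / 2)); rewrite ?lexx ?andbT; try lra.
- have [||||C _ t] := @achronal s 0 (- (3 / 4) * be) x Cs.
  + by rewrite ltr0_norm //; lra.
  + lra.
  + by [].
  + by rewrite pt_sub sub0r; apply: up_pt; rewrite ?normrN; lra.
  + by [].
- move=> tau /andP[h1 h2] Pl.
  have bt : - be < tau by lra.
  have Vb u : - be <= u < tau -> V0 (pt u x).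
    move=> /andP[g1 g2]; pose u' := Num.max u ((tau - 3 / 4 * be) / 2).
    have u'l : u' < tau by rewrite gt_max g2 /=; lra.
    have [[_ _ C] _] : P u'.
      by apply: Pl; rewrite u'l le_max andbT; apply/orP; right; lra.
    by apply: C; rewrite g1 le_max lexx.
  have tb : `|tau| <= be by rewrite ler_norml; apply/andP; split; lra.
  have box : `|pt tau x| < r by apply: pt_box; move: eps_be be_r; lra.
  pose K := [set v : 'rV[R]_4 | t1 <= v 0 0 <= tt /\ `|xs v - xq| <= 3 / 16].
  have [||w [/andP[tw _] xw] [Dw Ew]] := bc_closed_image B (@compact_region R xq tt t1 (3 / 16)) _ box.
  + by move=> w [/andP[h _] _]; exact: lt_le_trans h.
  + move=> N nN.
    have cp : {for tau, continuous (fun u => pt u x)} by apply: pt_cont; [exact: cvg_id | exact: cont_cst].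
    have [u /andP[u1 u2] Nu] := left_approach h1 (cp N nN).
    have [C tu] := Pl u (introT andP (conj u1 u2)).
    have [Vu tut xu ou] := columnP C; have [D1 W1 E1] := PhiP Vu.
    exists (pt u x); split=> //; exists (Phi (pt u x)) => //; split=> //.
    by split=> //; apply/andP; split=> //; exact: ltW.
  have Ww : sheet xq w by rewrite /sheet /=; lra.
  have Vt : V0 (pt tau x) by exists w.
  have C : column tau x.
    split=> // u /andP[g1 g2]; have [->//|un] := eqVneq u tau.
    by apply: Vb; rewrite g1 lt_neqAle un.
  have tE : tm (pt tau x) = w 0 0 by rewrite -Ew tmE.
  split=> //; rewrite lt_neqAle tE tw andbT; apply/eqP => E1.
  apply: (neq tau C); last by rewrite tE.
  by rewrite ler_norml; apply/andP; split; lra.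
- move=> tau /andP[h1 h2] Pl.
  have [C tl] : P tau by apply: Pl; rewrite h1 lexx.
  have [Vt _ _ _] := columnP C.
  have cp : {for tau, continuous (fun u => pt u x)} by apply: pt_cont; [exact: cvg_id | exact: cont_cst].
  have n1 : \forall u \near tau, V0 (pt u x) by exact: cp (V0_open B Vt).
  have ct : {for tau, continuous (fun u => tm (pt u x))}.
    by apply: (cont_comp (f := fun u => pt u x) (g := tm)) => //; exact: tm_cont.
  have n2 : \forall u \near tau, t1 < tm (pt u x) by exact: ct (lt_nbhsr tl).
  have [e /= e_gt0 He] := (nbhs_ballP tau _).1 (filterI n1 n2).
  exists e => // u /andP[g1 g2] ube.
  have inb u' : tau <= u' < tau + e -> ball tau e u'.
    move=> /andP[k1 k2]; rewrite -ball_normE /= ler0_norm ?subr_le0 //; lra.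
  have [Vu tu] := He u (inb u (introT andP (conj (ltW g1) g2))).
  split=> //; split=> [|//|u' /andP[k1 k2]]; first by case: C => k _ _; exact: lt_trans g1.
  have [u't|tu'] := leP u' tau; first by case: C => _ _; apply; rewrite k1.
  by have [] := He u' (inb u' (introT andP (conj (ltW tu') (le_lt_trans k2 g2)))).
Qed.

(** A vector tangent to a level of Kasner time is spacelike, so neither its image nor the opposite
    vector lies in the narrow cone. *)
Lemma level_slope v (u : 'rV[R]_4) : D v -> u 0 0 = 0 ->
  `|(u *m 'J E v) 0 0| <= 8 * `|xs (u *m 'J E v)|.
Proof.
move=> Dv u0; set w := u *m _; rewrite leNgt; apply/negP => h.
have g0 : 0 <= q (E v) w by rewrite (bc_isom B) // /gform u0 expr0n /= oppr0 add0r hform_ge0.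
have key (w' : 'rV[R]_4) : 0 < w' 0 0 -> 8 * `|xs w'| <= w' 0 0 -> q (E v) w' < 0.
  move=> p0 pn; have [nw _] : up w' by rewrite [w']ptE; exact: up_pt.
  apply: le_lt_trans (bc_N B (bc_box B Dv) nw) _.
  by rewrite nmulr_rlt0 ?exprn_gt0 //; lra.
have [wp|wn|w0] := ltgtP (w 0 0) 0.
- have := key (- w); rewrite (bc_N0 B) xsN normrN mxE oppr_gt0 => /(_ wp).
  by rewrite (ltr0_norm wp) in h; move=> /(_ (ltW h)); rewrite ltNge g0.
- by rewrite (gtr0_norm wn) in h; have := key w wn (ltW h); rewrite ltNge g0.
- by move: h; rewrite w0 normr0 ltNge mulr_ge0.
Qed.

Lemma xs_derive (c : R -> 'rV[R]_4) u : derivable c u 1 ->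
  derivable (fun v => xs (c v)) u 1 /\ derive1 (fun v => xs (c v)) u = xs (derive1 c u).
Proof.
pose P : 'M[R]_(4, 3) := \matrix_(i, j) (i == @rshift 1 3 j)%:R.
have PE (v : 'rV[R]_4) : xs v = v *m P.
  apply/rowP => j; rewrite xsE mxE (bigD1 (@rshift 1 3 j)) //= mxE eqxx mulr1 big1 ?addr0 // => i /negbTE h.
  by rewrite mxE h mulr0.
move=> dc; rewrite PE; have -> : (fun v => xs (c v)) = (fun v => c v *m P) by apply/funext => v.
exact: derive1_mulmx.
Qed.

Section LevelSet.
Variable s : R.
Hypothesis bs : - be / 2 <= s.
Hypothesis s_lt0 : s < 0.
Local Notation t1 := (tm (pt s 0)).

Definition level x := xget 0 [set tau | [/\ column tau x, `|tau| <= be & tm (pt tau x) = t1]].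

Lemma levelP x : `|x| <= eps -> [/\ column (level x) x, `|level x| <= be & tm (pt (level x) x) = t1].
Proof.
move=> xe; have [tau H] := level_exists bs s_lt0 xe.
pose P := [set tau | [/\ column tau x, `|tau| <= be & tm (pt tau x) = t1]].
by have : P (xget 0 P) by apply: xgetPex; exists tau.
Qed.

Lemma level_unique tau x : column tau x -> `|tau| <= 2 * be -> tm (pt tau x) = t1 -> tau = level x.
Proof.
move=> C tb tE; have [_ xe _] := C; have [C' tb' tE'] := levelP xe.
have b0 := be_gt0; have := column_inj C C' tb _ (etrans tE (esym tE')).
rewrite subrr normr0 mulr0 normr_le0 subr_eq0 => H; apply/eqP; apply: H; lra.
Qed.

Lemma level0 : level 0 = s.
Proof.
have b0 := be_gt0; apply/esym/level_unique => //; last first.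
  rewrite ltr0_norm //; move: bs; lra.
by apply: gamma_column => //; move: bs; lra.
Qed.

Lemma level_lip x x' : `|x| <= eps -> `|x'| <= eps -> `|level x - level x'| <= 8 * `|x - x'|.
Proof.
move=> xe xe'; have [C tb tE] := levelP xe; have [C' tb' tE'] := levelP xe'.
have b0 := be_gt0; apply: column_inj => //; [lra|lra|by rewrite tE].
Qed.

Lemma level_cont x : `|x| < eps -> {for x, continuous level}.
Proof.
move=> xe; apply/(@cvgrPdist_le _ _ _ (nbhs x)) => e e_gt0.
have n1 : \forall y \near x, `|x - y| < e / 8.
  by apply/nbhs_ballP; exists (e / 8) => [/=|y]; [rewrite divr_gt0|rewrite -ball_normE].
have n2 : \forall y \near x, `|y| < eps by exact: (norm_continuous (lt_nbhsl xe)).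
near=> y; have ye : `|y| < eps by near: y.
apply: le_trans (level_lip (ltW xe) (ltW ye)) _.
have : `|x - y| < e / 8 by near: y.
lra.
Unshelve. all: by end_near. Qed.

Definition level_map x := Phi (pt (level x) x).

(** The tangent of the lifted curve has no time component, so its spatial length is the [q]-length
    of its image [w]. Slope at most 8 gives [w] a norm of at most 9 eps / 2, rounded up to 5 eps; by
    [bc_U] the squared length is at most 150 eps^2, and 13^2 > 150. The coefficient of [f1]
    contributes the factor t1^(1/3). *)
Lemma level_speed xa u : `|xa| <= eps / 2 -> `|u| <= 1 ->
  derivable (fun v : R => level_map (v *: xa)) u 1 /\
  `|f1 (xs (derive1 (fun v : R => level_map (v *: xa)) u))| <= 13 * eps * t1 `^ (1 / 3).
Proof.
move=> xae u1; pose th (v : R) := level_map (v *: xa).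
have xu (v : R) : `|v| < 2 -> `|v *: xa| < eps.
  move=> v2; rewrite normrZ.
  have : `|v| * `|xa| <= `|v| * (eps / 2) by rewrite ler_wpM2l.
  have : `|v| * (eps / 2) < 2 * (eps / 2) by rewrite ltr_pM2r // divr_gt0.
  lra.
have u2 : `|u| < 2 by lra.
have [Cu tub tuE] := levelP (ltW (xu u u2)).
have [Vu _ _ _] := columnP Cu; have [Du Wu Eu] := PhiP Vu.
have thc : {for u, continuous th}.
  apply: (cont_comp (f := fun v : R => pt (level (v *: xa)) (v *: xa)) (g := Phi)); last exact: (Phi_cont B Vu).
  have c1 : {for u, continuous (fun v : R => v *: xa)} by exact: cvgZr_tmp.
  apply: pt_cont => //.
  apply: (cont_comp (f := fun v : R => v *: xa) (g := level)) => //; exact: level_cont (xu u u2).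
pose M : 'M[R]_4 := 1%:M - spmx R + 'J E (th u) *m spmx R.
(* Kasner time together with the space coordinates of the box. In these coordinates the curve is a
   straight line, and [level_slope] makes the Jacobian injective, so the lift is differentiable. *)
pose Ps (v : 'rV[R]_4) := v - v *m spmx R + E v *m spmx R.
have [dPs JPs] : differentiable Ps (th u) /\ 'J Ps (th u) = M.
  apply: diff_mx_eps => e e_gt0.
  have := diff_jacobian_eps (bc_diff B Du) e_gt0.
  apply: filterS => h H.
  have -> : Ps (h + th u) - Ps (th u) - h *m M =
      (E (h + th u) - E (th u) - h *m 'J E (th u)) *m spmx R.
    have abs (h' t' a b : 'rV[R]_4) (P J : 'M[R]_4) :
        h' + t' - (h' + t') *m P + a *m P - (t' - t' *m P + b *m P) - h' *m (1%:M - P + J *m P) =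
        (a - b - h' *m J) *m P.
      rewrite mulmxDl mulmxDr mulmxBr mulmx1 !mulmxBl mulmxA.
      by move: (h' *m P) (t' *m P) (a *m P) (b *m P) (h' *m J *m P) => x1 x2 x3 x4 x5; vring.
    exact: abs.
  by rewrite -emb_xsE; apply: le_trans (emb_norm _) _; apply: le_trans (xs_norm _) _.
have ME (y : 'rV[R]_4) : y *m M = pt (y 0 0) (xs (y *m 'J E (th u))).
  rewrite /M mulmxDr mulmxBr mulmx1 mulmxA -!emb_xsE /pt; congr (_ + _).
  by rewrite {1}[y]split4 addrK.
have pt_inj a x : pt a x = pt 0 0 -> a = 0 /\ x = 0.
  by move=> H; split; [rewrite -(pt0 a x) H pt0 | rewrite -(xs_pt a x) H xs_pt].
have p00 : pt 0 0 = 0 by rewrite /pt scale0r add0r emb_0.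
have kerM (y : 'rV[R]_4) : y *m M = 0 -> y = 0.
  rewrite ME -p00 => /pt_inj[y0 xy].
  have := level_slope Du y0; rewrite xy normr0 mulr0 normr_le0 => /eqP w0.
  have [L JL] := bc_unit B Du.
  have wE : y *m 'J E (th u) = 0 by rewrite [LHS]ptE xy w0 p00.
  by rewrite -[y]mulmx1 -JL mulmxA wE mul0mx.
have /row_freeP[K MK] : row_free M by exact: inj_row_free.
have nE : \forall v \near u, (Ps \o th) v = t1 *: e0 + v *: emb xa + 0.
  have n2 : \forall v \near u, `|v| < 2 by exact: (norm_continuous (lt_nbhsl u2)).
  apply: filterS n2 => v v2; have [Cv tvb tvE] := levelP (ltW (xu v v2)).
  have [Vv _ _ _] := columnP Cv; have [Dv Wv Ev] := PhiP Vv.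
  rewrite addr0 /= /Ps /th /level_map Ev -!emb_xsE xs_pt emb_scale; congr (_ + _).
  rewrite {1}[Phi _]split4 addrK; congr (_ *: _); exact: tvE.
have d0 : derivable (@id 'rV[R]_4) (t1 *: e0 + u *: emb xa) (emb xa) by exact: derivable_id.
have [dl dE] := derive_line d0.
have [dPt PtE] := derive1_near nE dl.
rewrite dE derive_id in PtE.
have JK : 'J Ps (th u) *m K = 1%:M by rewrite JPs.
have dth : derivable th u 1 := derivable_lift dPs JK thc dPt.
split; first exact: dth.
have [_ CE] := derive1_comp_jacobian dPs dth.
set y := derive1 th u in CE *.
rewrite JPs ME PtE in CE.
have y0 : y 0 0 = 0 by rewrite -(pt0 (y 0 0) (xs (y *m 'J E (th u)))) -CE emb0.
have wx : xs (y *m 'J E (th u)) = xa by rewrite -(xs_pt (y 0 0) (xs (y *m 'J E (th u)))) -CE xs_emb.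
have sl := level_slope Du y0.
set w := y *m 'J E (th u) in wx sl *.
have qw : q (E (th u)) w = gform (th u 0 0) y by rewrite (bc_isom B).
have tu : th u 0 0 = t1 by exact: tuE.
have t10 : 0 < t1 by rewrite -tu; exact: (bc_pos B Du).
rewrite tu /gform y0 expr0n /= oppr0 add0r in qw.
have wn : `|w| <= 5 * eps.
  rewrite [w]split4; apply: le_trans (ler_normD _ _) _; rewrite normrZ wx in sl *.
  have := emb_norm xa; have : `|w 0 0| * `|e0| <= `|w 0 0| by rewrite ler_piMr // e0_norm.
  move: eps_gt0; lra.
have qb : hform t1 (xs y) <= 6 * (5 * eps) ^+ 2.
  rewrite -qw; apply: le_trans (ler_norm _) _; apply: le_trans (bc_U B w (bc_box B Du)) _.
  exact: (scaled_sqr_le (ler0n R 6) (normr_ge0 w) wn).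
set p := t1 `^ (1 / 3); have p0 : 0 < p by exact: powR_gt0.
have pE : t1 `^ (- (2 / 3)) = p ^- 2.
  by rewrite /p -powR_mulrn ?powR_ge0 // -powRrM -powRN; congr (_ `^ _); lra.
have fb : p ^- 2 * f1 (xs y) ^+ 2 <= 6 * (5 * eps) ^+ 2.
  by apply: le_trans qb; rewrite /hform pE lerDl; apply: mulr_ge0; [exact: powR_ge0 | apply: addr_ge0; exact: sqr_ge0].
have fb2 : f1 (xs y) ^+ 2 <= 6 * (5 * eps) ^+ 2 * p ^+ 2.
  have aux (x k P : R) : 0 < P -> P^-1 * x <= k -> x <= k * P.
    by move=> P0; rewrite mulrC ler_pdivrMr.
  by apply: aux fb; exact: exprn_gt0.
apply: sqr_le; [exact: normr_ge0 | exact: (mulr_ge0 (mulr_ge0 (ler0n R 13) (ltW eps_gt0)) (ltW p0)) |].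
rewrite real_normK ?num_real //; apply: le_trans fb2 _.
have : 0 <= (eps * p) ^+ 2 by exact: sqr_ge0.
have -> : (13 * eps * p) ^+ 2 = 169 * (eps * p) ^+ 2 by ring.
have -> : 6 * (5 * eps) ^+ 2 * p ^+ 2 = 150 * (eps * p) ^+ 2 by ring.
lra.
Qed.

Lemma level_displacement xa : `|xa| <= eps / 2 ->
  `|f1 (xs (level_map xa)) - f1 (xs (Phi (pt s 0)))| <= 13 * eps * t1 `^ (1 / 3).
Proof.
move=> xae; pose f (v : R) := f1 (xs (level_map (v *: xa))).
have -> : f1 (xs (level_map xa)) = f 1 by rewrite /f scale1r.
have -> : f1 (xs (Phi (pt s 0))) = f 0 by rewrite /f scale0r /level_map level0.
rewrite -[leRHS]mulr1 -[X in _ <= _ * X](_ : `|1 - 0| = 1); last by rewrite subr0 normr1.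
apply: mean_value_norm => u; rewrite min_l ?max_r // => /andP[u0 u1].
have [|dth b] := level_speed xae (u := u); first by rewrite ger0_norm.
have [dx xE] := xs_derive dth.
by have [df fE] := f1_diff dx; split=> //; rewrite fE xE.
Qed.

End LevelSet.

End Level.

(** * Translations in space and exits to the side *)

Section Ramp.
Variables (R : realType) (r : R) (D : set 'rV[R]_4) (E : 'rV[R]_4 -> 'rV[R]_4).
Variable q : 'rV[R]_4 -> 'rV[R]_4 -> R.
Hypothesis B : box_chart r D E q.
Local Notation e0 := (e0 R).

(** Translations in space are isometries of the Kasner metric. *)
Lemma timelike_translate (sg al be : R) (c : R -> 'rV[R]_4) (Y : 'rV[R]_3) :
  timelike_on sg c al be -> timelike_on sg (fun s => c s + emb Y) al be.
Proof.
move=> [cc tl]; split=> s sin; first by apply: cont_add; [exact: cc | exact: cont_cst].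
have [dc g pos] := tl s sin.
have nE : \forall u \near s, c u + emb Y = c u + emb Y by near=> u.
have [d ->] := derive1_near nE dc; split=> //.
by rewrite [X in gform X _](_ : _ = c s 0 0) // mxE emb0 addr0.
Unshelve. all: by end_near. Qed.

(** The translation is performed on the stretch [al, m], where there is room to tilt. *)
Lemma ramp_homotopy (sg : R) (c : R -> 'rV[R]_4) (al m be d h k : R) (Y : 'rV[R]_3) :
  al < m -> m < be -> timelike_on sg c al m -> timelike_on sg c m be ->
  (forall s, al <= s <= be -> D (c s)) -> 0 < sg * orient E (c al) ->
  (forall (y : 'rV[R]_3) (s : R), `|y| <= d -> al < s < m -> gform (c s 0 0) (derive1 c s + emb y) < 0) ->
  `|Y| <= d * (m - al) ->
  (forall l : R, 0 <= l <= 1 -> D (c be + l *: emb Y) -> E (c be + l *: emb Y) 0 0 <= h) ->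
  `|E (c al)| + 2 * (h - E (c al) 0 0) <= k -> k < r ->
  [/\ D (c m + emb Y),
      forall i, `|E (c be + emb Y) 0 i - E (c m + emb Y) 0 i| <= 2 * (E (c be + emb Y) 0 0 - E (c m + emb Y) 0 0) &
      forall i, `|E (c be + emb Y) 0 i - E (c al) 0 i| <= 2 * (E (c be + emb Y) 0 0 - E (c al) 0 0)].
Proof.
move=> alm mbe T1 T2 cD o0 tilt Yd endh hk kr.
have albe : al < be := lt_trans alm mbe.
have m0 : 0 < m - al by rewrite subr_gt0.
pose rho s := if s <= m then (m - al)^-1 * (s - al) else 1.
have rc s : {for s, continuous rho}.
  apply: cont_glue; first by rewrite mulVf // gt_eqF.
    by apply: cont_mul; [exact: cont_cst | apply: cont_sub => //; exact: cont_cst].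
  exact: cont_cst.
pose H l s := c s + l *: (rho s *: emb Y).
have rm : rho m = 1 by rewrite /rho lexx mulVf // gt_eqF.
have rb : rho be = 1 by rewrite /rho leNgt mbe.
have ra : rho al = 0 by rewrite /rho (ltW alm) subrr mulr0.
have alin : al <= m <= be by rewrite !ltW.
have cc s : al <= s <= be -> {for s, continuous c}.
  move=> /andP[h1 h2]; have [sm|/ltW ms] := leP s m; first by apply: T1.1; rewrite h1.
  by apply: T2.1; rewrite ms.
have HT l : 0 <= l <= 1 -> timelike_on sg (H l) al m /\ timelike_on sg (H l) m be.
  move=> /andP[l0 l1].
  have cH s : al <= s <= be -> {for s, continuous (H l)}.
    by move=> sin; apply: (cont_add (cc s sin)); apply: cont_scaler; have crs := rc s; exact: cvgZr_tmp.
  split.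
    apply: (timelike_near (c := fun s => c s + (l * (s - al)) *: emb ((m - al)^-1 *: Y))).
    - apply: timelike_shift => // s sin; apply: tilt => //.
      rewrite !normrZ ger0_norm // gtr0_norm ?invr_gt0 //.
      have h1 : (m - al)^-1 * `|Y| <= d by rewrite mulrC ler_pdivrMr.
      apply: le_trans h1; rewrite ler_piMl // mulr_ge0 // invr_ge0 ltW //.
    - by move=> s /andP[h1 h2]; apply: cH; rewrite h1 (le_trans h2) // ltW.
    - move=> s /andP[h1 h2]; rewrite /H /rho (ltW h2) emb_scale !scalerA; congr (_ + _ *: _).
      by rewrite mulrAC mulrA.
  apply: (timelike_near (c := fun s => c s + emb (l *: Y))).
  - exact: timelike_translate.
  - by move=> s /andP[h1 h2]; apply: cH; rewrite h2 (le_trans (ltW alm)).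
  - by move=> s /andP[h1 h2]; rewrite /H /rho leNgt h1 /= scale1r emb_scale.
have H00 l s : H l s 0 0 = c s 0 0.
  by rewrite /H mxE -!emb_scale emb0 addr0.
have Hal l : H l al = c al by rewrite /H ra scale0r scaler0 addr0.
have Hbe l : H l be = c be + l *: emb Y by rewrite /H rb scale1r.
have H0 s : H 0 s = c s by rewrite /H scale0r addr0.
have HD l s : 0 <= l <= 1 -> al <= s <= be -> D (H l s).
  apply: (homotopy_in_box (m := m) (k := k) (sg := sg) B alin kr).
  - move=> {}l {}s _ sin; apply: cont_add; first by apply: cont_pair_snd; exact: cc.
    have := @cont_pair_scale R _ (fun s => rho s *: emb Y) l s; apply.
    have crs := rc s; exact: cvgZr_tmp.
  - by move=> {}l {}s _ sin; rewrite H00; exact: (bc_pos B (cD s sin)).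
  - exact: HT.
  - by move=> {}l _; rewrite !Hal.
  - by rewrite Hal.
  - move=> {}l lin; rewrite Hal Hbe => Dl; apply: le_trans hk.
    by rewrite lerD2l ler_wpM2l // lerD2r endh.
  - by move=> {}s sin; rewrite H0; exact: cD.
have l11 : 0 <= (1 : R) <= 1 by rewrite ler01 lexx.
have [HT1 HT2] := HT 1 l11.
have oH : 0 < sg * orient E (H 1 al) by rewrite Hal.
have [_ M] := timelike_mono2 B alin HT1 HT2 (fun s => @HD 1 s l11) oH.
have H1m : H 1 m = c m + emb Y by rewrite /H rm !scale1r.
have H1b : H 1 be = c be + emb Y by rewrite Hbe scale1r.
split.
- by rewrite -H1m; exact: HD.
- by move=> i; rewrite -H1m -H1b; apply: M => //; exact: ltW.
- by move=> i; rewrite -(Hal 1) -H1b; apply: M => //; exact: ltW.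
Qed.

End Ramp.

Section Exit.
Variables (R : realType) (r : R) (D : set 'rV[R]_4) (E : 'rV[R]_4 -> 'rV[R]_4).
Variable q : 'rV[R]_4 -> 'rV[R]_4 -> R.
Hypothesis B : box_chart r D E q.
Local Notation e0 := (e0 R).
Variables (xq : 'rV[R]_3) (be eps tt : R).
Hypothesis eps_gt0 : 0 < eps.
Hypothesis eps_be : 64 * eps <= be.
Hypothesis be_r : 8 * be <= r.
Hypothesis tt_gt0 : 0 < tt.
Hypothesis tt_le1 : tt <= 1.
Hypothesis tt_spread : 6 * tt `^ (1 / 3) <= 1 / 32.
Hypothesis slabP : forall z, slab be eps z ->
  exists v, [/\ D v, E v = z, `|xs v - xq| <= 1 / 8, v 0 0 <= tt & orient E v < 0].

Local Notation Phi := (sheet_inv D E xq).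
Local Notation V0 := (sheet_image D E xq).
Local Notation tm := (tm D E xq).
Local Notation leg := (leg D E xq).
Local Notation column := (column D E xq be eps).
Local Notation base := (base be).
Local Notation columnP := (columnP B tt_gt0 tt_le1 tt_spread slabP).
Local Notation achronal := (achronal B eps_gt0 eps_be be_r tt_gt0 tt_le1 tt_spread slabP).
Local Notation gamma_column := (gamma_column B eps_gt0 eps_be be_r tt_gt0 tt_le1 tt_spread slabP).
Local Notation level_unique := (level_unique B eps_gt0 eps_be be_r tt_gt0 tt_le1 tt_spread slabP).
Local Notation level_lip := (level_lip B eps_gt0 eps_be be_r tt_gt0 tt_le1 tt_spread slabP).
Local Notation level_displacement := (level_displacement B eps_gt0 eps_be be_r tt_gt0 tt_le1 tt_spread slabP).
Local Notation level0 := (level0 B eps_gt0 eps_be be_r tt_gt0 tt_le1 tt_spread slabP).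
Local Notation deform := (deform B eps_gt0 eps_be be_r tt_gt0 tt_le1 tt_spread slabP).

(** A direction whose [h_t]-length blows up as [t -> 0]. *)
Definition ex : 'rV[R]_3 := row3 1 0 0.

Lemma ex_norm : `|ex| <= 1.
Proof.
by apply: norm_le_coord => // i; apply: forall3; rewrite mxE /= ?normr1 ?normr0.
Qed.

Lemma f1_ex : 0 < f1 ex.
Proof. by rewrite /f1 !mxE /= mulr0 addr0 mulr1 invr_gt0 c_golden_gt0. Qed.

Lemma compact_cylinder (k h : R) : compact [set z : 'rV[R]_4 | `|xs z| <= k /\ `|z 0 0| <= h].
Proof.
apply: bounded_closed_compact.
  exists (k + h); split; first exact: num_real.
  move=> M hM z [h1 h2]; apply: ltW; apply: le_lt_trans hM.
  rewrite [z]split4; apply: le_trans (ler_normD _ _) _; rewrite normrZ.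
  have : `|z 0 0| * `|e0| <= `|z 0 0| by rewrite ler_piMr // e0_norm.
  have := emb_norm (xs z); lra.
have -> : [set z : 'rV[R]_4 | `|xs z| <= k /\ `|z 0 0| <= h] =
    ((fun z : 'rV[R]_4 => `|xs z|) @^-1` [set x | x <= k]) `&`
    ((fun z : 'rV[R]_4 => `|z 0 0|) @^-1` [set x | x <= h]).
  by apply/seteqP; split.
apply: closedI; apply: closed_comp; try exact: closed_le.
- move=> z _; apply: (cont_comp (f := fun z : 'rV[R]_4 => xs z) (g := fun x : 'rV[R]_3 => `|x|)).
    exact: xs_continuous.
  exact: norm_continuous.
- move=> z _; apply: (cont_comp (f := fun z : 'rV[R]_4 => z 0 0) (g := fun x : R => `|x|)).
    exact: coord_cont.
  exact: norm_continuous.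
Qed.

(** The orbit of the axis point at box time [s] under the isometric translations in the direction
    [ex]. *)
Definition shifted (s l : R) := Phi (pt s 0) + l *: emb ex.

Definition near_axis (v : 'rV[R]_4) := [/\ D v, `|xs (E v)| <= eps / 2 & `|E v 0 0| <= be / 2].

Lemma shifted00 s l : shifted s l 0 0 = tm (pt s 0).
Proof. by rewrite /shifted -emb_scale mxE emb0 addr0. Qed.

Lemma shifted_cont s l : {for l, continuous (shifted s)}.
Proof. by apply: cont_add; [exact: cont_cst | exact: cvgZr_tmp]. Qed.

Section AtLevel.
Variable s : R.
Hypothesis bs : - be / 2 <= s.
Hypothesis s_lt0 : s < 0.

Lemma bs' : - be < s.
Proof. by have b0 := be_gt0 eps_gt0 eps_be; move: bs; lra. Qed.

Lemma shifted_sheet l : 0 <= l <= 1 / 32 -> sheet xq (shifted s l).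
Proof.
move=> /andP[l0 l1]; have [_ _ x _] := columnP (gamma_column bs' s_lt0).
rewrite /sheet /= /shifted xsD -emb_scale xs_emb addrAC.
apply: le_lt_trans (ler_normD _ _) _; rewrite normrZ ger0_norm //.
have : l * `|ex| <= l by rewrite ler_piMr // ex_norm.
lra.
Qed.

(** Translations keep Kasner time, so [deform] applies with a moving end point and a fixed level:
    the image of the orbit stays on the graph of [level]. The Lipschitz constant 8 of this graph
    gives [4 * eps], and [level_displacement] bounds the translation itself. *)
Lemma near_axis_column a : 0 <= a -> a <= 1 / 32 ->
  (forall l, 0 <= l <= a -> near_axis (shifted s l)) ->
  [/\ column (E (shifted s a) 0 0) (xs (E (shifted s a))),
      `|E (shifted s a) 0 0 - s| <= 4 * eps &
      f1 ex * a <= 13 * eps * tm (pt s 0) `^ (1 / 3)].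
Proof.
move=> a0 a1 H; have b0 := be_gt0 eps_gt0 eps_be.
have Cs := gamma_column bs' s_lt0; have [Vs _ _ _] := columnP Cs; have [Ds Ws Es] := PhiP Vs.
have ain : 0 <= a <= a by rewrite a0 lexx.
pose z l := E (shifted s l).
have zpt l : z l = pt (z l 0 0) (xs (z l)) by exact: ptE.
have z0 : z 0 = pt s 0 by rewrite /z /shifted scale0r addr0.
have lsheet l : 0 <= l <= a -> sheet xq (shifted s l).
  by move=> /andP[l0 l1]; apply: shifted_sheet; rewrite l0 (le_trans l1).
have cz l : 0 <= l <= a -> {for l, continuous z}.
  move=> lin; have [Dl _ _] := H l lin.
  exact: (@cont_comp _ _ _ (shifted s) E l (@shifted_cont s l) (E_continuous B Dl)).
have cz0 l : 0 <= l <= a -> {for l, continuous (fun l => z l 0 0)}.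
  move=> lin; apply: (cont_comp (f := z) (g := fun M : 'rV[R]_4 => M 0 0)); first exact: cz.
  exact: coord_cont.
have czx l : 0 <= l <= a -> {for l, continuous (fun l => xs (z l))}.
  by move=> lin; exact: cont_xs (cz l lin).
pose m l := (z l 0 0 - be) / 2.
have zb l : 0 <= l <= a -> - be < m l /\ m l < z l 0 0.
  move=> lin; have [_ _] := H l lin; rewrite -/(z l) ler_norml => /andP[h1 h2].
  rewrite /m; split; lra.
have xe l : 0 <= l <= a -> `|xs (z l)| <= eps.
  by move=> lin; have [_ h _] := H l lin; apply: (le_trans h); move: eps_gt0; lra.
have HH : forall l, 0 <= l <= a -> leg (base (xs (z l))) (pt (m l) (xs (z l))) /\ leg (pt (m l) (xs (z l))) (z l).
  apply: (deform (b := fun l => base (xs (z l))) (m := fun l => pt (m l) (xs (z l))) (e := z)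
    (v := shifted s) (t1 := tm (pt s 0)) a0).
  - exact: (bc_pos B Ds).
  - move=> l lin; split; last exact: cz.
      by apply: pt_cont; [exact: cont_cst | exact: czx].
    apply: pt_cont; last exact: czx.
    by apply: cont_mul; [apply: cont_sub; [exact: cz0 | exact: cont_cst] | exact: cont_cst].
  - move=> l lin; have [h1 h2] := zb l lin; split.
    + by apply: base_slab; exact: xe.
    + exact: up_column.
    + by rewrite {1}zpt; exact: up_column.
  - move=> l lin; have [Dl _ _] := H l lin; split=> //; first exact: lsheet.
    by rewrite shifted00.
  - move=> l lin; have [h1 h2] := zb l lin; have [_ _] := H l lin; rewrite -/(z l) => h3.
    apply: pt_box; have := xe l lin; have : `|m l| <= be.
      by move: h3; rewrite !ler_norml => /andP[h4 h5]; apply/andP; split; lra.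
    move: eps_be be_r; lra.
  - have h1 : - be < m 0 by rewrite /m z0 pt0; move: bs'; lra.
    have h2 : m 0 <= s by rewrite /m z0 pt0; move: bs'; lra.
    by rewrite z0 xs_pt; exact: column_leg Cs (lexx _) (ltW h1) h2.
  - have h1 : - be < m 0 by rewrite /m z0 pt0; move: bs'; lra.
    have h2 : m 0 <= s by rewrite /m z0 pt0; move: bs'; lra.
    by rewrite z0 xs_pt; exact: column_leg Cs (ltW h1) h2 (lexx _).
have [Da xa ta] := H a ain.
have [h1 h2] := zb a ain.
have [L1 L2] := HH a ain.
have L3 : leg (pt (m a) (xs (z a))) (pt (z a 0 0) (xs (z a))) by rewrite -zpt.
have C1 := leg_column h1 (xe a ain) L1.
have C : column (z a 0 0) (xs (z a)).
  split; [exact: lt_trans h2|exact: xe|move=> u /andP[u1 u2]].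
  have [um|mu] := leP u (m a); first by case: C1 => _ _; apply; rewrite u1.
  have d0 : 0 < z a 0 0 - m a by rewrite subr_gt0.
  have := L3 ((u - m a) / (z a 0 0 - m a)); rewrite pt_lerp subrr scaler0 addr0.
  rewrite divfK ?gt_eqF // (_ : m a + (u - m a) = u); last by rewrite addrC subrK.
  apply; apply/andP; split; first by apply: divr_ge0; [rewrite subr_ge0 ltW | exact: ltW].
  by rewrite ler_pdivrMr // mul1r lerD2r.
have tE : tm (pt (z a 0 0) (xs (z a))) = tm (pt s 0).
  by rewrite -zpt /z (tmE B Da (lsheet a ain)) shifted00.
have tb2 : `|z a 0 0| <= 2 * be by move: ta; rewrite -/(z a); lra.
have lE := level_unique bs s_lt0 C tb2 tE.
split=> //.
  have := level_lip bs s_lt0 (xe a ain) (_ : `|0| <= eps).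
  rewrite -lE (level0 bs s_lt0) subr0 normr0 => /(_ (ltW eps_gt0)) h; apply: (le_trans h).
  by move: xa; rewrite -/(z a); lra.
have := level_displacement bs s_lt0 xa.
rewrite -/(z a) /level_map -lE -zpt /z (PhiE B Da (lsheet a ain)).
rewrite /shifted xsD -emb_scale xs_emb -f1B addrAC subrr add0r f1Z.
have p : 0 <= a * f1 ex by exact: mulr_ge0 a0 (ltW f1_ex).
by rewrite (ger0_norm p) [f1 ex * a]mulrC.
Qed.

(** An orbit staying near the axis up to [A] would contradict the displacement bound of
    [near_axis_column]. It cannot leave through the top or the bottom, because its box time stays
    within [5 * eps], which is less than [be / 2]. *)
Lemma exit (A : R) : 0 < A -> A <= 1 / 32 -> - eps <= s ->
  13 * eps * tm (pt s 0) `^ (1 / 3) < f1 ex * A ->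
  exists a, [/\ 0 <= a <= A, forall l, 0 <= l <= a -> near_axis (shifted s l) &
    `|xs (E (shifted s a))| = eps / 2].
Proof.
move=> A0 A1 es tA; have b0 := be_gt0 eps_gt0 eps_be.
have Cs := gamma_column bs' s_lt0; have [Vs _ _ _] := columnP Cs; have [Ds Ws Es] := PhiP Vs.
apply: contrapT => NE.
suff H : forall l, 0 <= l <= A -> near_axis (shifted s l).
  by have [_ _] := near_axis_column (ltW A0) A1 H; rewrite leNgt tA.
apply: real_induction; first exact: ltW.
- have e2 : shifted s 0 = Phi (pt s 0) by rewrite /shifted scale0r addr0.
  rewrite /near_axis e2 Es xs_pt pt0 normr0; split=> //; first by rewrite divr_ge0 // ltW.
  by rewrite ltr0_norm //; move: bs; lra.
- move=> l /andP[l0 lA] Pl.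
  have [|||Dl [xl tl]] := bc_closed B (@compact_cylinder (eps / 2) (be / 2)) _ (v := shifted s l).
  + move=> z [xz tz]; rewrite [z]ptE; apply: pt_box; move: eps_gt0 eps_be be_r; lra.
  + by rewrite shifted00; exact: (bc_pos B Ds).
  + move=> N nN; have [l' l'in Nl'] := left_approach l0 (@shifted_cont s l N nN).
    by exists (shifted s l'); split=> //; have [] := Pl l' l'in.
  + by [].
- move=> l /andP[l0 lA] Pl.
  have [Dl xl tl] := Pl l (introT andP (conj l0 (lexx l))).
  have l1 : l <= 1 / 32 by apply: le_trans A1; exact: ltW.
  have [_ tl' _] := near_axis_column l0 l1 Pl.
  have xlt : `|xs (E (shifted s l))| < eps / 2.
    rewrite lt_neqAle xl andbT; apply/eqP => xE; apply: NE; exists l; split=> //.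
    by rewrite l0 ltW.
  have tlt : `|E (shifted s l) 0 0| < be / 2.
    have := ler_normD (E (shifted s l) 0 0 - s) s; rewrite subrK.
    have : `|s| <= eps by rewrite ltr0_norm // lerNl.
    by move: eps_gt0 eps_be; lra.
  have cE : {for l, continuous (fun l => E (shifted s l))}.
    exact: (@cont_comp _ _ _ (shifted s) E l (@shifted_cont s l) (E_continuous B Dl)).
  have n1 : \forall u \near l, D (shifted s u).
    by have := @shifted_cont s l D (open_nbhs_nbhs (conj (bc_open B) Dl)).
  have n2 : \forall u \near l, `|xs (E (shifted s u))| < eps / 2.
    have c : {for l, continuous (fun l => `|xs (E (shifted s l))|)}.
      apply: (cont_comp (f := fun l => xs (E (shifted s l))) (g := fun x : 'rV[R]_3 => `|x|)).
        exact: cont_xs cE.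
      exact: norm_continuous.
    by have := c _ (lt_nbhsl xlt).
  have n3 : \forall u \near l, `|E (shifted s u) 0 0| < be / 2.
    have c : {for l, continuous (fun l => `|E (shifted s l) 0 0|)}.
      apply: (cont_comp (f := fun l => E (shifted s l) 0 0) (g := fun x : R => `|x|)); last exact: norm_continuous.
      apply: (cont_comp (f := fun l => E (shifted s l)) (g := fun M : 'rV[R]_4 => M 0 0)) => //.
      exact: coord_cont.
    by have := c _ (lt_nbhsl tlt).
  have [e /= e_gt0 He] := (nbhs_ballP l _).1 (filterI n1 (filterI n2 n3)).
  exists e => // u /andP[u1 u2] uA.
  have [|Du [xu tu]] := He u; last by split=> //; exact: ltW.
  rewrite -ball_normE /= ltr0_norm ?subr_lt0 //; lra.
Qed.

End AtLevel.

End Exit.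

Lemma cont_glue_cond (R : realType) (T : topologicalType) (f g : R -> T) (m s : R) : f m = g m ->
  (s <= m -> {for s, continuous f}) -> (m <= s -> {for s, continuous g}) ->
  {for s, continuous (fun u => if u <= m then f u else g u)}.
Proof.
move=> fg cf cg; have [sm|ms|sm] := ltgtP s m.
- apply: (cont_near (g := f)) (cf (ltW sm)); near=> u; rewrite ifT //; apply: ltW; near: u.
  exact: lt_nbhsl.
- apply: (cont_near (g := g)) (cg (ltW ms)); near=> u; rewrite ifF //; apply/negbTE; rewrite -ltNge; near: u.
  exact: lt_nbhsr.
- by apply: cont_glue => //; [apply: cf | apply: cg]; rewrite sm.
Unshelve. all: by end_near. Qed.

(** * Exit points and their cluster point *)

Section PastContra.
Variables (R : realType) (r : R) (D : set 'rV[R]_4) (E : 'rV[R]_4 -> 'rV[R]_4).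
Variable q : 'rV[R]_4 -> 'rV[R]_4 -> R.
Hypothesis B : box_chart r D E q.
Local Notation e0 := (e0 R).
Variables (xq : 'rV[R]_3) (be eps tt : R).
Hypothesis eps_gt0 : 0 < eps.
Hypothesis eps_be : 64 * eps <= be.
Hypothesis be_r : 8 * be <= r.
Hypothesis tt_gt0 : 0 < tt.
Hypothesis tt_le1 : tt <= 1.
Hypothesis tt_spread : 6 * tt `^ (1 / 3) <= 1 / 32.
Hypothesis slabP : forall z, slab be eps z ->
  exists v, [/\ D v, E v = z, `|xs v - xq| <= 1 / 8, v 0 0 <= tt & orient E v < 0].

Local Notation Phi := (sheet_inv D E xq).
Local Notation V0 := (sheet_image D E xq).
Local Notation tm := (tm D E xq).
Local Notation leg := (leg D E xq).
Local Notation column := (column D E xq be eps).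
Local Notation base := (base be).
Local Notation columnP := (columnP B tt_gt0 tt_le1 tt_spread slabP).
Local Notation achronal := (achronal B eps_gt0 eps_be be_r tt_gt0 tt_le1 tt_spread slabP).
Local Notation gamma_column := (gamma_column B eps_gt0 eps_be be_r tt_gt0 tt_le1 tt_spread slabP).
Local Notation level_unique := (level_unique B eps_gt0 eps_be be_r tt_gt0 tt_le1 tt_spread slabP).
Local Notation level_lip := (level_lip B eps_gt0 eps_be be_r tt_gt0 tt_le1 tt_spread slabP).
Local Notation level_displacement := (level_displacement B eps_gt0 eps_be be_r tt_gt0 tt_le1 tt_spread slabP).
Local Notation level0 := (level0 B eps_gt0 eps_be be_r tt_gt0 tt_le1 tt_spread slabP).
Local Notation deform := (deform B eps_gt0 eps_be be_r tt_gt0 tt_le1 tt_spread slabP).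

Local Notation shifted := (shifted D E xq).
Local Notation near_axis := (near_axis D E be eps).
Local Notation near_axis_column := (near_axis_column B eps_gt0 eps_be be_r tt_gt0 tt_le1 tt_spread slabP).
Local Notation exit := (exit B eps_gt0 eps_be be_r tt_gt0 tt_le1 tt_spread slabP).

Tactic Notation "lra_of" ne_hyp_list(hs) :=
  clear - hs R r D E q B xq be eps tt eps_gt0 eps_be be_r tt_gt0 tt_le1 tt_spread slabP; lra.

Lemma be_pos : 0 < be. Proof. exact: be_gt0 eps_gt0 eps_be. Qed.

Lemma axis_lift u : - be < u -> u < 0 ->
  [/\ {for u, continuous (fun u => Phi (pt u 0))}, D (Phi (pt u 0)) & E (Phi (pt u 0)) = 0 + u *: e0].
Proof.
move=> h1 h2; have [Vu _ _ _] := columnP (gamma_column h1 h2); have [Du _ Eu] := PhiP Vu; split; [|exact: Du|].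
  apply: (cont_comp (f := fun u => pt u 0) (g := Phi)); last exact: (Phi_cont B Vu).
  by apply: pt_cont; [exact: cvg_id | exact: cont_cst].
by rewrite Eu add0r /pt emb_0 addr0.
Qed.

Lemma shiftedE s a : shifted s a = Phi (pt s 0) + emb (a *: ex R).
Proof. by rewrite emb_scale. Qed.

Lemma shifted0 s : shifted s 0 = Phi (pt s 0).
Proof. by rewrite shiftedE scale0r emb_0 addr0. Qed.

Local Notation S1 := (- (eps / 200)).

(** The reference point at box time [S1] is fixed, and for small [a] its translate is still within
    [eps / 200] of the axis. The translated axis leads from there to the exit point and is timelike,
    so moving sideways by nearly [eps / 2] at slope at most 2 costs nearly [eps / 4] of box time. *)
Lemma height : exists2 d : R, 0 < d & forall s a, S1 < s -> s < 0 -> 0 <= a <= d ->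
  (forall l, 0 <= l <= a -> near_axis (shifted s l)) -> `|xs (E (shifted s a))| = eps / 2 ->
  eps / 8 <= E (shifted s a) 0 0.
Proof.
have b0 := be_pos; pose c u := Phi (pt u 0); pose al := - (be / 2).
have S10 : S1 < 0 by rewrite oppr_lt0; apply: divr_gt0; [exact: eps_gt0 | rewrite ltr0n].
have alS : al < S1 by rewrite /al; move: eps_gt0 eps_be; lra.
have bal : - be < al by rewrite /al; lra.
have H u : al <= u < 0 -> [/\ {for u, continuous c}, D (c u) & E (c u) = 0 + u *: e0].
  by move=> /andP[h1 h2]; apply: axis_lift => //; exact: lt_le_trans h1.
have H1 u : al <= u <= S1 -> [/\ {for u, continuous c}, D (c u) & E (c u) = 0 + u *: e0].
  by move=> /andP[h1 h2]; apply: H; rewrite h1 (le_lt_trans h2).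
have e00 : 0 < e0 0 0 by rewrite mxE.
have oal : 0 < -1 * orient E (c al).
  by have [_ _ _ o] := columnP (gamma_column bal (lt_trans alS S10)); rewrite mulN1r oppr_gt0.
have [d1 /andP[d10 _] tilt] := tilt_room B (ltW alS) (@narrow_e0 R) e00 H1 oal.
have [_ DS1 ES1] := H1 S1 (introT andP (conj (ltW alS) (lexx _))).
have cE : {for 0, continuous (fun l => E (shifted S1 l))}.
  have D0 : D (shifted S1 0) by rewrite shifted0.
  exact: (@cont_comp _ _ _ (shifted S1) E 0 (@shifted_cont _ _ _ _ S1 0) (E_continuous B D0)).
have z0 : E (shifted S1 0) = pt S1 0.
  by rewrite shifted0 ES1 add0r /pt emb_0 addr0.
have e200 : 0 < eps / 200 by apply: divr_gt0; [exact: eps_gt0 | rewrite ltr0n].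
have /cvgrPdist_le/(_ _ e200) := cE; rewrite z0 => /nbhs_ballP[e /= e_gt0 He].
exists (Num.min (d1 * (S1 - al)) (e / 2)).
  by rewrite lt_min divr_gt0 // andbT mulr_gt0 // subr_gt0.
move=> s a S1s s0 /andP[a0]; rewrite le_min => /andP[ad1 ae2] na xa.
have als : al < s := lt_trans alS S1s.
have Hs u : al <= u <= s -> [/\ {for u, continuous c}, D (c u) & E (c u) = 0 + u *: e0].
  by move=> /andP[h1 h2]; apply: H; rewrite h1 (le_lt_trans h2).
have [T1 _] := line_timelike B (@narrow_e0 R) e00 (ltW alS) H1 oal.
have oS1 : 0 < -1 * orient E (c S1).
  have bS1 : - be < S1 := lt_trans bal alS.
  by have [_ _ _ o] := columnP (gamma_column bS1 S10); rewrite mulN1r oppr_gt0.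
have H2 u : S1 <= u <= s -> [/\ {for u, continuous c}, D (c u) & E (c u) = 0 + u *: e0].
  by move=> /andP[h1 h2]; apply: H; rewrite (le_trans (ltW alS) h1) (le_lt_trans h2).
have [T2 _] := line_timelike B (@narrow_e0 R) e00 (ltW S1s) H2 oS1.
have Yn : `|a *: ex R| <= a.
  by rewrite normrZ ger0_norm // ler_piMr // ex_norm.
have [|||||D1 M _] := ramp_homotopy (h := be / 2) (k := 3 * be) (Y := a *: ex R) B alS S1s T1 T2 _ oal tilt.
- by move=> u /Hs[].
- exact: le_trans Yn ad1.
- move=> l /andP[l0 l1]; rewrite -emb_scale scalerA -shiftedE => _.
  have [|_ _] := na (l * a); last by rewrite ler_norml => /andP[].
  by rewrite mulr_ge0 //= ler_piMl.
- have [_ _ ->] := H1 al (introT andP (conj (lexx _) (ltW alS))).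
  rewrite add0r normrZ !mxE /= mulr1 /al normrN ger0_norm; last by rewrite divr_ge0 // ltW.
  have : be / 2 * `|e0| <= be / 2 by rewrite ler_piMr ?e0_norm // divr_ge0 // ltW.
  lra_of b0.
- by move: be_r; lra_of b0.
rewrite -!shiftedE in M.
have close : `|pt S1 0 - E (shifted S1 a)| <= eps / 200.
  by apply: He; rewrite -ball_normE /= sub0r normrN ger0_norm //; lra_of ae2 e_gt0.
set z := E (shifted s a) in xa M *; set z1 := E (shifted S1 a) in M close *.
have c0 : `|S1 - z1 0 0| <= eps / 200.
  apply: le_trans close; have := coord_le_norm (pt S1 0 - z1) 0 0.
  by rewrite [X in `|X| <= _ -> _]mxE pt0 [X in _ + X]mxE.
have cx : `|xs z1| <= eps / 200.
  by apply: le_trans close; apply: le_trans (xs_norm _); rewrite xsB xs_pt sub0r normrN.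
have : `|xs z| <= 2 * (z 0 0 - z1 0 0) + eps / 200.
  have p0 : 0 <= 2 * (z 0 0 - z1 0 0) by apply: le_trans (M 0).
  apply: norm_le_coord => [|i j]; first exact: (addr_ge0 p0 (ltW e200)).
  rewrite ord1; have := M (@rshift 1 3 j); rewrite -!xsE.
  have := coord_le_norm (xs z1) 0 j; have := ler_normD (xs z 0 j - xs z1 0 j) (xs z1 0 j).
  by rewrite subrK; lra_of cx.
by rewrite xa; move: c0; rewrite ler_norml => /andP[h1 h2]; lra_of h1 h2.
Qed.

Hypothesis vanish : forall T, 0 < T -> exists2 s0 : R, s0 < 0 & forall s, s0 < s -> s < 0 -> tm (pt s 0) < T.

Tactic Notation "lra_of" ne_hyp_list(hs) :=
  clear - hs vanish R r D E q B xq be eps tt eps_gt0 eps_be be_r tt_gt0 tt_le1 tt_spread slabP; lra.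

(** Near the end of the axis the Kasner time is so small that the hypothesis of [exit] already holds
    with [A] at most [d] and [1 / 32]. *)
Lemma pick_exit (d de : R) : 0 < d -> 0 < de -> exists s a, [/\ S1 < s, - de < s, s < 0, 0 <= a <= d /\ a <= 1 / 32 &
  (forall l, 0 <= l <= a -> near_axis (shifted s l)) /\ `|xs (E (shifted s a))| = eps / 2].
Proof.
move=> d0 de0; have b0 := be_pos; have F0 := f1_ex R.
pose A := Num.min d (1 / 32).
have A0 : 0 < A by rewrite lt_min d0 divr_gt0.
have e13 : 0 < 13 * eps by rewrite mulr_gt0.
pose b := f1 (ex R) * A / (13 * eps).
have bp : 0 < b by rewrite divr_gt0 // mulr_gt0.
have [s0 s00 Hs] := vanish (exprn_gt0 3 bp).
have S10 : S1 < 0 by rewrite oppr_lt0; apply: divr_gt0; [exact: eps_gt0 | rewrite ltr0n].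
pose M := Num.max s0 (Num.max S1 (- de)).
have M0 : M < 0 by rewrite !gt_max s00 S10 oppr_lt0.
pose s := M / 2.
have sM : M < s by rewrite /s; lra.
have s_0 : s < 0 by rewrite /s; lra.
have h1 : s0 < s by apply: le_lt_trans sM; rewrite le_max lexx.
have h2 : S1 < s by apply: le_lt_trans sM; rewrite !le_max lexx orbT.
have h3 : - de < s by apply: le_lt_trans sM; rewrite !le_max lexx !orbT.
have bs : - be / 2 <= s by move: h2 eps_gt0 eps_be; lra.
have bs1 : - be < s by lra.
have [Vs _ _ _] := columnP (gamma_column bs1 s_0); have [Ds _ _] := PhiP Vs.
have t0 : 0 < tm (pt s 0) := bc_pos B Ds.
have [|||a [/andP[a0 aA] na xa]] := exit bs s_0 A0.
- by rewrite /A ge_min lexx orbT.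
- by move: h2 eps_gt0; lra.
- have pb : tm (pt s 0) `^ (1 / 3) < b.
    rewrite ltNge; apply/negP => bt; have := Hs s h1 s_0; apply/negP; rewrite -leNgt.
    have pE : (tm (pt s 0) `^ (1 / 3)) ^+ 3 = tm (pt s 0).
      rewrite -powR_mulrn ?powR_ge0 // -powRrM (_ : 1 / 3 * 3%:R = 1) ?powRr1 ?ltW //; lra.
    by rewrite -pE ler_pXn2r // nnegrE ?powR_ge0 ?(ltW bp).
  by rewrite mulrC -ltr_pdivlMr.
exists s, a; split=> //; rewrite a0 (le_trans aA) /A ?ge_min ?lexx //; split=> //.
by apply: (le_trans aA); rewrite ge_min lexx orbT.
Qed.

(** Exit points have box time at least [eps / 8], although their translations tend to 0. A timelike
    curve starting at positive box time and ending at an exit point is tilted by the opposite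
    translation; this brings its end back to the axis at negative box time. *)
Lemma past_contra : False.
Proof.
have b0 := be_pos; have [d d0 hgt] := height.
have /choice[f Hf] : forall n : nat, exists p : R * R,
    [/\ S1 < p.1, p.1 < 0, 0 <= p.2 <= d /\ p.2 <= 1 / 32, p.2 <= n.+1%:R^-1 &
     (forall l, 0 <= l <= p.2 -> near_axis (shifted p.1 l)) /\ `|xs (E (shifted p.1 p.2))| = eps / 2].
  move=> n; have dn : 0 < Num.min d n.+1%:R^-1 by rewrite lt_min d0 invr_gt0 ltr0n.
  have [s [a [h1 _ h2 [/andP[h3 h4] h5] h6]]] := pick_exit dn d0.
  move: h4; rewrite le_min => /andP[h4 h7].
  by exists (s, a); split=> //; rewrite h3 h4.
pose w n := E (shifted (f n).1 (f n).2).
have wZ n : `|xs (w n)| <= eps / 2 /\ `|w n 0 0| <= be / 2.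
  have [_ _ [/andP[a0 _] _] _ [na _]] := Hf n.
  by have [] := na (f n).2; rewrite ?a0 ?lexx.
have [wi [[xwi twi] clw]] := @compact_cylinder R (eps / 2) (be / 2) (w @ \oo) _ (filterE _ wZ).
have near_w (e de : R) : 0 < e -> 0 < de -> exists n, (f n).2 <= de /\ `|w n - wi| < e.
  move=> e_gt0 de_gt0.
  have F1 : (w @ \oo) (w @` [set n | n.+1%:R^-1 < de]).
    have := near_infty_natSinv_lt (PosNum de_gt0).
    by apply: filterS => n h; exists n.
  have N1 : nbhs wi [set z : 'rV[R]_4 | `|z - wi| < e].
    apply/nbhs_rV; exists e => // z; by rewrite /= ?(distrC z).
  have [_ [[n h <-] h2]] := clw _ _ F1 N1.
  exists n; split=> //; apply: ltW; apply: le_lt_trans h.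
  by have [] := Hf n.
(* Since exit points are at height at least [eps / 8], descending by [2 * g] from the cluster point
   leaves box time positive. The radius [g / 16] makes the difference from nearby exit points
   narrow. *)
pose g := eps / 100; have g0 : 0 < g by rewrite divr_gt0.
have g16 : 0 < g / 16 by rewrite divr_gt0.
have Cw n : column (w n 0 0) (xs (w n)) /\ eps / 8 <= w n 0 0.
  have [h1 h2 [/andP[h3 h4] h5] _ [na xa]] := Hf n.
  have bs : - be / 2 <= (f n).1 by move: h1 eps_gt0 eps_be; lra.
  have [C _ _] := near_axis_column bs h2 h3 h5 na.
  by split=> //; apply: hgt; rewrite ?h3.
pose ti := wi 0 0; pose xi := xs wi.
have xie : `|xi| <= eps by apply: (le_trans xwi); move: eps_gt0; lra.
have diff n : `|w n - wi| < g / 16 -> `|w n 0 0 - ti| < g / 16 /\ `|xs (w n) - xi| < g / 16.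
  move=> h; split.
    by apply: le_lt_trans h; have := coord_le_norm (w n - wi) 0 0; rewrite [X in `|X| <= _ -> _]mxE [X in _ + X]mxE.
  by apply: le_lt_trans h; rewrite -xsB; exact: xs_norm.
pose tp := ti - 2 * g.
have pw n t : `|w n - wi| < g / 16 -> tp <= t <= ti - g ->
    [/\ column t xi, leg (pt t xi) (w n) & 0 < tp].
  move=> wn /andP[h1 h2]; have [c1 c2] := diff n wn; have [C hw] := Cw n.
  move: c1; rewrite ltr_norml => /andP[c3 c4].
  have tp0 : 0 < tp by rewrite /tp; move: eps_gt0; rewrite /g in c3 c4 *; lra.
  have wb : `|w n 0 0| <= 2 * be by have [_] := wZ n; lra.
  have tb : - be < t by rewrite /tp in tp0 h1; lra.
  have ue : up (pt (w n 0 0) (xs (w n)) - pt t xi).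
    rewrite pt_sub; apply: up_pt; first by lra.
    by apply: le_trans (_ : 8 * (g / 16) <= _); [rewrite ler_wpM2l // ltW | lra].
  by have [h3 h4 _] := achronal C wb tb xie ue; rewrite -ptE in h4.
have [n1 [_ w1]] := near_w _ _ g16 d0.
have tpt : tp <= ti - g by rewrite /tp; lra.
have [Cp _ tp0] := pw n1 (ti - g) w1 (introT andP (conj tpt (lexx _))).
have ge0 : up (g *: e0) by apply: upZ => //; split; [exact: narrow_e0 | rewrite mxE].
pose c1 (u : R) := Phi (pt tp xi + u *: (g *: e0)).
have ptu u : pt tp xi + u *: (g *: e0) = pt (tp + u * g) xi.
  by rewrite /pt scalerA addrAC -scalerDl.
have tpb : - be <= tp by lra.
have H1 u : 0 <= u <= 1 -> [/\ {for u, continuous c1}, D (c1 u) & E (c1 u) = pt tp xi + u *: (g *: e0)].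
  move=> /andP[u0 u1]; have [_ _ CV] := Cp.
  have Vu : V0 (pt tp xi + u *: (g *: e0)).
    rewrite ptu; apply: CV; have p1 : 0 <= u * g by rewrite mulr_ge0 // ltW.
    have p2 : u * g <= g by rewrite ler_piMl // ltW.
    by apply/andP; split; rewrite /tp in tpb *; lra.
  have [Du _ Eu] := PhiP Vu; split; [|exact: Du|exact: Eu].
  apply: (cont_comp (f := fun u : R => pt tp xi + u *: (g *: e0)) (g := Phi)); last exact: (Phi_cont B Vu).
  by apply: cont_add; [exact: cont_cst | exact: cvgZr_tmp].
have [Ctp _ _] := pw n1 tp w1 (introT andP (conj (lexx _) tpt)).
have [_ _ _ otp] := columnP Ctp.
have c10 : c1 0 = Phi (pt tp xi) by rewrite /c1 scale0r addr0.
have o1 : 0 < -1 * orient E (c1 0) by rewrite c10 mulN1r oppr_gt0.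
(* The first stretch lies below the cluster point and does not involve the exit point, so its room
   [d3] is known before [n] is chosen with a translation of at most [d3]. *)
have [d3 /andP[d30 _] tilt] := tilt_room B ler01 ge0.1 ge0.2 H1 o1.
have [n [ad3 wn]] := near_w _ _ g16 d30.
have [_ s0 [/andP[a0 _] a32] _ [na _]] := Hf n.
set s := (f n).1 in s0 na *; set a := (f n).2 in a0 a32 ad3 na *.
have [Cn Ln _] := pw n (ti - g) wn (introT andP (conj tpt (lexx _))).
set p := pt (ti - g) xi in Ln.
have upw : up (w n - p).
  have [C hw] := Cw n; have [k1 k2] := diff n wn; move: k1; rewrite ltr_norml => /andP[k3 k4].
  rewrite [w n]ptE pt_sub; apply: up_pt; first by lra_of k3 k4 g0.
  by apply: le_trans (_ : 8 * (g / 16) <= _); [rewrite ler_wpM2l // ltW | lra_of k3 k4 g0].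
(* Parametrised so that [u = 1] gives [p] and [u = 2] gives [w n], in the affine form that
   [line_timelike] expects. *)
pose c2 (u : R) := Phi (p - (w n - p) + u *: (w n - p)).
have pu (u : R) : p - (w n - p) + u *: (w n - p) = p + (u - 1) *: (w n - p).
  by rewrite scalerBl scale1r addrAC addrA.
have H2 (u : R) : 1 <= u <= 2 -> [/\ {for u, continuous c2}, D (c2 u) & E (c2 u) = p - (w n - p) + u *: (w n - p)].
  move=> /andP[u1 u2].
  have Vu : V0 (p - (w n - p) + u *: (w n - p)) by rewrite pu; apply: Ln; apply/andP; split; lra_of u1 u2.
  have [Du _ Eu] := PhiP Vu; split; [|exact: Du|exact: Eu].
  apply: (cont_comp (f := fun u : R => p - (w n - p) + u *: (w n - p)) (g := Phi)); last exact: (Phi_cont B Vu).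
  by apply: cont_add; [exact: cont_cst | exact: cvgZr_tmp].
pose c (u : R) := if u <= 1 then c1 u else c2 u.
have c12 : c1 1 = c2 1.
  rewrite /c1 /c2 ptu pu subrr scale0r addr0 mul1r; congr (Phi (pt _ _)); rewrite /tp; ring.
have cc u : 0 <= u <= 2 -> {for u, continuous c}.
  move=> /andP[u0 u2]; apply: cont_glue_cond; [exact: c12 | move=> h | move=> h].
    by case: (H1 u (introT andP (conj u0 h))).
  by case: (H2 u (introT andP (conj h u2))).
have H1' (u : R) : 0 <= u <= 1 -> [/\ {for u, continuous c}, D (c u) & E (c u) = pt tp xi + u *: (g *: e0)].
  move=> /andP[u0 u1]; have [_ Du Eu] := H1 u (introT andP (conj u0 u1)).
  rewrite /c u1; split; [|exact: Du|exact: Eu]; apply: cc; rewrite u0 /=; lra_of u1.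
have H2' (u : R) : 1 <= u <= 2 -> [/\ {for u, continuous c}, D (c u) & E (c u) = p - (w n - p) + u *: (w n - p)].
  move=> /andP[u1 u2]; have [_ Du Eu] := H2 u (introT andP (conj u1 u2)).
  have cu : c u = c2 u.
    rewrite /c; case: ifP => // h; have -> : u = 1 by apply/eqP; rewrite eq_le h u1.
    exact: c12.
  rewrite cu; split; [|exact: Du|exact: Eu]; apply: cc; rewrite u2 andbT; lra_of u1.
have o1' : 0 < -1 * orient E (c 0) by rewrite /c ler01.
have ltr12 : (1 : R) < 2 by rewrite ltr1n.
have [T1 _] := line_timelike B ge0.1 ge0.2 ler01 H1' o1'.
have o2 : 0 < -1 * orient E (c 1).
  by rewrite /c lexx c12 /c2 pu subrr scale0r addr0 mulN1r oppr_gt0; have [] := columnP Cn.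
have [T2 _] := line_timelike B upw.1 upw.2 (ltW ltr12) H2' o2.
have tilt' (y : 'rV[R]_3) (u : R) : `|y| <= d3 -> 0 < u < 1 -> gform (c u 0 0) (derive1 c u + emb y) < 0.
  move=> yd /andP[u0 u1]; have uin : 0 < u < 1 by rewrite u0.
  have nE : \forall v \near u, c v = c1 v + 0.
    by near=> v; rewrite addr0 /c ifT //; apply: ltW; near: v; exact: lt_nbhsl.
  have [dc1 _] := line_lift B uin H1.
  have [_ ->] := derive1_near nE dc1.
  by rewrite {1}/c (ltW u1); exact: tilt.
have Dw : D (shifted s a) by have [] := na a; rewrite ?a0 ?lexx.
have Sw : sheet xq (shifted s a).
  have [h1 h2 _ _ _] := Hf n; have bs : - be / 2 <= s by move: h1 eps_gt0 eps_be; rewrite -/s; lra_of b0.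
  by apply: (shifted_sheet B eps_gt0 eps_be be_r tt_gt0 tt_le1 tt_spread slabP bs s0); rewrite a0.
have cw : c 2 = shifted s a.
  have -> : c 2 = c2 2 by rewrite /c ifF //; apply/negbTE; rewrite -ltNge.
  rewrite /c2 pu (_ : 2 - 1 = 1) ?lerp1 ?(PhiE B) //; lra_of g0.
(* During the tilt the end point runs back along its own orbit, which stays near the axis; this
   bounds its box time. *)
have cE l : c 2 + l *: emb ((- a) *: ex R) = shifted s (a - l * a).
  rewrite cw !shiftedE -addrA -emb_scale -emb_add; congr (_ + emb _).
  by rewrite scalerA -scalerDl mulrN.
have [|||||_ _ M] := ramp_homotopy (h := be / 2) (k := 4 * be) (Y := (- a) *: ex R) B ltr01 ltr12 T1 T2 _ o1' tilt'.
- move=> u /andP[u0 u2]; have [u1|/ltW u1] := leP u 1.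
    by have [] := H1' u (introT andP (conj u0 u1)).
  by have [] := H2' u (introT andP (conj u1 u2)).
- rewrite subr0 mulr1 normrZ normrN ger0_norm //; apply: le_trans ad3.
  by rewrite ler_piMr // ex_norm.
- move=> l /andP[l0 l1]; rewrite cE => _.
  have la : l * a <= a by rewrite ler_piMl.
  have la0 : 0 <= l * a by rewrite mulr_ge0.
  have [|_ _] := na (a - l * a); last by rewrite ler_norml => /andP[].
  by apply/andP; split; lra_of la la0 a0.
- have [_ _ ->] := H1' 0 (introT andP (conj (lexx _) ler01)).
  rewrite scale0r addr0 pt0.
  have : `|pt tp xi| <= be / 2 + eps.
    rewrite /pt; apply: le_trans (ler_normD _ _) _; rewrite normrZ gtr0_norm //.
    have : tp * `|e0| <= tp by rewrite ler_piMr ?e0_norm // ltW.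
    have := emb_norm xi; move: twi; rewrite -/ti ler_norml => /andP[_ k2]; rewrite /tp; lra_of k2 g0 xie.
  by move: eps_gt0 eps_be; lra_of tp0 b0.
- by move: be_r; lra_of b0.
(* Box time cannot decrease along the tilted curve, but it goes from [tp > 0] to [s < 0]. *)
have := M 0; rewrite -[emb _]scale1r cE mul1r subrr shifted0.
have [_ _ ->] := H1' 0 (introT andP (conj (lexx _) ler01)).
have bs1 : - be < s by have [h1 h2 _ _ _] := Hf n; move: h1 eps_gt0 eps_be; rewrite -/s; lra_of b0.
have [Vs _ _ _] := columnP (gamma_column bs1 s0); have [_ _ ->] := PhiP Vs.
rewrite scale0r addr0 !pt0 => h; have := le_trans (normr_ge0 _) h; lra_of tp0 s0.
Unshelve. all: by end_near. Qed.

End PastContra.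

(** * The alternative for Kasner time along the segment *)

Section Dichotomy.
Variables (R : realType) (r : R) (D : set 'rV[R]_4) (E : 'rV[R]_4 -> 'rV[R]_4).
Variable q : 'rV[R]_4 -> 'rV[R]_4 -> R.
Hypothesis B : box_chart r D E q.
Local Notation e0 := (e0 R).

Lemma time_along (sg s0 s s' : R) (v0 v v' : 'rV[R]_4) : - r < s0 -> s0 <= s -> s <= s' -> s' < 0 ->
  D v0 -> E v0 = s0 *: e0 -> 0 < sg * orient E v0 -> D v -> E v = s *: e0 -> D v' -> E v' = s' *: e0 ->
  0 <= sg * (v' 0 0 - v 0 0).
Proof.
move=> rs0 s0s ss' s'0 D0 E0 o0 Dv Ev Dv' Ev'.
have s0s' := le_trans s0s ss'.
have [c [c0 cH]] := bc_lift B rs0 s0s' s'0 D0 E0.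
have H u : s0 <= u <= s' -> [/\ {for u, continuous c}, D (c u) & E (c u) = 0 + u *: e0].
  by rewrite add0r; exact: cH.
have e00 : 0 < e0 0 0 by rewrite mxE.
have [|T _] := line_timelike (sg := sg) B (@narrow_e0 R) e00 s0s' H; first by rewrite c0.
have := time_mono T s0s ss' (lexx _).
have [_ D1 E1] := cH s (introT andP (conj s0s ss')).
have [_ D2 E2] := cH s' (introT andP (conj s0s' (lexx _))).
by rewrite (bc_time B D1 Dv) ?E1 // (bc_time B D2 Dv') ?E2.
Qed.

Lemma orient_along (sg s0 s : R) (v0 : 'rV[R]_4) : - r < s0 -> s0 <= s -> s < 0 ->
  D v0 -> E v0 = s0 *: e0 -> 0 < sg * orient E v0 ->
  exists v, [/\ D v, E v = s *: e0 & 0 < sg * orient E v].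
Proof.
move=> rs0 s0s s'0 D0 E0 o0.
have [c [c0 cH]] := bc_lift B rs0 s0s s'0 D0 E0.
have sin : s0 <= s <= s by rewrite s0s lexx.
have [_ Dc Ec] := cH s sin; exists (c s); split; [exact: Dc | exact: Ec |].
by apply: (orient_path B _ _ _ sin); rewrite ?c0 // => u /cH[].
Qed.

(** By [bc_red] the lifts can be taken in a bounded part of space, so they lie in a compact set of
    positive times; [bc_closed_image] then makes the origin an image point, against [bc_exit]. *)
Lemma confined (al bt s1 : R) : 0 < al -> - r <= s1 -> s1 < 0 ->
  (forall s v, s1 < s -> s < 0 -> D v -> E v = s *: e0 -> al <= v 0 0 <= bt) -> False.
Proof.
move=> al0 rs1 s10 H.
have r0 : `|0 : 'rV[R]_4| < r by rewrite normr0 (bc_r B).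
have [||v _ [Dv Ev]] := bc_closed_image B (@compact_region R 0 bt al 1) _ r0.
- by move=> v [/andP[h _] _]; exact: lt_le_trans h.
- move=> N nN.
  have c : {for 0, continuous (fun s : R => s *: e0)} by exact: cvgZr_tmp.
  have nN' : nbhs ((fun s : R => s *: e0) 0) N by rewrite scale0r.
  have h0 : s1 / 2 < 0 by lra.
  have [s /andP[h1 h2] Ns] := left_approach h0 (c N nN').
  exists (s *: e0); split=> //.
  have sin : - r < s < 0 by apply/andP; split=> //; lra.
  have [v Dv Ev] := bc_start B sin; have [v' [Dv' Ev' tv' xv']] := bc_red B Dv.
  exists v'; last by rewrite Ev'.
  split=> //; split; last by rewrite subr0.
  by apply: (H s) => //; [lra | rewrite Ev'].
- by apply: (bc_exit B Dv).
Qed.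

(** Where Kasner time has fallen below [tt], openness of [E] provides lifts of a whole ball around
    the axis point that are close to one another; this ball is the slab. *)
Lemma past_case s0 v0 : - r < s0 -> s0 < - r / 8 -> D v0 -> E v0 = s0 *: e0 -> orient E v0 < 0 ->
  (forall T, 0 < T -> exists s v, [/\ - r / 8 < s, s < 0, D v, E v = s *: e0 & v 0 0 < T]) -> False.
Proof.
move=> rs0 s0r D0 E0 o0 HT; have r0 := bc_r B.
(* 6 / 192 = 1 / 32, the horizon allowed in [past_contra]. *)
pose k : R := 1 / 192; have k0 : 0 < k by rewrite /k; lra.
pose tt := k ^+ 3; have tt0 : 0 < tt by rewrite exprn_gt0.
have k1 : k <= 1 by rewrite /k; lra.
have tt1 : tt <= 1 by rewrite exprn_ile1 // ltW.
have ttk : tt `^ (1 / 3) = k.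
  rewrite /tt -powR_mulrn ?ltW // -powRrM (_ : 3%:R * (1 / 3) = 1) ?powRr1 ?ltW //; lra.
have tts : 6 * tt `^ (1 / 3) <= 1 / 32 by rewrite ttk /k; lra.
have o0' : 0 < -1 * orient E v0 by rewrite mulN1r oppr_gt0.
have [s2 [v2 [s2r s20 D2 E2 t2]]] := HT tt tt0.
have s02 : s0 <= s2 by lra.
have [vb [Db Eb ob]] := orient_along rs0 s02 s20 D0 E0 o0'.
have tb : vb 0 0 < tt by rewrite (bc_time B Db D2) // E2.
pose be := - s2; have be0 : 0 < be by rewrite oppr_gt0.
pose U := [set v : 'rV[R]_4 | [/\ `|xs v - xs vb| < 1 / 8, v 0 0 < tt & orient E v < 0]].
have nU : nbhs vb U.
  have n1 : \forall v \near (vb : 'rV[R]_4), `|xs v - xs vb| < 1 / 8.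
    have c : {for vb, continuous (fun u : 'rV[R]_4 => `|xs u - xs vb|)}.
      apply: (cont_comp (f := fun u : 'rV[R]_4 => xs u - xs vb) (g := fun x : 'rV[R]_3 => `|x|)).
        apply: cont_sub; [exact: xs_continuous | exact: cont_cst].
      exact: norm_continuous.
    have h : `|xs vb - xs vb| < 1 / 8 :> R by rewrite subrr normr0; apply: divr_gt0; [exact: ltr01 | rewrite ltr0n].
    by have := c _ (lt_nbhsl h).
  have n2 : nbhs vb [set v : 'rV[R]_4 | v 0 0 < tt] by have := @coord_cont R 1 4 0 0 vb _ (lt_nbhsl tb).
  have n3 : \forall v \near (vb : 'rV[R]_4), orient E v < 0.
    have c : {for vb, continuous (orient E)}.
      apply: (cont_comp (f := fun v => 'D_e0 E v) (g := fun M : 'rV[R]_4 => M 0 0)); last exact: coord_cont.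
      exact: (bc_cont B Db).
    have h : orient E vb < 0 by rewrite -oppr_gt0 -mulN1r.
    by have := c _ (lt_nbhsl h).
  by apply: filterS3 n1 n2 n3 => v.
have /nbhs_rV[e1 e10 He] := bc_open_map B Db nU.
pose eps := Num.min (e1 / 2) (be / 64).
have eps0 : 0 < eps by rewrite lt_min !divr_gt0.
have eps_be : 64 * eps <= be.
  have h : eps <= be / 64 by rewrite ge_min lexx orbT.
  by rewrite mulrC -ler_pdivlMr; [exact: h | rewrite ltr0n].
have eps_e1 : eps < e1.
  have h : eps <= e1 / 2 by rewrite ge_min lexx.
  apply: le_lt_trans h _; rewrite ltr_pdivrMr; [|by rewrite ltr0n].
  by rewrite (ltr_pMr _ e10) ltr1n.
have slabP z : slab be eps z ->
    exists v, [/\ D v, E v = z, `|xs v - xs vb| <= 1 / 8, v 0 0 <= tt & orient E v < 0].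
  rewrite /slab => h; have [|v [[xv tv ov] Dv] Ev] := He z.
    rewrite Eb; apply: le_lt_trans eps_e1; move: h; rewrite /be scaleNr.
    by [].
  by exists v; split=> //; exact: ltW.
have be_r : 8 * be <= r by rewrite /be; clear - s2r r0 R r D E q B; lra.
apply: (past_contra B eps0 eps_be be_r tt0 tt1 tts slabP) => T T0.
have tbp := bc_pos B Db.
(* The minimum with the time at the slab forces [s'] to lie after [s2], where the columns over the
   slab apply. *)
have [|s' [v' [s'r s'0 D' E' t']]] := HT (Num.min T (vb 0 0)); first by rewrite lt_min T0.
move: t'; rewrite lt_min => /andP[t'T t'b].
have s2s' : s2 < s'.
  rewrite ltNge; apply/negP => h.
  have s0s' : s0 <= s' by clear - s'r s0r r0 R r D E q B; lra.
  have := time_along rs0 s0s' h s20 D0 E0 o0' D' E' Db Eb.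
  by rewrite mulN1r opprB subr_ge0 leNgt t'b.
exists s' => // s h1 h2.
have bs' : - be < s' by rewrite /be opprK.
have Cs := gamma_column B eps0 eps_be be_r tt0 tt1 tts slabP (lt_trans bs' h1) h2.
apply: lt_trans (column_mono B slabP Cs (ltW bs') h1) _.
have Cs' := gamma_column B eps0 eps_be be_r tt0 tt1 tts slabP bs' s'0.
have [V' _ _ _] := columnP B tt0 tt1 tts slabP Cs'; have [DP _ EP] := PhiP V'.
by rewrite /tm (bc_time B DP D') // EP E' /pt emb_0 addr0.
Qed.

(** Kasner time is monotone along the segment. In the direction in which it runs it either passes
    every bound, which [future_contra] and [past_case] exclude, or it is confined to a compact
    interval of positive times. *)
Theorem box_chart_false : False.
Proof.
have r0 := bc_r B; pose s0 := - r / 4.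
have rs0 : - r < s0 by rewrite /s0; lra.
have s00 : s0 < 0 by rewrite /s0; lra.
have s0r : s0 < - r / 8 by rewrite /s0; lra.
have r8 : - r / 8 < 0 by lra.
have rr8 : - r <= - r / 8 by lra.
have [v0 D0 E0] := bc_start B (introT andP (conj rs0 s00)).
have t0 := bc_pos B D0.
have mono sg s v : 0 < sg * orient E v0 -> - r / 8 < s -> s < 0 -> D v -> E v = s *: e0 ->
    0 <= sg * (v 0 0 - v0 0 0).
  move=> o0 h1 h2 Dv Ev.
  by apply: (time_along rs0 (lexx s0) (ltW (lt_trans s0r h1)) h2 D0 E0 o0 D0 E0 Dv Ev).
have [oz|oz|oz] := ltgtP (orient E v0) 0; last first.
- by have := orient_neq0 B D0; rewrite oz eqxx.
- have o1 : 0 < 1 * orient E v0 by rewrite mul1r.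
  have [HT|] := pselect (forall T : R, exists s v, [/\ - r / 8 < s < 0, D v, E v = s *: e0 & T <= v 0 0]).
    exact: (future_contra B D0 E0 oz HT).
  move=> /existsNP[T HT].
  apply: (confined (bt := T) t0 rr8 r8) => s v h1 h2 Dv Ev; apply/andP; split.
    by have := mono 1 s v o1 h1 h2 Dv Ev; rewrite mul1r subr_ge0.
  rewrite leNgt; apply/negP => h; apply: HT; exists s, v.
  by split=> //; [rewrite h1 | exact: ltW].
- have o1 : 0 < -1 * orient E v0 by rewrite mulN1r oppr_gt0.
  have [HT|] := pselect (forall T, 0 < T -> exists s v, [/\ - r / 8 < s, s < 0, D v, E v = s *: e0 & v 0 0 < T]).
    exact: (past_case rs0 s0r D0 E0 oz HT).
  move=> /existsNP[T /not_implyP[T0 HT]].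
  apply: (confined (al := T) (bt := v0 0 0) T0 rr8 r8) => s v h1 h2 Dv Ev; apply/andP; split.
    rewrite leNgt; apply/negP => h; apply: HT; exists s, v; split=> //.
  by have := mono (-1) s v o1 h1 h2 Dv Ev; rewrite mulN1r opprB subr_ge0.
Qed.

End Dichotomy.

(** * The universal cover of the spacetime *)

Section Cover.
Variable R : realType.
Local Notation X := (spacetime R).

Lemma time_space (Q : 'I_4 -> Prop) : Q 0 -> (forall j : 'I_3, Q (@rshift 1 3 j)) -> forall i, Q i.
Proof.
move=> Q0 Qj i; case: (@split_ordP 1 3 i) => j ->; last exact: Qj.
by rewrite ord1; have -> : lshift 3 (0 : 'I_1) = 0 by exact: val_inj.
Qed.

Lemma pt_lt (e a : R) (x : 'rV[R]_3) : 0 < e -> `|a| < e -> `|x| < e -> `|pt a x| < e.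
Proof.
move=> e0 ae xe; apply: norm_lt_coord => // i; rewrite ord1; apply: time_space; first by rewrite pt0.
by move=> j; rewrite -xsE xs_pt; apply: le_lt_trans xe; exact: coord_le_norm.
Qed.

Definition time_one : set_type (`]0, +oo[%classic : set R).
Proof. by exists 1; apply/mem_set; rewrite /= in_itv /= ltr01. Defined.

(** Made total by sending nonpositive numbers to time 1; only positive arguments matter. *)
Definition to_time (t : R) : set_type (`]0, +oo[%classic : set R) :=
  match pselect (t \in (`]0, +oo[%classic : set R)) with
  | left h => exist _ t h
  | right _ => time_one
  end.

Lemma to_timeE t : 0 < t -> set_val (to_time t) = t.
Proof.
move=> t0; rewrite /to_time; case: pselect => // h; exfalso; apply: h.
by apply/mem_set; rewrite /= in_itv /= t0.
Qed.

Lemma time_gt0 (s : set_type (`]0, +oo[%classic : set R)) : 0 < set_val s.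
Proof. by have := set_valP s; rewrite /= in_itv /= andbT. Qed.

Lemma to_timeK s : to_time (set_val s) = s.
Proof. by apply: val_inj; exact: (to_timeE (time_gt0 s)). Qed.

Lemma to_time_continuous (t : R) : 0 < t -> {for t, continuous to_time}.
Proof.
move=> t0 U [V [[W oW WV] Vt VU]].
have Wt : W t by rewrite -[t]to_timeE //; rewrite -WV in Vt.
have n1 : nbhs t W by exact: open_nbhs_nbhs.
have n2 : nbhs t [set s : R | 0 < s] by exact: lt_nbhsr.
apply: filterS2 n1 n2 => s Ws s0; apply: VU; rewrite -WV /=.
by rewrite to_timeE.
Qed.

(** The universal covering map of the spacetime, meaningful at positive time. *)
Definition kcover (v : 'rV[R]_4) : X := (to_time (v 0 0), torus_pi (xs v)).

Lemma kcover_surj (m : X) : exists v : 'rV[R]_4, 0 < v 0 0 /\ kcover v = m.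
Proof.
case: m => s p; have [x <-] := torus_pi_surj p.
exists (pt (set_val s) x); rewrite pt0 time_gt0; split=> //.
by rewrite /kcover pt0 xs_pt to_timeK.
Qed.

Lemma kcover_eq (v v' : 'rV[R]_4) : 0 < v 0 0 -> 0 < v' 0 0 -> kcover v = kcover v' ->
  v 0 0 = v' 0 0 /\ torus_pi (xs v) = torus_pi (xs v').
Proof.
move=> v0 v0' [tE xE]; split=> //.
by rewrite -(to_timeE v0) -(to_timeE v0') tE.
Qed.

Lemma kcover_continuous (v : 'rV[R]_4) : 0 < v 0 0 -> {for v, continuous kcover}.
Proof.
move=> v0.
have c1 : (fun v : 'rV[R]_4 => to_time (v 0 0)) @ v --> to_time (v 0 0).
  exact: (@cont_comp _ _ _ (fun v : 'rV[R]_4 => v 0 0) to_time v (@coord_cont R 1 4 0 0 v) (to_time_continuous v0)).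
have c2 : (fun v : 'rV[R]_4 => torus_pi (xs v)) @ v --> torus_pi (xs v).
  exact: (@cont_comp _ _ _ (fun v : 'rV[R]_4 => xs v) (@torus_pi R) v (@xs_continuous R v) (@torus_pi_continuous R (xs v))).
exact: (cvg_pair c1 c2).
Qed.

Lemma kcover_open (U : set 'rV[R]_4) : open U -> (forall v : 'rV[R]_4, U v -> 0 < v 0 0) -> open (kcover @` U).
Proof.
move=> oU U0; rewrite openE => _ [u Uu <-].
have /nbhs_rV[e e0 H] : nbhs u U by exact: open_nbhs_nbhs.
have n1 : nbhs (to_time (u 0 0)) [set s | `|set_val s - u 0 0| < e].
  exists (set_val @^-1` ball (u 0 0) e); split.
  - by exists (ball (u 0 0) e) => //; exact: ball_open.
  - by rewrite /= to_timeE ?(U0 u Uu) //; exact: ballxx.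
  - by move=> s; rewrite /= -ball_normE /= distrC.
have n2 : nbhs (torus_pi (xs u)) (@torus_pi R @` ball (xs u) e).
  apply: open_nbhs_nbhs; split; first exact/torus_pi_open/ball_open.
  by exists (xs u) => //; exact: ballxx.
exists ([set s | `|set_val s - u 0 0| < e], @torus_pi R @` ball (xs u) e) => // -[s p] [/= se [x xe <-]].
exists (pt (set_val s) x); last by rewrite /kcover pt0 xs_pt to_timeK.
apply: H; rewrite [u in _ - u]ptE pt_sub.
by apply: pt_lt => //; move: xe; rewrite -ball_normE /= distrC.
Qed.

Definition kasner_chart (x0 : 'rV[R]_3) : chart R 4 X :=
  Chart (fun m : X => chart_dom (torus_chart x0) m.2)
    (fun m : X => pt (set_val m.1) (chart_map (torus_chart x0) m.2)) kcover.

Definition half_cube (x0 : 'rV[R]_3) : set 'rV[R]_4 := [set v : 'rV[R]_4 | 0 < v 0 0 /\ ball x0 (1 / 2) (xs v)].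

Lemma kasner_chart_mapE x0 v : half_cube x0 v -> chart_map (kasner_chart x0) (kcover v) = v.
Proof.
move=> [v0 xv].
change (pt (set_val (to_time (v 0 0))) (chart_map (torus_chart x0) (torus_pi (xs v))) = v).
by rewrite to_timeE // (torus_chart_mapE xv) -ptE.
Qed.

Lemma kasner_chart_dom x0 v : half_cube x0 v -> chart_dom (kasner_chart x0) (kcover v).
Proof. by move=> [v0 xv]; exists (xs v). Qed.

Lemma kasner_chart_domP x0 m : chart_dom (kasner_chart x0) m -> exists2 v, half_cube x0 v & kcover v = m.
Proof.
case: m => s p [x xb xp]; exists (pt (set_val s) x).
  by rewrite /half_cube /= pt0 xs_pt; split=> //; exact: time_gt0.
by rewrite /kcover pt0 xs_pt to_timeK xp.
Qed.

Lemma kasner_chart_image x0 : chart_map (kasner_chart x0) @` chart_dom (kasner_chart x0) = half_cube x0.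
Proof.
apply/seteqP; split=> [_ [m /kasner_chart_domP[v hv <-] <-]|v hv].
  by rewrite kasner_chart_mapE.
by exists (kcover v); [exact: kasner_chart_dom | exact: kasner_chart_mapE].
Qed.

Lemma half_cube_open x0 : open (half_cube x0).
Proof.
have -> : half_cube x0 = (fun v : 'rV[R]_4 => v 0 0) @^-1` [set t | 0 < t] `&` (fun v : 'rV[R]_4 => xs v) @^-1` ball x0 (1 / 2).
  by apply/seteqP; split.
apply: openI; apply: open_comp.
- by move=> v _; exact: coord_cont.
- exact: open_gt.
- by move=> v _; exact: xs_continuous.
- exact: ball_open.
Qed.

Lemma kasner_chartP x0 : spacetime_atlas (kasner_chart x0).
Proof.
have inj v v' : half_cube x0 v -> half_cube x0 v' -> kcover v = kcover v' -> v = v'.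
  by move=> hv hv' e; rewrite -(kasner_chart_mapE hv) e kasner_chart_mapE.
have cm v : half_cube x0 v -> {for kcover v, continuous (chart_map (kasner_chart x0))}.
  move=> hv U; rewrite kasner_chart_mapE // => nU.
  have [V [oV Vv] VU] : exists2 V, open_nbhs v V & V `<=` U `&` half_cube x0.
    have : nbhs v (U `&` half_cube x0).
      by apply: filterI => //; apply: open_nbhs_nbhs; split=> //; exact: half_cube_open.
    by rewrite nbhsE => -[V ? ?]; exists V.
  apply: (@filterS _ _ _ (kcover @` V)).
    move=> _ [y Vy <-]; have [Uy hy] := VU _ Vy.
    by change (U (chart_map (kasner_chart x0) (kcover y))); rewrite kasner_chart_mapE.
  apply: (@open_nbhs_nbhs X); split; last by exists v.
  by apply: kcover_open => // y /VU[_ []].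
split; last first.
  move=> m /kasner_chart_domP[v hv <-]; rewrite kasner_chart_mapE //.
  by case: hv => v0 _; rewrite /= to_timeE.
split.
- have -> : chart_dom (kasner_chart x0) = kcover @` half_cube x0.
    apply/seteqP; split=> [m /kasner_chart_domP[v hv <-]|_ [v hv <-]]; first by exists v.
    exact: kasner_chart_dom.
  by apply: kcover_open => [|v []//]; exact: half_cube_open.
- by rewrite kasner_chart_image; exact: half_cube_open.
- by move=> m /kasner_chart_domP[v hv <-]; rewrite kasner_chart_mapE.
- by move=> m /kasner_chart_domP[v hv <-]; exact: cm.
- by move=> v; rewrite kasner_chart_image => -[v0 _]; exact: kcover_continuous.
Qed.

Lemma half_cube_center (v : 'rV[R]_4) : 0 < v 0 0 -> half_cube (xs v) v.
Proof. by move=> v0; split=> //; apply: ballxx; rewrite divr_gt0. Qed.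

Definition kasner_gram (t : R) : 'M[R]_4 := (block_mx (-1)%:M 0 0 (h_gram t) : 'M[R]_(1 + 3)).

Lemma kasner_gramE t (u : 'rV[R]_4) : (u *m kasner_gram t *m u^T) 0 0 = gform t u.
Proof.
have uE : u = @row_mx R 1 1 3 (u 0 0)%:M (xs u).
  rewrite {1}[u]split4 /xs; apply/rowP; apply: time_space.
    by rewrite mxE emb0 addr0 !mxE /=; case: splitP => // j _; rewrite !mxE ord1 eqxx !mulr1n mulr1.
  move=> j; rewrite (@row_mxEr R 1 1 3) mxE /emb (@row_mxEr R 1 1 3) !mxE /=.
  by rewrite mulr0 add0r.
rewrite /kasner_gram {1 2}uE (@mul_row_block R 1 1 3 1 3) !mulmx0 addr0 add0r.
rewrite (@tr_row_mx R 1 1 3) (@mul_row_col R 1 1 3) mxE /gform; congr (_ + _).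
  by rewrite tr_scalar_mx -!scalar_mxM mxE eqxx mulr1n; ring.
exact: h_gramE.
Qed.

End Cover.

(** * Adapted coordinates at a boundary point *)

Section Minkowski.
Variable R : realType.
Local Notation e0 := (e0 R).

Lemma sq_le (a b : R) : `|a| <= b -> a ^+ 2 <= b ^+ 2.
Proof.
by move=> ab; rewrite -[leLHS]real_normK ?num_real // ler_sqr ?nnegrE // (le_trans _ ab).
Qed.

Lemma sq_ge (a b : R) : 0 <= b -> b <= `|a| -> b ^+ 2 <= a ^+ 2.
Proof. by move=> b0 ab; rewrite -[leRHS]real_normK ?num_real // ler_sqr ?nnegrE. Qed.

Definition mk (u : 'rV[R]_4) : R := - u 0 0 ^+ 2 + \sum_i xs u 0 i ^+ 2.

Lemma minkowskiE (u : 'rV[R]_4) : (u *m Defs.minkowski R 3 *m u^T) 0 0 = mk u.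
Proof.
rewrite /Defs.minkowski mul_mx_diag mxE big_ord_recl /mk; congr (_ + _).
  by rewrite !mxE /=; ring.
apply: eq_bigr => i _; rewrite [u^T _ _]mxE [X in X * _]mxE [X in _ * X * _]mxE xsE.
have -> : lift ord0 i = @rshift 1 3 i by exact: val_inj.
have -> : (@rshift 1 3 i == 0) = false by [].
by rewrite mulr1 expr2.
Qed.

(** Linear coordinates whose time axis is the vector [w]. *)
Definition tilt_mx (w : 'rV[R]_4) : 'M[R]_4 := \matrix_(i, j) if i == 0 then w 0 j else (i == j)%:R.

Lemma tilt_mxE w (u : 'rV[R]_4) : u *m tilt_mx w = u 0 0 *: w + emb (xs u).
Proof.
apply/rowP => j; rewrite mxE big_ord_recl [RHS]mxE [X in _ = X + _]mxE; congr (_ + _).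
  by rewrite mxE eqxx.
rewrite (eq_bigr (fun i : 'I_3 => xs u 0 i * (@rshift 1 3 i == j)%:R)); last first.
  move=> i _; rewrite !mxE /=; have -> : lift ord0 i = @rshift 1 3 i by exact: val_inj.
  by [].
move: j; apply: time_space; first by rewrite emb0 big1 // => i _; rewrite mulr0.
move=> j; rewrite -xsE xs_emb (bigD1 j) //= eqxx mulr1 big1 ?addr0 // => i ij.
by rewrite eq_rshift (negbTE ij) mulr0.
Qed.

Lemma mk_tilt (w u : 'rV[R]_4) : w 0 0 ^+ 2 = 1 ->
  mk (u *m tilt_mx w) = - u 0 0 ^+ 2 + \sum_i (xs u 0 i + u 0 0 * xs w 0 i) ^+ 2.
Proof.
move=> w1; rewrite tilt_mxE /mk xsD xsZ xs_emb; congr (_ + _).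
  by rewrite mxE emb0 addr0 mxE exprMn w1 mulr1.
by apply: eq_bigr => i _; rewrite !mxE addrC.
Qed.

(** 1/8 + 1/15 < 1/5. This estimate and those of [mk_W] and [mk_U] leave room for an error of
    [|u|^2 / 100] before the bounds required by [box_chart] are reached. *)
Lemma mk_N (w u : 'rV[R]_4) : w 0 0 ^+ 2 = 1 -> `|xs w| <= 1 / 15 -> 0 <= u 0 0 ->
  (forall i, `|xs u 0 i| <= u 0 0 / 8) -> mk (u *m tilt_mx w) <= - (3 / 4) * u 0 0 ^+ 2.
Proof.
move=> w1 wn u0 un; rewrite mk_tilt //.
have h i : (xs u 0 i + u 0 0 * xs w 0 i) ^+ 2 <= (1 / 5) ^+ 2 * u 0 0 ^+ 2.
  rewrite -exprMn; apply: sq_le.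
  apply: le_trans (ler_normD _ _) _; rewrite normrM (ger0_norm u0).
  have : u 0 0 * `|xs w 0 i| <= u 0 0 * (1 / 15).
    by rewrite ler_wpM2l //; apply: le_trans wn; exact: coord_le_norm.
  have := un i; lra.
have : \sum_i (xs u 0 i + u 0 0 * xs w 0 i) ^+ 2 <= \sum_(i < 3) (1 / 5) ^+ 2 * u 0 0 ^+ 2.
  by apply: ler_sum => i _; exact: h.
rewrite sumr_const card_ord -mulr_natl; have := sqr_ge0 (u 0 0); lra.
Qed.

Lemma mk_W (w u : 'rV[R]_4) (i : 'I_3) : w 0 0 ^+ 2 = 1 -> `|xs w| <= 1 / 15 ->
  2 * `|u 0 0| < `|xs u 0 i| -> 1 / 2 * `|xs u 0 i| ^+ 2 <= mk (u *m tilt_mx w).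
Proof.
move=> w1 wn un; rewrite mk_tilt //.
set n := `|xs u 0 i| in un *; set v := `|u 0 0| in un.
have v0 : 0 <= v := normr_ge0 _.
have h : (29 / 30) ^+ 2 * n ^+ 2 <= (xs u 0 i + u 0 0 * xs w 0 i) ^+ 2.
  have n0 : 0 <= n := normr_ge0 _.
  rewrite -exprMn; apply: sq_ge; first by rewrite mulr_ge0.
  have := ler_normD (xs u 0 i + u 0 0 * xs w 0 i) (- (u 0 0 * xs w 0 i)).
  rewrite addrK normrN normrM -/n -/v.
  have : v * `|xs w 0 i| <= v * (1 / 15).
    by rewrite ler_wpM2l //; apply: le_trans wn; exact: coord_le_norm.
  lra.
have vn : u 0 0 ^+ 2 <= (n / 2) ^+ 2.
  by apply: sq_le; rewrite -/v; lra.
rewrite (bigD1 i) //=.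
have : 0 <= \sum_(j | j != i) (xs u 0 j + u 0 0 * xs w 0 j) ^+ 2 by apply: sumr_ge0 => j _; exact: sqr_ge0.
have := sqr_ge0 n; lra.
Qed.

Lemma mk_U (w u : 'rV[R]_4) : w 0 0 ^+ 2 = 1 -> `|xs w| <= 1 / 15 ->
  `|mk (u *m tilt_mx w)| <= 5 * `|u| ^+ 2.
Proof.
move=> w1 wn; rewrite mk_tilt //.
have un j : `|u 0 j| <= `|u| by exact: coord_le_norm.
have u0 : u 0 0 ^+ 2 <= `|u| ^+ 2 by exact: sq_le.
have h i : (xs u 0 i + u 0 0 * xs w 0 i) ^+ 2 <= (16 / 15) ^+ 2 * `|u| ^+ 2.
  rewrite -exprMn; apply: sq_le.
  apply: le_trans (ler_normD _ _) _; rewrite normrM.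
  have : `|u 0 0| * `|xs w 0 i| <= `|u| * (1 / 15).
    by apply: ler_pM => //; apply: le_trans wn; exact: coord_le_norm.
  have : `|xs u 0 i| <= `|u| by rewrite xsE.
  lra.
have s1 : \sum_i (xs u 0 i + u 0 0 * xs w 0 i) ^+ 2 <= \sum_(i < 3) (16 / 15) ^+ 2 * `|u| ^+ 2.
  by apply: ler_sum => i _; exact: h.
have s0 : 0 <= \sum_i (xs u 0 i + u 0 0 * xs w 0 i) ^+ 2 by apply: sumr_ge0 => j _; exact: sqr_ge0.
rewrite sumr_const card_ord -mulr_natl in s1.
have := sqr_ge0 (u 0 0); have := sqr_ge0 `|u|.
by rewrite ler_norml => g1 g2; apply/andP; split; lra.
Qed.

Lemma tilt_norm (w u : 'rV[R]_4) : w 0 0 ^+ 2 = 1 -> `|xs w| <= 1 / 15 -> `|u *m tilt_mx w| <= 2 * `|u|.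
Proof.
move=> w1 wn; rewrite tilt_mxE; apply: le_trans (ler_normD _ _) _; rewrite normrZ.
have w00 : `|w 0 0| = 1.
  apply/eqP; rewrite -(eqrXn2 (n := 2)) //= expr1n real_normK ?num_real // w1 //.
have ww : `|w| <= 1.
  apply: norm_le_coord => // i; rewrite ord1; apply: time_space; first by rewrite w00.
  move=> j; rewrite -xsE; apply: le_trans (coord_le_norm _ _ _) _; apply: le_trans wn _; lra.
have : `|u 0 0| * `|w| <= `|u| * 1 by apply: ler_pM => //; exact: coord_le_norm.
have := emb_norm (xs u); have := xs_norm u; lra.
Qed.

Lemma tilt_unit (w : 'rV[R]_4) : w 0 0 != 0 -> tilt_mx w \in unitmx.
Proof.
move=> w0; rewrite -row_free_unit; apply: inj_row_free => u; rewrite tilt_mxE => H.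
have u0 : u 0 0 = 0.
  have := congr1 (fun M : 'rV[R]_4 => M 0 0) H; rewrite [X in X = _ -> _]mxE emb0 addr0 !mxE => /eqP.
  by rewrite mulf_eq0 (negbTE w0) orbF => /eqP.
by rewrite [u]split4 u0 scale0r add0r; move: H; rewrite u0 scale0r add0r.
Qed.

Lemma first_exit (P : R -> Prop) (b : R) : 0 <= b -> P 0 -> ~ P b ->
  (forall s, 0 <= s <= b -> P s -> \forall u \near s, P u) ->
  exists s, [/\ 0 < s <= b, ~ P s & forall u, 0 <= u < s -> P u].
Proof.
move=> b0 P0 Pb oP; apply: contrapT => NE; apply: Pb.
apply: (@real_induction R 0 b P b0 P0); last by rewrite b0 lexx.
- by move=> s sin Pl; apply: contrapT => nP; apply: NE; exists s.
- move=> s /andP[s0 sb] Pl.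
  have /nbhs_ballP[e /= e_gt0 He] : \forall u \near s, P u.
    by apply: oP; [rewrite s0 ltW | apply: Pl; rewrite s0 lexx].
  exists e => // u /andP[su us] _; apply: He; rewrite -ball_normE /= ltr0_norm ?subr_lt0 //; lra.
Qed.

Lemma line_cont (p w : 'rV[R]_4) (s : R) : {for s, continuous (fun u : R => p + u *: w)}.
Proof. by apply: cont_add; [exact: cont_cst | exact: cvgZr_tmp]. Qed.

(** Either the line going down from [z1] leaves [S], or the line from a point far below it up to [0]
    does. *)
Lemma exit_line (S : set 'rV[R]_4) (rho : R) (z1 : 'rV[R]_4) : 0 < rho ->
  (forall z, S z -> `|z| < rho -> nbhs z S) -> ~ S 0 -> S z1 -> `|z1| <= rho / 100 ->
  exists (p w : 'rV[R]_4) (l : R), [/\ `|p| <= rho / 2, w 0 0 ^+ 2 = 1 /\ `|xs w| <= 1 / 15, 0 < l, ~ S p &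
    forall s, - l < s < 0 -> S (p + s *: w)].
Proof.
move=> rho0 oS S0 S1 z1n; pose k := rho / 100.
have k0 : 0 < k by rewrite divr_gt0.
have e00 : e0 0 0 = 1 by rewrite mxE.
have z0k : `|z1 0 0| <= k by apply: le_trans z1n; exact: coord_le_norm.
have b1 s : 0 <= s <= 16 * k -> `|z1 - s *: e0| <= rho / 5.
  move=> /andP[s0 sk]; apply: le_trans (ler_normB _ _) _; rewrite normrZ ger0_norm //.
  have : s * `|e0| <= s by rewrite ler_piMr // e0_norm.
  rewrite /k in sk z1n *; lra.
have [H|] := pselect (forall s, 0 <= s <= 16 * k -> S (z1 - s *: e0)); last first.
  move=> /existsNP[b /not_implyP[/andP[b0 bk] nSb]].
  have [||s sin|s [/andP[s0 sb] nS Hs]] := @first_exit (fun s => S (z1 - s *: e0)) b b0.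
  - by rewrite scale0r subr0.
  - exact: nSb.
  - move=> Ss; have c : {for s, continuous (fun u : R => z1 - u *: e0)}.
      by apply: cont_sub; [exact: cont_cst | exact: cvgZr_tmp].
    apply: c; apply: oS => //; apply: le_lt_trans (b1 s _) _; last lra.
    by case/andP: sin => h1 h2; rewrite h1 (le_trans h2).
  exists (z1 - s *: e0), (- e0), s; split=> //.
  - by apply: le_trans (b1 s _) _; [rewrite ltW // (le_trans sb) | lra].
  - by rewrite xsN xs_e0 oppr0 normr0 mxE e00 sqrrN expr1n; split=> //; lra.
  - move=> u /andP[u1 u2].
    have -> : z1 - s *: e0 + u *: - e0 = z1 - (s + u) *: e0 by rewrite scalerN scalerDl; vring.
    by apply: Hs; apply/andP; split; lra.
(* A descent by [16 * k] makes the height [b] at least [15 * k], while the sideways distance is at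
   most [k]; this is the slope 1/15. *)
pose a := z1 - (16 * k) *: e0.
have Sa : S a by apply: H; rewrite lexx andbT mulr_ge0 // ltW.
have a0 : a 0 0 = z1 0 0 - 16 * k by rewrite /a !mxE /= mulr1.
pose b := - a 0 0.
have bk : 15 * k <= b by move: z0k; rewrite ler_norml /b a0 => /andP[h1 h2]; lra.
have b0 : 0 < b by lra.
pose w := - b^-1 *: a.
have an : `|a| <= rho / 5 by apply: b1; rewrite lexx andbT mulr_ge0 // ltW.
have aw : a + b *: w = 0 by rewrite /w scalerA mulrN divff ?gt_eqF // scaleN1r subrr.
have aws s : 0 <= s <= b -> `|a + s *: w| <= rho / 5.
  move=> /andP[s0 sb]; have -> : a + s *: w = (1 - s / b) *: a.
    by rewrite /w scalerA scalerBl scale1r mulrN scaleNr.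
  have sb1 : s / b <= 1 by rewrite ler_pdivrMr // mul1r.
  have sb0 : 0 <= s / b by rewrite divr_ge0 // ltW.
  rewrite normrZ ger0_norm ?subr_ge0 //; apply: le_trans an; rewrite ler_piMl //; lra.
have [||s sin|s [/andP[s0 sb] nS Hs]] := @first_exit (fun s => S (a + s *: w)) b (ltW b0).
- by rewrite scale0r addr0.
- by rewrite aw.
- by move=> Ss; have c := @line_cont a w s; apply: c; apply: oS => //; apply: le_lt_trans (aws s sin) _; lra.
exists (a + s *: w), w, s; split=> //.
- by apply: le_trans (aws s _) _; [rewrite ltW | lra].
- split.
    by rewrite mxE a0 -a0 -[a 0 0]opprK -/b mulrN mulNr opprK mulVf ?expr1n // gt_eqF.
  have xa : xs a = xs z1 by rewrite /a xsB xsZ xs_e0 scaler0 subr0.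
  rewrite /w xsZ xa normrZ normrN gtr0_norm ?invr_gt0 // mulrC ler_pdivrMr //.
  have := xs_norm z1; rewrite /k in bk; lra.
- move=> u /andP[u1 u2].
  have -> : a + s *: w + u *: w = a + (s + u) *: w by rewrite scalerDl addrA.
  by apply: Hs; apply/andP; split; lra.
Qed.

End Minkowski.

(** * The box chart of an extension *)

Section Extension.
Variables (R : realType) (Y : topologicalType) (A : set (chart R 4 Y)) (gY : metric R 4 Y).
Variable f : spacetime R -> Y.
Hypothesis mY : is_manifold A.
Hypothesis ef : smooth_embedding (@spacetime_atlas R) A f.
Hypothesis pf : is_pullback (@spacetime_atlas R) (@spacetime_metric R) A gY f.
Hypothesis of_ : open (range f).
Local Notation e0 := (e0 R).

Definition unfold (v : 'rV[R]_4) : Y := f (kcover v).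

Lemma embedding_open (U : set (spacetime R)) : open U -> open (f @` U).
Proof. by move=> oU; case: ef => _ _ _ /(_ U oU)[V oV ->]; exact: openI. Qed.

Lemma unfold_cont (v : 'rV[R]_4) : 0 < v 0 0 -> {for v, continuous unfold}.
Proof.
move=> v0; have [[fc _] _ _ _] := ef.
exact: (@cont_comp _ _ _ (@kcover R) f v (kcover_continuous v0) (fc (kcover v))).
Qed.

Lemma unfold_range y : range f y -> exists2 v : 'rV[R]_4, 0 < v 0 0 & unfold v = y.
Proof. by move=> [m _ <-]; have [v [v0 <-]] := kcover_surj m; exists v. Qed.

Lemma unfold_eq (v v' : 'rV[R]_4) : 0 < v 0 0 -> 0 < v' 0 0 -> unfold v = unfold v' ->
  v 0 0 = v' 0 0 /\ torus_pi (xs v) = torus_pi (xs v').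
Proof. by move=> v0 v0' e; apply: kcover_eq => //; case: ef => _ _ inj _; exact: inj. Qed.

Section Chart.
Variable c : chart R 4 Y.
Hypothesis Ac : A c.

Lemma chartP : is_chart c. Proof. by case: mY => _ _ /(_ c Ac). Qed.

Definition rep (v : 'rV[R]_4) : 'rV[R]_4 := chart_map c (unfold v).

Lemma rep_dom_open (v : 'rV[R]_4) : 0 < v 0 0 -> chart_dom c (unfold v) ->
  nbhs v [set u : 'rV[R]_4 | 0 < u 0 0 /\ chart_dom c (unfold u)].
Proof.
move=> v0 dv; have [od _ _ _ _] := chartP.
have n1 : nbhs v [set u : 'rV[R]_4 | 0 < u 0 0] by have := @coord_cont R 1 4 0 0 v _ (lt_nbhsr v0).
have n2 : nbhs v [set u | chart_dom c (unfold u)].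
  by have := unfold_cont v0 (open_nbhs_nbhs (conj od dv)).
by apply: filterS2 n1 n2 => u.
Qed.

Lemma repP (v : 'rV[R]_4) : 0 < v 0 0 -> chart_dom c (unfold v) ->
  [/\ differentiable rep v, forall i, {for v, continuous (fun y => 'D_(delta_mx 0 i) rep y)},
      row_free ('J rep v) & kasner_gram (v 0 0) = 'J rep v *m gY c (unfold v) *m ('J rep v)^T].
Proof.
move=> v0 dv; pose k := kasner_chart (xs v).
have Ak : spacetime_atlas k by exact: kasner_chartP.
have hv := half_cube_center v0.
pose W := chart_map k @` (chart_dom k `&` f @^-1` chart_dom c).
have WE : W = half_cube (xs v) `&` [set u | chart_dom c (unfold u)].
  apply/seteqP; split=> [_ [m [/kasner_chart_domP[u hu <-] du] <-]|u [hu du]].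
    by rewrite kasner_chart_mapE.
  exists (kcover u); last exact: kasner_chart_mapE.
  by split=> //; exact: kasner_chart_dom.
have oW : open W.
  rewrite WE openE => u [hu du]; have [u0 _] := hu.
  have n1 : nbhs u (half_cube (xs v)) by apply: open_nbhs_nbhs; split=> //; exact: half_cube_open.
  by apply: filterS2 n1 (rep_dom_open u0 du) => w hw [_ dw].
have Wv : W v by rewrite WE.
have [[_ sf] rf _ _] := ef.
have [d1 d2] := smooth_C1 oW (sf k c Ak Ac) Wv.
have dk : chart_dom k (kcover v) by exact: kasner_chart_dom.
have km : chart_map k (kcover v) = v by exact: kasner_chart_mapE.
split=> //.
- by have := rf k c Ak Ac _ dk dv; rewrite km.
- have := pf Ak Ac dk dv; rewrite km => <-.
  by rewrite /spacetime_metric /kcover /= to_timeE.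
Qed.

Variables (ys : 'rV[R]_4) (T : 'M[R]_4) (r : R).
Hypothesis uT : T \in unitmx.
Hypothesis r_gt0 : 0 < r.
Hypothesis box_image : forall z : 'rV[R]_4, `|z| < r -> (chart_map c @` chart_dom c) (ys + z *m T).

Definition box_pt (z : 'rV[R]_4) : Y := chart_inv c (ys + z *m T).
Definition box_coord (v : 'rV[R]_4) : 'rV[R]_4 := (rep v - ys) *m invmx T.
Definition box_dom : set 'rV[R]_4 := [set v : 'rV[R]_4 | [/\ 0 < v 0 0, chart_dom c (unfold v) & `|box_coord v| < r]].
Definition box_form (z u : 'rV[R]_4) : R := ((u *m T) *m gY c (box_pt z) *m (u *m T)^T) 0 0.

Hypothesis box_N : forall z w : 'rV[R]_4, `|z| < r -> (forall i, `|w 0 i| <= w 0 0 / 8 \/ i = 0) ->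
  box_form z w <= - (1 / 2) * w 0 0 ^+ 2.
Hypothesis box_W : forall z w : 'rV[R]_4, `|z| < r -> box_form z w <= 0 -> forall i, `|w 0 i| <= 2 * `|w 0 0|.
Hypothesis box_U : forall z w : 'rV[R]_4, `|z| < r -> `|box_form z w| <= 6 * `|w| ^+ 2.
Hypothesis box_start : forall s, - r < s < 0 -> range f (box_pt (s *: e0)).
Hypothesis box_exit : ~ range f (box_pt 0).

Lemma box_ptP z : `|z| < r ->
  [/\ chart_dom c (box_pt z), chart_map c (box_pt z) = ys + z *m T & {for z, continuous box_pt}].
Proof.
move=> zr; have [_ _ ck _ ci] := chartP.
have im := box_image zr; have [y dy ye] := im.
have pE : box_pt z = y by rewrite /box_pt -ye ck.
split; rewrite ?pE //.
apply: (cont_comp (f := fun z : 'rV[R]_4 => ys + z *m T) (g := chart_inv c)); last exact: ci.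
by apply: cont_add; [exact: cont_cst | exact: mulmxr_continuous].
Qed.

Lemma box_ptE (v : 'rV[R]_4) : box_dom v -> box_pt (box_coord v) = unfold v.
Proof.
move=> [v0 dv vr]; have [_ _ ck _ _] := chartP.
by rewrite /box_pt /box_coord mulmxKV // addrC subrK /rep ck.
Qed.

Lemma box_pt_unfold z (v : 'rV[R]_4) : `|z| < r -> 0 < v 0 0 -> unfold v = box_pt z -> box_dom v /\ box_coord v = z.
Proof.
move=> zr v0 e; have [dz mz _] := box_ptP zr.
have E : box_coord v = z by rewrite /box_coord /rep e mz addrAC subrr add0r mulmxK.
by split=> //; rewrite /box_dom /= E e.
Qed.

Lemma box_coord_diff (v : 'rV[R]_4) : 0 < v 0 0 -> chart_dom c (unfold v) ->
  differentiable box_coord v /\ 'J box_coord v = 'J rep v *m invmx T.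
Proof.
move=> v0 dv; have [dr _ _ _] := repP v0 dv.
pose C : R := 4%:R * `|invmx T|; have C0 : 0 <= C by rewrite mulr_ge0.
apply: diff_mx_eps => e e_gt0.
have e1 : 0 < e / (C + 1) by rewrite divr_gt0 // ltr_wpDl.
have := diff_jacobian_eps dr e1; apply: filterS => h H.
have -> : box_coord (h + v) - box_coord v - h *m ('J rep v *m invmx T) =
    (rep (h + v) - rep v - h *m 'J rep v) *m invmx T.
  rewrite /box_coord mulmxA -!mulmxBl; congr (_ *m _); vring.
apply: le_trans (mulmx_norm_le _ _) _; rewrite -/C.
apply: le_trans (_ : C * (e / (C + 1) * `|h|) <= _); first by rewrite ler_wpM2l.
rewrite mulrA ler_wpM2r // mulrCA ler_piMr ?(ltW e_gt0) // ler_pdivrMr ?ltr_wpDl // mul1r lerDl //.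
Qed.

Lemma box_coord_cont (v : 'rV[R]_4) : 0 < v 0 0 -> chart_dom c (unfold v) -> {for v, continuous box_coord}.
Proof. by move=> v0 dv; apply: differentiable_continuous; have [] := box_coord_diff v0 dv. Qed.

Lemma box_dom_nbhs (v : 'rV[R]_4) : box_dom v -> nbhs v box_dom.
Proof.
move=> [v0 dv vr].
have n2 : nbhs v [set u | `|box_coord u| < r].
  have c1 : {for v, continuous (fun u => `|box_coord u|)}.
    apply: (cont_comp (f := box_coord) (g := fun z : 'rV[R]_4 => `|z|)); last exact: norm_continuous.
    exact: box_coord_cont.
  by have := c1 _ (lt_nbhsl vr).
by apply: filterS2 (rep_dom_open v0 dv) n2 => u [].
Qed.

Definition unembed (y : Y) : spacetime R := xget (kcover (pt 1 0)) [set m | f m = y].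

Lemma unembedK m : unembed (f m) = m.
Proof.
rewrite /unembed; case: xgetP => [m' _ e|/(_ m) []//].
by have [_ _ inj _] := ef; exact: inj.
Qed.

Lemma unembed_cont m : {for f m, continuous unembed}.
Proof.
move=> U; rewrite unembedK nbhsE => -[V [oV Vm] VU].
apply: (@filterS _ _ _ (f @` V)); first by move=> _ [k Vk <-]; rewrite /= unembedK; exact: VU.
by apply: open_nbhs_nbhs; split; [exact: embedding_open | exists m].
Qed.

Lemma e0_small (s : R) : - r < s < 0 -> `|s *: e0| < r.
Proof.
move=> /andP[s1 s2]; rewrite normrZ ltr0_norm //.
have : - s * `|e0| <= - s by rewrite ler_piMr ?e0_norm // oppr_ge0 ltW.
lra.
Qed.

(** The two factors are treated separately: the time component is read off from the spacetime point,
    and the torus component is lifted as a path. *)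
Lemma box_lift s0 S v0 : - r < s0 -> s0 <= S -> S < 0 -> box_dom v0 -> box_coord v0 = s0 *: e0 ->
  exists g : R -> 'rV[R]_4, g s0 = v0 /\ forall s, s0 <= s <= S ->
    [/\ {for s, continuous g}, box_dom (g s) & box_coord (g s) = s *: e0].
Proof.
move=> rs0 s0S S0 Dv0 Ev0.
pose m s := unembed (box_pt (s *: e0)).
have sr s : s0 <= s <= S -> - r < s < 0.
  by move=> /andP[h1 h2]; rewrite (lt_le_trans rs0) // (le_lt_trans h2).
have fm s : s0 <= s <= S -> f (m s) = box_pt (s *: e0).
  by move=> sin; have [k _ e] := box_start (sr s sin); rewrite /m -e unembedK.
have cm s : s0 <= s <= S -> {for s, continuous m}.
  move=> sin; have [_ _ cb] := box_ptP (e0_small (sr s sin)).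
  apply: (cont_comp (f := fun s : R => box_pt (s *: e0)) (g := unembed)).
    apply: (cont_comp (f := fun s : R => s *: e0) (g := box_pt)); [exact: cvgZr_tmp | exact: cb].
  by rewrite -(fm s sin); exact: unembed_cont.
have s0in : s0 <= s0 <= S by rewrite lexx.
have km : kcover v0 = m s0.
  by rewrite /m -Ev0 box_ptE // /unfold unembedK.
have c1 s : s0 <= s <= S -> {for s, continuous (fun s => set_val (m s).1)}.
  move=> sin; apply: (cont_comp (f := fun s => (m s).1) (g := set_val)).
    by apply: (cont_comp (f := m) (g := fst)); [exact: cm | exact: cvg_fst].
  exact: initial_continuous.
have c2 s : s0 <= s <= S -> {for s, continuous (fun s => (m s).2)}.
  by move=> sin; apply: (cont_comp (f := m) (g := snd)); [exact: cm | exact: cvg_snd].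
have e2 : torus_pi (xs v0) = (m s0).2 by rewrite -km.
have [x [x0 xc xp]] := path_lifting s0S e2 c2.
exists (fun s => pt (set_val (m s).1) (x s)); split.
  by rewrite x0 -km /= to_timeE -?ptE //; case: Dv0.
move=> s sin; have kg : kcover (pt (set_val (m s).1) (x s)) = m s.
  rewrite /kcover pt0 xs_pt to_timeK (nbhs_singleton (xp s sin)).
  by case: (m s).
have g0 : 0 < pt (set_val (m s).1) (x s) 0 0 by rewrite pt0; exact: time_gt0.
have ug : unfold (pt (set_val (m s).1) (x s)) = box_pt (s *: e0) by rewrite /unfold kg fm.
have [D1 E1] := box_pt_unfold (e0_small (sr s sin)) g0 ug; split; [|exact: D1|exact: E1].
by apply: pt_cont; [exact: c1 | exact: xc].
Qed.

(** Both closedness clauses come from the Hausdorff property of [Y]: the compact set, carried into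
    [Y] from the box by [box_pt] or from the cover by [unfold], has a closed image, and limits are
    compared there. *)
Lemma extension_box_chart : box_chart r box_dom box_coord box_form.
Proof.
have hY : hausdorff_space Y by case: mY.
split=> //.
- by move=> z w; rewrite /box_form !mulNmx linearN mulmxN opprK.
- by move=> v [].
- by rewrite openE => v; exact: box_dom_nbhs.
- by move=> v [].
- by move=> v [v0 dv _]; have [] := box_coord_diff v0 dv.
- move=> v Dv; have [v0 dv vr] := Dv.
  apply: (cont_near (g := fun y => 'D_e0 rep y *m invmx T)).
    apply: filterS (box_dom_nbhs Dv) => u [u0 du _].
    have [d1 J1] := box_coord_diff u0 du; have [d2 _ _ _] := repP u0 du.
    by rewrite !deriveEjacobian // J1 mulmxA.
  have [_ c2 _ _] := repP v0 dv.
  by apply: (cont_comp (f := fun y => 'D_e0 rep y) (g := fun z => z *m invmx T)); [exact: (c2 0) | exact: mulmxr_continuous].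
- move=> v u Dv; have [v0 dv vr] := Dv; have [d1 J1] := box_coord_diff v0 dv.
  have [_ _ _ G] := repP v0 dv.
  by rewrite /box_form box_ptE // J1 !mulmxA mulmxKV // -kasner_gramE G trmx_mul !mulmxA.
- move=> v [v0 dv vr]; have [d1 J1] := box_coord_diff v0 dv.
  have [_ _ /row_freeP[L JL] _] := repP v0 dv.
  by exists (T *m L); rewrite J1 mulmxA mulmxKV.
- move=> K cK Kr v v0 cl.
  have cbK : compact (box_pt @` K).
    apply: continuous_compact => //; apply: continuous_in_subspaceT => z /set_mem/Kr zr.
    by have [] := box_ptP zr.
  have [z Kz zE] : (box_pt @` K) (unfold v).
    apply: (compact_closed hY cbK) => N nN.
    have [u [[Du Ku] Nu]] := cl _ (unfold_cont v0 nN).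
    by exists (unfold u); split=> //; exists (box_coord u) => //; exact: box_ptE.
  have [D1 E1] := box_pt_unfold (Kr z Kz) v0 (esym zE).
  by split=> //; rewrite E1.
- move=> K cK K0 z zr cl.
  have cuK : compact (unfold @` K).
    apply: continuous_compact => //; apply: continuous_in_subspaceT => v /set_mem/K0 v0.
    exact: unfold_cont.
  have [_ _ cb] := box_ptP zr.
  have [v Kv vE] : (unfold @` K) (box_pt z).
    apply: (compact_closed hY cuK) => N nN.
    have [_ [[u [Du Ku] <-] Nu]] := cl _ (cb _ nN).
    by exists (unfold u); split; [exists u | rewrite -box_ptE].
  by exists v => //; exact: box_pt_unfold zr (K0 v Kv) vE.
- move=> v U Dv nU; have [v0 dv vr] := Dv.
  have nUD : nbhs v (U `&` box_dom) by apply: filterI => //; exact: box_dom_nbhs.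
  move: nUD; rewrite nbhsE => -[V [oV Vv] VU].
  have V0 w : V w -> 0 < w 0 0 by move=> /VU[_ []].
  have oW : open (unfold @` V).
    have -> : unfold @` V = f @` (@kcover R @` V) by rewrite -image_comp.
    exact/embedding_open/kcover_open.
  have [_ _ cb] := box_ptP vr.
  have n1 : nbhs (box_coord v) (box_pt @^-1` (unfold @` V)).
    by apply: cb; apply: open_nbhs_nbhs; split=> //; exists v => //; rewrite box_ptE.
  have n2 : nbhs (box_coord v) [set z : 'rV[R]_4 | `|z| < r] by exact: (norm_continuous (lt_nbhsl vr)).
  apply: filterS2 n1 n2 => z [u Vu uz] zr.
  have [Uu Du] := VU u Vu.
  by exists u => //; have [] := box_pt_unfold zr (V0 u Vu) uz.
- move=> v v' Dv Dv' e xd; have [v0 _ _] := Dv; have [v0' _ _] := Dv'.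
  have [tE pE] : v 0 0 = v' 0 0 /\ torus_pi (xs v) = torus_pi (xs v').
    by apply: unfold_eq => //; rewrite -!box_ptE // e.
  by rewrite [v]ptE [v']ptE tE (lattice_eq pE xd).
- move=> v v' Dv Dv' e; have [v0 _ _] := Dv; have [v0' _ _] := Dv'.
  by have [] : v 0 0 = v' 0 0 /\ torus_pi (xs v) = torus_pi (xs v')
    by apply: unfold_eq => //; rewrite -!box_ptE // e.
- move=> v Dv; have [v0 dv vr] := Dv.
  pose n : 'rV[R]_3 := \row_i - (Num.floor (xs v 0 i))%:~R.
  have pE : torus_pi (xs v + n) = torus_pi (xs v).
    by apply: lattice_shift => i; rewrite mxE rpredN intr_int.
  pose v' := pt (v 0 0) (xs v + n).
  have uE : unfold v' = unfold v by rewrite /unfold /kcover pt0 xs_pt pE.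
  have cE : box_coord v' = box_coord v by rewrite /box_coord /rep uE.
  exists v'; split=> //; rewrite ?pt0 //.
    by rewrite /box_dom /= cE uE pt0.
  rewrite xs_pt; apply: norm_le_coord => // i j; rewrite ord1 !mxE.
  have /andP[h1 h2] := floor_itv (xs v 0 j); rewrite intrD in h2.
  rewrite -xsE ger0_norm ?subr_ge0 //; lra.
- exact: box_lift.
- move=> s sin; have [v v0 ve] := unfold_range (box_start sin).
  by have [D1 E1] := box_pt_unfold (e0_small sin) v0 ve; exists v.
- move=> v Dv Ev; apply: box_exit; rewrite -Ev box_ptE //; by exists (kcover v).
Qed.

End Chart.

End Extension.

(** * From an extension to a contradiction *)

Section Inextendible.
Variable R : realType.
Local Notation e0 := (e0 R).

Tactic Notation "lra_with" ne_hyp_list(hs) := clear - hs; lra.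

Lemma boundary_point (Y : topologicalType) (U : set Y) : connected [set: Y] -> open U -> U !=set0 ->
  U <> [set: Y] -> exists p, closure U p /\ ~ U p.
Proof.
move=> cY oU U0 nU; apply: contrapT => NE; apply: nU; apply: cY => //.
- by exists U => //; rewrite setTI.
- exists U; last by rewrite setTI.
  by move=> p clp; apply: contrapT => nUp; apply: NE; exists p.
Qed.

Lemma mulmxl_cont n (P X : 'M[R]_n) : {for X, continuous (fun G : 'M[R]_n => P *m G)}.
Proof.
apply/(@cvgrPdist_le _ _ _ (nbhs X)) => e e0.
pose C : R := n%:R * `|P| + 1; have C0 : 0 < C by rewrite ltr_wpDl // mulr_ge0.
have n1 : \forall G \near X, `|X - G| < e / C.
  by apply/nbhs_ballP; exists (e / C) => [/=|y]; [rewrite divr_gt0|rewrite -ball_normE].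
apply: filterS n1 => G XG; rewrite -mulmxBr; apply: le_trans (mulmx_norm_le _ _) _.
apply: le_trans (_ : C * `|X - G| <= _); last by rewrite mulrC -ler_pdivlMr // ltW.
by rewrite /C mulrDl mul1r mulrAC lerDl.
Qed.

Lemma form_bound (N : 'M[R]_4) (u : 'rV[R]_4) : `|(u *m N *m u^T) 0 0| <= 16 * `|N| * `|u| ^+ 2.
Proof.
have ut : `|u^T| <= `|u| by apply: norm_le_coord => // i j; rewrite mxE; exact: coord_le_norm.
apply: le_trans (coord_le_norm _ _ _) _; apply: le_trans (mulmx_norm_le _ _) _.
have h : `|u *m N| <= 4 * `|N| * `|u| by exact: mulmx_norm_le.
have h1 : 4 * `|u^T| * `|u *m N| <= 4 * `|u| * (4 * `|N| * `|u|).
  by apply: ler_pM => //; rewrite ler_wpM2l.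
apply: le_trans h1 _; rewrite expr2; lra.
Qed.

Lemma sixteenth (a : R) : 0 < a -> exists2 k : R, 0 < k & 16 * k = a.
Proof. by move=> a0; exists (a / 16); lra. Qed.

(** A frame makes the metric exactly Minkowski at [p], and continuity of the coefficients does the
    rest. The tolerance 1/400 anticipates [tilt_mx], which at most doubles norms and turns it into
    1/100. *)
Lemma near_minkowski (Y : topologicalType) (A : set (chart R 4 Y)) (gY : metric R 4 Y) (c : chart R 4 Y) (p : Y) :
  is_manifold A -> is_C0_lorentz_metric A gY -> A c -> chart_dom c p ->
  exists P : 'M[R]_4, P \in unitmx /\ exists2 eta : R, 0 < eta &
    forall y, `|y - chart_map c p| < eta -> (chart_map c @` chart_dom c) y /\
      forall u : 'rV[R]_4, `|(u *m P *m gY c (chart_inv c y) *m (u *m P)^T) 0 0 - mk u| <= 1 / 400 * `|u| ^+ 2.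
Proof.
move=> [_ _ mA _ _] [lor gc _] Ac dp; have [od oi ck cc ci] := mA c Ac.
have [_ [P uP PE]] := lor c p Ac dp; exists P; split=> //.
set y0 := chart_map c p.
have Iy0 : (chart_map c @` chart_dom c) y0 by exists p.
pose M y := P *m gY c (chart_inv c y) *m P^T.
have M0 : M y0 = Defs.minkowski R 3 by rewrite /M ck.
have cM : {for y0, continuous M}.
  apply: (cont_comp (f := fun y => gY c (chart_inv c y)) (g := fun G => P *m G *m P^T)).
    apply: (cont_comp (f := chart_inv c) (g := gY c)); first exact: ci.
    by rewrite /y0 ck //; exact: gc.
  apply: (cont_comp (f := fun G : 'M[R]_4 => P *m G) (g := fun G => G *m P^T)); last exact: mulmxr_continuous.
  exact: mulmxl_cont.
have [k k0 kE] : exists2 k : R, 0 < k & 16 * k = 1 / 400 by apply: sixteenth; apply: divr_gt0; [exact: ltr01 | rewrite ltr0n].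
have n1 : \forall y \near y0, `|M y0 - M y| <= k.
  by have /cvgrPdist_le/(_ _ k0) := cM.
have n2 : nbhs y0 (chart_map c @` chart_dom c) by exact: open_nbhs_nbhs.
have [eta eta0 H] := (nbhs_rV _ _).1 (filterI n1 n2).
exists eta => // y /H[My Iy]; split=> // u.
have -> : (u *m P *m gY c (chart_inv c y) *m (u *m P)^T) 0 0 - mk u = (u *m (M y - M y0) *m u^T) 0 0.
  by rewrite mulmxBr mulmxBl [RHS]mxE [X in _ = _ + X]mxE M0 minkowskiE /M trmx_mul !mulmxA.
apply: le_trans (form_bound _ _) _; rewrite ler_wpM2r ?sqr_ge0 // distrC.
by rewrite -kE ler_wpM2l.
Qed.

Theorem kasner_inextendible : globally_C0_inextendible (@spacetime_atlas R) (@spacetime_metric R).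
Proof.
move=> [Y [A [gY [f [[mY cY] lY [ef pf] of_ nf]]]]].
have f0 : range f !=set0 by exists (f (kcover (pt 1 0))), (kcover (pt 1 0)).
have [p0 [clp np]] := boundary_point cY of_ f0 nf. clear nf.
have [_ _ mA atl _] := mY; have [c Ac dp] := atl p0.
have [od oi ck cc ci] := mA c Ac.
have [P [uP [eta eta0 HP]]] := near_minkowski mY lY Ac dp.
set y0 := chart_map c p0 in HP.
pose C : R := 4 * `|P| + 1.
have C0 : 0 < C by rewrite ltr_wpDl // mulr_ge0.
pose rho := eta / C; have rho0 : 0 < rho by rewrite divr_gt0.
have Prho (z : 'rV[R]_4) : `|z| < rho -> `|y0 + z *m P - y0| < eta.
  move=> zr; rewrite addrAC subrr add0r.
  have h : `|z *m P| <= 4 * `|P| * `|z| by exact: mulmx_norm_le.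
  apply: le_lt_trans h _; apply: le_lt_trans (_ : C * `|z| < _).
    by rewrite ler_wpM2r // /C lerDl.
  by rewrite mulrC -ltr_pdivlMr.
(* The image of the spacetime in the linear coordinates given by [P], with the boundary point at the
   origin. *)
pose S := [set z : 'rV[R]_4 | `|z| < rho /\ range f (chart_inv c (y0 + z *m P))].
have oS z : S z -> `|z| < rho -> nbhs z S.
  move=> [zr rz] _; have [Iz _] := HP _ (Prho z zr).
  have cz : {for z, continuous (fun z : 'rV[R]_4 => chart_inv c (y0 + z *m P))}.
    apply: (cont_comp (f := fun z : 'rV[R]_4 => y0 + z *m P) (g := chart_inv c)); last exact: ci.
    by apply: cont_add; [exact: cont_cst | exact: mulmxr_continuous].
  have n1 : nbhs z [set z : 'rV[R]_4 | `|z| < rho] by exact: (norm_continuous (lt_nbhsl zr)).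
  by apply: filterS2 n1 (cz _ (open_nbhs_nbhs (conj of_ rz))) => u.
have S0 : ~ S 0 by move=> [_]; rewrite mul0mx addr0 /y0 ck.
have [z1 S1 z1n] : exists2 z1, S z1 & `|z1| <= rho / 100.
  have cx : {for p0, continuous (fun x : Y => `|(chart_map c x - y0) *m invmx P|)}.
    apply: (cont_comp (f := fun x : Y => (chart_map c x - y0) *m invmx P) (g := fun z : 'rV[R]_4 => `|z|)); last exact: norm_continuous.
    apply: (cont_comp (f := fun x : Y => chart_map c x - y0) (g := fun z : 'rV[R]_4 => z *m invmx P)); last exact: mulmxr_continuous.
    by apply: cont_sub; [exact: cc | exact: cont_cst].
  have r100 : 0 < rho / 100 by rewrite divr_gt0.
  have h0 : `|(chart_map c p0 - y0) *m invmx P| < rho / 100 by rewrite subrr mul0mx normr0.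
  have n1 : nbhs p0 [set x : Y | `|(chart_map c x - y0) *m invmx P| < rho / 100] by exact: (cx _ (lt_nbhsl h0)).
  have n2 : nbhs p0 (chart_dom c) by exact: open_nbhs_nbhs.
  have [x [rx [xz dx]]] := clp _ (filterI n1 n2).
  exists ((chart_map c x - y0) *m invmx P); last exact: ltW.
  split; first by apply: lt_trans xz _; rewrite ltr_pdivrMr // ltr_pMr // ltr1n.
  by rewrite mulmxKV // addrC subrK ck.
have [p [w [l [pn [w1 wn] l0 nSp Sl]]]] := exit_line rho0 oS S0 S1 z1n.
(* [r <= l] keeps the axis in the image; [r <= rho / 8] and [tilt_norm] keep the whole box within
   [3 / 4 * rho] of the boundary point. *)
pose r := Num.min l (rho / 8).
have r0 : 0 < r by rewrite lt_min l0 divr_gt0.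
have rl : r <= l by rewrite ge_min lexx.
have rr : r <= rho / 8 by rewrite ge_min lexx orbT.
pose ys := y0 + p *m P; pose T := tilt_mx w *m P.
have w0 : w 0 0 != 0 by apply/eqP => e; move: w1; rewrite e expr0n /= => /eqP; rewrite eq_sym oner_eq0.
have uT : T \in unitmx by rewrite unitmx_mul uP tilt_unit.
have yz z : ys + z *m T = y0 + (p + z *m tilt_mx w) *m P by rewrite /ys /T mulmxDl mulmxA addrA.
have zr (z : 'rV[R]_4) : `|z| < r -> `|p + z *m tilt_mx w| < rho.
  move=> h; apply: le_lt_trans (ler_normD _ _) _; have := tilt_norm z w1 wn; lra_with h rr pn rho0.
have im (z : 'rV[R]_4) : `|z| < r -> (chart_map c @` chart_dom c) (ys + z *m T).
  by move=> /zr/Prho/HP[]; rewrite yz.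
have form (z u : 'rV[R]_4) : `|z| < r -> `|box_form gY c ys T z u - mk (u *m tilt_mx w)| <= 1 / 100 * `|u| ^+ 2.
  move=> /zr/Prho/HP[_ H]; have := H (u *m tilt_mx w).
  rewrite /box_form /box_pt yz /T mulmxA => h; apply: le_trans h _.
  have := tilt_norm u w1 wn; have n0 := normr_ge0 u => h.
  have : `|u *m tilt_mx w| ^+ 2 <= (2 * `|u|) ^+ 2 by rewrite ler_sqr ?nnegrE // mulr_ge0.
  lra_with n0.
apply: (box_chart_false (extension_box_chart mY ef pf of_ Ac uT r0 im _ _ _ _ _)).
- move=> z u zr' nu.
  have xu (j : 'I_3) : `|xs u 0 j| <= u 0 0 / 8 by rewrite xsE; case: (nu (@rshift 1 3 j)).
  have u0 : 0 <= u 0 0 by have := xu 0; have := normr_ge0 (xs u 0 0); lra_with u.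
  have un : `|u| <= u 0 0.
    apply: norm_le_coord => // i; rewrite ord1; apply: time_space; first by rewrite ger0_norm.
    move=> j; rewrite -xsE; have := xu j; lra_with u0.
  have := form z u zr'; have := mk_N w1 wn u0 xu.
  have : `|u| ^+ 2 <= u 0 0 ^+ 2 by rewrite ler_sqr ?nnegrE.
  have := sqr_ge0 (u 0 0); set b := box_form _ _ _ _ _ _; set m := mk _.
  by rewrite ler_norml => h1 h2 h3 /andP[_ h4]; clearbody b m; lra_with h1 h2 h3 h4.
- move=> z u zr' q0; apply: time_space; first by have := normr_ge0 (u 0 0); lra_with u.
  move=> j; rewrite -xsE leNgt; apply/negP => h.
  (* The largest space component bounds the norm of [u], so the error term is small against the
     lower bound of [mk_W]. *)
  have [k _ kmax] : exists2 k : 'I_3, true & forall i, `|xs u 0 i| <= `|xs u 0 k|.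
    by case: (@Order.TotalTheory.arg_maxP _ _ _ j xpredT (fun i => `|xs u 0 i|)) => // k _ H; exists k => // i; exact: H.
  set n := `|xs u 0 k| in kmax.
  have nk : 2 * `|u 0 0| < n by exact: lt_le_trans h (kmax j).
  have n0 : 0 < n by apply: le_lt_trans nk; rewrite mulr_ge0.
  have un : `|u| <= n.
    apply: norm_le_coord => [|i]; first exact: ltW.
    rewrite ord1; apply: time_space; first by have := normr_ge0 (u 0 0); lra_with nk.
    by move=> i'; rewrite -xsE.
  have := form z u zr'; have := mk_W w1 wn nk.
  have : `|u| ^+ 2 <= n ^+ 2 by rewrite ler_sqr ?nnegrE // ltW.
  have := exprn_gt0 2 n0; rewrite -/n; move: q0; set b := box_form _ _ _ _ _ _; set m := mk _.
  by rewrite ler_norml => h0 h1 h2 h3 /andP[h4 _]; clearbody b m; lra_with h0 h1 h2 h3 h4.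
- move=> z u zr'; have := form z u zr'; have := mk_U u w1 wn; have := sqr_ge0 `|u|.
  set b := box_form _ _ _ _ _ _; set m := mk _.
  by rewrite !ler_norml => h1 /andP[h2 h3] /andP[h4 h5]; clearbody b m; apply/andP; split; lra_with h1 h2 h3 h4 h5.
- move=> s /andP[s1 s2]; rewrite /box_pt yz tilt_mxE.
  have -> : (s *: e0) 0 0 *: w + emb (xs (s *: e0)) = s *: w.
    by rewrite xsZ xs_e0 scaler0 emb_0 addr0 !mxE /= mulr1.
  have [|_] := Sl s; last by [].
  by rewrite s2 andbT; apply: le_lt_trans s1; rewrite lerN2.
- rewrite /box_pt mul0mx addr0 => h; apply: nSp; split=> //; lra.
Qed.

End Inextendible.

(** * The spacetime manifold *)

Section Manifold.
Variable R : realType.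
Local Notation X := (spacetime R).

Lemma hausdorff_separates (T U : topologicalType) (f : T -> U) (p q : T) :
  hausdorff_space U -> {for p, continuous f} -> {for q, continuous f} ->
  cluster (nbhs p) q -> f p = f q.
Proof.
move=> hU cp cq cl; apply: hU => A B nA nB.
by have [x [Ax Bx]] := cl _ _ (cp _ nA) (cq _ nB); exists (f x).
Qed.

Lemma spacetime_hausdorff : hausdorff_space X.
Proof.
move=> [s p] [s' p'] cl.
have c1 (x : X) : {for x, continuous (fun m : X => set_val m.1 : R)}.
  apply: (cont_comp (f := fst) (g := set_val)); first exact: cvg_fst.
  exact: initial_continuous.
have e1 := hausdorff_separates (@Rhausdorff R) (c1 _) (c1 _) cl.
have e2 := hausdorff_separates (f := snd) (@torus_hausdorff R) cvg_snd cvg_snd cl.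
by congr (_, _); [exact: val_inj | exact: e2].
Qed.

Lemma rational_approx n (v : 'rV[R]_n) (e : R) : 0 < e ->
  exists q : 'rV[rat]_n, `|v - map_mx ratr q| < e.
Proof.
move=> e0; have H i : exists r : rat, `|v 0 i - ratr r| < e.
  have le : v 0 i < v 0 i + e by rewrite ltrDl.
  have [q] := rat_in_itvoo le; rewrite in_itv /= => /andP[q1 q2].
  by exists q; rewrite ltr_norml; apply/andP; split; lra.
have [q Hq] := boolp.choice H.
exists (\row_i q i); apply: norm_lt_coord => // i j.
by rewrite ord1 !mxE; exact: Hq.
Qed.

Definition rational_box (i : 'rV[rat]_4 * nat) : set X :=
  @kcover R @` (ball (map_mx ratr i.1 : 'rV[R]_4) i.2.+1%:R^-1 `&` [set v : 'rV[R]_4 | 0 < v 0 0]).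

(** The covering map is open, so the images of rational balls cut to positive time form a countable
    base. *)
Lemma spacetime_second_countable : @second_countable X.
Proof.
exists (range rational_box).
  apply: sub_countable (card_image_le _ _) _; exact: countableP.
split=> [_ [i _ <-]|m N nN].
  apply: kcover_open => [|v []//]; apply: openI; first exact: ball_open.
  have -> : [set v : 'rV[R]_4 | 0 < v 0 0] = (fun v : 'rV[R]_4 => v 0 0) @^-1` [set t | 0 < t] by [].
  by apply: open_comp => [v _|]; [exact: coord_cont | exact: open_gt].
have [v [v0 vm]] := kcover_surj m; rewrite -vm in nN.
have [e e0 H] := (nbhs_rV _ _).1 (kcover_continuous v0 nN).
have [k] := ltr_add_invr (divr_gt0 e0 (ltr0n R 2)); rewrite add0r => ke.
have k0 : 0 < k.+1%:R^-1 :> R by rewrite invr_gt0.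
have [q qv] := rational_approx v k0.
exists (rational_box (q, k)).
  split; first by exists (q, k).
  by exists v => //; split=> //; rewrite -ball_normE /= distrC.
move=> _ [u [+ u0] <-]; rewrite -ball_normE /= => qu; apply: H.
have -> : u - v = - (map_mx ratr q - u) - (v - map_mx ratr q) by vring.
apply: le_lt_trans (ler_normB _ _) _; rewrite normrN; apply: lt_trans (ltrD qu qv) _.
have -> : e = e / 2 + e / 2 by lra.
exact: ltrD.
Qed.

(** The half-space of positive times is star-shaped about [e0]. *)
Lemma spacetime_connected : connected [set: X].
Proof.
have -> : [set: X] = \bigcup_(v in [set v : 'rV[R]_4 | 0 < v 0 0])
    ((fun s : R => kcover (e0 R + s *: (v - e0 R))) @` `[0, 1]).
  apply/esym/seteqP; split=> // m _; have [v [v0 vm]] := kcover_surj m.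
  by exists v => //; exists 1; [rewrite /= in_itv /= ler01 lexx | rewrite scale1r addrC subrK].
apply: bigcup_connected.
  exists (kcover (e0 R)) => v _; exists 0; first by rewrite /= in_itv /= ler01 lexx.
  by rewrite scale0r addr0.
move=> v v0; apply: connected_continuous_connected; first exact: segment_connected.
apply: continuous_in_subspaceT => s /set_mem; rewrite /= in_itv /= => /andP[s0 s1].
apply: (cont_comp (f := fun s : R => e0 R + s *: (v - e0 R)) (g := @kcover R)).
  by apply: cont_add; [exact: cont_cst | exact: cvgZr_tmp].
apply: kcover_continuous; rewrite !mxE /=; rewrite /= in v0.
by have := mulr_ge0 s0 (ltW v0); nra.
Qed.

(** Both charts read the same time, and their space parts lift the same torus point, so [lift_near]
    makes the transition a local translation. *)
Lemma transition_near (c c' : chart R 4 X) (x : X) :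
  spacetime_atlas c -> spacetime_atlas c' -> chart_dom c x -> chart_dom c' x ->
  exists k, \forall u \near chart_map c x, local_rep c c' id u = u + k.
Proof.
move=> [[od oi ck cc ci] cE] [[od' _ ck' cc' _] cE'] dx dx'; rewrite /local_rep.
set v := chart_map c x; have Iv : (chart_map c @` chart_dom c) v by exists x.
have n1 : \forall u \near v, (chart_map c @` chart_dom c) u by exact: open_nbhs_nbhs.
have n2 : \forall u \near v, chart_dom c' (chart_inv c u).
  by apply: (ci v Iv); apply: open_nbhs_nbhs; split=> //; rewrite ck.
have cv : {for v, continuous (fun u => chart_map c' (chart_inv c u))}.
  by apply: (cont_comp (f := chart_inv c) (g := chart_map c')); [exact: ci | rewrite ck //; exact: cc'].
have near_space : \forall u \near v, xs (chart_map c' (chart_inv c u)) = xs u + (xs (chart_map c' (chart_inv c v)) - xs v).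
  apply: lift_near.
  - exact: (cont_comp (g := @xs R) cv (@xs_continuous _ _)).
  - exact: xs_continuous.
  - apply: filterS2 n1 n2 => _ [m dm <-]; rewrite ck // => dm'.
    by have [_ ->] := cE m dm; have [_ ->] := cE' m dm'.
exists (emb (xs (chart_map c' (chart_inv c v)) - xs v)).
have n12 : \forall u \near v, (chart_map c @` chart_dom c) u /\ chart_dom c' (chart_inv c u) by exact: filterI.
apply: filterS2 n12 near_space => u [[m dm mu] dm'] xu.
rewrite [LHS]split4 xu [u in RHS]split4 -addrA; congr (_ *: _ + _).
  rewrite -mu ck // in dm' *.
  by have [-> _] := cE m dm; have [-> _] := cE' m dm'.
by apply/rowP => i; rewrite !mxE; case: splitP => j _; rewrite !mxE ?addr0.
Qed.

End Manifold.

(** * Smoothness and curvature *)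

Section Smooth.
Variable R : realType.

Lemma open_near n (U : set 'rV[R]_n) (P : 'rV[R]_n -> Prop) x :
  open U -> U x -> (forall y, U y -> P y) -> \forall y \near x, P y.
Proof. by move=> oU Ux H; apply: filterS H _; exact: open_nbhs_nbhs. Qed.

Lemma Ck_on_eq n (W : normedModType R) k (U : set 'rV[R]_n) (f g : 'rV[R]_n -> W) :
  open U -> (forall x, U x -> f x = g x) -> Ck_on k U g -> Ck_on k U f.
Proof.
move=> oU; elim: k f g => [|k IH] f g fg /=.
  by move=> cg x Ux; apply: cont_near (cg x Ux); exact: open_near fg.
move=> H i; have [dg Dg] := H i.
have fgx x : U x -> \forall y \near x, f y = g y by move=> Ux; exact: open_near fg.
split=> [x Ux|].
  by apply: near_eq_derivable (dg x Ux); apply: filterS (fgx x Ux) => y ->.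
by apply: IH Dg => x Ux; exact: near_eq_derive (fgx x Ux).
Qed.

Lemma Ck_on_cst n (W : normedModType R) k (U : set 'rV[R]_n) (a : W) :
  Ck_on k U (fun=> a).
Proof.
elim: k a => [|k IH] a /=; first by move=> x _; exact: cont_cst.
move=> i; split=> [x _|]; first exact: derivable_cst.
have -> : (fun x : 'rV[R]_n => 'D_(delta_mx 0 i) (fun=> a) x) = fun=> 0.
  by apply/funext => x; exact: derive_cst.
exact: IH.
Qed.

Lemma Ck_on_add n (W : normedModType R) k (U : set 'rV[R]_n) (f g : 'rV[R]_n -> W) :
  open U -> Ck_on k U f -> Ck_on k U g -> Ck_on k U (fun x => f x + g x).
Proof.
move=> oU; elim: k f g => [|k IH] f g /=.
  by move=> cf cg x Ux; apply: cont_add; [exact: cf | exact: cg].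
move=> Hf Hg i; have [df Df] := Hf i; have [dg Dg] := Hg i; split=> [x Ux|].
  by apply: derivableD; [exact: df | exact: dg].
apply: (Ck_on_eq oU _ (IH _ _ Df Dg)) => x Ux.
by apply: deriveD; [exact: df | exact: dg].
Qed.

Lemma smooth_translation n k (U : set 'rV[R]_n) (f : 'rV[R]_n -> 'rV[R]_n) : open U ->
  (forall x, U x -> exists a, \forall y \near x, f y = y + a) -> Ck_on k U f.
Proof.
move=> oU H; case: k => [|k] /=.
  move=> x Ux; have [a Ha] := H x Ux.
  by apply: (cont_near Ha); apply: cont_add; [exact: cvg_id | exact: cont_cst].
move=> i.
have D x : U x -> derivable f x (delta_mx 0 i) /\ 'D_(delta_mx 0 i) f x = delta_mx 0 i.
  move=> Ux; have [a Ha] := H x Ux; have [d J] := jacobian_translation Ha.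
  split; first exact: diff_derivable.
  by rewrite deriveEjacobian // J mulmx1.
split=> [x /D[]//|].
by apply: (Ck_on_eq oU _ (Ck_on_cst k U (delta_mx 0 i))) => x /D[].
Qed.

Lemma is_derive_time (W : normedModType R) (f : R -> W) (v : 'rV[R]_4) (i : 'I_4) (df : W) :
  is_derive (v 0 0) 1 f df ->
  is_derive v (delta_mx 0 i) (fun u : 'rV[R]_4 => f (u 0 0)) ((i == 0)%:R *: df).
Proof.
move=> d.
have E (h : R) : (h *: (delta_mx 0 i : 'rV[R]_4) + v) 0 0 = h * (i == 0)%:R + v 0 0.
  by rewrite !mxE eqxx eq_sym.
case: (eqVneq i 0) => [i0|i0]; last first.
  have Z : (fun h : R => h^-1 *: (f ((h *: (delta_mx 0 i : 'rV[R]_4) + v) 0 0) - f (v 0 0))) = fun=> 0.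
    by apply/funext => h; rewrite E (negbTE i0) mulr0 add0r subrr scaler0.
  rewrite scale0r.
  split; first by rewrite /derivable Z; exact: is_cvg_cst.
  by rewrite /derive Z lim_cst.
have Z : (fun h : R => h^-1 *: (f ((h *: (delta_mx 0 i : 'rV[R]_4) + v) 0 0) - f (v 0 0))) =
    (fun h : R => h^-1 *: (f (h *: (1 : R^o) + v 0 0) - f (v 0 0))).
  by apply/funext => h; rewrite E i0 eqxx.
case: d => d1 d2; rewrite scale1r.
by split; [rewrite /derivable Z | rewrite /derive Z].
Qed.

Lemma is_derive_scalel (W : normedModType R) (f : R -> R) (t df : R) (a : W) :
  is_derive t 1 f df -> is_derive t 1 (fun s => f s *: a) (df *: a).
Proof.
move=> [d1 d2].
have c : (h^-1 *: (f (h *: (1 : R^o) + t) *: a - f t *: a)) @[h --> 0^'] --> df *: a.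
  have -> : (fun h : R => h^-1 *: (f (h *: (1 : R^o) + t) *: a - f t *: a)) =
      (fun h : R => (h^-1 *: (f (h *: (1 : R^o) + t) - f t)) *: a).
    by apply/funext => h; rewrite -scalerBl scalerA.
  by apply: cvgZr_tmp; rewrite -d2; exact: d1.
by split; [apply/cvg_ex; exists (df *: a) | exact: cvg_lim c].
Qed.

Lemma is_derive_powRZ (W : normedModType R) (p t : R) (a : W) : 0 < t ->
  is_derive t 1 (fun s : R => s `^ p *: a) ((p * t `^ (p - 1)) *: a).
Proof. by move=> t0; apply: is_derive_scalel; exact: is_derive1_powR. Qed.

(** The exponent and the coefficient are general, so that partial derivatives have the same shape
    and the induction closes. *)
Lemma Ck_on_powR (W : normedModType R) k (U : set 'rV[R]_4) (p : R) (a : W) :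
  open U -> (forall v : 'rV[R]_4, U v -> 0 < v 0 0) -> Ck_on k U (fun v : 'rV[R]_4 => v 0 0 `^ p *: a).
Proof.
move=> oU U0; elim: k p a => [|k IH] p a /=.
  move=> v Uv; apply: (cont_comp (f := fun v : 'rV[R]_4 => v 0 0) (g := fun s => s `^ p *: a)); first exact: coord_cont.
  have [d _] := is_derive_powRZ p a (U0 v Uv).
  by apply: differentiable_continuous; apply/derivable1_diffP.
move=> i; have D v : U v -> is_derive v (delta_mx 0 i) (fun v : 'rV[R]_4 => v 0 0 `^ p *: a)
    ((i == 0)%:R *: ((p * v 0 0 `^ (p - 1)) *: a)).
  by move=> Uv; exact: is_derive_time (is_derive_powRZ p a (U0 v Uv)).
split=> [v /D[]//|].
apply: (Ck_on_eq oU _ (IH (p - 1) (((i == 0)%:R * p) *: a))) => v /D[_ ->].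
by rewrite !scalerA; congr (_ *: _); ring.
Qed.

End Smooth.

(** * The Ricci tensor of the Kasner metric *)

Section Ricci.
Variable R : realType.
Local Notation e0 := (e0 R).

Definition inner n (u w : 'rV[R]_n) : R := (u *m w^T) 0 0.

Lemma covector_form n (u w v : 'rV[R]_n) : (u *m covector_sq w *m v^T) 0 0 = inner u w * inner v w.
Proof.
rewrite /covector_sq mulmxA -mulmxA mxE big_ord1 /inner; congr (_ * _).
by rewrite -[w *m v^T]trmxK trmx_mul trmxK mxE.
Qed.

Lemma covector_sq_mul n (u w : 'rV[R]_n) : covector_sq u *m covector_sq w = inner u w *: (u^T *m w).
Proof.
rewrite /covector_sq mulmxA -(mulmxA u^T) /inner.
by rewrite {1}[u *m w^T]mx11_scalar -mulmxA mul_scalar_mx -scalemxAr.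
Qed.

Lemma covector_sq_tr n (u : 'rV[R]_n) : \tr (covector_sq u) = inner u u.
Proof. by rewrite mxtrace_mulC /mxtrace big_ord1. Qed.

Lemma covector_sqT n (u : 'rV[R]_n) : (covector_sq u)^T = covector_sq u.
Proof. by rewrite trmx_mul trmxK. Qed.

Lemma covector_sqE n (u : 'rV[R]_n) i j : covector_sq u i j = u 0 i * u 0 j.
Proof. by rewrite mxE big_ord1 mxE. Qed.

Lemma inner_emb (u w : 'rV[R]_3) : inner (emb u) (emb w) = inner u w.
Proof. by rewrite /inner /emb (@tr_row_mx R 1 1 3) (@mul_row_col R 1 1 3) trmx0 mulmx0 add0r. Qed.

Lemma inner_e0_emb (w : 'rV[R]_3) : inner e0 (emb w) = 0 /\ inner (emb w) e0 = 0.
Proof.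
have H : inner (emb w) e0 = 0.
  by rewrite /inner trmx_delta -colE mxE emb0.
by split=> //; rewrite /inner -[_ *m _]trmxK trmx_mul trmxK mxE.
Qed.

Lemma inner_e0 : inner e0 e0 = 1.
Proof. by rewrite /inner trmx_delta -colE !mxE. Qed.

Lemma eta_inner : [/\ inner (eta1 R) (eta1 R) = 1, inner (eta2 R) (eta2 R) = 1, inner (dz R) (dz R) = 1,
  inner (eta1 R) (eta2 R) = 0 & inner (eta1 R) (dz R) = 0 /\ inner (eta2 R) (dz R) = 0].
Proof.
have c0 := c_golden_gt0 R; have cs : (c_golden R)^-1 ^+ 2 * (1 + golden R ^+ 2) = 1.
  by rewrite -c_golden_sq exprVn mulVf // expf_neq0 // gt_eqF.
rewrite /inner; split; rewrite ?[in RHS]/= !mxE !sum3 !mxE /=; try lra.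
Qed.

Lemma eta_complete : covector_sq (eta1 R) + covector_sq (eta2 R) + covector_sq (dz R) = 1%:M.
Proof.
have c0 := c_golden_gt0 R; have cs : (c_golden R)^-1 ^+ 2 * (1 + golden R ^+ 2) = 1.
  by rewrite -c_golden_sq exprVn mulVf // expf_neq0 // gt_eqF.
by apply/matrixP; do 2!apply: forall3; rewrite !mxE !big_ord1 !mxE /=; lra.
Qed.

(** With the two that follow, the orthogonal projections onto eigenspaces common to the metric, its
    inverse and its time derivatives; products of such matrices reduce to products of
    eigenvalues. *)
Definition time_proj : 'M[R]_4 := covector_sq e0.
Definition axis_proj : 'M[R]_4 := covector_sq (emb (eta1 R)).
Definition plane_proj : 'M[R]_4 := covector_sq (emb (eta2 R)) + covector_sq (emb (dz R)).
Local Notation F0 := time_proj.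
Local Notation F1 := axis_proj.
Local Notation F2 := plane_proj.

Lemma covector_sq_emb (w : 'rV[R]_3) : covector_sq (emb w) = @block_mx R 1 3 1 3 0 0 0 (covector_sq w).
Proof. by rewrite /covector_sq /emb (@tr_row_mx R 1 1 3) (@mul_col_row R 1 3 1 1 3) trmx0 !(mul0mx, mulmx0). Qed.

Lemma time_projE : F0 = @block_mx R 1 3 1 3 1%:M 0 0 0.
Proof.
have -> : F0 = delta_mx 0 0 by rewrite /F0 /covector_sq trmx_delta mul_delta_mx.
have z : (0 : 'I_4) = lshift 3 (0 : 'I_1) by exact: val_inj.
apply/matrixP; do 2!(apply: time_space => [|?]); rewrite [LHS]mxE /=.
- by rewrite z (@block_mxEul R 1 3 1 3) mxE.
- by rewrite z (@block_mxEur R 1 3 1 3) mxE.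
- by rewrite z (@block_mxEdl R 1 3 1 3) mxE.
- by rewrite (@block_mxEdr R 1 3 1 3) mxE.
Qed.

Lemma kasner_gram_proj t : kasner_gram t = - F0 + t `^ (- (2 / 3)) *: F1 + t `^ (4 / 3) *: F2.
Proof.
rewrite /F1 /F2 !covector_sq_emb time_projE /kasner_gram /h_gram.
rewrite !(@scale_block_mx R 1 3 1 3, @opp_block_mx R 1 3 1 3, @add_block_mx R 1 3 1 3, scaler0, addr0, oppr0, add0r).
by rewrite raddfN.
Qed.

Lemma proj_mul : [/\ F0 *m F0 = F0, F1 *m F1 = F1, F2 *m F2 = F2 &
  [/\ F0 *m F1 = 0, F0 *m F2 = 0, F1 *m F2 = 0 & [/\ F1 *m F0 = 0, F2 *m F0 = 0 & F2 *m F1 = 0]]].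
Proof.
have [a b c d [e f]] := eta_inner.
have sym (u w : 'rV[R]_3) : inner u w = inner w u by rewrite /inner -[_ *m _]trmxK trmx_mul trmxK mxE.
by split; last split; last split;
  rewrite /F0 /F1 /F2 ?mulmxDl ?mulmxDr !covector_sq_mul ?inner_emb ?inner_e0 ?(inner_e0_emb _).1 ?(inner_e0_emb _).2
  ?a ?b ?c ?d ?e ?f ?(sym (eta2 R) (eta1 R)) ?(sym (dz R) _) ?d ?e ?f ?scale0r ?scale1r ?addr0 ?add0r.
Qed.

Lemma proj_sum : F0 + F1 + F2 = 1%:M.
Proof.
rewrite /F1 /F2 !covector_sq_emb time_projE !(@add_block_mx R 1 3 1 3) !addr0 !add0r addrA eta_complete.
by rewrite -(@scalar_mx_block R 1 3).
Qed.

Lemma proj_T : [/\ F0^T = F0, F1^T = F1 & F2^T = F2].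
Proof. by split; rewrite ?raddfD /= !covector_sqT. Qed.

Lemma proj_tr : \tr F1 = 1 /\ \tr F2 = 2.
Proof.
have [a b c _ _] := eta_inner.
by split; rewrite ?mxtraceD !covector_sq_tr !inner_emb ?a // b c.
Qed.

Lemma proj_entry0 (i : 'I_4) : [/\ F1 0 i = 0, F1 i 0 = 0, F2 0 i = 0 & F2 i 0 = 0].
Proof.
have h (w : 'rV[R]_3) : covector_sq (emb w) 0 i = 0 by rewrite covector_sqE emb0 mul0r.
have h' (w : 'rV[R]_3) : covector_sq (emb w) i 0 = 0 by rewrite covector_sqE emb0 mulr0.
by split; [exact: h | exact: h' | rewrite [LHS]mxE !h addr0 | rewrite [LHS]mxE !h' addr0].
Qed.

(** The case of a metric -dt^2 + h with [h] depending on time only: [S] stands for h^(-1) h', [S1]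
    for its derivative, [G1] and [G2] for h' and h'', and [g] is the Christoffel symbol. As all
    these matrices vanish in the time row and column, the Kronecker factors [d] collapse the
    sums. *)
Lemma ricci_sum (S S1 G1 G2 : 'M[R]_4) (i j : 'I_4) :
  (forall k, S 0 k = 0) -> (forall k, S k 0 = 0) -> (forall k, S1 0 k = 0) -> (forall k, S1 k 0 = 0) ->
  (forall k, G1 0 k = 0) -> (forall k, G1 k 0 = 0) -> (forall k, G2 0 k = 0) -> (forall k, G2 k 0 = 0) ->
  let d (k : 'I_4) : R := (k == 0)%:R in
  let g (S G1 : 'M[R]_4) k i j := 2^-1 * (d i * S k j + d j * S k i + d k * G1 i j) in
  \sum_k (d k * g S1 G2 k i j - d j * g S1 G2 k i k) +
  \sum_k \sum_l (g S G1 k k l * g S G1 l i j - g S G1 k j l * g S G1 l i k) =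
  2^-1 * G2 i j - 2^-1 * d i * d j * \tr S1 + 4^-1 * \tr S * G1 i j - 4^-1 * d i * d j * \tr (S *m S)
  - 4^-1 * ((G1 *m S) i j + (G1 *m S) j i).
Proof.
move=> S0 S0' S10 S10' G10 G10' G20 G20' d g.
have sd (F : 'I_4 -> R) : \sum_k d k * F k = F 0.
  rewrite (bigD1 0) //= big1 => [|k k0]; first by rewrite /d eqxx mul1r addr0.
  by rewrite /d (negbTE k0) mul0r.
have tr (T H : 'M[R]_4) a : (forall k, T 0 k = 0) -> (forall k, H k 0 = 0) ->
    \sum_k g T H k a k = 2^-1 * d a * \tr T.
  move=> T0 H0; rewrite -mulr_sumr !big_split /= -mulr_sumr !sd T0 H0 !addr0 mulrA.
  by rewrite /mxtrace.
have tr' (T H : 'M[R]_4) l : (forall k, T 0 k = 0) -> (forall k, H 0 k = 0) ->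
    \sum_k g T H k k l = 2^-1 * d l * \tr T.
  move=> T0 H0; rewrite -mulr_sumr !big_split /= sd -mulr_sumr sd T0 H0 add0r addr0 mulrA.
  by rewrite /mxtrace.
have P k l : g S G1 k j l * g S G1 l i k =
    4^-1 * (d j * d i * (S k l * S l k) + d l * (G1 i k * S k j) + d k * (G1 j l * S l i)).
  rewrite /g /d; have [->|_] := eqVneq k 0; have [->|_] := eqVneq l 0;
    rewrite ?eqxx ?(S0, S0', G10, G10') /=; by field.
have -> : \sum_k \sum_l (g S G1 k k l * g S G1 l i j - g S G1 k j l * g S G1 l i k) =
    4^-1 * \tr S * G1 i j - 4^-1 * (d j * d i * \tr (S *m S) + (G1 *m S) i j + (G1 *m S) j i).
  under eq_bigr do rewrite sumrB.
  rewrite sumrB exchange_big /=; congr (_ - _).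
    transitivity (\sum_l d l * (2^-1 * \tr S * g S G1 l i j)).
      by apply: eq_bigr => l _; rewrite -mulr_suml tr' //; ring.
    by rewrite sd /g !S0 /d eqxx /=; field.
  transitivity (\sum_k 4^-1 * (d j * d i * (\sum_l S k l * S l k) + G1 i k * S k j + d k * \sum_l G1 j l * S l i)).
    apply: eq_bigr => k _; rewrite (eq_bigr _ (fun l _ => P k l)) -mulr_sumr !big_split /= sd.
    by rewrite -!mulr_sumr.
  rewrite -mulr_sumr !big_split /= -mulr_sumr sd !mxE /mxtrace.
  by under [in RHS]eq_bigr do rewrite mxE.
rewrite sumrB sd -mulr_sumr tr // /g !S10 /d eqxx /=; ring.
Qed.

End Ricci.

Section Curvature.
Variable R : realType.
Local Notation F0 := (time_proj R).
Local Notation F1 := (axis_proj R).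
Local Notation F2 := (plane_proj R).

Lemma powR_pred (t p : R) : 0 < t -> t `^ (p - 1) = t `^ p * t^-1.
Proof. by move=> t0; rewrite powRB ?powRr1 ?(ltW t0) ?(gt_eqF t0) ?implybT. Qed.

Lemma near_eq_partial n (f g : 'rV[R]_n -> R) (v : 'rV[R]_n) i :
  (\forall u \near v, f u = g u) -> partial_deriv i f v = partial_deriv i g v.
Proof. exact: near_eq_derive. Qed.

Lemma near_eq_christoffel n (G G' : 'rV[R]_n -> 'M[R]_n) (v : 'rV[R]_n) k i j :
  (\forall u \near v, G u = G' u) -> christoffel G k i j v = christoffel G' k i j v.
Proof.
move=> H; rewrite /christoffel (nbhs_singleton H); congr (_ * _); apply: eq_bigr => l _.
have E a b c : partial_deriv c (fun u => G u a b) v = partial_deriv c (fun u => G' u a b) v.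
  by apply: near_eq_partial; apply: filterS H => u ->.
by rewrite !E.
Qed.

Lemma near_eq_ricci n (G G' : 'rV[R]_n -> 'M[R]_n) (v : 'rV[R]_n) i j :
  (\forall u \near v, G u = G' u) -> ricci G i j v = ricci G' i j v.
Proof.
move=> H; rewrite /ricci.
have C k a b : christoffel G k a b v = christoffel G' k a b v by exact: near_eq_christoffel.
have D c k a b : partial_deriv c (christoffel G k a b) v = partial_deriv c (christoffel G' k a b) v.
  apply: near_eq_partial; have /nbhs_interior H' := H.
  by apply: filterS H' => u; exact: near_eq_christoffel.
apply: f_equal2; first by apply: eq_bigr => k _; rewrite (D k) (D j).
by apply: eq_bigr => k _; apply: eq_bigr => l _; rewrite !C.
Qed.

Lemma partial_time (f : R -> R) (v : 'rV[R]_4) i df : is_derive (v 0 0) 1 f df ->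
  partial_deriv i (fun u : 'rV[R]_4 => f (u 0 0)) v = (i == 0)%:R * df.
Proof. by move=> /(is_derive_time i)[_]. Qed.

Definition gram_dot (t : R) : 'M[R]_4 :=
  (- (2 / 3) * t `^ (- (2 / 3) - 1)) *: F1 + (4 / 3 * t `^ (4 / 3 - 1)) *: F2.
(** The coefficients are left as the power rule produces them. *)
Definition gram_ddot (t : R) : 'M[R]_4 :=
  ((- (2 / 3) - 1) * t `^ (- (2 / 3) - 1 - 1)) *: (- (2 / 3) *: F1) + ((4 / 3 - 1) * t `^ (4 / 3 - 1 - 1)) *: ((4 / 3) *: F2).
(** The eigenvalues are twice the Kasner exponents -1/3, 2/3, 2/3. *)
Definition exponents : 'M[R]_4 := - (2 / 3) *: F1 + (4 / 3) *: F2.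
Definition shape (t : R) : 'M[R]_4 := t `^ (-1) *: exponents.
Definition shape_dot (t : R) : 'M[R]_4 := (-1 * t `^ (-1 - 1)) *: exponents.

Lemma is_derive_entry m n (f : R -> 'M[R]_(m, n)) (df : 'M[R]_(m, n)) (t : R) i j :
  is_derive t 1 f df -> is_derive t 1 (fun s => f s i j) (df i j).
Proof.
by move=> [d1 d2]; have := is_derive_coord i j d1; rewrite derive1E d2.
Qed.

Lemma kasner_gram_derive (t : R) : 0 < t -> is_derive t 1 (@kasner_gram R) (gram_dot t).
Proof.
move=> t0; have -> : @kasner_gram R = fun s => (- F0 + s `^ (- (2 / 3)) *: F1) + s `^ (4 / 3) *: F2.
  by apply/funext => s; exact: kasner_gram_proj.
rewrite /gram_dot -[X in X + _]add0r.
apply: is_deriveD; last exact: is_derive_powRZ.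
apply: is_deriveD; last exact: is_derive_powRZ.
Qed.

Lemma gram_dot_derive (t : R) : 0 < t -> is_derive t 1 gram_dot (gram_ddot t).
Proof.
move=> t0; have -> : gram_dot = fun s => s `^ (- (2 / 3) - 1) *: (- (2 / 3) *: F1) + s `^ (4 / 3 - 1) *: ((4 / 3) *: F2).
  by apply/funext => s; rewrite /gram_dot !scalerA ![_ `^ _ * _]mulrC.
by apply: is_deriveD; exact: is_derive_powRZ.
Qed.

Lemma shape_derive (t : R) : 0 < t -> is_derive t 1 shape (shape_dot t).
Proof. exact: is_derive_powRZ. Qed.

Definition proj_comb (a b c : R) : 'M[R]_4 := a *: F0 + b *: F1 + c *: F2.

Lemma proj_comb_mul a b c a' b' c' :
  proj_comb a b c *m proj_comb a' b' c' = proj_comb (a * a') (b * b') (c * c').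
Proof.
have [m00 m11 m22 [m01 m02 m12 [m10 m20 m21]]] := proj_mul R.
rewrite /proj_comb !(mulmxDl, mulmxDr) -!(scalemxAl, scalemxAr) m00 m11 m22 m01 m02 m12 m10 m20 m21.
by rewrite !scaler0 !(addr0, add0r) !scalerA.
Qed.

Lemma proj_combT a b c : (proj_comb a b c)^T = proj_comb a b c.
Proof.
have [s0 s1 s2] := proj_T R; rewrite /proj_comb.
by apply/matrixP => i j; rewrite -[in LHS]s0 -[in LHS]s1 -[in LHS]s2 !mxE.
Qed.

Lemma proj_comb_tr b c : \tr (proj_comb 0 b c) = b + 2 * c.
Proof.
have [tr1 tr2] := proj_tr R.
by rewrite /proj_comb scale0r add0r mxtraceD !mxtraceZ tr1 tr2; ring.
Qed.

Lemma proj_comb_ij b c i j : proj_comb 0 b c i j = b * F1 i j + c * F2 i j.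
Proof. by rewrite /proj_comb scale0r add0r [LHS]mxE; congr (_ + _); rewrite [LHS]mxE. Qed.

Lemma proj_comb0k b c k : proj_comb 0 b c 0 k = 0.
Proof. by have [x _ z _] := proj_entry0 R k; rewrite proj_comb_ij x z !mulr0 addr0. Qed.

Lemma proj_combk0 b c k : proj_comb 0 b c k 0 = 0.
Proof. by have [_ x _ z] := proj_entry0 R k; rewrite proj_comb_ij x z !mulr0 addr0. Qed.

Lemma proj_comb_col0 a b c k : proj_comb a b c k 0 = (k == 0)%:R * a.
Proof.
have -> : proj_comb a b c = a *: F0 + proj_comb 0 b c by rewrite /proj_comb scale0r add0r addrA.
rewrite [LHS]mxE proj_combk0 addr0 [LHS]mxE /time_proj covector_sqE !mxE eqxx.
by rewrite mulr1 mulrC eq_sym.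
Qed.

Lemma proj_comb_eq a b c a' b' c' : a = a' -> b = b' -> c = c' -> proj_comb a b c = proj_comb a' b' c'.
Proof. by move=> -> -> ->. Qed.

Lemma kasner_gram_comb t : kasner_gram t = proj_comb (-1) (t `^ (- (2 / 3))) (t `^ (4 / 3)).
Proof. by rewrite kasner_gram_proj /proj_comb scaleN1r. Qed.

Lemma gram_dot_comb t : 0 < t -> gram_dot t =
  proj_comb 0 (- (2 / 3) * (t `^ (- (2 / 3)) * t^-1)) (4 / 3 * (t `^ (4 / 3) * t^-1)).
Proof. by move=> t0; rewrite /gram_dot /proj_comb scale0r add0r !powR_pred. Qed.

Lemma gram_ddot_comb t : 0 < t -> gram_ddot t =
  proj_comb 0 ((- (2 / 3) - 1) * - (2 / 3) * (t `^ (- (2 / 3)) * t^-1 ^+ 2))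
    ((4 / 3 - 1) * (4 / 3) * (t `^ (4 / 3) * t^-1 ^+ 2)).
Proof.
move=> t0; rewrite /gram_ddot /proj_comb scale0r add0r !powR_pred // !scalerA expr2.
by congr (_ *: _ + _ *: _); ring.
Qed.

Lemma powRm1 (t : R) : 0 < t -> t `^ (-1) = t^-1.
Proof. by move=> t0; rewrite powRN powRr1 // ltW. Qed.

Lemma shape_comb t : 0 < t -> shape t = proj_comb 0 (- (2 / 3) * t^-1) (4 / 3 * t^-1).
Proof.
move=> t0; rewrite /shape /proj_comb scale0r add0r powRm1 // scalerDr !scalerA.
by congr (_ *: _ + _ *: _); ring.
Qed.

Lemma shape_dot_comb t : 0 < t -> shape_dot t = proj_comb 0 (2 / 3 * t^-1 ^+ 2) (- (4 / 3) * t^-1 ^+ 2).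
Proof.
move=> t0; rewrite /shape_dot /proj_comb scale0r add0r powR_pred // powRm1 // scalerDr !scalerA expr2.
by congr (_ *: _ + _ *: _); ring.
Qed.

Lemma kasner_gram_inv (t : R) : 0 < t ->
  invmx (kasner_gram t) = proj_comb (-1) (t `^ (- (2 / 3)))^-1 (t `^ (4 / 3))^-1.
Proof.
move=> t0; set B := RHS.
have E : kasner_gram t *m B = 1%:M.
  rewrite kasner_gram_comb /B proj_comb_mul mulrNN mulr1 !mulfV ?gt_eqF ?powR_gt0 //.
  by rewrite /proj_comb !scale1r proj_sum.
have [uG _] := mulmx1_unit E.
by rewrite -[LHS]mulmx1 -E mulmxA mulVmx // mul1mx.
Qed.

Lemma kasner_shape (t : R) : 0 < t -> invmx (kasner_gram t) *m gram_dot t = shape t.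
Proof.
move=> t0; rewrite kasner_gram_inv // gram_dot_comb // shape_comb // proj_comb_mul.
have p0 : t `^ (- (2 / 3)) != 0 by rewrite gt_eqF // powR_gt0.
have q0 : t `^ (4 / 3) != 0 by rewrite gt_eqF // powR_gt0.
by apply: proj_comb_eq; [rewrite mulr0 | rewrite mulrCA (mulKf p0) | rewrite mulrCA (mulKf q0)].
Qed.

Definition kasner_gamma (S G1 : 'M[R]_4) (k i j : 'I_4) : R :=
  2^-1 * ((i == 0)%:R * S k j + (j == 0)%:R * S k i + (k == 0)%:R * G1 i j).

Local Notation G := (fun u : 'rV[R]_4 => kasner_gram (u 0 0)).

Lemma kasner_christoffel (v : 'rV[R]_4) k i j : 0 < v 0 0 ->
  christoffel G k i j v = kasner_gamma (shape (v 0 0)) (gram_dot (v 0 0)) k i j.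
Proof.
move=> v0; have D a b c : partial_deriv c (fun u : 'rV[R]_4 => kasner_gram (u 0 0) a b) v = (c == 0)%:R * gram_dot (v 0 0) a b.
  by apply: (partial_time (f := fun s => kasner_gram s a b)); apply: is_derive_entry; exact: kasner_gram_derive.
have Sk a b : shape (v 0 0) a b = \sum_l invmx (kasner_gram (v 0 0)) a l * gram_dot (v 0 0) l b.
  by rewrite -kasner_shape // [LHS]mxE.
rewrite /christoffel /kasner_gamma; congr (_ * _); rewrite !Sk !mulr_sumr.
have K (l : 'I_4) : invmx (kasner_gram (v 0 0)) k l * ((l == 0)%:R * gram_dot (v 0 0) i j) =
    if l == 0 then (k == 0)%:R * -1 * gram_dot (v 0 0) i j else 0.
  have [->|_] := eqVneq l 0; last by rewrite mul0r mulr0.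
  by rewrite mul1r kasner_gram_inv // proj_comb_col0.
have sym a b : gram_dot (v 0 0) a b = gram_dot (v 0 0) b a by rewrite gram_dot_comb // -[in LHS]proj_combT [LHS]mxE.
transitivity (\sum_l (invmx (kasner_gram (v 0 0)) k l * ((i == 0)%:R * gram_dot (v 0 0) l j)
  + invmx (kasner_gram (v 0 0)) k l * ((j == 0)%:R * gram_dot (v 0 0) l i)
  - invmx (kasner_gram (v 0 0)) k l * ((l == 0)%:R * gram_dot (v 0 0) i j))).
  by apply: eq_bigr => l _; rewrite !D mulrBr mulrDr (sym j l) (sym i l).
rewrite sumrB big_split /= (eq_bigr _ (fun l _ => K l)) -big_mkcond big_pred1_eq mulrN1 mulNr opprK.
by congr (_ + _ + _); apply: eq_bigr => l _; rewrite mulrCA.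
Qed.

Lemma kasner_ricci (v : 'rV[R]_4) i j : 0 < v 0 0 -> ricci G i j v = 0.
Proof.
move=> v0; have C := @kasner_christoffel v.
pose t := v 0 0.
have D c k a b : partial_deriv c (christoffel G k a b) v = (c == 0)%:R * kasner_gamma (shape_dot t) (gram_ddot t) k a b.
  have -> : partial_deriv c (christoffel G k a b) v =
      partial_deriv c (fun u : 'rV[R]_4 => kasner_gamma (shape (u 0 0)) (gram_dot (u 0 0)) k a b) v.
    apply: near_eq_partial.
    have n0 : \forall u \near v, 0 < (u : 'rV[R]_4) 0 0 by exact: (@coord_cont R 1 4 0 0 v _ (lt_nbhsr v0)).
    by apply: filterS n0 => u; exact: kasner_christoffel.
  apply: (partial_time (f := fun s => kasner_gamma (shape s) (gram_dot s) k a b)).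
  have ds x y : is_derive t 1 (fun s => shape s x y) (shape_dot t x y).
    by apply: is_derive_entry; exact: shape_derive.
  have dg x y : is_derive t 1 (fun s => gram_dot s x y) (gram_ddot t x y).
    by apply: is_derive_entry; exact: gram_dot_derive.
  apply: is_derive_mull; apply: is_derive_add.
rewrite /ricci.
under eq_bigr => k _ do rewrite !D.
under [X in _ + X]eq_bigr => k _ do under eq_bigr => l _ do rewrite !C //.
have t0 : 0 < t := v0.
rewrite -/t shape_comb // shape_dot_comb // gram_dot_comb // gram_ddot_comb //.
rewrite ricci_sum; try exact: proj_comb0k; try exact: proj_combk0.
have sym b c b' c' : (proj_comb 0 b c *m proj_comb 0 b' c') j i = (proj_comb 0 b c *m proj_comb 0 b' c') i j.
  by rewrite proj_comb_mul -[in LHS]proj_combT [LHS]mxE.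
(* The traces are 2 / t and 4 / t^2, that is, the Kasner exponents and their squares both sum to 1;
   with this every component vanishes. *)
rewrite sym !proj_comb_mul mulr0 !proj_comb_tr !proj_comb_ij; field; exact: lt0r_neq0.
Qed.

End Curvature.

(** * The spacetime as a vacuum solution *)

Section Vacuum.
Variable R : realType.
Local Notation X := (spacetime R).

Lemma spacetime_manifold : is_manifold (@spacetime_atlas R).
Proof.
split.
- exact: spacetime_hausdorff.
- exact: spacetime_second_countable.
- by move=> c [].
- move=> m; have [v [v0 vm]] := kcover_surj m.
  exists (kasner_chart (xs v)); first exact: kasner_chartP.
  by rewrite -vm; apply: kasner_chart_dom; exact: half_cube_center.
split=> [x|c c' Ac Ac' k]; first exact: cvg_id.
have [[od oi ck cc ci] _] := Ac; have [[od' _ _ _ _] _] := Ac'.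
apply: smooth_translation.
  rewrite openE => v [m [dm dm'] mv].
  have Iv : (chart_map c @` chart_dom c) v by exists m.
  have n1 : nbhs v (chart_map c @` chart_dom c) by exact: open_nbhs_nbhs.
  have n2 : nbhs v (chart_inv c @^-1` chart_dom c').
    by apply: (ci v Iv); apply: open_nbhs_nbhs; split=> //; rewrite -mv ck.
  apply: filterS2 n1 n2 => _ [p dp <-]; rewrite /preimage /= ck // => dp'.
  by exists p.
by move=> _ [m [dm dm'] <-]; exact: transition_near.
Qed.

Lemma spacetime_metricE (c : chart R 4 X) (m : X) : spacetime_metric c m = kasner_gram (set_val m.1).
Proof. by []. Qed.

Lemma spacetime_metric_chart (c : chart R 4 X) (v : 'rV[R]_4) : spacetime_atlas c ->
  (chart_map c @` chart_dom c) v -> 0 < v 0 0 /\ spacetime_metric c (chart_inv c v) = kasner_gram (v 0 0).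
Proof.
move=> [[_ _ ck _ _] cE] [m dm <-]; have [tE _] := cE m dm.
rewrite (ck m dm) spacetime_metricE tE; split; first exact: time_gt0.
exact: erefl.
Qed.

Lemma kasner_form (t : R) (u v : 'rV[R]_4) : (u *m kasner_gram t *m v^T) 0 0 =
  - (inner u (e0 R) * inner v (e0 R)) + t `^ (- (2 / 3)) * (inner u (emb (eta1 R)) * inner v (emb (eta1 R)))
  + t `^ (4 / 3) * (inner u (emb (eta2 R)) * inner v (emb (eta2 R)) + inner u (emb (dz R)) * inner v (emb (dz R))).
Proof.
have qD (A B : 'M[R]_4) : (u *m (A + B) *m v^T) 0 0 = (u *m A *m v^T) 0 0 + (u *m B *m v^T) 0 0.
  by rewrite mulmxDr mulmxDl [LHS]mxE.
have qZ k (A : 'M[R]_4) : (u *m (k *: A) *m v^T) 0 0 = k * (u *m A *m v^T) 0 0.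
  by rewrite -scalemxAr -scalemxAl [LHS]mxE.
by rewrite kasner_gram_comb /proj_comb /plane_proj !qD !qZ !qD !covector_form mulN1r.
Qed.

Lemma kasner_lorentzian (t : R) : 0 < t -> @lorentzian R 3 (kasner_gram t).
Proof.
move=> t0; split; first by rewrite kasner_gram_comb proj_combT.
have a0 := a1_gt0 t0; have b0 := a2_gt0 t0.
(* An orthonormal frame: the three covectors are orthonormal rows, hence equal to their own dual
   basis, and are divided by the scale factors. *)
pose w (i : 'I_4) : 'rV[R]_4 := nth 0 [:: e0 R; (a1 t)^-1 *: emb (eta1 R);
  (a2 t)^-1 *: emb (eta2 R); (a2 t)^-1 *: emb (dz R)] i.
pose P : 'M[R]_4 := \matrix_i w i.
have E : P *m kasner_gram t *m P^T = Defs.minkowski R 3.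
  have PE i j : (P *m kasner_gram t *m P^T) i j = (w i *m kasner_gram t *m (w j)^T) 0 0.
    have rowE n (A : 'M[R]_(4, n)) k l : A k l = row k A 0 l by rewrite mxE.
    rewrite rowE !row_mul rowK [LHS]mxE [RHS]mxE; apply: eq_bigr => k _.
    by congr (_ * _); rewrite !mxE.
  have [x y z u [p q]] := eta_inner R.
  have i1 := inner_e0 R.
  have sc n k (a b : 'rV[R]_n) : inner (k *: a) b = k * inner a b by rewrite /inner -scalemxAl mxE.
  have sym n (a b : 'rV[R]_n) : inner a b = inner b a by rewrite /inner -[_ *m _]trmxK trmx_mul trmxK mxE.
  apply/matrixP => i j; rewrite PE kasner_form a1_sq // a2_sq // !mxE.
  have [e1 e2] := inner_e0_emb (eta1 R).
  have [e3 e4] := inner_e0_emb (eta2 R).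
  have [e5 e6] := inner_e0_emb (dz R).
  have y1 := sym _ (eta2 R) (eta1 R); have y2 := sym _ (dz R) (eta1 R); have y3 := sym _ (dz R) (eta2 R).
  by move: i j; do 2!apply: forall4; rewrite /w /= ?sc ?i1 ?e1 ?e2 ?e3 ?e4 ?e5 ?e6 ?inner_emb ?y1 ?y2 ?y3 ?x ?y ?z ?u ?p ?q;
    field; rewrite ?gt_eqF.
exists P => //.
have MM : Defs.minkowski R 3 *m Defs.minkowski R 3 = 1%:M.
  by rewrite mulmx_diag; apply/matrixP; do 2!apply: forall4; rewrite !mxE /= ?mulrNN ?mulr1.
have : P *m (kasner_gram t *m P^T *m Defs.minkowski R 3) = 1%:M by rewrite !mulmxA E.
by move=> /mulmx1_unit[].
Qed.

Lemma kasner_gram_continuous (t : R) : 0 < t -> {for t, continuous (@kasner_gram R)}.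
Proof.
move=> t0; have [d _] := kasner_gram_derive t0.
by apply: differentiable_continuous; apply/derivable1_diffP.
Qed.

Theorem kasner_vacuum : vacuum_spacetime (@spacetime_atlas R) (@spacetime_metric R).
Proof.
split.
- exact: spacetime_manifold.
- exact: spacetime_connected.
- split.
  + by move=> c m _ _; rewrite spacetime_metricE; exact: (kasner_lorentzian (time_gt0 m.1)).
  + move=> c m _ _.
    apply: (cont_comp (f := fun m : X => set_val m.1 : R) (g := @kasner_gram R)); last exact/kasner_gram_continuous/time_gt0.
    apply: (cont_comp (f := fst) (g := set_val)); first exact: cvg_fst.
    exact: initial_continuous.
  + move=> c c' Ac Ac' m dm dm' J.
    have [a Ha] := transition_near Ac Ac' dm dm'.
    have [_ J1] := jacobian_translation Ha.
    by rewrite /J J1 mul1mx trmx1 mulmx1.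
- move=> c Ac k; have [[_ oi _ _ _] _] := Ac.
  have U0 v : (chart_map c @` chart_dom c) v -> 0 < (v : 'rV[R]_4) 0 0 by move=> /(spacetime_metric_chart Ac)[].
  apply: (Ck_on_eq (g := fun v : 'rV[R]_4 => - time_proj R + v 0 0 `^ (- (2 / 3)) *: axis_proj R + v 0 0 `^ (4 / 3) *: plane_proj R) oi).
    by move=> v /(spacetime_metric_chart Ac)[_ ->]; exact: kasner_gram_proj.
  apply: Ck_on_add => //; last exact: Ck_on_powR.
  apply: Ck_on_add => //; last exact: Ck_on_powR.
  exact: Ck_on_cst.
- move=> c Ac v Iv i j; have [[_ oi _ _ _] _] := Ac.
  have [v0 _] := spacetime_metric_chart Ac Iv.
  rewrite -[RHS](kasner_ricci i j v0); apply: near_eq_ricci.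
  by apply: (open_near oi Iv) => u /(spacetime_metric_chart Ac)[].
Qed.

End Vacuum.

(** * Volume *)

Section Volume.
Variable R : realType.
Local Notation mu := (@lebesgue_measure R).
Local Notation B := (measurableTypeR R).
Local Notation T3 := (B * B * B)%type.
Local Notation vol := ((mu \x mu) \x mu)%E.

Lemma measurable_translation (a : R) : measurable_fun [set: B] (fun x : B => (x + a : B)).
Proof. exact: (measurable_realfun.measurable_funD (f := idfun) (g := cst a) (@measurable_id _ _ _) (@measurable_cst _ _ _ _ _ _)). Qed.

(** Both measures agree on half-open intervals, which determine Lebesgue measure. *)
Lemma lebesgue_translation (a : R) (A : set B) : measurable A -> mu ((fun x : B => (x + a : B)) @^-1` A) = mu A.
Proof.
move=> mA; rewrite -[LHS]/(pushforward mu (fun x : B => (x + a : B)) A).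
apply/esym/lebesgue_measure_unique => //=; first exact: measurable_translation.
move=> mf _ [[x y]] _ <-.
have -> : pushforward mu (fun x : B => (x + a : B)) `]x, y]%classic = mu `]x - a, y - a]%classic.
  rewrite /pushforward; congr (mu _); apply/seteqP; split=> z; rewrite /= !in_itv /=.
    by rewrite ltrBlDr lerBrDr.
  by rewrite ltrBlDr lerBrDr.
rewrite !lebesgue_measure_itv /= !lte_fin ltrD2r; case: ifP => // _.
by rewrite -!EFinD; congr (_%:E); ring.
Qed.

Lemma product_preserving d1 d2 (T1 : measurableType d1) (T2 : measurableType d2)
    (m1 : {measure set T1 -> \bar R}) (m2 : {sigma_finite_measure set T2 -> \bar R})
    (f1 : T1 -> T1) (f2 : T2 -> T2) (A : set (T1 * T2)) :
  measurable_fun [set: T1] f1 ->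
  (forall A, measurable A -> m1 (f1 @^-1` A) = m1 A) -> (forall A, measurable A -> m2 (f2 @^-1` A) = m2 A) ->
  measurable A -> (m1 \x m2)%E ((fun p => (f1 p.1, f2 p.2)) @^-1` A) = (m1 \x m2)%E A.
Proof.
move=> mf1 p1 p2 mA; rewrite /product_measure1.
transitivity (\int[m1]_x ((m2 \o xsection A) \o f1) x)%E.
  apply: eq_integral => x _ /=; rewrite -(p2 _ (measurable_xsection (f1 x) mA)).
  by congr (m2 _); apply/seteqP; split=> y /set_mem h; exact/mem_set.
rewrite -[LHS](ge0_integral_pushforward mf1 m1 measurableT (measurable_fun_xsection m2 mA)) //.
by apply: eq_measure_integral => D mD _; exact: p1.
Qed.

Definition shift3 (k : int * int * int) (p : T3) : T3 :=
  (p.1.1 + k.1.1%:~R, p.1.2 + k.1.2%:~R, p.2 + k.2%:~R).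

Lemma measurable_shift3 k : measurable_fun [set: T3] (shift3 k).
Proof.
apply: measurable_fun_pair; last exact: (measurableT_comp (measurable_translation _) measurable_snd).
apply: measurable_fun_pair; apply: (measurableT_comp (measurable_translation _)).
  exact: (measurableT_comp measurable_fst measurable_fst).
exact: (measurableT_comp measurable_snd measurable_fst).
Qed.

Lemma vol_shift3 k (A : set T3) : measurable A -> vol (shift3 k @^-1` A) = vol A.
Proof.
move=> mA; pose m := [the {sigma_finite_measure set B -> \bar R} of mu].
pose m2 := [the {measure set (B * B)%type -> \bar R} of (m \x m)%E].
have tr (a : R) := lebesgue_translation a.
have p2 (D : set (B * B)) : measurable D -> m2 ((fun p => (p.1 + k.1.1%:~R, p.2 + k.1.2%:~R)) @^-1` D) = m2 D.
  by move=> mD; apply: (product_preserving (measurable_translation _) (tr _) (tr _) mD).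
apply: (@product_preserving _ _ _ _ m2 m (fun p => (p.1 + k.1.1%:~R, p.2 + k.1.2%:~R)) (fun x => x + k.2%:~R) A _ p2 (tr _) mA).
exact: (measurable_fun_pair (measurableT_comp (measurable_translation _) measurable_fst) (measurableT_comp (measurable_translation _) measurable_snd)).
Qed.

Lemma measurable_preimage_shift3 k (A : set T3) : measurable A -> measurable (shift3 k @^-1` A).
Proof. by move=> mA; rewrite -[X in measurable X]setTI; exact: measurable_shift3. Qed.

Definition unit_cube : set T3 := (`[0, 1[%classic `*` `[0, 1[%classic) `*` `[0, 1[%classic.

Lemma measurable_unit_cube : measurable unit_cube.
Proof. by apply: measurableX; [apply: measurableX|]; exact: measurable_itv. Qed.

Lemma vol_cube (I : set B) : measurable I -> mu I = 1%E -> vol ((I `*` I) `*` I) = 1%E.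
Proof.
move=> mI I1; pose m := [the {sigma_finite_measure set B -> \bar R} of mu].
pose m2 := [the {measure set (B * B)%type -> \bar R} of (m \x m)%E].
have e2 : m2 (I `*` I) = 1%E by apply: (etrans (product_measure1E m m mI mI)); rewrite /m /= I1 mule1.
apply: (etrans (product_measure1E m2 m (measurableX mI mI) mI)).
by rewrite [X in (X * _)%E]e2 mul1e.
Qed.

Lemma vol_unit_cube : vol unit_cube = 1%E.
Proof.
by apply: vol_cube; [exact: measurable_itv | rewrite lebesgue_measure_itv /= lte_fin ltr01 oppr0 adde0].
Qed.

Lemma unit_cube_floor (p : T3) k : unit_cube (shift3 k p) ->
  k = (- Num.floor (p.1.1 : R), - Num.floor (p.1.2 : R), - Num.floor (p.2 : R)).
Proof.
have F (x : R) (m : int) : (x + m%:~R) \in `[0, 1[ -> m = - Num.floor x.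
  rewrite in_itv /= => /andP[x0 x1]; apply/eqP; rewrite -eqr_oppLR; apply/eqP/esym.
  by apply: floor_def; rewrite intrD intrN; apply/andP; split; lra.
by case: k => [[k1 k2] k3] [[/F h1 /F h2] /F h3]; rewrite /= in h1 h2 h3; rewrite h1 h2 h3.
Qed.

Lemma unit_cube_cover (p : T3) : unit_cube (shift3 (- Num.floor (p.1.1 : R), - Num.floor (p.1.2 : R), - Num.floor (p.2 : R)) p).
Proof.
have F (x : R) : (x + (- Num.floor x)%:~R) \in `[0, 1[.
  have /andP[a b] := floor_itv x; rewrite in_itv /= intrN; move: b; rewrite intrD => b.
  by apply/andP; split; lra.
by split; [split|]; exact: F.
Qed.

Lemma shift3K k p : shift3 (- k.1.1, - k.1.2, - k.2) (shift3 k p) = p.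
Proof. by case: p => [[x y] z]; rewrite /shift3 /= !intrN !addrK. Qed.

(** The translates of [S] into the unit cube, enumerated along a coding of Z^3. *)
Definition cut (S : set T3) (n : nat) : set T3 :=
  if pickle_inv n is Some k then unit_cube `&` shift3 k @^-1` S else set0.

(** The part of [S] in one lattice cell, of which [cut S n] is the translate. The partial inverse
    [pickle_inv] prevents a cell from being counted twice. *)
Definition piece (S : set T3) (n : nat) : set T3 :=
  if pickle_inv n is Some k then S `&` shift3 (- k.1.1, - k.1.2, - k.2) @^-1` unit_cube else set0.

Lemma measurable_cut S n : measurable S -> measurable (cut S n).
Proof.
move=> mS; rewrite /cut; case: (pickle_inv n) => // k.
by apply: measurableI; [exact: measurable_unit_cube | exact: measurable_preimage_shift3].
Qed.

Lemma measurable_piece S n : measurable S -> measurable (piece S n).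
Proof.
move=> mS; rewrite /piece; case: (pickle_inv n) => // k.
by apply: measurableI => //; apply: measurable_preimage_shift3; exact: measurable_unit_cube.
Qed.

Lemma vol_piece S n : measurable S -> vol (piece S n) = vol (cut S n).
Proof.
move=> mS; have := @measurable_piece S n mS; rewrite /piece /cut; case: (pickle_inv n) => // k mP.
rewrite -(vol_shift3 k mP); congr (vol _); apply/seteqP; split=> p /=.
  by rewrite shift3K => -[].
by rewrite shift3K => -[].
Qed.

Lemma pickle_inv_inj (n m : nat) (k : int * int * int) : pickle_inv n = Some k -> pickle_inv m = Some k -> n = m.
Proof.
move=> h1 h2; have := @pickle_invK (int * int * int)%type n; have := @pickle_invK (int * int * int)%type m.
by rewrite h1 h2 /= => -> ->.
Qed.

Lemma bigcup_piece S : \bigcup_n piece S n = S.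
Proof.
apply/seteqP; split=> [p [n _]|p Sp].
  by rewrite /piece; case: (pickle_inv n) => // k [].
have [k Hk] : exists k : int * int * int, unit_cube (shift3 (- k.1.1, - k.1.2, - k.2) p).
  by eexists (_, _, _); exact: unit_cube_cover.
by exists (pickle k); [exact: Logic.I | rewrite /piece pickleK_inv].
Qed.

Lemma trivIset_piece S : trivIset setT (piece S).
Proof.
apply/trivIsetP => n m _ _ /eqP nm; rewrite -subset0 => p [].
rewrite /piece; case En: (pickle_inv n) => [k|//] [_ /unit_cube_floor h1].
case Em: (pickle_inv m) => [k'|//] [_ /unit_cube_floor h2].
apply: nm; apply: (pickle_inv_inj En); rewrite Em; congr Some.
move: h1 h2; case: k {En} => [[a b] c]; case: k' {Em} => [[a' b'] c'] /= -[x y z] [x' y' z'].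
by congr (_, _, _); apply: oppr_inj; rewrite ?x ?y ?z ?x' ?y' ?z'.
Qed.

Lemma vol_cut S : measurable S -> trivIset setT (cut S) -> vol (\bigcup_n cut S n) = vol S.
Proof.
move=> mS tS; pose m3 := [the {measure set T3 -> \bar R} of vol].
have mc n : measurable (cut S n) by exact: measurable_cut.
have mp n : measurable (piece S n) by exact: measurable_piece.
have mUc : measurable (\bigcup_n cut S n) by apply: bigcup_measurable => n _; exact: mc.
have mUp : measurable (\bigcup_n piece S n) by rewrite bigcup_piece.
have ec : m3 (\bigcup_n cut S n) = (\sum_(n <oo) m3 (cut S n))%E.
  exact: (@measure_semi_bigcup _ _ _ m3 _ mc tS mUc).
have ep : m3 (\bigcup_n piece S n) = (\sum_(n <oo) m3 (piece S n))%E.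
  exact: (@measure_semi_bigcup _ _ _ m3 _ mp (@trivIset_piece S) mUp).
rewrite bigcup_piece in ep; apply: (etrans ec); apply/esym/(etrans ep).
by apply: eq_eseriesr => n _; exact: vol_piece.
Qed.

(** The hypothesis says that the sets together inject into the torus, so all their cuts are disjoint
    in the unit cube. *)
Lemma vol_lattice_packing (N : nat) (S : 'I_N -> set T3) : (forall i, measurable (S i)) ->
  (forall i i' k k' p, S i (shift3 k p) -> S i' (shift3 k' p) -> i = i' /\ k = k') ->
  (\sum_(i < N) vol (S i) <= 1)%E.
Proof.
move=> mS inj; have cutP i n p : cut (S i) n p -> exists k, [/\ pickle_inv n = Some k, unit_cube p & S i (shift3 k p)].
  by rewrite /cut; case En: (pickle_inv n) => [k|//] [q s]; exists k.
have tS i : trivIset setT (cut (S i)).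
  apply/trivIsetP => n m _ _ /eqP nm; rewrite -subset0 => p [/cutP[k [En _ s]] /cutP[k' [Em _ s']]].
  by apply: nm; apply: (pickle_inv_inj En); have [_ ->] := inj _ _ _ _ _ s s'.
pose C i := \bigcup_n cut (S i) n.
have mC i : measurable (C i) by apply: bigcup_measurable => n _; exact: measurable_cut.
have tC : trivIset setT C.
  apply/trivIsetP => i j _ _ /eqP ij; rewrite -subset0 => p [[n _ /cutP[k [_ _ s]]] [m _ /cutP[k' [_ _ s']]]].
  by apply: ij; have [] := inj _ _ _ _ _ s s'.
have mU : measurable (\big[setU/set0]_(i < N) C i) by apply: bigsetU_measurable => i _.
have -> : (\sum_(i < N) vol (S i) = \sum_(i < N) vol (C i))%E.
  by apply: eq_bigr => i _; rewrite -(vol_cut (mS i) (tS i)).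
pose m3 := [the {measure set T3 -> \bar R} of vol].
have eU : m3 (\big[setU/set0]_(i < N) C i) = (\sum_(i < N) m3 (C i))%E.
  exact: (@measure_bigsetU_ord _ _ _ m3 _ xpredT C mC tC).
apply: (@le_trans _ _ (m3 unit_cube)); last by rewrite -[leRHS]vol_unit_cube.
rewrite -[leLHS]eU; apply: le_measure; rewrite ?inE //; first exact: measurable_unit_cube.
by rewrite -bigcup_seq => p [i _ [n _ /cutP[k []]]].
Qed.

End Volume.

(** * The volume of the torus and the conclusion *)

Section Main.
Variable R : realType.
Local Notation B := (measurableTypeR R).
Local Notation T3 := (B * B * B)%type.
Local Notation mu := (@lebesgue_measure R).
Local Notation vol := ((mu \x mu) \x mu)%E.

(** The three covectors are the rows of an orthogonal matrix that diagonalises the metric, and the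
    exponents add up to -2/3 + 4/3 + 4/3 = 2. *)
Lemma det_h_gram (t : R) : 0 < t -> \det (h_gram t) = t ^+ 2.
Proof.
move=> t0; pose M : 'M[R]_3 := \matrix_i nth 0 [:: eta1 R; eta2 R; dz R] i.
pose d : 'rV[R]_3 := row3 (t `^ (- (2 / 3))) (t `^ (4 / 3)) (t `^ (4 / 3)).
have hE : h_gram t = M^T *m diag_mx d *m M.
  apply/matrixP; do 2!apply: forall3; rewrite /h_gram /covector_sq !mxE !sum3 !mxE !sum3 ?mxE !big_ord1 !mxE /=; ring.
have MM : M *m M^T = 1%:M.
  have [a b c e [f g]] := eta_inner R.
  have sym (u w : 'rV[R]_3) : inner u w = inner w u by rewrite /inner -[_ *m _]trmxK trmx_mul trmxK mxE.
  have E i j : (M *m M^T) i j = inner (nth 0 [:: eta1 R; eta2 R; dz R] i) (nth 0 [:: eta1 R; eta2 R; dz R] j).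
    by rewrite /inner !mxE; apply: eq_bigr => k _; rewrite !mxE.
  apply/matrixP => i j; rewrite E mxE; move: i j.
  by do 2!apply: forall3; rewrite /= ?a ?b ?c ?e ?f ?g // sym ?e ?f ?g.
have dM : \det M * \det M = 1 by rewrite -{2}det_tr -det_mulmx MM det1.
rewrite hE !det_mulmx det_tr det_diag mulrAC dM mul1r big_ord_recl big_ord_recl big_ord1 !mxE /= -powRD ?(gt_eqF t0) ?implybT //.
rewrite -powRD ?(gt_eqF t0) ?implybT // -powR_mulrn ?(ltW t0) //; congr (_ `^ _); lra.
Qed.

Lemma torus_chart_vol (t : R) (c : chart R 3 (torus R)) (E : set 'rV[R]_3) : 0 < t ->
  measurable (@of_triple R @^-1` E) -> chart_vol (torus_metric t) c E = (t%:E * vol (@of_triple R @^-1` E))%E.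
Proof.
move=> t0 mE; rewrite /chart_vol.
have sE : Num.sqrt (\det (h_gram t)) = t by rewrite det_h_gram // sqrtr_sqr gtr0_norm.
under eq_integral => p _ do rewrite sE.
pose m3 := [the {measure set T3 -> \bar R} of vol].
exact: (integral_cst m3 mE t%:E).
Qed.

Lemma torus_chart_inv (c : chart R 3 (torus R)) v : torus_atlas c ->
  (chart_map c @` chart_dom c) v -> chart_inv c v = torus_pi v /\ chart_map c (torus_pi v) = v.
Proof. by move=> [[_ _ ck _ _] cE] [q dq <-]; rewrite cE ?ck. Qed.

Lemma of_triple_shift3 k (p : T3) : torus_pi (of_triple (shift3 k p)) = torus_pi (of_triple p).
Proof.
have -> : of_triple (shift3 k p) = of_triple p + row3 k.1.1%:~R k.1.2%:~R k.2%:~R.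
  by apply/rowP; apply: forall3; rewrite !mxE.
by apply: lattice_shift; apply: forall3; rewrite mxE /=; exact: intr_int.
Qed.

Lemma of_triple_inj : injective (@of_triple R).
Proof.
move=> [[x y] z] [[x' y'] z'] /rowP e.
by have := e 0; have := e 1; have := e 2; rewrite !mxE /= => -> -> ->.
Qed.

Lemma shift3_inj (p : T3) : injective (fun k => shift3 k p).
Proof.
move=> [[a b] c] [[a' b'] c'] [/addrI/intr_inj h1 /addrI/intr_inj h2 /addrI/intr_inj h3].
by rewrite /= in h1 h2 h3; rewrite h1 h2 h3.
Qed.

Lemma torus_vol (t : R) : 0 < t -> riem_vol (@torus_atlas R) (torus_metric t) = t%:E.
Proof.
move=> t0; apply/eqP; rewrite eq_le; apply/andP; split.
  apply: ge_ereal_sup => _ [N [c [E [Ac Ec mE tE ->]]]].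
  have vE i : chart_vol (torus_metric t) (c i) (E i) = (t%:E * vol (@of_triple R @^-1` E i))%E.
    exact: torus_chart_vol.
  rewrite (eq_bigr _ (fun i _ => vE i)) -ge0_sume_distrr; last by move=> i _; exact: measure_ge0.
  rewrite -[leRHS]mule1; apply: lee_wpmul2l; first by rewrite lee_fin ltW.
  apply: vol_lattice_packing => // i i' k k' p Si Si'.
  have [v1 m1] := torus_chart_inv (Ac i) (Ec i _ Si).
  have [v2 m2] := torus_chart_inv (Ac i') (Ec i' _ Si').
  have ii : i = i'.
    apply: (tE i i') => //; exists (torus_pi (of_triple p)); split.
      by exists (of_triple (shift3 k p)) => //; rewrite v1 of_triple_shift3.
    by exists (of_triple (shift3 k' p)) => //; rewrite v2 of_triple_shift3.
  split=> //; subst i'; apply: (@shift3_inj p); apply: of_triple_inj.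
  by rewrite -m1 -m2 !of_triple_shift3.
(* A single chart, the open unit cube around [x0], already carries the full volume. *)
pose x0 : 'rV[R]_3 := row3 (1 / 2) (1 / 2) (1 / 2).
have pE : @of_triple R @^-1` ball x0 (1 / 2) = ((`]0, 1[%classic `*` `]0, 1[%classic) `*` `]0, 1[%classic : set T3).
  have F (x : R) : (`|1 / 2 - x| < 1 / 2) = (0 < x < 1).
    by rewrite ltr_norml; apply/andP/andP => -[h1 h2]; split; lra.
  apply/seteqP; split=> -[[x y] z].
    rewrite -[X in X -> _]/(ball x0 (1 / 2) (of_triple (x, y, z))) -ball_normE /= => h.
    have c i := le_lt_trans (coord_le_norm (x0 - of_triple (x, y, z)) 0 i) h.
    by have := c 0; have := c 1; have := c 2; rewrite !mxE /= !F /= !in_itv /=.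
  rewrite /= !in_itv /= -!F => -[[h1 h2] h3].
  rewrite -ball_normE /=.
  apply: norm_lt_coord => // i j; rewrite ord1; move: j; by apply: forall3; rewrite !mxE.
have mI : measurable (`]0, 1[%classic : set B) by exact: measurable_itv.
have mE : measurable (@of_triple R @^-1` ball x0 (1 / 2)).
  by rewrite pE; apply: measurableX => //; apply: measurableX.
apply: ereal_sup_ubound; exists 1%N, (fun=> torus_chart x0), (fun=> ball x0 (1 / 2)); split=> //.
- by move=> i; exact: torus_chartP.
- by move=> i; rewrite torus_chart_image.
- by move=> i j _ _ _; rewrite !ord1.
rewrite big_ord1 torus_chart_vol // pE.
have -> : vol ((`]0, 1[%classic `*` `]0, 1[%classic) `*` `]0, 1[%classic) = 1%E.
  by apply: vol_cube => //; rewrite lebesgue_measure_itv /= lte_fin ltr01 oppr0 adde0.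
by rewrite mule1.
Qed.

End Main.

Theorem proposition4p7 (R : realType) :
  vacuum_spacetime (@spacetime_atlas R) (@spacetime_metric R) /\
  globally_C0_inextendible (@spacetime_atlas R) (@spacetime_metric R) /\
  (exists c C : R, (0 < c < C) /\
     forall t : R, 0 < t <= 1 ->
       let D := riem_diam (@torus_atlas R) (torus_metric t) [set: torus R] in
       ((c * t `^ (1 / 6))%:E <= D)%E /\ (D <= (C * t `^ (1 / 6))%:E)%E) /\
  (forall t : R, 0 < t <= 1 ->
     riem_vol (@torus_atlas R) (torus_metric t) = t%:E) /\
  (forall U : set 'rV[R]_3, U !=set0 -> open U -> compact (closure U) ->
     exists cU : R, 0 < cU /\
       forall t : R, 0 < t <= 1 ->
         forall k : metric R 3 'rV[R]_3,
           is_pullback (@R3_atlas R) k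
             (@torus_atlas R) (torus_metric t) (@torus_pi R) ->
           ((cU * t `^ (- (1 / 3)))%:E <= riem_diam (@R3_atlas R) k U)%E).
Proof.
split; first exact: kasner_vacuum.
split; first exact: kasner_inextendible.
split.
  pose c : R := Num.sqrt (golden R / (4 * c_golden R ^+ 2)).
  have c0 : 0 < c by rewrite sqrtr_gt0 divr_gt0 ?mulr_gt0 ?exprn_gt0 ?c_golden_gt0 //; have := golden_gt1 R; lra.
  have s0 : 0 < Num.sqrt 11 :> R by rewrite sqrtr_gt0.
  (* Adding [c] to the upper constant makes the strict inequality between the two constants
     immediate. *)
  exists c, (Num.sqrt 11 + c); rewrite c0 ltrDr s0; split=> // t t01 D.
  have [lo up] := torus_diam t01; split=> //.
  apply: le_trans up _; rewrite lee_fin ler_wpM2r ?powR_ge0 // lerDl ltW //.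
split; first by move=> t /andP[t0 _]; exact: torus_vol.
by move=> U U0 oU _; exact: R3_diam_ge.
Qed.
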